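(* Let $\kappa$ be a non-zero positive Radon measure on $\mathbb R$ and let $(\mathcal Y_\infty,\mathcal Z_\infty)$ be the pair of random subsets of $\mathbb R$ produced by Wilson's algorithm (described in the context) applied to the Brownian motion on $\mathbb R$ with killing measure $\kappa$, with a dense sequence $(x_n)_{n\ge1}$ of pairwise distinct starting points in $\mathbb R$. Then the law of $(\mathcal Y_\infty,\mathcal Z_\infty)$ does not depend on the starting points $(x_n)_{n\ge1}$.
   Context: Brownian motion with killing measure $\kappa$: a standard Brownian motion $B$ killed at the time $\zeta$ when $\int_{\mathbb R}\ell^x_t(B)\kappa(dx)$ ($\ell^x_t$ local times relative to Lebesgue measure) reaches an independent exponential variable of parameter $1$. Wilson's algorithm. $(B^{(x_n)}_t)_{0\le t<\zeta_n}$, $n\ge1$, are independent Brownian motions with killing measure $\kappa$ started from $x_n$; $[a,b]$ denotes the closed interval between $a$ and $b$ in either order. Set $T_1=\zeta_1$, $\mathcal Y_1=\{B^{(x_1)}_{T_1^-}\}$, $\mathcal J_1=\{[x_1,B^{(x_1)}_{T_1^-}]\}$. Given $(\mathcal Y_n,\mathcal J_n)$: if $x_{n+1}\in\bigcup_{J\in\mathcal J_n}J$, set $\mathcal Y_{n+1}=\mathcal Y_n$, $\mathcal J_{n+1}=\mathcal J_n$. Otherwise let $T_{n+1}=\min\big(\zeta_{n+1},\inf\{t\ge0:B^{(x_{n+1})}_t\in\bigcup_{J\in\mathcal J_n}J\}\big)$ and $p=B^{(x_{n+1})}_{T_{n+1}^-}$. If $p\in J$ for a (unique) $J\in\mathcal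 J_n$, set $\mathcal Y_{n+1}=\mathcal Y_n$ and $\mathcal J_{n+1}=(\mathcal J_n\setminus\{J\})\cup\{J\cup[x_{n+1},p]\}$; otherwise set $\mathcal Y_{n+1}=\mathcal Y_n\cup\{p\}$, $\mathcal J_{n+1}=\mathcal J_n\cup\{[x_{n+1},p]\}$. Finally $\mathcal Y_\infty=\bigcup_{n\ge1}\mathcal Y_n$ and $\mathcal Z_\infty=\mathbb R\setminus\bigcup_{n\ge1}\bigcup_{J\in\mathcal J_n}J$. Almost surely $\mathcal Y_\infty$ and $\mathcal Z_\infty$ are locally finite. *)

(* Defs.v *)
From HB Require Import structures.
From mathcomp Require Import all_boot all_order all_algebra.
From mathcomp Require Import all_classical all_reals all_analysis.
From mathcomp Require Import measurable_realfun.

Set Implicit Arguments.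
Unset Strict Implicit.
Unset Printing Implicit Defensive.

Import Order.TTheory GRing.Theory Num.Theory.
Import numFieldNormedType.Exports.

Local Open Scope classical_set_scope.
Local Open Scope ring_scope.

(* On the real line, the positive Radon measures are exactly the Borel
   measures that are finite on compact sets. *)
Definition radon_measure (R : realType)
    (kappa : {measure set (measurableTypeR R) -> \bar R}) : Prop :=
  forall K : set R, compact K -> (kappa K < +oo)%E.

Section independence.
Context d (Omega : measurableType d) (R : realType) (P : probability Omega R).

Definition independent2 (F G : set (set Omega)) : Prop :=
  forall A C, F A -> G C -> P (A `&` C) = (P A * P C)%E.

(* Mutual independence: product rule over every finite subfamily. *)
Definition mutually_independent (F : nat -> set (set Omega)) : Prop :=
  forall (s : seq nat) (A : nat -> set Omega), uniq s ->
    (forall n, n \in s -> F n (A n)) ->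
    P (\bigcap_(n in [set` s]) A n) = (\prod_(n <- s) P (A n))%E.

(* sigma(X_t, t in D) *)
Definition process_sigma (D : set R) (X : R -> Omega -> R) : set (set Omega) :=
  <<s [set C | exists t, exists A : set (measurableTypeR R),
         [/\ D t, measurable A & C = X t @^-1` A] ]>>.

(* The sigma-algebra of the path (X_t), 0 <= t < zeta, killed at zeta. *)
Definition killed_path_sigma (X : R -> Omega -> R) (zeta : Omega -> \bar R)
    : set (set Omega) :=
  <<s [set C | exists t, exists A : set (measurableTypeR R),
         [/\ 0 <= t, measurable A &
             C = [set w | (t%:E < zeta w)%E /\ A (X t w)]] ]>>.

End independence.

Section killed_brownian_motion.
Context d (Omega : measurableType d) (R : realType) (P : probability Omega R).

(* Processes are indexed by R, but only the times t >= 0 are relevant.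
   The second parameter of normal_prob is the standard deviation. *)
Definition brownian_motion (x : R) (B : R -> Omega -> R) : Prop :=
  [/\ forall t, 0 <= t ->
        measurable_fun [set: Omega] (B t : Omega -> measurableTypeR R),
      {ae P, forall w, B 0 w = x /\
                       {within `[0, +oo[, continuous (fun t => B t w)}},
      forall s t, 0 <= s -> s < t -> forall A : set (measurableTypeR R),
        measurable A ->
        P [set w | A (B t w - B s w)] = normal_prob 0 (Num.sqrt (t - s)) A &
      forall s t, 0 <= s -> s < t ->
        independent2 P (process_sigma `[0, s] B)
          (process_sigma [set: R] (fun _ w => B t w - B s w))].

(* ell y t is the local time at y up to time t: the jointly continuous version
   of the density of the occupation measure with respect to Lebesgue measure. *)
Definition local_times (B : R -> Omega -> R) (ell : R -> R -> Omega -> R)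
    : Prop :=
  {ae P, forall w,
    {within [set yt : R * R | 0 <= yt.2],
       continuous (fun yt : R * R => ell yt.1 yt.2 w)} /\
    forall t, 0 <= t -> forall A : set (measurableTypeR R), measurable A ->
      lebesgue_measure [set s | 0 <= s <= t /\ A (B s w)] =
      (\int[lebesgue_measure]_(y in A) (ell y t w)%:E)%E}.

(* The killed Brownian motion is (B_t), 0 <= t < zeta; the values of B after
   zeta are those of the motion before killing and are never observed. *)
Definition killed_brownian_motion
    (kappa : {measure set (measurableTypeR R) -> \bar R})
    (x : R) (B : R -> Omega -> R) (zeta : Omega -> \bar R) : Prop :=
  exists (ell : R -> R -> Omega -> R) (e : Omega -> R),
    [/\ brownian_motion x B,
        local_times B ell,
        measurable_fun [set: Omega] (e : Omega -> measurableTypeR R) /\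
        (forall A : set (measurableTypeR R), measurable A ->
           P (e @^-1` A) = exponential_prob 1 A),
        independent2 P (process_sigma `[0, +oo[ B)
          (process_sigma [set: R] (fun _ => e)) &
        measurable_fun [set: Omega] zeta /\
        {ae P, forall w, zeta w =
           ereal_inf [set t%:E | t in [set t : R | 0 <= t /\
             ((e w)%:E <= \int[kappa]_y (ell y t w)%:E)%E]]}].

End killed_brownian_motion.

Section wilson.
Context (R : realType).

Definition segment (a b : R) : set R := `[Num.min a b, Num.max a b].

Definition left_limit (b : R -> R) (t : \bar R) : R :=
  lim (b s @[s --> (fine t)^'-]).

Definition hitting_time (b : R -> R) (zeta : \bar R) (U : set R) : \bar R :=
  ereal_inf [set t%:E | t in [set t : R | [/\ 0 <= t, (t%:E < zeta)%E & U (b t)]]].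

Definition support (J : set (set R)) : set R := \bigcup_(I in J) I.

Definition wilson_step (x : R) (b : R -> R) (zeta : \bar R)
    (YJ : set R * set (set R)) : set R * set (set R) :=
  let: (Y, J) := YJ in
  if `[< support J x >] then (Y, J) else
  let T := Order.min zeta (hitting_time b zeta (support J)) in
  let p := left_limit b T in
  if `[< support J p >] then
    let I := xget set0 [set I | J I /\ I p] in
    (Y, (J `\ I) `|` [set I `|` segment x p])
  else (Y `|` [set p], J `|` [set segment x p]).

(* Indices are shifted by one: wilson n is the state after treating the
   starting points x 0, ..., x n. *)
Fixpoint wilson (x : nat -> R) (b : nat -> R -> R) (zeta : nat -> \bar R)
    (n : nat) : set R * set (set R) :=
  if n is m.+1 then wilson_step (x n) (b n) (zeta n) (wilson x b zeta m)
  else let p := left_limit (b 0%N) (zeta 0%N) in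
       ([set p], [set segment (x 0%N) p]).

Definition wilson_Y x b zeta : set R := \bigcup_n (wilson x b zeta n).1.

Definition wilson_Z x b zeta : set R :=
  ~` \bigcup_n support (wilson x b zeta n).2.

(* Subsets of R, as point configurations, with the sigma-algebra generated by
   the numbers of points in bounded Borel sets. *)
Definition count_events : set (set (set R)) :=
  [set E | exists (I : set (measurableTypeR R)) (k : nat),
     [/\ measurable I, bounded_set (I : set R) &
         E = [set A | (A `&` I #= `I_k)%card]] ].

Definition config := g_sigma_algebraType count_events.

End wilson.

(* X is only required to be measurable up to a P-negligible set. *)
Definition has_law d (Omega : measurableType d) (R : realType)
    (P : probability Omega R) d' (T : measurableType d') (X : Omega -> T)
    (mu : probability T R) : Prop :=
  exists V : Omega -> T,
    [/\ measurable_fun [set: Omega] V,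
        {ae P, forall w, V w = X w} &
        forall S : set T, measurable S -> mu S = pushforward P V S].

(* Main.v *)
(* After n steps the algorithm is described by the list of the pairs (x_i, p_i)
   of a starting point and an end point, which determines the union U of the
   segments and the set Y of roots; one step from x draws p with the law of the
   killed Brownian motion from x when it hits U.

   Two consecutive steps commute in law: on an interval free of U, the exit law
   from x has, with respect to a common measure, a density given by the
   probabilities h(x, y) that the motion from x reaches y before being killed,
   and these are multiplicative along the line.  Hence the law of (U_n, Y_n)
   does not depend on the order of x_1, ..., x_n.  Events that are increasing in
   (U, Y) are insensitive to starting points that are already covered, and every
   fixed point ends up covered, so the probability that such an event ever occurs
   is a supremum over all finite lists of points, whatever the dense sequence.
   The events that finitely many rational intervals are eventually covered and Y
   has at least k_j points in the Borel sets I_j form a pi-system, which gives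
   the law of Y together with the family of covered rational intervals.

   Z is recovered from this family.  A point is broken if no rational interval
   around it is ever covered.  The number of uncovered cells of a subdivision of
   [c, d] has mean at most 1/h(d, c) - 1 uniformly in the mesh, so broken points
   are isolated; and Z is exactly the set of broken points because both sides of
   every end point of a segment are eventually covered: the motion started close
   to p hits p first with probability close to 1. *)

Require Import Defs.
From HB Require Import structures.
From mathcomp Require Import all_boot all_order all_algebra.
From mathcomp Require Import all_classical all_reals all_analysis.
From mathcomp Require Import measurable_realfun.
From mathcomp Require Import ring lra.

Set Implicit Arguments.
Unset Strict Implicit.
Unset Printing Implicit Defensive.

Import Order.TTheory GRing.Theory Num.Theory.
Import numFieldNormedType.Exports.

Local Open Scope classical_set_scope.
Local Open Scope ring_scope.

(** * Independence, Gaussian and exponential laws *)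

Section independence_tools.
Local Open Scope ereal_scope.

(** The starting points, the probability space and the versions of the local times all vary, so
    nothing may refer to a fixed space. Exit times, lifetimes and local times are therefore rebuilt
    as measurable functionals of a path and an exponential variable, from suprema over rational
    times and normalised occupation times; the given objects agree with them almost surely. One
    motion, translated, then serves all starting points, and laws can be carried from one space to
    another.

    The common measure for the exit laws is not constructed. The laws from the two ends [l] and [r]
    of a free interval are compared directly, with density [h(l, v) / h(r, v)], and the two orders
    of attachment become the same double integral against the exit law from [r].

    That the motion is almost surely killed needs an argument of its own. Multiplicativity and
    translation invariance give recurrence of the unkilled motion; a motion that could survive would
    then have a vanishing clock at time 1 from every starting point, while by Tonelli these clocks
    integrate over the starting points to [kappa setT]. *)

Lemma finite_measure_unique d (T : measurableType d) (R : realType)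
    (G : set (set T)) (m1 m2 : {measure set T -> \bar R}) :
  G `<=` measurable -> setI_closed G -> G setT -> m1 setT < +oo ->
  (forall A, G A -> m1 A = m2 A) -> forall A, <<s G >> A -> m1 A = m2 A.
Proof.
move=> Gm GI GT m1oo m12 A.
apply: (@g_sigma_algebra_measure_unique _ _ _ G Gm (fun=> setT)) => //.
by rewrite bigcup_const.
Qed.

(** Independence makes the law of the pair the product of the two marginals, so Tonelli allows the
    first variable to be frozen while the second is averaged. *)
Lemma indep_fubini d (Omega : measurableType d) (R : realType)
    (P : probability Omega R) d1 d2 (T1 : measurableType d1)
    (T2 : measurableType d2) (X : Omega -> T1) (Y : Omega -> T2)
    (f : T1 * T2 -> \bar R) :
  measurable_fun setT X -> measurable_fun setT Y ->
  (forall A B, measurable A -> measurable B ->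
     P (X @^-1` A `&` Y @^-1` B) = P (X @^-1` A) * P (Y @^-1` B)) ->
  measurable_fun setT f -> (forall z, 0 <= f z) ->
  \int[P]_w f (X w, Y w) = \int[P]_w \int[P]_w' f (X w, Y w').
Proof.
move=> mX mY ind mf f0.
pose X' : {mfun Omega >-> T1} := HB.pack X (isMeasurableFun.Build _ _ _ _ X mX).
pose Y' : {mfun Omega >-> T2} := HB.pack Y (isMeasurableFun.Build _ _ _ _ Y mY).
pose m1 := distribution P X'; pose m2 := distribution P Y'.
have mXY : measurable_fun setT (fun w => (X w, Y w)) by exact: measurable_fun_pair.
pose XY' : {mfun Omega >-> (T1 * T2)%type} :=
  HB.pack (fun w => (X w, Y w)) (isMeasurableFun.Build _ _ _ _ _ mXY).
transitivity (\int[distribution P XY']_z f z).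
  by rewrite ge0_integral_pushforward.
transitivity (\int[m1 \x m2]_z f z).
  apply: eq_measure_integral => A mA _; apply/esym.
  by apply: product_measure_unique => // B C mB mC; exact: ind.
rewrite fubini_tonelli1// /fubini_F ge0_integral_pushforward//=; last 2 first.
- exact: measurable_fun_fubini_tonelli_F.
- by move=> x _; exact: integral_ge0.
apply: eq_integral => w _; rewrite ge0_integral_pushforward//.
exact: measurableT_comp.
Qed.

Lemma indep2_fubini d (Omega : measurableType d) (R : realType)
    (P : probability Omega R) (F G : set (set Omega)) d1 d2
    (T1 : measurableType d1)
    (T2 : measurableType d2) (X : Omega -> T1) (Y : Omega -> T2)
    (f : T1 * T2 -> \bar R) :
  F `<=` measurable -> G `<=` measurable ->
  independent2 P F G ->
  (forall A, measurable A -> F (X @^-1` A)) ->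
  (forall A, measurable A -> G (Y @^-1` A)) ->
  measurable_fun setT f -> (forall z, 0 <= f z) ->
  \int[P]_w f (X w, Y w) = \int[P]_w \int[P]_w' f (X w, Y w').
Proof.
move=> Fm Gm FG FX GY mf f0; apply: indep_fubini => //.
- by move=> _ A mA; rewrite setTI; apply: Fm; exact: FX.
- by move=> _ A mA; rewrite setTI; apply: Gm; exact: GY.
- by move=> A B mA mB; apply: FG; [exact: FX|exact: GY].
Qed.

End independence_tools.

(** * Invariance of Lebesgue measure, and measures with a density *)

Section lebesgue_translation.
Local Open Scope ereal_scope.
Context {R : realType}.
Local Notation mu := (@lebesgue_measure R).

Lemma lebesgue_measure_addr (c : R) (A : set R) : measurable A ->
  mu [set x | A (x + c)%R] = mu A.
Proof.
move=> mA.
have mc : measurable_fun setT (fun x : measurableTypeR R => (x + c)%R : measurableTypeR R).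
  exact: measurable_funD.
pose X : {mfun measurableTypeR R >-> measurableTypeR R} :=
  HB.pack (fun x : measurableTypeR R => (x + c)%R : measurableTypeR R) (isMeasurableFun.Build _ _ _ _ _ mc).
suff : mu A = pushforward mu X A by move=> ->.
apply: lebesgue_measure_unique => // _ [[a b]] _ <-.
rewrite /pushforward.
rewrite [X in _ = mu X](_ : _ = `](a - c)%R, (b - c)%R]%classic); last first.
  by apply/seteqP; split => x /=; rewrite !in_itv/= ltrBlDr lerBrDr.
by rewrite !lebesgue_measure_itv/= !lte_fin ltrD2r -!EFinB; case: ifPn => // _; congr EFin; ring.
Qed.

Lemma ge0_integral_addr (c : R) (f : R -> \bar R) : measurable_fun setT f ->
  (forall x, 0 <= f x) -> \int[mu]_x f (x + c)%R = \int[mu]_x f x.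
Proof.
move=> mf f0.
have mc : measurable_fun setT (fun x : measurableTypeR R => (x + c)%R : measurableTypeR R).
  exact: measurable_funD.
pose X : {mfun measurableTypeR R >-> measurableTypeR R} :=
  HB.pack (fun x : measurableTypeR R => (x + c)%R : measurableTypeR R) (isMeasurableFun.Build _ _ _ _ _ mc).
transitivity (\int[pushforward mu X]_x f x).
  by rewrite ge0_integral_pushforward.
by apply: eq_measure_integral => A mA _; exact: lebesgue_measure_addr.
Qed.

End lebesgue_translation.

Section density.
Local Open Scope ereal_scope.
Context d (T : measurableType d) (R : realType).
Variables (mu m : {measure set T -> \bar R}) (h : T -> R).
Hypothesis mh : measurable_fun setT h.
Hypothesis h0 : forall x, (0 <= h x)%R.
Hypothesis mE : forall A, measurable A -> m A = \int[mu]_(x in A) (h x)%:E.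

Import HBNNSimple.

Let mEh : measurable_fun setT (EFin \o h). Proof. exact/measurable_EFinP. Qed.

Let density_nnsfun (g : {nnsfun T >-> R}) :
  \int[m]_x (g x)%:E = \int[mu]_x ((g x)%:E * (h x)%:E).
Proof.
have indic r : measurable_fun setT (fun x => (r * \1_(g @^-1` [set r]) x)%:E).
  by apply/measurable_EFinP; exact: measurable_funM.
have gE x : (g x)%:E = \sum_(r \in range g) (r * \1_(g @^-1` [set r]) x)%:E.
  by rewrite {1}fimfunE -fsumEFin.
under eq_integral do rewrite gE.
under [RHS]eq_integral => x _.
  rewrite gE ge0_mule_fsuml//; last by move=> r; exact: nnfun_muleindic_ge0.
  over.
rewrite !ge0_integral_fsum//.
- apply: eq_fsbigr => r /set_mem[x _ <-{r}].
  rewrite integralZl_indic_nnsfun// integral_indic// setIT mE//.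
  rewrite -(@ge0_integralZl _ _ _ mu _ _ (EFin \o h)) ?lee_fin//; last 2 first.
    exact: measurable_funTS.
    by move=> y _; rewrite /= lee_fin.
  rewrite [LHS]integral_mkcond; apply: eq_integral => y _.
  rewrite patchE indicE; case: ifPn => yg /=; first by rewrite mulr1.
  by rewrite mulr0 mul0e.
- by move=> r; apply: emeasurable_funM.
- by move=> r x _; rewrite mule_ge0 ?lee_fin//; exact: nnfun_muleindic_ge0.
- by move=> r x _; exact: nnfun_muleindic_ge0.
Qed.

Lemma ge0_integral_density (f : T -> \bar R) : measurable_fun setT f ->
  (forall x, 0 <= f x) -> \int[m]_x f x = \int[mu]_x (f x * (h x)%:E).
Proof.
move=> mf f0; pose g := nnsfun_approx measurableT mf.
have gf x : (g n x)%:E @[n --> \oo] --> f x.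
  by apply: cvg_nnsfun_approx => // y _.
transitivity (limn (fun n => \int[m]_x (g n x)%:E)).
  rewrite -monotone_convergence//.
  - by apply: eq_integral => x _; apply/esym/cvg_lim => //; exact: gf.
  - by move=> n; exact/measurable_EFinP.
  - by move=> n x _; rewrite lee_fin.
  - by move=> x _ a b ab; rewrite lee_fin; exact/lefP/nd_nnsfun_approx.
under eq_fun do rewrite density_nnsfun.
rewrite -monotone_convergence//.
- apply: eq_integral => x _; apply/cvg_lim => //.
  by apply: cvgeZr => //; exact: gf.
- by move=> n; apply: emeasurable_funM => //; exact/measurable_EFinP.
- by move=> n x _; rewrite mule_ge0// lee_fin.
- move=> x _ a b ab; rewrite lee_wpmul2r ?lee_fin//.
  exact/lefP/nd_nnsfun_approx.
Qed.

End density.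

(** * Gaussian estimates *)

Section gaussian.
Local Open Scope ereal_scope.
Context {R : realType}.
Local Notation mu := (@lebesgue_measure R).
Variable s : R.
Hypothesis s0 : s != 0%R.
Local Notation N := (normal_prob 0 s).
Local Notation pdf := (normal_pdf 0 s).
Local Notation peak := (normal_peak s).

Lemma ge0_integral_normal_prob (f : R -> \bar R) : measurable_fun setT f ->
  (forall x, 0 <= f x) -> \int[N]_y f y = \int[mu]_y (f y * (pdf y)%:E).
Proof.
move=> mf f0; apply: (@ge0_integral_density _ _ _ mu N pdf) => //.
- exact: measurable_normal_pdf.
- by move=> x; exact: normal_pdf_ge0.
Qed.

Lemma ge0_integral_opp (f : R -> \bar R) : measurable_fun setT f ->
  (forall x, 0 <= f x) -> \int[mu]_x f (- x)%R = \int[mu]_x f x.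
Proof.
move=> mf f0.
have mc : measurable_fun setT (fun x : measurableTypeR R => (- x)%R : measurableTypeR R).
  exact: measurable_funN.
pose X : {mfun measurableTypeR R >-> measurableTypeR R} :=
  HB.pack (fun x : measurableTypeR R => (- x)%R : measurableTypeR R) (isMeasurableFun.Build _ _ _ _ _ mc).
transitivity (\int[pushforward mu X]_x f x).
  by rewrite ge0_integral_pushforward.
by apply: eq_measure_integral => A mA _; exact: lebesgue_measureN.
Qed.

Lemma normal_pdf_sym y : pdf (- y)%R = pdf y.
Proof. by rewrite !normal_pdfE// /normal_fun !subr0 sqrrN. Qed.

Lemma normal_pdf_le x y : (`|x| <= `|y|)%R -> (pdf y <= pdf x)%R.
Proof.
move=> xy; rewrite !normal_pdfE// /normal_fun !subr0 ler_wpM2l ?normal_peak_ge0//.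
rewrite ler_expR !mulNr lerN2 ler_wpM2r//.
  by rewrite invr_ge0 mulrn_wge0// sqr_ge0.
by rewrite -(real_normK (num_real x)) -(real_normK (num_real y)) lerXn2r// nnegrE.
Qed.

Lemma ge0_integral_normal_sym (f : R -> \bar R) : measurable_fun setT f ->
  (forall x, 0 <= f x) -> \int[N]_y f (- y)%R = \int[N]_y f y.
Proof.
move=> mf f0.
have mfo : measurable_fun setT (fun x : R => f (- x)%R) by exact: measurableT_comp.
have mpdf : measurable_fun setT (EFin \o pdf).
  by apply/measurable_EFinP; exact: measurable_normal_pdf.
rewrite (@ge0_integral_normal_prob f)// (@ge0_integral_normal_prob (fun y => f (- y)%R))// -[RHS]ge0_integral_opp.
- by apply: eq_integral => y _; rewrite normal_pdf_sym.
- exact: emeasurable_funM.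
- by move=> x; rewrite mule_ge0// lee_fin normal_pdf_ge0.
Qed.

(** The densities [pdf u] and [pdf (u - z)] cross at [z / 2], so the excess of one integral over the
    other is largest when [g] is the indicator of the half-line below [z / 2]. It is then the mass
    of the interval from [- z / 2] to [z / 2], at most its length [z] times the peak of the
    density. *)
Let normal_shift_le0 (g : R -> R) (z : R) : measurable_fun setT g ->
  (forall x, (0 <= g x <= 1)%R) -> (0 <= z)%R ->
  \int[N]_y (g y)%:E <= \int[N]_y (g (z + y)%R)%:E + (z * peak)%:E.
Proof.
move=> mg g01 z0.
have mpdf : measurable_fun setT (EFin \o pdf).
  by apply/measurable_EFinP; exact: measurable_normal_pdf.
have mg' : measurable_fun setT (fun u : R => (g (z + u)%R)%:E).
  apply/measurable_EFinP; apply: measurableT_comp => //; exact: measurable_funD.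
have g0 x : (0 <= g x)%R by have /andP[] := g01 x.
have pdf0 x : (0 <= pdf x)%R := normal_pdf_ge0 _ _ _.
have mpdfz : measurable_fun setT (fun u : R => (pdf (u - z)%R)%:E).
  apply: (@measurableT_comp _ _ _ _ _ _ (EFin \o pdf)) => //.
  exact: measurable_funB.
have EzE : \int[N]_y (g (z + y)%R)%:E = \int[mu]_u ((g u)%:E * (pdf (u - z)%R)%:E).
  have g0' (x : R) : 0 <= (g (z + x)%R)%:E by rewrite lee_fin.
  rewrite (ge0_integral_normal_prob mg' g0').
  rewrite -(@ge0_integral_addr _ z (fun u => (g u)%:E * (pdf (u - z)%R)%:E)); last 2 first.
  - by apply: emeasurable_funM => //; exact/measurable_EFinP.
  - by move=> x; rewrite mule_ge0 ?lee_fin.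
  by apply: eq_integral => u _; rewrite addrK addrC.
have mEg : measurable_fun setT (EFin \o g) by exact/measurable_EFinP.
rewrite EzE (@ge0_integral_normal_prob (EFin \o g))//=.
pose I (A : set R) := \int[mu]_(u in A) (pdf u)%:E.
have IN A : I A = N A by [].
have Ish : \int[mu]_u ((\1_(`]-oo, (z / 2)%R[%classic) u)%:E * (pdf (u - z)%R)%:E) =
    I `]-oo, (- (z / 2))%R[%classic.
  rewrite -(@ge0_integral_addr _ z); last 2 first.
  - apply: emeasurable_funM => //; exact/measurable_EFinP.
  - by move=> x; rewrite mule_ge0 ?lee_fin.
  rewrite [RHS]integral_mkcond; apply: eq_integral => u _.
  rewrite addrK patchE indicE.
  have -> : ((u + z)%R \in (`]-oo, (z / 2)%R[%classic : set R)) =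
      (u \in (`]-oo, (- (z / 2))%R[%classic : set R)).
    by apply/idP/idP; rewrite !inE/= !in_itv/=; lra.
  by case: ifPn; rewrite ?mul1e ?mul0e.
have Ile : \int[mu]_u ((\1_(`]-oo, (z / 2)%R[%classic) u)%:E * (pdf u)%:E) <=
    I `]-oo, (- (z / 2))%R[%classic + (z * peak)%:E.
  have -> : \int[mu]_u ((\1_(`]-oo, (z / 2)%R[%classic) u)%:E * (pdf u)%:E) =
      I (`]-oo, (- (z / 2))%R[%classic `|` `[(- (z / 2))%R, (z / 2)%R[%classic).
    rewrite [RHS]integral_mkcond; apply: eq_integral => u _.
    rewrite patchE indicE.
    have -> : (u \in (`]-oo, (z / 2)%R[%classic : set R)) =
      (u \in (`]-oo, (- (z / 2))%R[%classic `|` `[(- (z / 2))%R, (z / 2)%R[%classic : set R)).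
      apply/idP/idP; rewrite !inE/= !in_itv/=; last by case; lra.
      by move=> uz; case: (ltP u (- (z / 2))%R) => ?; [left|right].
    by case: ifPn; rewrite ?mul1e ?mul0e.
  rewrite [X in X <= _]IN; apply: (le_trans (measureU2 _ _ _)) => //.
  rewrite leeD2l// -[leLHS]/(I _) /I.
  apply: (@le_trans _ _ (\int[mu]_(u in `[(- (z / 2))%R, (z / 2)%R[) peak%:E)).
    apply: ge0_le_integral => //.
    - by move=> x _; rewrite lee_fin.
    - exact: measurable_funTS.
    - by move=> x _; rewrite lee_fin; exact: normal_pdf_ub.
  rewrite integral_cst//= lebesgue_measure_itv/= lte_fin; case: ifPn => _.
    by rewrite -EFinB -EFinM lee_fin mulrC ler_wpM2r ?normal_peak_ge0//; lra.
  by rewrite mule0 lee_fin mulr_ge0// normal_peak_ge0.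
have Ifin : I `]-oo, (- (z / 2))%R[%classic \is a fin_num.
  by rewrite IN fin_num_measure.
(* The masses of the half-lines are added on both sides, so that only integrals of nonnegative
   functions are compared. *)
rewrite -(leeD2rE _ _ Ifin) -[in leRHS]addeA [in leRHS](addeC (z * peak)%:E).
apply: (@le_trans _ _ (\int[mu]_u ((g u)%:E * (pdf (u - z)%R)%:E) +
   \int[mu]_u ((\1_(`]-oo, (z / 2)%R[%classic) u)%:E * (pdf u)%:E))); last by rewrite leeD2l.
rewrite -Ish.
pose f1 (u : R) : \bar R := (g u)%:E * (pdf u)%:E.
pose f2 (u : R) : \bar R := (\1_(`]-oo, (z / 2)%R[%classic : set R) u)%:E * (pdf (u - z)%R)%:E.
pose f3 (u : R) : \bar R := (g u)%:E * (pdf (u - z)%R)%:E.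
pose f4 (u : R) : \bar R := (\1_(`]-oo, (z / 2)%R[%classic : set R) u)%:E * (pdf u)%:E.
have mi : measurable_fun setT (EFin \o (\1_(`]-oo, (z / 2)%R[%classic : set R) : R -> R)).
  by apply/measurable_EFinP; exact: measurable_indic.
have mf1 : measurable_fun setT f1 by exact: emeasurable_funM.
have mf2 : measurable_fun setT f2 by exact: emeasurable_funM.
have mf3 : measurable_fun setT f3 by exact: emeasurable_funM.
have mf4 : measurable_fun setT f4 by exact: emeasurable_funM.
have f10 u (_ : setT u) : 0 <= f1 u by rewrite mule_ge0 ?lee_fin.
have f20 u (_ : setT u) : 0 <= f2 u by rewrite mule_ge0 ?lee_fin.
have f30 u (_ : setT u) : 0 <= f3 u by rewrite mule_ge0 ?lee_fin.
have f40 u (_ : setT u) : 0 <= f4 u by rewrite mule_ge0 ?lee_fin.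
rewrite -[X in X + _ <= _]/(\int[mu]_u f1 u) -[X in _ + X <= _]/(\int[mu]_u f2 u).
rewrite -[X in _ <= X + _]/(\int[mu]_u f3 u) -[X in _ <= _ + X]/(\int[mu]_u f4 u).
rewrite -(ge0_integralD mu measurableT f10 mf1 f20 mf2).
rewrite -(ge0_integralD mu measurableT f30 mf3 f40 mf4).
apply: ge0_le_integral; [exact: measurableT| | | |].
- by move=> u _; rewrite adde_ge0 ?f10 ?f20.
- exact: emeasurable_funD.
- exact: emeasurable_funD.
- move=> u _; rewrite /f1 /f2 /f3 /f4 -!EFinM -!EFinD lee_fin indicE.
  have /andP[gu0 gu1] := g01 u.
  have [|] := boolP (u \in _).
    rewrite inE/= in_itv/= => uz; rewrite !mul1r.
    have : (pdf (u - z) <= pdf u)%R.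
      by apply: normal_pdf_le; case: (ger0P u) => ?; case: (ger0P (u - z)%R) => ?; lra.
    nra.
  rewrite notin_setE/= in_itv/= => /negP; rewrite -leNgt => uz.
  rewrite !mul0r !addr0 ler_wpM2l//; apply: normal_pdf_le.
  by case: (ger0P u) => ?; case: (ger0P (u - z)%R) => ?; lra.
Qed.

(** A smoothing estimate: Gaussian averages of an arbitrary measurable function with values in
    [[0, 1]] are Lipschitz in the centre. This is the source of the continuity of exit laws in the
    starting point. A downward shift is reduced to an upward one by reflection. *)
Lemma normal_shift_le (g : R -> R) (z z' : R) : measurable_fun setT g ->
  (forall x, (0 <= g x <= 1)%R) ->
  \int[N]_y (g (z + y)%R)%:E <=
  \int[N]_y (g (z' + y)%R)%:E + (`|z - z'| * peak)%:E.
Proof.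
move=> mg g01.
have g0 x : (0 <= g x)%R by have /andP[] := g01 x.
have [zz'|zz'] := leP z z'.
  have d0 : (0 <= z' - z)%R by rewrite subr_ge0.
  have := @normal_shift_le0 (fun y => g (z + y)%R) (z' - z) _ _ d0.
  rewrite distrC ger0_norm// => /(_ _ _)/le_trans; apply => //.
    by apply: measurableT_comp => //; exact: measurable_funD.
  rewrite leeD2r//; under eq_integral do rewrite addrA [(z + _)%R]addrC subrK.
  by [].
have d0 : (0 <= z - z')%R by rewrite subr_ge0 ltW.
have mgz y : measurable_fun setT (fun u : R => (g (y + u)%R)%:E).
  by apply/measurable_EFinP; apply: measurableT_comp => //; exact: measurable_funD.
have gz0 y u : 0 <= (g (y + u)%R)%:E by rewrite lee_fin.
rewrite -(ge0_integral_normal_sym (mgz z))// -(ge0_integral_normal_sym (mgz z'))//.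
have := @normal_shift_le0 (fun y => g (z - y)%R) (z - z') _ _ d0.
rewrite ger0_norm// => /(_ _ _)/le_trans; apply => //.
  by apply: measurableT_comp => //; exact: measurable_funB.
rewrite leeD2r//; under eq_integral do rewrite opprD opprB addrA [(z + _)%R]addrC subrK.
by [].
Qed.

Lemma normal_probE (A : set R) : measurable A -> N A = \int[N]_y (\1_A y)%:E.
Proof. by move=> mA; rewrite integral_indic// setIT. Qed.

Lemma normal_prob_pos : N `]0%R, +oo[%classic = 2^-1%:E.
Proof.
pose NN : probability (measurableTypeR R) R := N.
rewrite -[LHS]/(NN _).
have NNE (A : set R) : measurable A -> NN A = \int[N]_y (\1_A y)%:E by exact: normal_probE.
have N0 : NN [set 0%R] = 0.
  by rewrite /NN/= /normal_prob integral_set1.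
have Nsym : NN `]-oo, 0%R[%classic = NN `]0%R, +oo[%classic.
  rewrite !NNE// -[RHS]ge0_integral_normal_sym//.
  - apply: eq_integral => x _; rewrite !indicE; congr (EFin (nat_of_bool _)%:R).
    by apply/idP/idP; rewrite !inE/= !in_itv/= ?andbT; lra.
  - by apply/measurable_EFinP; exact: measurable_indic.
have : NN setT = NN `]-oo, 0%R[%classic + NN [set 0%R] + NN `]0%R, +oo[%classic.
  have -> : [set: R] = (`]-oo, 0%R[ `|` [set 0%R]) `|` `]0%R, +oo[%classic.
    apply/seteqP; split => // x _; rewrite /= !in_itv/= andbT.
    by case: (ltgtP x 0%R); [left; left|right|left; right].
  rewrite measureU//; last 2 first.
  - exact: measurableU.
  - apply/seteqP; split => // x [[|->]]/=; rewrite !in_itv/= ?andbT ?ltxx//; lra.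
  rewrite measureU//.
  by apply/seteqP; split => // x [/=]; rewrite in_itv/= => + x0; rewrite x0 ltxx.
rewrite probability_setT N0 adde0 Nsym.
have : NN `]0%R, +oo[%classic \is a fin_num by exact: fin_num_measure.
by case: (NN _) => // r _; rewrite -EFinD => -[rr]; congr EFin; lra.
Qed.

(** The shift estimate for the indicator of the positive half-line, whose mass is one half. *)
Lemma normal_prob_ray (a : R) : (0 <= a)%R ->
  (2^-1 - a * peak)%:E <= N `]a, +oo[%classic.
Proof.
move=> a0.
pose g : R -> R := \1_(`]0%R, +oo[%classic).
have gE z : \int[N]_y (g (z + y)%R)%:E = N `](- z)%R, +oo[%classic.
  rewrite normal_probE//; apply: eq_integral => y _.
  rewrite /g !indicE; congr (EFin (nat_of_bool _)%:R).
  by apply/idP/idP; rewrite !inE/= !in_itv/= ?andbT; lra.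
have mg : measurable_fun setT g by exact: measurable_indic.
have g01 x : (0 <= g x <= 1)%R by rewrite /g indicE; case: (_ \in _); rewrite /= ?lexx ler01.
have := normal_shift_le 0%R (- a)%R mg g01.
rewrite !gE oppr0 !opprK normal_prob_pos add0r ger0_norm//.
by rewrite EFinB leeBlDr.
Qed.

End gaussian.

(** * The exponential law *)

Section exponential_law.
Context d (Omega : measurableType d) (R : realType) (P : probability Omega R).
Variable e : Omega -> R.
Hypothesis me : measurable_fun setT (e : Omega -> measurableTypeR R).
Hypothesis elaw : forall A : set (measurableTypeR R), measurable A ->
  P (e @^-1` A) = exponential_prob 1 A.
Local Notation mu := (@lebesgue_measure R).
Local Notation pdf := (@exponential_pdf R 1).

Let e' : {mfun Omega >-> measurableTypeR R} :=
  HB.pack e (isMeasurableFun.Build _ _ _ _ (e : Omega -> measurableTypeR R) me).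

Let pdf0 (x : R) : 0 <= pdf x. Proof. by apply: exponential_pdf_ge0. Qed.

Let mpdf : measurable_fun setT (EFin \o pdf).
Proof. by apply/measurable_EFinP; exact: measurable_exponential_pdf. Qed.

Let int_e (f : R -> \bar R) : measurable_fun setT f -> (forall x, (0 <= f x)%E) ->
  (\int[P]_w f (e w) = \int[mu]_u (f u * (pdf u)%:E))%E.
Proof.
move=> mf f0; rewrite -(@ge0_integral_density _ _ _ mu (distribution P e') pdf) //.
- by rewrite ge0_integral_pushforward.
- exact: measurable_exponential_pdf.
Qed.

Lemma exp_singleton (c : R) : P [set w | e w = c] = 0%E.
Proof.
have -> : [set w | e w = c] = e @^-1` [set c] by [].
by rewrite elaw// /exponential_prob integral_set1.
Qed.

Lemma exp_le0 : P [set w | e w <= 0] = 0%E.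
Proof.
have -> : [set w | e w <= 0] = e @^-1` `]-oo, 0]%classic.
  by apply/seteqP; split => w /=; rewrite in_itv.
rewrite elaw// /exponential_prob.
rewrite -(@integral_itv_bndo_bndc _ -oo%O); last first.
  exact: measurable_funTS.
rewrite integral0_eq// => x /=; rewrite in_itv/= => x0.
by rewrite lt0_exponential_pdf.
Qed.

Lemma exp_memoryless (a : R) (f : R -> \bar R) : 0 <= a ->
  measurable_fun setT f -> (forall x, (0 <= f x)%E) ->
  (\int[P]_w (if (a < e w)%R then f (e w - a)%R else 0) =
   (expR (- a))%:E * \int[P]_w f (e w))%E.
Proof.
move=> a0 mf f0.
pose I : set R := `]a, +oo[%classic.
have mI : measurable I by exact: measurable_itv.
pose f1 u : \bar R := ((\1_I u)%:E * f (u - a)%R)%E.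
have mf1 : measurable_fun setT f1.
  apply: emeasurable_funM.
    by apply/measurable_EFinP; exact: measurable_indic.
  have mua : measurable_fun setT (fun u : R => u - a) by exact: measurable_funB.
  exact: (measurableT_comp mf mua).
have f10 x : (0 <= f1 x)%E by rewrite mule_ge0 ?lee_fin.
transitivity (\int[P]_w f1 (e w))%E.
  apply: eq_integral => w _; rewrite /f1 indicE.
  case: ifPn => ae; first by rewrite mem_set ?mul1e//= /I/= in_itv/= ae.
  by rewrite memNset ?mul0e//= /I/= in_itv/= (negbTE ae).
rewrite (int_e mf1 f10) (int_e mf f0).
have mfp : measurable_fun setT (fun u => f u * (pdf u)%:E)%E.
  exact: emeasurable_funM.
have fp0 (u : R) : (0 <= f u * (pdf u)%:E)%E by rewrite mule_ge0 ?lee_fin.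
rewrite -ge0_integralZl_EFin ?expR_ge0//.
rewrite -(@ge0_integral_addr _ a); last 2 first.
- exact: emeasurable_funM.
- by move=> x; rewrite mule_ge0 ?lee_fin.
rewrite /f1.
have mg : measurable_fun setT (fun u : R => (expR (- a))%:E * (f u * (pdf u)%:E))%E.
  exact: measurable_funeM.
have g0 (u : R) : (0 <= (expR (- a))%:E * (f u * (pdf u)%:E))%E.
  by rewrite mule_ge0// lee_fin expR_ge0.
have mJ : measurable (`]0, +oo[%classic : set R) by [].
transitivity (\int[mu]_(u in `]0%R, +oo[) ((expR (- a))%:E * (f u * (pdf u)%:E)))%E.
  rewrite [RHS]integral_mkcond; apply: eq_integral => u _.
  rewrite patchE indicE addrK /I.
  have -> : (u + a \in (`]a, +oo[%classic : set R)) = (u \in (`]0, +oo[%classic : set R)).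
    by apply/idP/idP; rewrite !inE/= !in_itv/= !andbT; lra.
  case: ifPn => [|_]; last by rewrite !mul0e.
  rewrite inE/= in_itv/= andbT => u0.
  rewrite mul1e muleCA; congr (_ * _)%E.
  rewrite !exponential_pdfE ?addr_ge0 ?(ltW u0)// ?mul1r.
  by rewrite -EFinM !mulN1r opprD expRD; congr EFin; ring.
have -> : [set: R] = `]-oo, 0[%classic `|` `[0, +oo[%classic.
  by apply/seteqP; split => // x _; rewrite /= !in_itv/= andbT; case: (ltP x 0); [left|right].
rewrite ge0_integral_setU//; last 2 first.
- exact: measurable_funTS.
- by apply/disj_setPS => x [/=]; rewrite !in_itv/= andbT; lra.
rewrite [X in (_ = X + _)%E]integral0_eq ?add0e; last first.
  by move=> x /=; rewrite in_itv/= => x0; rewrite lt0_exponential_pdf// !mule0.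
by rewrite -integral_itv_obnd_cbnd//; exact: measurable_funTS.
Qed.

End exponential_law.

(** Real induction on the supremum of the points [b] for which [Q x b] holds. It stands in for
    cutting a compact interval into cells shorter than a Lebesgue number. *)
Lemma interval_induction (R : realType) (Q : R -> R -> Prop) (x y : R) :
  x <= y ->
  (forall a b c, x <= a -> a <= b -> b <= c -> c <= y ->
     Q a b -> Q b c -> Q a c) ->
  (forall z, x <= z <= y -> exists2 r, 0 < r &
     forall a b, x <= a -> a <= b -> b <= y -> `|a - z| < r -> `|b - z| < r ->
       Q a b) ->
  Q x y.
Proof.
move=> xy Qtr Qloc.
pose S : set R := [set b | x <= b <= y /\ Q x b].
have Sx : S x.
  split; first by rewrite lexx.
  have [|r r0] := Qloc x; first by rewrite lexx.
  by apply; rewrite ?lexx// subrr normr0.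
have Sub : has_ubound S by exists y => b [/andP[]].
have S0 : S !=set0 by exists x.
have Ss : has_sup S by split.
set s := sup S.
have xs : x <= s by exact: ub_le_sup.
have sy : s <= y by apply: ge_sup => // b [/andP[]].
have [|r r0 Qr] := Qloc s; first by rewrite xs.
have [b Sb sb] := sup_adherent r0 Ss.
have bs : b <= s by exact: ub_le_sup.
(* One more local step carries [Q x b] past the supremum, unless [y] has been reached. *)
pose c := Num.min y (s + r / 2).
have sc : s <= c by rewrite /c le_min sy/=; lra.
have cy : c <= y by rewrite /c ge_min lexx.
have cr : c <= s + r / 2 by rewrite /c ge_min lexx orbT.
have Qxc : Q x c.
  have [/andP[xb _] Qxb] := Sb.
  apply: (Qtr _ b) => //; first exact: le_trans sc.
  apply: Qr => //.
  - exact: le_trans sc.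
  - by rewrite ler0_norm; [rewrite -/s in sb; lra|lra].
  - by rewrite ger0_norm; lra.
have Sc : S c by split => //; rewrite cy (le_trans xs).
have cs : c <= s by exact: ub_le_sup.
suff <- : c = y by [].
move: cs; rewrite /c; case: (leP y (s + r / 2)) => // _; lra.
Qed.

(** * Independence of the past and the next path *)

Section mutual_independence.
Context d (Omega : measurableType d) (R : realType) (P : probability Omega R).
Variable F : nat -> set (set Omega).
Hypothesis sF : forall n, sigma_algebra setT (F n).
Hypothesis Fm : forall n, F n `<=` measurable.

Definition past_sigma (n : nat) : set (set Omega) :=
  <<s \bigcup_(i in `I_n) F i >>.

Lemma past_sigma_measurable n : past_sigma n `<=` measurable.
Proof.
apply: smallest_sub; first exact: sigma_algebra_measurable.
by move=> A [i _]; exact: Fm.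
Qed.

(** Intersections of one event from each of the first [n] sigma-algebras form a pi-system generating
    the past. On it the product rule says that the restriction of [P] to [C] and the multiple [P C]
    of [P] agree. *)
Lemma mutually_independent_past n : mutually_independent P F ->
  independent2 P (past_sigma n) (F n).
Proof.
move=> ind A C pA FC.
have mC : measurable C by exact: Fm FC.
pose G : set (set Omega) := [set A | exists2 B : nat -> set Omega,
  (forall i, (i < n)%N -> F i (B i)) & A = \bigcap_(i in `I_n) B i].
have FT i : F i setT by have [F0 FD _] := sF i; rewrite -[setT]setD0; exact: FD.
have FI i A1 A2 : F i A1 -> F i A2 -> F i (A1 `&` A2).
  by move=> F1 F2; have /sigma_algebraP[//|_ _ _] := sF i; apply.
have GI : setI_closed G.
  move=> _ _ [B1 B1F ->] [B2 B2F ->]; exists (fun i => B1 i `&` B2 i).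
    by move=> i ni; apply: FI; [exact: B1F|exact: B2F].
  by rewrite -bigcapI.
have Gm : G `<=` measurable.
  move=> _ [B BF ->]; apply: fin_bigcap_measurable; first exact: finite_II.
  by move=> i ni; apply: Fm; exact: BF.
have GT : G setT.
  by exists (fun=> setT) => //; rewrite bigcapT.
have sG : <<s G >> A.
  move: pA; apply: smallest_sub; first exact: smallest_sigma_algebra.
  move=> B [i /= ni FB]; apply: sub_gen_smallest.
  exists (fun j => if j == i then B else setT).
    by move=> j jn; case: eqP => // ->.
  apply/seteqP; split => [w Bw j _|w /(_ i ni)]; last by rewrite eqxx.
  by case: eqP.
have Ps : (0 <= fine (P C))%R by rewrite fine_ge0.
pose s : {nonneg R} := NngNum Ps.
have PC : P C = (fine (P C))%:E by rewrite fineK// fin_num_measure.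
transitivity (mrestr P mC A) => //.
transitivity (mscale s P A); last by rewrite /mscale/= muleC PC.
apply: (finite_measure_unique Gm GI GT) sG; first by rewrite /= /mrestr setTI PC ltry.
move=> _ [B BF ->]; rewrite /= /mrestr /mscale/= -PC.
have bigE (D : nat -> set Omega) (k : nat) :
    \bigcap_(i in `I_k) D i = \bigcap_(i in [set` iota 0 k]) D i.
  by congr bigcap; apply/seteqP; split => i /=; rewrite mem_iota.
have -> : \bigcap_(i in `I_n) B i `&` C =
    \bigcap_(i in [set` iota 0 n.+1]) (if i == n then C else B i).
  rewrite -bigE; apply/seteqP; split => [w [Bw Cw] i /= ni|w Bw].
    by case: eqP => // /eqP ni'; apply: Bw => /=; rewrite ltn_neqAle ni'.
  split; last by have := Bw n (ltnSn n); rewrite eqxx.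
  by move=> i /= ni; have := Bw i (ltnW ni); rewrite lt_eqF.
rewrite bigE !ind ?iota_uniq//; last 2 first.
- by move=> i; rewrite mem_iota => /andP[_]; exact: BF.
- move=> i; rewrite mem_iota => /andP[_]; rewrite add0n ltnS => ni.
  by case: eqP => [->//|/eqP ni']; apply: BF; rewrite ltn_neqAle ni'.
rewrite -addn1 iotaD big_cat/= big_seq1 add0n eqxx muleC; congr (_ * _)%E.
rewrite !big_seq; apply: eq_bigr => i.
by rewrite mem_iota => /andP[_ ni]; rewrite lt_eqF.
Qed.

End mutual_independence.

(** * Measurability by countable operations *)

Section measurable_events.
Context d (T : measurableType d) (R : realType).

Lemma measurable_exists (I : countType) (A : I -> T -> Prop) :
  (forall i, measurable [set x | A i x]) -> measurable [set x | exists i, A i x].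
Proof.
move=> mA; have -> : [set x | exists i, A i x] = \bigcup_i [set x | A i x].
  by apply/seteqP; split => [x [i Aix]|x [i _ Aix]]; exists i.
by apply: countable_bigcupT_measurable => // i; exact: mA.
Qed.

Lemma measurable_forall (I : countType) (A : I -> T -> Prop) :
  (forall i, measurable [set x | A i x]) -> measurable [set x | forall i, A i x].
Proof.
move=> mA; rewrite -[X in measurable X]setCK; apply: measurableC.
rewrite (_ : ~` _ = [set x | exists i, (~` [set x | A i x]) x]).
  by apply: measurable_exists => i; apply: measurableC; exact: mA.
by apply/seteqP; split => x /= => [/existsNP|[i Ai] /(_ i)].
Qed.

Lemma measurable_ltr (f g : T -> R) : measurable_fun setT f ->
  measurable_fun setT g -> measurable [set x | f x < g x].
Proof.
move=> mf mg; have := measurable_fun_ltr mf mg.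
by move=> /(_ measurableT [set true]); rewrite setTI; exact.
Qed.

Lemma measurable_ler (f g : T -> R) : measurable_fun setT f ->
  measurable_fun setT g -> measurable [set x | f x <= g x].
Proof.
move=> mf mg; have := measurable_fun_ler mf mg.
by move=> /(_ measurableT [set true]); rewrite setTI; exact.
Qed.

Lemma measurable_lteE (f g : T -> \bar R) : measurable_fun setT f ->
  measurable_fun setT g -> measurable [set x | (f x < g x)%E].
Proof.
move=> mf mg; have := measurable_fun_lte mf mg.
by move=> /(_ measurableT [set true]); rewrite setTI; exact.
Qed.

Lemma measurable_imply (p : Prop) (A : T -> Prop) :
  (p -> measurable [set x | A x]) -> measurable [set x | p -> A x].
Proof.
move=> mA; have [hp|hp] := pselect p.
  rewrite (_ : [set x | p -> A x] = [set x | A x]); first exact: mA.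
  by apply/seteqP; split => x /=; tauto.
rewrite (_ : [set x | p -> A x] = setT)//.
by apply/seteqP; split => x /=; tauto.
Qed.

Lemma measurable_and (A B : T -> Prop) : measurable [set x | A x] ->
  measurable [set x | B x] -> measurable [set x | A x /\ B x].
Proof. exact: measurableI. Qed.

Lemma measurable_cst_event (p : Prop) : measurable [set _ : T | p].
Proof.
have [hp|hp] := pselect p.
  by rewrite (_ : [set _ | p] = setT)//; apply/seteqP; split.
by rewrite (_ : [set _ | p] = set0)//; apply/seteqP; split.
Qed.

Lemma measurable_ereal_sup_events (I : countType) (v : I -> \bar R)
    (A : I -> T -> Prop) :
  (forall i, measurable [set x | A i x]) ->
  measurable_fun setT (fun x => ereal_sup [set v i | i in [set i | A i x]]).
Proof.
move=> mA.
apply: (measurability _ (ErealGenOInfty.measurableE R)) => _ [_ [r ->] <-].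
rewrite setTI.
rewrite (_ : _ @^-1` _ = [set x | exists i, A i x /\ (r%:E < v i)%E]).
  by apply: measurable_exists => i; apply: measurable_and => //; exact: measurable_cst_event.
apply/seteqP; split => x /=; rewrite in_itv/= andbT.
  by move=> /ereal_sup_gt[_ [i Aix <-] ri]; exists i.
by move=> [i [Aix ri]]; apply: (lt_le_trans ri); apply: ereal_sup_ubound; exists i.
Qed.

End measurable_events.

Lemma within_continuous_retract (T U : topologicalType) (A : set T)
    (f : T -> U) (g : T -> T) : {within A, continuous f} -> continuous g ->
  (forall x, A (g x)) -> continuous (f \o g).
Proof.
move=> cf cg gA x.
have cfg : f @ within A (nbhs (g x)) --> f (g x).
  by rewrite nbhs_subspace_in//; exact: cf.
move=> B /cfg nB.
have nB' : nbhs (g x) [set y | A y -> B (f y)] by exact: nB.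
have nC : nbhs x (g @^-1` [set y | A y -> B (f y)]) by exact: (cg x _ nB').
by apply: filterS nC => y /= ; apply; exact: gA.
Qed.

(** * Measurable functionals of paths *)

Section path_space.
Context {R : realType}.
Implicit Types (t y : R) (n : nat).

(** Only nonnegative times are observable, so every functional of paths below is built from
    coordinates at such times. *)
Definition path_events : set (set (R -> R)) :=
  [set C | exists t, exists A : set (measurableTypeR R),
     [/\ 0 <= t, measurable A & C = [set w | A (w t)]]].

Definition path := g_sigma_algebraType path_events.

Lemma measurable_eval t : 0 <= t -> measurable_fun setT (fun w : path => w t).
Proof.
move=> t0 _ A mA; rewrite setTI; apply: sub_gen_smallest.
by exists t, A.
Qed.

Lemma measurable_path d (T : measurableType d) (f : T -> path) :
  (forall t, 0 <= t -> measurable_fun setT (fun x => f x t)) ->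
  measurable_fun setT f.
Proof.
move=> mf; apply: (@measurability _ _ T path setT f path_events) => // _ [_ [t [A [t0 mA ->]]] <-].
by apply: (mf t t0).
Qed.

(** The index [i] of the dyadic interval open at [i / 2^n] and closed at [(i + 1) / 2^n] that
    contains [t]. Being open on the left, it puts [lgrid n t] strictly before a positive [t]; the
    index is 0 for [t <= 0]. *)
Definition grid n t : nat :=
  if 0 < t then (absz (Num.ceil (t * 2 ^+ n))).-1 else 0%N.

Definition lgrid n t : R := (grid n t)%:R / 2 ^+ n.

Lemma gridP n t (i : nat) : 0 < t ->
  (grid n t == i) = (i%:R / 2 ^+ n < t <= i.+1%:R / 2 ^+ n).
Proof.
move=> t0; have p0 : 0 < 2 ^+ n :> R by rewrite exprn_gt0.
have c0 : 0 < Num.ceil (t * 2 ^+ n) by rewrite ceil_gt0 mulr_gt0.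
rewrite /grid t0 ltr_pdivrMr// ler_pdivlMr//.
have -> : ((`|Num.ceil (t * 2 ^+ n)|%N).-1 == i) = (Num.ceil (t * 2 ^+ n) == i.+1%:Z).
  case: (Num.ceil _) c0 => // -[//|k] _ /=.
  by apply/eqP/eqP => [->//|[->]].
by rewrite ceil_eq -[i.+1%:Z]/(Posz i.+1) intS addrAC subrr add0r.
Qed.

Lemma lgrid_ge0 n t : 0 <= lgrid n t.
Proof. by rewrite divr_ge0// exprn_ge0. Qed.

Lemma lgrid_le0 n t : t <= 0 -> lgrid n t = 0.
Proof. by move=> t0; rewrite /lgrid /grid ltNge t0/= mul0r. Qed.

Lemma lgrid_lt n t : 0 < t -> lgrid n t < t.
Proof. by move=> t0; have := eqxx (grid n t); rewrite gridP// => /andP[]. Qed.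

Lemma lgrid_gt n t : 0 < t -> t - (2 ^+ n)^-1 <= lgrid n t.
Proof.
move=> t0; have := eqxx (grid n t); rewrite gridP// => /andP[_].
by rewrite -natr1 mulrDl mul1r -lerBlDr.
Qed.

Lemma measurable_grid n i : measurable [set t | grid n t = i].
Proof.
have -> : [set t | grid n t = i] =
    ([set t | 0 < t] `&` [set t | i%:R / 2 ^+ n < t] `&` [set t | t <= i.+1%:R / 2 ^+ n])
    `|` ([set t : R | t <= 0] `&` [set _ | i = 0%N]).
  apply/seteqP; split => t /=.
    move=> <-; have [t0|t0] := ltP 0 t; last first.
      by right; split => //; rewrite /grid ltNge t0.
    by have := eqxx (grid n t); rewrite {1}gridP// => /andP[]; left.
  move=> [[[t0 t1] t2]|[t0 ->]]; last by rewrite /grid ltNge t0.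
  by apply/eqP; rewrite gridP// t1 t2.
apply: measurableU; repeat apply: measurableI.
- exact: measurable_ltr.
- exact: measurable_ltr.
- exact: measurable_ler.
- exact: measurable_ler.
- exact: measurable_cst_event.
Qed.

Lemma measurable_lgrid_eval d (T : measurableType d) n (w : T -> path) (t : T -> R) :
  measurable_fun setT w -> measurable_fun setT t ->
  measurable_fun setT (fun x => w x (lgrid n (t x))).
Proof.
move=> mw mt.
have -> : [set: T] = \bigcup_i [set x | grid n (t x) = i].
  by apply/seteqP; split => // x _; exists (grid n (t x)).
have mE i : measurable [set x | grid n (t x) = i].
  by have := mt measurableT _ (measurable_grid n i); rewrite setTI.
apply/measurable_fun_bigcup => // i.
apply: (eq_measurable_fun (fun x => w x (i%:R / 2 ^+ n))).
  by move=> x; rewrite inE /lgrid => ->.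
have i0 : 0 <= i%:R / 2 ^+ n :> R by rewrite divr_ge0// exprn_ge0.
exact: measurable_funTS (measurableT_comp (measurable_eval i0) mw).
Qed.

(* For a continuous path this is w t at every t > 0, but it is jointly
   measurable and at t it only depends on the path strictly before t. *)
Definition left_eval (w : R -> R) t : R :=
  fine (limn_esup (fun n => (w (lgrid n t))%:E)).

Lemma measurable_left_eval d (T : measurableType d) (w : T -> path) (t : T -> R) :
  measurable_fun setT w -> measurable_fun setT t ->
  measurable_fun setT (fun x => left_eval (w x) (t x)).
Proof.
move=> mw mt; apply: measurableT_comp; first exact: fine_measurable.
apply: measurable_fun_limn_esup => n; apply/measurable_EFinP.
exact: measurable_lgrid_eval.
Qed.

Lemma left_eval_le0 w t : t <= 0 -> left_eval w t = w 0.
Proof.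
move=> t0; rewrite /left_eval.
under eq_fun do rewrite lgrid_le0//.
have c : (w 0)%:E @[_ --> \oo] --> (w 0)%:E by exact: cvg_cst.
by rewrite is_cvg_limn_esupE ?(cvg_lim _ c)//; apply/cvg_ex; exists (w 0)%:E.
Qed.

(** Agreement at 0 and strictly before [t] is enough. A path may thus be altered from its lifetime
    on without moving its exit point. *)
Lemma eq_left_eval w1 w2 t : (w1 0 = w2 0) ->
  (forall u, 0 <= u -> u < t -> w1 u = w2 u) ->
  left_eval w1 t = left_eval w2 t.
Proof.
move=> w0 w12; have [t0|t0] := leP t 0; first by rewrite !left_eval_le0.
rewrite /left_eval; congr (fine (limn_esup _)); apply/funext => n.
by rewrite w12 ?lgrid_ge0 ?lgrid_lt.
Qed.

Lemma cvg_lgrid t : 0 <= t -> lgrid n t @[n --> \oo] --> t.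
Proof.
rewrite le_eqVlt => /predU1P[<-|t0].
  by under eq_fun do rewrite lgrid_le0//; exact: cvg_cst.
apply: (@squeeze_cvgr _ _ _ _ (fun n => t - (2 ^+ n)^-1) (fun=> t)).
- by apply: nearW => n; rewrite lgrid_gt//= ltW// lgrid_lt.
- rewrite -[X in _ --> X]subr0; apply: cvgB; first exact: cvg_cst.
  under eq_fun do rewrite -exprVn.
  by apply: cvg_expr; rewrite ger0_norm ?invr_ge0//; lra.
- exact: cvg_cst.
Qed.

(* A path on [0, +oo[ is extended to the left of 0 by its value at 0. *)
Definition cpath (w : R -> R) : Prop := continuous (fun t => w (Num.max 0 t)).

Lemma left_eval_cont w t : cpath w -> 0 <= t -> left_eval w t = w t.
Proof.
move=> cw t0; rewrite /left_eval.
have wt : w (lgrid n t) @[n --> \oo] --> w t.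
  have -> : w t = w (Num.max 0 t) by rewrite max_r.
  have -> : (fun n => w (lgrid n t)) = (fun u => w (Num.max 0 u)) \o (lgrid^~ t).
    by apply/funext => n /=; rewrite max_r// lgrid_ge0.
  exact: (cvg_comp _ _ (cvg_lgrid t0) (cw t)).
have ewt : (w (lgrid n t))%:E @[n --> \oo] --> (w t)%:E by apply: cvg_EFin => //; exact: nearW.
by rewrite is_cvg_limn_esupE ?(cvg_lim _ ewt)//; apply/cvg_ex; exists (w t)%:E.
Qed.

(* The upper limit of the normalised occupation times of [y, y + 1/k]; it is
   the local time whenever the latter exists and is continuous in space. *)
Definition loctime (y t : R) (w : R -> R) : \bar R :=
  limn_esup (fun k : nat => k.+1%:R%:E *
    lebesgue_measure [set s | (0 <= s <= t)%R /\ (y <= left_eval w s <= y + k.+1%:R^-1)%R])%E.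

(** Occupation times are measures of sections of a set that is jointly measurable in the parameter
    and the time, because [left_eval] is. *)
Lemma measurable_loctime d (T : measurableType d) (w : T -> path) (y : T -> R) t :
  measurable_fun setT w -> measurable_fun setT y ->
  measurable_fun setT (fun x => loctime (y x) t (w x)).
Proof.
move=> mw my; apply: measurable_fun_limn_esup => k; apply: measurable_funeM.
pose A : set (T * measurableTypeR R) := [set z | 0 <= z.2 <= t /\
  y z.1 <= left_eval (w z.1) z.2 <= y z.1 + k.+1%:R^-1].
have m2 : measurable_fun setT (fun z : T * measurableTypeR R => z.2 : R) by exact: measurable_snd.
have my1 : measurable_fun setT (fun z : T * measurableTypeR R => y z.1).
  exact: (measurableT_comp my (@measurable_fst _ _ T (measurableTypeR R))).
have mw1 : measurable_fun setT (fun z : T * measurableTypeR R => w z.1).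
  exact: (measurableT_comp mw (@measurable_fst _ _ T (measurableTypeR R))).
have ml : measurable_fun setT
  (fun z : T * measurableTypeR R => left_eval (w z.1) z.2) by exact: measurable_left_eval.
have mA : measurable A.
  rewrite (_ : A = ([set z | 0 <= (z.2 : R)] `&` [set z | (z.2 : R) <= t]) `&`
    ([set z | y z.1 <= left_eval (w z.1) z.2] `&`
     [set z | left_eval (w z.1) z.2 <= y z.1 + k.+1%:R^-1])).
    apply: measurableI; apply: measurableI; apply: measurable_ler => //.
    exact: measurable_funD.
  by apply/seteqP; split => z /=; rewrite /A/=; [case=> /andP[-> ->] /andP[-> ->]|move=> [[-> ->] [-> ->]]].
rewrite (_ : (fun x => _) = (@lebesgue_measure R) \o xsection A).
  exact: measurable_fun_xsection.
apply/funext => x /=; congr lebesgue_measure; apply/seteqP.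
by split => s /=; rewrite /xsection/= inE.
Qed.

End path_space.

Lemma within_cpath (R : realType) (w : R -> R) :
  {within `[0, +oo[, continuous w} -> cpath w.
Proof.
move=> cw; apply: (within_continuous_retract cw).
  by move=> t; apply: (@continuous_max _ _ (fun=> 0) id); [exact: cvg_cst|exact: cvg_id].
by move=> t; rewrite /= in_itv/= andbT le_max lexx.
Qed.

(** * Exit time and exit point as functionals of the path *)

Section exit_functional.
Context {R : realType}.
Implicit Types (s : seq (R * R)) (w : R -> R) (x y t : R).

Definition covered s y : Prop :=
  exists2 c, c \in s & Num.min c.1 c.2 <= y <= Num.max c.1 c.2.

Definition dist_seg (c : R * R) y : R :=
  Num.max 0 (Num.max (Num.min c.1 c.2 - y) (y - Num.max c.1 c.2)).

(** Distance to the covered set, truncated at 1 so that the empty state also gets a finite value.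
    Being covered becomes the vanishing of a measurable function. *)
Definition dist_cov s y : R := foldr (fun c r => Num.min (dist_seg c y) r) 1 s.

(* A state is the list of the segments [x_i, p_i], the most recent one first. A
   measurable random state is one of constant length with measurable entries. *)
Inductive mstate d (T : measurableType d) : (T -> seq (R * R)) -> Prop :=
| mstate_nil : mstate (fun=> [::])
| mstate_cons (x p : T -> R) (s : T -> seq (R * R)) : measurable_fun setT x -> measurable_fun setT p ->
    mstate s -> mstate (fun z : T => (x z, p z) :: s z).

Lemma mstate_cst d (T : measurableType d) s : mstate (fun _ : T => s).
Proof.
elim: s => [|[x p] s ih]; first exact: mstate_nil.
by apply: (@mstate_cons _ _ (fun=> x) (fun=> p)).
Qed.

Lemma mstate_comp d d' (T : measurableType d) (T' : measurableType d')
    (s : T -> seq (R * R)) (g : T' -> T) :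
  mstate s -> measurable_fun setT g -> mstate (fun z => s (g z)).
Proof.
move=> + mg; elim=> [|x p s' mx mp _ ih]; first exact: mstate_nil.
apply: (@mstate_cons _ _ (fun z => x (g z)) (fun z => p (g z))) => //.
  exact: measurableT_comp.
exact: measurableT_comp.
Qed.

Lemma measurable_dist_cov d (T : measurableType d) (s : T -> seq (R * R))
    (y : T -> R) : mstate s -> measurable_fun setT y ->
  measurable_fun setT (fun z => dist_cov (s z) (y z)).
Proof.
move=> + my; elim=> [|x p s' mx mp _ ih]; first exact: measurable_cst.
apply: measurable_minr => //; apply: measurable_maxr => //.
by apply: measurable_maxr; apply: measurable_funB => //;
  [exact: measurable_minr|exact: measurable_maxr].
Qed.

Lemma dist_seg_ge0 c y : 0 <= dist_seg c y.
Proof. by rewrite /dist_seg le_max lexx. Qed.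

Lemma dist_seg0 c y :
  (dist_seg c y == 0) = (Num.min c.1 c.2 <= y <= Num.max c.1 c.2).
Proof.
rewrite eq_le dist_seg_ge0 andbT /dist_seg !ge_max lexx/= !subr_le0.
by rewrite andbC andbC.
Qed.

Lemma dist_segP c y y' : dist_seg c y <= dist_seg c y' + `|y - y'|.
Proof.
have yy : y - y' <= `|y - y'| := ler_norm _.
have yy' : y' - y <= `|y - y'| by rewrite distrC ler_norm.
have n0 : 0 <= `|y - y'| by [].
rewrite /dist_seg; set m := Num.min _ _; set M := Num.max c.1 c.2.
have [a0 [b0 c0]] : [/\ 0 <= dist_seg c y', m - y' <= dist_seg c y' &
    y' - M <= dist_seg c y'].
  by rewrite /dist_seg !le_max !lexx ?orbT.
by rewrite /dist_seg -/m -/M in a0 b0 c0 *; rewrite !ge_max; apply/and3P; split; lra.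
Qed.

Lemma dist_cov_ge0 s y : 0 <= dist_cov s y.
Proof. by elim: s => [|c s ih] //=; rewrite le_min dist_seg_ge0. Qed.

Lemma dist_covP s y y' : dist_cov s y <= dist_cov s y' + `|y - y'|.
Proof.
elim: s => [|c s ih] /=; first by rewrite lerDl.
have := dist_segP c y y'; rewrite addr_minl le_min !ge_min => ->/=.
by rewrite ih orbT.
Qed.

Lemma coveredE s y : covered s y <-> dist_cov s y = 0.
Proof.
elim: s => [|c s ih] /=.
  by split => [[]//|/eqP]; rewrite oner_eq0.
split=> [[c' ]|].
  rewrite inE => /predU1P[->|c's] cy.
    by move: cy; rewrite -dist_seg0 => /eqP ->; rewrite min_l// dist_cov_ge0.
  by rewrite (ih.1 _) ?min_r// ?dist_seg_ge0//; exists c'.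
have [_ /eqP|_] := leP (dist_seg c y) (dist_cov s y).
  by rewrite dist_seg0; exists c => //; exact: mem_head.
by move=> /ih[c' c's c'y]; exists c' => //; rewrite inE c's orbT.
Qed.

Lemma dist_cov_gt0 s y : ~ covered s y -> 0 < dist_cov s y.
Proof. by move=> sy; rewrite lt0r dist_cov_ge0 andbT; apply/eqP => /coveredE. Qed.

(** A uniform positive distance at rational times. For a continuous path this says, with countable
    operations only, that the path stays off the closed covered set during all of [[0, t]]. *)
Definition avoids s w t : Prop :=
  exists m : nat, forall q : rat, 0 <= (ratr q : R) -> ratr q <= t ->
    m.+1%:R^-1 <= dist_cov s (w (ratr q)).

(** The supremum of an empty set is [-oo]: this is the value for a continuous path that starts on
    the covered set. As [fine] sends [-oo] to 0, [exit_point] is then the starting point. *)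
Definition exit_time s w (Z : \bar R) : \bar R :=
  ereal_sup [set (ratr q)%:E | q in [set q : rat |
    [/\ 0 <= (ratr q : R), ((ratr q : R)%:E < Z)%E & avoids s w (ratr q)]]].

Definition exit_point s w (Z : \bar R) : R := left_eval w (fine (exit_time s w Z)).

Lemma measurable_avoids d (T : measurableType d) (s : T -> seq (R * R))
    (w : T -> path) (t : R) : mstate s -> measurable_fun setT w ->
  measurable [set z | avoids (s z) (w z) t].
Proof.
move=> ms mw; apply: measurable_exists => m; apply: measurable_forall => q.
apply: measurable_imply => q0; apply: measurable_imply => qt.
apply: measurable_ler => //; apply: measurable_dist_cov => //.
exact: (measurableT_comp (measurable_eval q0) mw).
Qed.

Lemma measurable_exit_time d (T : measurableType d) (s : T -> seq (R * R))
    (w : T -> path) (Z : T -> \bar R) : mstate s -> measurable_fun setT w ->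
  measurable_fun setT Z ->
  measurable_fun setT (fun z => exit_time (s z) (w z) (Z z)).
Proof.
move=> ms mw mZ.
apply: (measurable_ereal_sup_events (fun q : rat => (ratr q)%:E)
  (A := fun q z => [/\ 0 <= (ratr q : R), ((ratr q : R)%:E < Z z)%E & avoids (s z) (w z) (ratr q)])).
move=> q; rewrite (_ : [set z | _] = [set _ | 0 <= (ratr q : R)] `&`
    [set z | ((ratr q : R)%:E < Z z)%E] `&` [set z | avoids (s z) (w z) (ratr q)]).
  apply: measurableI; last exact: measurable_avoids.
  by apply: measurableI; [exact: measurable_cst_event|exact: measurable_lteE].
by apply/seteqP; split => z /=; [case|case=> -[]].
Qed.

Lemma measurable_exit_point d (T : measurableType d) (s : T -> seq (R * R))
    (w : T -> path) (Z : T -> \bar R) : mstate s -> measurable_fun setT w ->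
  measurable_fun setT Z ->
  measurable_fun setT (fun z => exit_point (s z) (w z) (Z z)).
Proof.
move=> ms mw mZ; apply: measurable_left_eval => //.
apply: measurableT_comp; first exact: fine_measurable.
exact: measurable_exit_time.
Qed.

End exit_functional.

(** * The additive functional that kills the motion *)

Section killing_clock.
Context {R : realType} (kappa : {sigma_finite_measure set (measurableTypeR R) -> \bar R}).

Definition clock (t : R) (w : R -> R) : \bar R :=
  (\int[kappa]_y loctime y t w)%E.

Lemma loctime_ge0 (y t : R) w : (0 <= loctime y t w)%E.
Proof.
rewrite /loctime /limn_esup; apply: limf_esup_ge0 => [|k].
  exact: filter_not_empty.
by rewrite mule_ge0// measure_ge0.
Qed.

(** A supremum of rational times before the clock rings, in place of an infimum of real times after
    it: the two agree on good paths, and this form is measurable in the path and the exponential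
    variable. *)
Definition killing_time (w : R -> R) (e : R) : \bar R :=
  ereal_sup [set (ratr q)%:E | q in [set q : rat |
    0 <= (ratr q : R) /\ (clock (ratr q) w < e%:E)%E]].

End killing_clock.

Lemma limn_esup_eq (R : realType) (u : (\bar R)^nat) l :
  u @ \oo --> l -> limn_esup u = l.
Proof.
by move=> ul; rewrite is_cvg_limn_esupE ?(cvg_lim _ ul)//; apply/cvg_ex; exists l.
Qed.

(** * Paths with a jointly continuous occupation density *)

Section good_paths.
Context {R : realType}.
Local Notation mu := (@lebesgue_measure R).
Implicit Types (w : R -> R) (t y : R) (ell : R -> R -> R).

(* [ell y t] is a jointly continuous occupation density of the path [w]. *)
Record good_path w ell : Prop := GoodPath {
  good_cpath : cpath w ;
  good_ell : continuous (fun yt : R * R => ell yt.1 (Num.max 0 yt.2)) ;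
  good_occ : forall t, 0 <= t -> forall A : set (measurableTypeR R),
    measurable A ->
    mu [set u | 0 <= u <= t /\ A (w u)] = (\int[mu]_(y in A) (ell y t)%:E)%E }.

Lemma local_average (f : R -> R) (m : nat -> \bar R) y : continuous f ->
  (forall k, m k = \int[mu]_(v in `[y, (y + k.+1%:R^-1)%R]) (f v)%:E)%E ->
  ((k.+1%:R)%R%:E * m k)%E @[k --> \oo] --> (f y)%:E.
Proof.
move=> cf mE.
have int_f k : mu.-integrable `[y, y + k.+1%:R^-1] (EFin \o f).
  apply: continuous_compact_integrable; first exact: segment_compact.
  exact: continuous_subspaceT.
have int_c k c : mu.-integrable `[y, y + k.+1%:R^-1] (EFin \o cst c).
  apply: continuous_compact_integrable; first exact: segment_compact.
  exact: continuous_subspaceT (@cst_continuous _ _ c).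
have cE k (c : R) : ((k.+1%:R)%R%:E * \int[mu]_(v in `[y, (y + k.+1%:R^-1)%R]) c%:E = c%:E)%E.
  rewrite integral_cst//= lebesgue_measure_itv/= lte_fin ltrDl invr_gt0 ltr0n/=.
  by rewrite -EFinB -!EFinM addrAC subrr add0r mulrCA mulfV// mulr1.
have mfin k : m k = (fine (m k))%:E.
  by rewrite fineK// mE; apply: integrable_fin_num => //; exact: int_f.
apply: (@cvg_trans _ ((fun k => (k.+1%:R * fine (m k))%:E) @ \oo)).
  by under eq_fun do rewrite mfin -EFinM.
apply: cvg_EFin; first exact: nearW.
apply/cvgrPdist_le => eps eps0 /=.
have /cvgrPdist_le/(_ _ eps0)[/= r r0 fr] := cf y.
near=> k.
have kr : k.+1%:R^-1 < r.
  rewrite -[r]invrK ltf_pV2 ?posrE ?invr_gt0//.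
  rewrite (@le_lt_trans _ _ k%:R) ?ltr_nat//.
  by near: k; exact: nbhs_infty_ger.
have fb v : y <= v <= y + k.+1%:R^-1 -> f y - eps <= f v <= f y + eps.
  move=> /andP[yv vy]; have : `|f y - f v| <= eps.
    apply: fr => /=; rewrite distrC ger0_norm ?subr_ge0//.
    by rewrite (le_lt_trans _ kr)// lerBlDl.
  by rewrite ler_norml => /andP[]; lra.
have k0 : (0 <= k.+1%:R :> R) by [].
have ub : k.+1%:R * fine (m k) <= f y + eps.
  rewrite -lee_fin EFinM -mfin -(cE k (f y + eps)) lee_wpmul2l ?lee_fin// mE.
  apply: le_integral; [exact: measurable_itv|exact: int_f|exact: int_c|].
  by move=> v; rewrite inE/= in_itv/= => /fb/andP[_]; rewrite lee_fin.
have lb : f y - eps <= k.+1%:R * fine (m k).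
  rewrite -lee_fin EFinM -mfin -(cE k (f y - eps)) lee_wpmul2l ?lee_fin// mE.
  apply: le_integral; [exact: measurable_itv|exact: int_c|exact: int_f|].
  by move=> v; rewrite inE/= in_itv/= => /fb/andP[+ _]; rewrite lee_fin.
by rewrite ler_norml; apply/andP; split; lra.
Unshelve. all: by end_near. Qed.

Section fixed_path.
Variables (w : R -> R) (ell : R -> R -> R).
Hypothesis gw : good_path w ell.

Lemma cts_ell t : 0 <= t -> continuous (fun y => ell y t).
Proof.
move=> t0 y.
have -> : (fun y => ell y t) =
    (fun yt : R * R => ell yt.1 (Num.max 0 yt.2)) \o (fun y => (y, t)).
  by apply/funext => v /=; rewrite max_r.
have H : (fun y : R => (y, t)) @ y --> (y, t).
  move=> A [[B C]/= [nB nC] BC]; apply: filterS nB => v Bv; apply: BC.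
  by split => //=; exact: nbhs_singleton nC.
exact: (continuous_comp H (@good_ell _ _ gw (y, t))).
Qed.

Lemma cts_ell_time y : continuous (fun t => ell y (Num.max 0 t)).
Proof.
move=> t.
have H : (fun t : R => (y, t)) @ t --> (y, t).
  move=> A [[B C]/= [nB nC] BC]; apply: filterS nC => v Cv; apply: BC.
  by split => //=; exact: nbhs_singleton nB.
exact: (continuous_comp H (@good_ell _ _ gw (y, t))).
Qed.

(** Any jointly continuous occupation density is recovered from the path alone. The local times
    supplied with a motion therefore carry no information beyond its path. *)
Lemma loctimeE y t : 0 <= t -> loctime y t w = (ell y t)%:E.
Proof.
move=> t0; rewrite /loctime.
set m := (X in limn_esup X).
suff ml : m @ \oo --> (ell y t)%:E.
  exact: limn_esup_eq.
apply: (local_average (cts_ell t0)) => k.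
rewrite -(good_occ gw)//; congr (mu _); apply/seteqP.
split => u /=; rewrite in_itv/= => -[/andP[u0 ut]].
  by rewrite left_eval_cont ?u0 ?ut//; exact: good_cpath gw.
by rewrite -{1 2}(left_eval_cont (good_cpath gw) u0) u0 ut.
Qed.

Lemma ell_ge0 y t : 0 <= t -> 0 <= ell y t.
Proof. by move=> t0; rewrite -lee_fin -loctimeE// loctime_ge0. Qed.

Lemma ell_out y t : 0 <= t ->
  (exists2 r, 0 < r & forall u, 0 <= u <= t -> ~ (y <= w u <= y + r)) ->
  ell y t = 0.
Proof.
move=> t0 [r r0 wy]; apply: EFin_inj; rewrite -loctimeE// /loctime.
set m := (X in limn_esup X).
suff ml : m @ \oo --> 0%E.
  exact: limn_esup_eq.
apply: cvg_near_cst; near=> k.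
rewrite /m [X in mu X](_ : _ = set0) ?measure0 ?mule0//.
apply/seteqP; split => // u /= [ut]; have /andP[u0 _] := ut.
rewrite left_eval_cont//; last exact: good_cpath gw.
move=> /andP[yu uy]; apply: (wy u ut); rewrite yu (le_trans uy)// lerD2l ltW//.
rewrite -[r]invrK ltf_pV2 ?posrE ?invr_gt0//.
rewrite (@le_lt_trans _ _ k%:R) ?ltr_nat//.
by near: k; exact: nbhs_infty_ger.
Unshelve. all: by end_near. Qed.

Lemma ell0 y : ell y 0 = 0.
Proof.
apply: EFin_inj; rewrite -loctimeE// /loctime.
set m := (X in limn_esup X).
suff -> : m = fun=> 0%E.
  by apply: limn_esup_eq; exact: cvg_cst.
apply/funext => k; rewrite /m.
suff -> : (mu [set u | (0 <= u <= 0)%R /\ (y <= left_eval w u <= y + k.+1%:R^-1)%R] = 0)%E.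
  by rewrite mule0.
have [y0|y0] := pselect (y <= left_eval w 0 <= y + k.+1%:R^-1).
  rewrite (_ : [set _ | _] = [set 0]) ?lebesgue_measure_set1//.
  by apply/seteqP; split => u /= => [[/le_anti ->]|->]//; rewrite lexx.
rewrite (_ : [set _ | _] = set0) ?measure0//.
by apply/seteqP; split => u //= [/le_anti <-].
Qed.

End fixed_path.

Lemma cpath_bounded w t : cpath w -> 0 <= t ->
  exists2 M, 0 <= M & forall u, 0 <= u <= t -> `|w u| <= M.
Proof.
move=> cw t0.
have cn : continuous (fun u : R => `|w (Num.max 0 u)|).
  by move=> u; apply: cvg_norm; exact: cw.
have [|c _ wc] := @EVT_max R (fun u : R => `|w (Num.max 0 u)|) 0 t t0.
  exact: continuous_subspaceT.
exists `|w (Num.max 0 c)| => // u ut; have /andP[u0 _] := ut.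
by have := wc u; rewrite in_itv/= max_r// => /(_ ut).
Qed.

Lemma continuous_pair2 (T : topologicalType) (f g : T -> R) :
  continuous f -> continuous g -> continuous (fun x => (f x, g x)).
Proof.
move=> cf cg x A [[B C]/= [nB nC] BC].
have nf : nbhs x [set v | B (f v)] by exact: (cf x _ nB).
have ng : nbhs x [set v | C (g v)] by exact: (cg x _ nC).
by apply: filterS (filterI nf ng) => v [Bv Cv]; exact: BC.
Qed.

Lemma continuous_max0 : continuous (fun t : R => Num.max 0 t).
Proof.
by move=> t; apply: (@continuous_max _ _ (fun=> 0) id); [exact: cvg_cst|exact: cvg_id].
Qed.

Section fixed_path2.
Variables (w : R -> R) (ell : R -> R -> R).
Hypothesis gw : good_path w ell.

Lemma measurable_ell t : 0 <= t -> measurable_fun setT (fun y : R => (ell y t)%:E).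
Proof.
move=> t0; apply/measurable_EFinP; apply: continuous_measurable_fun.
exact: (cts_ell gw).
Qed.

(** Continuity bounds the density on a compact rectangle, and boundedness of the path confines its
    support. The result is the dominating function for limits under the integral against [kappa]. *)
Lemma ell_dominated t1 : 0 <= t1 -> exists M C, [/\ 0 <= M, 0 <= C &
  forall t y, 0 <= t <= t1 -> ell y t <= C * \1_(`[- M, M]%classic : set R) y].
Proof.
move=> t10; have [M M0 wM] := cpath_bounded (good_cpath gw) t10.
pose K : set (R * R) := `[- (M + 1), M + 1]%classic `*` `[0, t1]%classic.
have cK : compact K by apply: compact_setX; exact: segment_compact.
pose f (yt : R * R) := ell yt.1 (Num.max 0 yt.2).
have cf : {within K, continuous f}.
  by apply: continuous_subspaceT; exact: (good_ell gw).
have [C [_ fC]] := compact_bounded (continuous_compact cf cK).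
(* The margin 1 keeps the window [[y, y + 1/2]] of a level [y] outside the support clear of the
   path. *)
exists (M + 1), (Num.max 0 (C + 1)); split; [lra|by rewrite le_max lexx|].
move=> t y /andP[t0 tt1]; rewrite indicE; have [|yM] := boolP (_ \in _).
  rewrite inE/= mulr1 => yM; rewrite le_max; apply/orP; right.
  apply: le_trans (ler_norm _) _; apply: (fC (C + 1)); first by rewrite ltrDl.
  by exists (y, t); rewrite /K /f/= ?max_r//; split => //=; rewrite in_itv/= t0.
rewrite mulr0 (ell_out gw)//; exists (2^-1); first by rewrite invr_gt0.
move=> u /andP[u0 ut].
have /andP[wu1 wu2] : - M <= w u <= M.
  by rewrite -ler_norml; apply: wM; rewrite u0 (le_trans ut).
move: yM; rewrite notin_setE/= in_itv/= => yM /andP[yw wy]; apply: yM.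
by apply/andP; split; lra.
Qed.

Lemma ell_shiftE t r A : 0 <= t -> 0 <= r -> measurable (A : set (measurableTypeR R)) ->
  mu [set u | 0 <= u <= r /\ A (w (t + u))] =
  (\int[mu]_(y in A) (ell y (t + r) - ell y t)%:E)%E.
Proof.
move=> t0 r0 mA.
have tr0 : 0 <= t + r by rewrite addr_ge0.
have mw : measurable_fun setT (fun u : R => w (Num.max 0 u)).
  by apply: continuous_measurable_fun; exact: good_cpath gw.
have mB (I : interval R) : [set` I] `<=` [set u | 0 <= u] ->
    measurable [set u | u \in I /\ A (w u)].
  move=> I0; rewrite (_ : [set u | _] = [set` I] `&` [set u | A (w (Num.max 0 u))]).
    by apply: measurableI => //; rewrite -[X in measurable X]setTI; exact: mw.
  by apply/seteqP; split => u /= [uI]; have := I0 u uI => /= u0; rewrite max_r.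
have intf t' : 0 <= t' -> mu.-integrable A (fun y : R => (ell y t')%:E).
  move=> t'0; apply/integrableP; split; first exact: measurable_funTS (measurable_ell t'0).
  under eq_integral => y _ do rewrite gee0_abs ?lee_fin ?(ell_ge0 gw)//.
  rewrite -(good_occ gw)//; apply: (@le_lt_trans _ _ (mu `[0, t'])).
    apply: le_measure; rewrite ?inE//; last by move=> u /= [].
    by apply: (mB `[0, t']) => u /=; rewrite in_itv/= => /andP[].
  by rewrite lebesgue_measure_itv/=; case: ifP => _; rewrite ?ltry.
have mS : mu [set u | u \in `[t, t + r] /\ A (w u)] =
    mu [set u | u \in `]t, t + r] /\ A (w u)].
  have sub : forall I : interval R, (I = `[t, t + r] \/ I = `]t, t + r] \/ I = `[t, t]) ->
      [set` I] `<=` [set u | 0 <= u].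
    by move=> I [->|[->|->]] u /=; rewrite in_itv/= => /andP[]; lra.
  apply/eqP; rewrite eq_le; apply/andP; split; last first.
    apply: le_measure; rewrite ?inE; [apply: mB|apply: mB|]; try by apply: sub; tauto.
    by move=> u /= []; rewrite !in_itv/= => /andP[/ltW -> ->].
  rewrite (_ : [set u | u \in `[t, t + r] /\ A (w u)] =
    [set u | u \in `[t, t] /\ A (w u)] `|` [set u | u \in `]t, t + r] /\ A (w u)]).
    apply: le_trans (measureU2 _ _ _) _; try by apply: mB; apply: sub; tauto.
    rewrite -[leRHS]add0e leeD2r//.
    apply: (@le_trans _ _ (mu [set t])); last by rewrite lebesgue_measure_set1.
    apply: le_measure; rewrite ?inE//; first by apply: mB; apply: sub; tauto.
    by move=> u /= []; rewrite in_itv/= => /le_anti ->.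
  apply/seteqP; split => u /=; rewrite !in_itv/=.
    move=> [/andP[tu ur] Au]; have [ut|ut] := ltP t u; [right|left]; split => //;
      apply/andP; split; lra.
  by move=> [[/andP[tu ur] Au]|[/andP[tu ur] Au]]; split => //; apply/andP; split; lra.
have -> : mu [set u | 0 <= u <= r /\ A (w (t + u))] =
    mu [set u | u \in `[t, t + r] /\ A (w u)].
  rewrite -[RHS](lebesgue_measure_addr t); last first.
    by apply: mB => u /=; rewrite in_itv/= => /andP[]; lra.
  by congr (mu _); apply/seteqP; split => u /=; rewrite in_itv/= (addrC u t) => -[/andP[? ?] Au];
    split => //; apply/andP; split; lra.
have -> : (\int[mu]_(y in A) (ell y (t + r) - ell y t)%:E =
    \int[mu]_(y in A) (ell y (t + r))%:E - \int[mu]_(y in A) (ell y t)%:E)%E.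
  by rewrite -integralB ?intf//; apply: eq_integral.
rewrite -!(good_occ gw)// mS.
rewrite (_ : [set u | 0 <= u <= t + r /\ A (w u)] =
   [set u | u \in `]t, t + r] /\ A (w u)] `|` [set u | 0 <= u <= t /\ A (w u)]); last first.
  apply/seteqP; split => u /=; rewrite !in_itv/=.
    move=> [/andP[tu ur] Au]; have [ut|ut] := ltP t u; [left|right]; split => //;
      apply/andP; split; lra.
  by move=> [[/andP[tu ur] Au]|[/andP[tu ur] Au]]; split => //; apply/andP; split; lra.
have fin_t : mu [set u | 0 <= u <= t /\ A (w u)] \is a fin_num.
  by rewrite (good_occ gw)//; apply: integrable_fin_num => //; exact: intf.
rewrite measureU//.
- by rewrite addeK.
- by apply: mB => u /=; rewrite in_itv/= => /andP[]; lra.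
- by apply: (mB `[0, t]) => u /=; rewrite in_itv/= => /andP[].
- apply/seteqP; split => u //= [[]]; rewrite in_itv/= => /andP[tu _] _ [/andP[_ ut] _]; lra.
Qed.

Lemma good_shift t : 0 <= t ->
  good_path (fun r : R => w (t + r)) (fun y r => ell y (t + r) - ell y t).
Proof.
move=> t0; split.
- move=> r.
  have -> : (fun r : R => w (t + Num.max 0 r)) =
      (fun u : R => w (Num.max 0 u)) \o (fun r : R => t + Num.max 0 r).
    by apply/funext => v /=; rewrite [Num.max 0 (_ + _)]max_r// addr_ge0// le_max lexx.
  apply: continuous_comp; last exact: (@good_cpath _ _ gw).
  by apply: cvgD; [exact: cvg_cst|exact: continuous_max0].
- have c1 : continuous (fun yt : R * R => ell yt.1 (t + Num.max 0 yt.2)).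
    have -> : (fun yt : R * R => ell yt.1 (t + Num.max 0 yt.2)) =
      (fun yt : R * R => ell yt.1 (Num.max 0 yt.2)) \o
      (fun yt : R * R => (yt.1, t + Num.max 0 yt.2)).
      by apply/funext => v /=; rewrite [Num.max 0 (_ + _)]max_r// addr_ge0// le_max lexx.
    move=> yt; apply: continuous_comp; last exact: (@good_ell _ _ gw).
    apply: continuous_pair2; first by move=> x; exact: cvg_fst.
    move=> x; apply: cvgD; first exact: cvg_cst.
    by apply: continuous_comp; [exact: cvg_snd|exact: continuous_max0].
  have c2 : continuous (fun yt : R * R => ell yt.1 t).
    move=> yt; apply: (@continuous_comp _ _ _ fst (fun y => ell y t)); first exact: cvg_fst.
    exact: (cts_ell gw).
  by move=> yt; exact: (cvgB (c1 yt) (c2 yt)).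
- by move=> r r0 A mA; rewrite ell_shiftE.
Qed.

Lemma good_translate z : good_path (fun r : R => z + w r) (fun y r => ell (y - z) r).
Proof.
split.
- by move=> r; apply: cvgD; [exact: cvg_cst|exact: (@good_cpath _ _ gw)].
- move=> yt.
  have -> : (fun yt : R * R => ell (yt.1 - z) (Num.max 0 yt.2)) =
      (fun yt : R * R => ell yt.1 (Num.max 0 yt.2)) \o (fun yt : R * R => (yt.1 - z, yt.2)) by [].
  apply: continuous_comp; last exact: (@good_ell _ _ gw).
  apply: continuous_pair2; last by move=> x; exact: cvg_snd.
  by move=> x; apply: cvgB; [exact: cvg_fst|exact: cvg_cst].
- move=> t t0 A mA.
  have mAz : measurable [set y : measurableTypeR R | A (z + y)].
    rewrite -[X in measurable X]setTI.
    have : measurable_fun setT (fun y : measurableTypeR R => z + y : measurableTypeR R).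
      exact: measurable_funD.
    exact.
  rewrite (good_occ gw t0 mAz).
  have mell := measurable_ell t0.
  rewrite integral_mkcond [RHS]integral_mkcond -[RHS](ge0_integral_addr z).
  - apply: eq_integral => y _; rewrite !patchE addrK addrC.
    by congr (if _ then _ else _); apply/idP/idP; rewrite !inE/= addrC.
  - apply/(measurable_restrictT _ _).1 => //; apply: measurable_funTS.
    have mz : measurable_fun setT (fun y : R => y - z) by exact: measurable_funB.
    exact: (measurableT_comp mell mz).
  - by move=> y; rewrite patchE; case: ifP => // _; rewrite lee_fin (ell_ge0 gw).
Qed.

End fixed_path2.

End good_paths.

Section rational_suprema.
Context {R : realType}.

(** A set of times that is closed downwards and open to the right is some [[0, s[], so membership is
    a strict comparison with its supremum, and the rational times have the same supremum. *)
Lemma sup_ratP (Q : R -> Prop) :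
  (forall t t', 0 <= t -> t <= t' -> Q t' -> Q t) ->
  (forall t, 0 <= t -> Q t -> exists2 r, 0 < r & Q (t + r)) ->
  forall t, 0 <= t ->
  (t%:E < ereal_sup [set (ratr q)%:E | q in
     [set q : rat | (0 <= (ratr q : R))%R /\ Q (ratr q)]])%E <-> Q t.
Proof.
move=> Qd Qr t t0; split=> [/ereal_sup_gt[_ [q [q0 Qq] <-]]|Qt].
  by rewrite lte_fin => /ltW tq; exact: Qd Qq.
have [r r0 Qtr] := Qr t t0 Qt.
have [q] := @rat_in_itvoo R t (t + r) ltac:(lra).
rewrite in_itv/= => /andP[tq qr].
apply: (@lt_le_trans _ _ (ratr q)%:E); first by rewrite lte_fin.
apply: ereal_sup_ubound; exists q => //=; split; first lra.
by apply: Qd Qtr; [lra|exact: ltW].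
Qed.

End rational_suprema.

(** * Exit times of continuous paths *)

Section exit_paths.
Context {R : realType}.
Implicit Types (s : seq (R * R)) (w : R -> R) (t : R) (Z : \bar R).

Lemma continuous_dist_cov s w : cpath w ->
  continuous (fun u : R => dist_cov s (w (Num.max 0 u))).
Proof.
move=> cw u; apply/cvgrPdist_lt => e e0.
have /cvgrPdist_lt/(_ _ e0) := cw u.
apply: filterS => v; apply: le_lt_trans.
have := dist_covP s (w (Num.max 0 u)) (w (Num.max 0 v)).
have := dist_covP s (w (Num.max 0 v)) (w (Num.max 0 u)).
rewrite [`|w (Num.max 0 v) - _|]distrC ler_norml => ? ?.
by apply/andP; split; lra.
Qed.

Lemma avoidsP s w t : cpath w -> 0 <= t ->
  avoids s w t <-> (forall u, 0 <= u <= t -> ~ covered s (w u)).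
Proof.
move=> cw t0; have cd := @continuous_dist_cov s _ cw; split=> [[m wm] u /andP[u0 ut]|ws].
  move=> /coveredE du.
  have m0 : 0 < m.+1%:R^-1 :> R by rewrite invr_gt0.
  have /cvgrPdist_lt/(_ _ m0)[/= r r0 dr] := cd u.
  suff [q [q0 qt qr]] : exists q : rat, [/\ 0 <= (ratr q : R), ratr q <= t & `|u - ratr q| < r].
    have := dr (ratr q) qr; rewrite !max_r// du sub0r normrN.
    have := wm q q0 qt; rewrite ger0_norm ?dist_cov_ge0// => h1 h2.
    by have := lt_le_trans h2 h1; rewrite ltxx.
  have [tpos|tle] := ltP 0 t; last first.
    exists 0%Q; rewrite rmorph0; split => //; rewrite subr0 ger0_norm//; lra.
  have [q] := @rat_in_itvoo R (Num.max 0 (u - r)) (Num.min t (u + r)) ltac:(rewrite gt_max !lt_min; apply/andP; split; apply/andP; split; lra).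
  rewrite in_itv/= gt_max lt_min => /andP[/andP[q0 qr] /andP[qt qr']].
  exists q; split; [exact: ltW|exact: ltW|].
  by rewrite ltr_norml; apply/andP; split; lra.
have [c + dc] := @EVT_min R _ 0 t t0 (continuous_subspaceT cd).
rewrite in_itv/= => ct; have /andP[c0 _] := ct.
have := dist_cov_gt0 (ws c ct); set r := dist_cov _ _ => r0.
exists (Num.truncn r^-1) => q q0 qt.
have := dc (ratr q); rewrite in_itv/= q0 qt !max_r// => /(_ isT); apply: le_trans.
rewrite -[leRHS]invrK lef_pV2 ?posrE ?invr_gt0//; first exact/ltW/truncnS_gt.
Qed.

(** The covered set is closed and the path continuous, so the times of survival form a set open to
    the right. All later arguments on exit times go through this equivalence. *)
Lemma exit_timeP s w Z t : cpath w -> 0 <= t ->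
  (t%:E < exit_time s w Z)%E <->
  ((t%:E < Z)%E /\ forall u, 0 <= u <= t -> ~ covered s (w u)).
Proof.
move=> cw t0.
pose Q t := (t%:E < Z)%E /\ forall u, 0 <= u <= t -> ~ covered s (w u).
have -> : exit_time s w Z = ereal_sup [set (ratr q)%:E | q in
     [set q : rat | 0 <= (ratr q : R) /\ Q (ratr q)]].
  congr ereal_sup; congr image; apply/seteqP; split => q /=.
    by move=> [q0 qZ /(avoidsP _ cw q0)].
  by move=> [q0 [qZ wq]]; split => //; exact/avoidsP.
apply: (sup_ratP (Q := Q)) => //.
- move=> t1 t2 t10 t12 [tZ wt]; split.
    by apply: le_lt_trans tZ; rewrite lee_fin.
  by move=> u /andP[u0 ut]; apply: wt; rewrite u0 (le_trans ut).
- move=> t1 t10 [tZ wt].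
  have [r1 r10 r1Z] : exists2 r, 0 < r & ((t1 + r)%:E < Z)%E.
    case: Z tZ {Q} => [z| |//]; last by exists 1 => //; rewrite ltry.
    by rewrite lte_fin => tz; exists ((z - t1) / 2); rewrite ?lte_fin; lra.
  have d0 := dist_cov_gt0 (wt t1 _); rewrite t10 lexx in d0; have {}d0 := d0 isT.
  have /cvgrPdist_lt/(_ _ d0)[/= r2 r20 dr] := @continuous_dist_cov s _ cw t1.
  exists (Num.min r1 (r2 / 2)); first by rewrite lt_min r10; lra.
  have m1 : Num.min r1 (r2 / 2) <= r1 by rewrite ge_min lexx.
  have m2 : Num.min r1 (r2 / 2) <= r2 / 2 by rewrite ge_min lexx orbT.
  split; first by apply: le_lt_trans r1Z; rewrite lee_fin lerD2l.
  move=> u /andP[u0 ut]; have [ut1|ut1] := leP u t1; first by apply: wt; rewrite u0.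
  move=> /coveredE du.
  have /dr : `|t1 - u| < r2 by rewrite ler0_norm; lra.
  by rewrite /= !max_r// du subr0 ger0_norm ?dist_cov_ge0// ltxx.
Qed.

Lemma exit_time_covered s w Z : cpath w -> covered s (w 0) -> exit_time s w Z = -oo%E.
Proof.
move=> cw s0; rewrite /exit_time (_ : [set q : rat | _] = set0) ?image_set0 ?ereal_sup0//.
apply/seteqP; split => // q /= [q0 _ /(avoidsP _ cw q0)] /(_ 0).
by rewrite lexx q0 => /(_ isT).
Qed.

Lemma exit_point_covered s w Z : cpath w -> covered s (w 0) -> exit_point s w Z = w 0.
Proof. by move=> cw s0; rewrite /exit_point exit_time_covered// left_eval_le0. Qed.

Lemma eq_exit_time s1 s2 w1 w2 Z1 Z2 : cpath w1 -> cpath w2 ->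
  (forall t, 0 <= t ->
    ((t%:E < Z1)%E /\ forall u, 0 <= u <= t -> ~ covered s1 (w1 u)) <->
    ((t%:E < Z2)%E /\ forall u, 0 <= u <= t -> ~ covered s2 (w2 u))) ->
  exit_time s1 w1 Z1 = exit_time s2 w2 Z2.
Proof.
move=> c1 c2 h; congr ereal_sup; congr image; apply/seteqP; split => q /=.
  by move=> [q0 qZ /(avoidsP _ c1 q0) aq]; have [] := (h _ q0).1 (conj qZ aq); split => //; exact/avoidsP.
by move=> [q0 qZ /(avoidsP _ c2 q0) aq]; have [] := (h _ q0).2 (conj qZ aq); split => //; exact/avoidsP.
Qed.

Lemma exit_timeW s w Z : (exit_time s w Z <= Z)%E.
Proof. by apply: ge_ereal_sup => _ [q [_ /ltW qZ _] <-]. Qed.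

(* The first exit from the complement of the covered set, or the lifetime. *)
Lemma exit_pointP s w Z : cpath w -> ~ covered s (w 0) -> (0 < Z)%E ->
  (exit_time s w Z < +oo)%E -> exists t, [/\ exit_time s w Z = t%:E, 0 < t,
    exit_point s w Z = w t /\ (t%:E <= Z)%E,
    (forall u, 0 <= u < t -> ~ covered s (w u)) &
    Z = t%:E \/ covered s (w t)].
Proof.
move=> cw s0 Z0 Too.
have T0 : (0 < exit_time s w Z)%E.
  apply/exit_timeP => //; split => // u /le_anti <-; exact: s0.
have [t TE] : exists t, exit_time s w Z = t%:E.
  by case: exit_time T0 Too => // t _ _; exists t.
have t0 : 0 < t by rewrite -lte_fin -TE.
exists t; split => //.
- split; first by rewrite /exit_point TE/= left_eval_cont// ltW.
  by rewrite -TE exit_timeW.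
- move=> u /andP[u0 ut]; have : (u%:E < exit_time s w Z)%E by rewrite TE lte_fin.
  by move=> /(exit_timeP _ _ cw u0)[_]; apply; rewrite u0 lexx.
- apply: contrapT => /not_orP[/eqP Zt st].
  suff : (t%:E < exit_time s w Z)%E by rewrite TE ltxx.
  apply/exit_timeP => //; first exact: ltW.
  split.
    by rewrite lt_neqAle eq_sym Zt/= -TE exit_timeW.
  move=> u /andP[u0]; rewrite le_eqVlt => /predU1P[->//|ut].
  have : (u%:E < exit_time s w Z)%E by rewrite TE lte_fin.
  by move=> /(exit_timeP _ _ cw u0)[_]; apply; rewrite u0 lexx.
Qed.

Lemma shift_ereal (t : R) (T T' : \bar R) : 0 <= t ->
  (t%:E < T)%E ->
  (forall r, 0 <= r -> ((t + r)%R%:E < T)%E <-> (r%:E < T')%E) -> T = (t%:E + T')%E.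
Proof.
move=> t0 tT h.
have T'0 : (0 < T')%E by apply/h; rewrite ?addr0.
case: T tT h => [T| |//] tT h; case: T' T'0 h => [T'| |//] T'0 h.
- rewrite lte_fin in tT; rewrite lte_fin in T'0; congr EFin.
  apply: le_anti; apply/andP; split.
    rewrite leNgt; apply/negP => H; have /h : 0 <= T' by exact: ltW.
    by rewrite !lte_fin ltxx => -[/(_ H)].
  rewrite leNgt; apply/negP => H; have /h : 0 <= T - t by rewrite subr_ge0 ltW.
  rewrite !lte_fin addrC subrK ltxx => -[_]; have H' : T - t < T' by lra.
  by move=> /(_ H').
- have /h : 0 <= T - t by rewrite subr_ge0 ltW// -lte_fin.
  by rewrite !lte_fin addrC subrK ltxx ltry => -[_ /(_ isT)].
- have /h : 0 <= T' by rewrite ltW// -lte_fin.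
  by rewrite lte_fin ltxx ltry => -[/(_ isT)].
- by rewrite addey.
Qed.

Lemma cpath_shift w t : cpath w -> 0 <= t -> cpath (fun r : R => w (t + r)).
Proof.
move=> cw t0 r.
have -> : (fun r : R => w (t + Num.max 0 r)) =
    (fun u : R => w (Num.max 0 u)) \o (fun r : R => t + Num.max 0 r).
  by apply/funext => v /=; rewrite [Num.max 0 (_ + _)]max_r// addr_ge0// le_max lexx.
apply: continuous_comp; last exact: cw.
by apply: cvgD; [exact: cvg_cst|exact: continuous_max0].
Qed.

Lemma exit_time_shift s w Z Z' t : cpath w -> 0 <= t -> (t%:E < exit_time s w Z)%E ->
  (forall r, 0 <= r -> ((t + r)%R%:E < Z)%E <-> (r%:E < Z')%E) ->
  exit_time s w Z = (t%:E + exit_time s (fun r : R => w (t + r)%R) Z')%E.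
Proof.
move=> cw t0 tT ZZ'; apply: shift_ereal => // r r0.
have [tZ wt] := (exit_timeP s Z cw t0).1 tT.
have tr0 : 0 <= t + r by rewrite addr_ge0.
split.
  move=> /(exit_timeP _ _ cw tr0)[trZ wtr]; apply/exit_timeP => //; first exact: cpath_shift.
  split; first exact/ZZ'.
  by move=> u /andP[u0 ur]; apply: wtr; apply/andP; split; lra.
move=> /(exit_timeP _ _ (cpath_shift cw t0) r0)[trZ wtr]; apply/exit_timeP => //.
split; first exact/ZZ'.
move=> u /andP[u0 ur]; have [ut|ut] := leP u t; first by apply: wt; rewrite u0.
have := wtr (u - t); rewrite /= [t + _]addrC subrK; apply; apply/andP; split; lra.
Qed.

Lemma exit_point_shift s w Z Z' t : cpath w -> 0 <= t -> (t%:E < exit_time s w Z)%E ->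
  (exit_time s w Z < +oo)%E ->
  (forall r, 0 <= r -> ((t + r)%R%:E < Z)%E <-> (r%:E < Z')%E) ->
  exit_point s w Z = exit_point s (fun r : R => w (t + r)) Z'.
Proof.
move=> cw t0 tT Too ZZ'.
have TE := exit_time_shift cw t0 tT ZZ'.
rewrite /exit_point; move: tT Too; rewrite TE.
case: exit_time => [T'| |]//= tT _; rewrite -EFinD lte_fin in tT.
rewrite (left_eval_cont cw); last lra.
by rewrite (left_eval_cont (cpath_shift cw t0)); last lra.
Qed.

End exit_paths.

(** * The clock along a good path *)

Section clock_paths.
Context {R : realType} (kappa : {sigma_finite_measure set (measurableTypeR R) -> \bar R}).
Hypothesis kappa_radon : radon_measure kappa.
Variables (w : R -> R) (ell : R -> R -> R).
Hypothesis gw : good_path w ell.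
Local Notation A := (clock kappa).

Lemma clockE t : 0 <= t -> A t w = (\int[kappa]_y (ell y t)%:E)%E.
Proof. by move=> t0; apply: eq_integral => y _; rewrite (loctimeE gw). Qed.

Lemma clock_ge0 t v : (0 <= A t v)%E.
Proof. by apply: integral_ge0 => y _; exact: loctime_ge0. Qed.

Lemma clock0 : A 0 w = 0%E.
Proof. by rewrite clockE//; apply: integral0_eq => y _; rewrite (ell0 gw). Qed.

Lemma integrable_window (M C : R) : 0 <= C ->
  kappa.-integrable setT (fun y => (C * \1_(`[- M, M]%classic : set R) y)%:E).
Proof.
move=> C0; apply/integrableP; split.
  by apply/measurable_EFinP; apply: measurable_funM => //; exact: measurable_indic.
under eq_integral => y _ do rewrite gee0_abs ?lee_fin ?mulr_ge0// EFinM.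
rewrite ge0_integralZl_EFin//; last first.
  by apply/measurable_EFinP; exact: measurable_indic.
rewrite integral_indic// setIT lte_mul_pinfty ?lee_fin//.
by apply: kappa_radon; exact: segment_compact.
Qed.

Lemma clock_cvg (u : nat -> R) t t1 : (forall n, 0 <= u n <= t1) ->
  u @ \oo --> t -> A (u n) w @[n --> \oo] --> A t w.
Proof.
move=> ut1 ut; have t10 : 0 <= t1 by have /andP[] := ut1 0%N; exact: le_trans.
have t0 : 0 <= t.
  rewrite -(cvg_lim (@Rhausdorff R) ut); apply: limr_ge; first by apply/cvg_ex; exists t.
  by apply: nearW => n; have /andP[] := ut1 n.
have [M [C [M0 C0 dom]]] := ell_dominated gw t10.
rewrite clockE//.
have -> : (fun n => A (u n) w) = (fun n => \int[kappa]_y (ell y (u n))%:E)%E.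
  by apply/funext => n; rewrite clockE//; have /andP[] := ut1 n.
apply: (@dominated_cvg _ _ _ kappa setT measurableT _ _
    (fun y => (C * \1_(`[- M, M]%classic : set R) y)%:E)) => //.
- by move=> n; apply: (measurable_ell gw); have /andP[] := ut1 n.
- move=> y _; apply: cvg_EFin; first exact: nearW.
  have -> : (fine \o (fun n => (ell y (u n))%:E)) = (fun r => ell y (Num.max 0 r)) \o u.
    by apply/funext => n /=; rewrite max_r//; have /andP[] := ut1 n.
  have K : (fun r : R => ell y (Num.max 0 r)) @ t --> ell y (Num.max 0 t).
    exact: (@cts_ell_time _ _ _ gw y t).
  by have := cvg_comp _ _ ut K; rewrite max_r.
- exact: integrable_window.
- move=> n y _; rewrite gee0_abs ?lee_fin; last first.
    by apply: (ell_ge0 gw); have /andP[] := ut1 n.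
  exact: dom.
Qed.

Lemma clock_fin t : 0 <= t -> A t w \is a fin_num.
Proof.
move=> t0; rewrite ge0_fin_numE ?clock_ge0// clockE//.
have [M [C [M0 C0 dom]]] := ell_dominated gw t0.
have /integrableP[_] := integrable_window M C0.
apply: le_lt_trans; apply: ge0_le_integral => //.
- by move=> y _; rewrite lee_fin (ell_ge0 gw).
- exact: (measurable_ell gw).
- by apply/measurable_EFinP/measurableT_comp => //; apply: measurable_funM => //; exact: measurable_indic.
- move=> y _; rewrite gee0_abs ?lee_fin ?mulr_ge0//.
  by apply: dom; rewrite t0 lexx.
Qed.

Lemma clockD t r : 0 <= t -> 0 <= r ->
  A (t + r) w = (A t w + A r (fun u : R => w (t + u)%R))%E.
Proof.
move=> t0 r0; have tr0 : 0 <= t + r by rewrite addr_ge0.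
have gs := good_shift gw t0.
rewrite !clockE// /clock.
under [X in (_ = _ + X)%E]eq_integral => y _ do rewrite (loctimeE gs)//.
have gt0 y : 0 <= ell y (t + r) - ell y t by exact: (ell_ge0 gs).
have m1 := measurable_ell gw t0; have m2 := measurable_ell gs r0.
have p1 y (_ : setT y) : (0 <= (ell y t)%:E)%E by rewrite lee_fin (ell_ge0 gw).
have p2 y (_ : setT y) : (0 <= (ell y (t + r) - ell y t)%:E)%E by rewrite lee_fin.
rewrite -(ge0_integralD kappa measurableT p1 m1 p2 m2); apply: eq_integral => y _.
by rewrite -EFinD [(ell y t + _)%R]addrC subrK.
Qed.

Lemma clock_le t t' : 0 <= t -> t <= t' -> (A t w <= A t' w)%E.
Proof.
move=> t0 tt'; rewrite [t'](_ : _ = t + (t' - t)); last ring.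
by rewrite clockD ?subr_ge0// leeDl// clock_ge0.
Qed.

Lemma clock_right t (e : R) : 0 <= t -> (A t w < e%:E)%E ->
  exists2 r, 0 < r & (A (t + r) w < e%:E)%E.
Proof.
move=> t0 te.
have ut n : 0 <= t + n.+1%:R^-1 <= t + 1.
  rewrite addr_ge0//= lerD2l invf_le1// ler1n//.
have cu : (fun n => t + n.+1%:R^-1) @ \oo --> t.
  rewrite -[X in _ --> X]addr0; apply: cvgD; first exact: cvg_cst.
  exact: cvg_harmonic.
have nb : nbhs (A t w) [set x | (x < e%:E)%E].
  by apply: open_nbhs_nbhs; split => //; exact: open_ereal_lt_ereal.
have [N _ /(_ N (leqnn N))/= H] := clock_cvg ut cu nb.
by exists N.+1%:R^-1.
Qed.

Lemma killing_timeP (e t : R) : 0 <= t ->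
  (t%:E < killing_time kappa w e)%E <-> (A t w < e%:E)%E.
Proof.
apply: (sup_ratP (Q := fun t => (A t w < e%:E)%E)).
- by move=> t1 t2 t10 t12; apply: le_lt_trans; exact: clock_le.
- by move=> t1 t10; exact: clock_right.
Qed.

Lemma killing_time_gt0 (e : R) : 0 < e -> (0 < killing_time kappa w e)%E.
Proof. by move=> e0; apply/killing_timeP => //; rewrite clock0 lte_fin. Qed.

Lemma killing_timeE (e : R) : 0 < e -> killing_time kappa w e =
  ereal_inf [set t%:E | t in [set t : R | 0 <= t /\ (e%:E <= A t w)%E]].
Proof.
move=> e0; apply/eqP; rewrite eq_le; apply/andP; split.
  apply: le_ereal_inf_tmp => _ [t [t0 et] <-]; rewrite leNgt; apply/negP.
  by move=> /(killing_timeP _ t0); rewrite ltNge et.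
rewrite leNgt; apply/negP => H.
have k0 := killing_time_gt0 e0.
case: (killing_time kappa w e) k0 H (fun t => @killing_timeP e t) => [r| |//].
- rewrite lte_fin => r0 /= H kP.
  have : ~ (r%:E < r%:E)%E by rewrite ltxx.
  apply; apply/kP; first exact: ltW.
  rewrite ltNge; apply/negP => eA.
  suff : (r%:E < r%:E)%E by rewrite ltxx.
  apply: (lt_le_trans H); apply: ereal_inf_lbound; exists r => //; split => //.
  exact: ltW.
- by move=> _; rewrite ltNge leey.
Qed.

Lemma clock_killing_time (e t : R) : 0 < t -> killing_time kappa w e = t%:E ->
  A t w = e%:E.
Proof.
move=> t0 ke; have t0' := ltW t0; apply/eqP; rewrite eq_le; apply/andP; split; last first.
  rewrite leNgt; apply/negP => /(killing_timeP e t0').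
  by rewrite ke ltxx.
have ut n : 0 <= t - t / n.+1%:R <= t.
  rewrite subr_ge0 ler_pdivrMr// ler_peMr ?ler1n//=.
  by rewrite gerBl divr_ge0// ltW.
have cu : (fun n => t - t / n.+1%:R) @ \oo --> t.
  rewrite -[X in _ --> X]subr0; apply: cvgB; first exact: cvg_cst.
  rewrite -[X in _ --> X](mulr0 t); apply: cvgM; first exact: cvg_cst.
  exact: cvg_harmonic.
have cA := clock_cvg ut cu.
rewrite -(cvg_lim _ cA)//; apply: lime_le; first by apply/cvg_ex; exists (A t w).
apply: nearW => n; apply: ltW; have /andP[u0 _] := ut n.
by apply/killing_timeP => //; rewrite ke lte_fin ltrBlDr ltrDl divr_gt0.
Qed.

(** The reading of the clock when the path meets the covered set. It is a functional of the path
    only, so the exponential variable almost surely differs from it, which excludes a simultaneous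
    hitting and killing. *)
Definition exit_clock s (v : R -> R) : \bar R :=
  ereal_sup [set A (ratr q) v | q in [set q : rat | 0 <= (ratr q : R) /\ avoids s v (ratr q)]].

Lemma exit_killing_tie s (e t : R) : 0 < t -> exit_time s w +oo = t%:E ->
  killing_time kappa w e = t%:E -> exit_clock s w = e%:E.
Proof.
move=> t0 et ke; have cw := good_cpath gw; have t0' := ltW t0.
apply/eqP; rewrite eq_le; apply/andP; split.
  apply: ge_ereal_sup => _ [q [q0 aq] <-]; rewrite -(clock_killing_time t0 ke).
  apply: clock_le => //; rewrite -lee_fin -et; apply: ereal_sup_ubound.
  by exists q => //; split => //; rewrite ltry.
rewrite -(clock_killing_time t0 ke).
have ut n : 0 <= t - t / n.+1%:R <= t.
  rewrite subr_ge0 ler_pdivrMr// ler_peMr ?ler1n//=.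
  by rewrite gerBl divr_ge0// ltW.
have cu : (fun n => t - t / n.+1%:R) @ \oo --> t.
  rewrite -[X in _ --> X]subr0; apply: cvgB; first exact: cvg_cst.
  rewrite -[X in _ --> X](mulr0 t); apply: cvgM; first exact: cvg_cst.
  exact: cvg_harmonic.
have cA := clock_cvg ut cu.
rewrite -(cvg_lim _ cA)//; apply: lime_le; first by apply/cvg_ex; exists (A t w).
apply: nearW => n; have /andP[u0 _] := ut n.
have u1 : t - t / n.+1%:R < t by rewrite ltrBlDr ltrDl divr_gt0.
have [q] := rat_in_itvoo u1; rewrite in_itv/= => /andP[q1 q2].
have q0 : 0 <= ratr q :> R by rewrite (le_trans u0)// ltW.
apply: (@le_trans _ _ (A (ratr q) w)); first by apply: clock_le => //; exact: ltW.
apply: ereal_sup_ubound; exists q => //; split => //; apply/avoidsP => // u uq.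
have : ((ratr q)%:E < exit_time s w +oo)%E by rewrite et lte_fin.
by move=> /(exit_timeP _ _ cw q0)[_]; exact.
Qed.

End clock_paths.

Lemma killing_time_shift (R : realType)
    (kappa : {sigma_finite_measure set (measurableTypeR R) -> \bar R})
    (w : R -> R) (ell : R -> R -> R) (e t r : R) : radon_measure kappa ->
  good_path w ell -> 0 <= t -> 0 <= r ->
  ((t + r)%R%:E < killing_time kappa w e)%E <->
  (r%:E < killing_time kappa (fun u : R => w (t + u)%R) (e - fine (clock kappa t w))%R)%E.
Proof.
move=> kr gw t0 r0; have gs := good_shift gw t0.
rewrite (killing_timeP kr gw) ?addr_ge0// (killing_timeP kr gs)//.
have cf := clock_fin kr gw t0.
by rewrite (clockD kappa gw t0 r0) EFinB lteBrDl ?fineK.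
Qed.

Section measurable_clock.
Context {R : realType} (kappa : {sigma_finite_measure set (measurableTypeR R) -> \bar R}).
Context d (T : measurableType d).

Lemma measurable_clock (w : T -> path) (t : R) : measurable_fun setT w ->
  measurable_fun setT (fun x => clock kappa t (w x)).
Proof.
move=> mw.
pose f (z : T * measurableTypeR R) := loctime (z.2 : R) t (w z.1).
have mf : measurable_fun setT f.
  apply: measurable_loctime; last exact: measurable_snd.
  exact: (measurableT_comp mw (@measurable_fst _ _ T (measurableTypeR R))).
exact: (@measurable_fun_fubini_tonelli_F _ _ T (measurableTypeR R) R kappa f mf
  (fun z => loctime_ge0 _ _ _)).
Qed.

Lemma measurable_killing_time (w : T -> path) (e : T -> R) :
  measurable_fun setT w -> measurable_fun setT e ->
  measurable_fun setT (fun x => killing_time kappa (w x) (e x)).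
Proof.
move=> mw me.
apply: (measurable_ereal_sup_events (fun q : rat => (ratr q)%:E)
  (A := fun q x => 0 <= (ratr q : R) /\ (clock kappa (ratr q) (w x) < (e x)%:E)%E)).
move=> q; apply: measurable_and; first exact: measurable_cst_event.
apply: measurable_lteE; first exact: measurable_clock.
exact/measurable_EFinP.
Qed.

Lemma measurable_exit_clock (w : T -> path) s : measurable_fun setT w ->
  measurable_fun setT (fun x => exit_clock kappa s (w x)).
Proof.
move=> mw.
apply: (measurability _ (ErealGenOInfty.measurableE R)) => _ [_ [r ->] <-].
rewrite setTI (_ : _ @^-1` _ = [set x | exists q : rat, (0 <= (ratr q : R) /\
    avoids s (w x) (ratr q)) /\ (r%:E < clock kappa (ratr q) (w x))%E]).
  apply: measurable_exists => q; repeat apply: measurable_and.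
  - exact: measurable_cst_event.
  - by apply: measurable_avoids => //; exact: mstate_cst.
  - by apply: measurable_lteE => //; exact: measurable_clock.
apply/seteqP; split => x /=; rewrite in_itv/= andbT.
  by move=> /ereal_sup_gt[_ [q Aq <-] rq]; exists q.
by move=> [q [Aq rq]]; apply: (lt_le_trans rq); apply: ereal_sup_ubound; exists q.
Qed.

End measurable_clock.

(** * Law of Brownian motion and Markov property *)

Section cylinders.
Context {R : realType}.
Implicit Types (l : seq (R * set R)) (u z : R) (b : R -> R).

Definition nonneg_times l := forall a, a \in l -> 0 <= a.1.
Definition borel_cyl l := forall a, a \in l -> measurable (a.2 : set (measurableTypeR R)).

Definition cylinder l : set path := [set w : R -> R | forall a, a \in l -> a.2 (w a.1)].

Definition cylinders : set (set (@path R)) :=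
  [set C | exists l, [/\ nonneg_times l, borel_cyl l & C = cylinder l]].

Lemma measurable_cylinders : cylinders `<=` measurable.
Proof.
move=> _ [l [l0 ml ->]].
elim: l l0 ml => [|a l ih] l0 ml.
  rewrite (_ : cylinder [::] = setT) //; by apply/seteqP; split => // w _ a.
rewrite (_ : cylinder (a :: l) = [set w : path | a.2 (w a.1)] `&` cylinder l).
  apply: measurableI; last first.
    by apply: ih => c cl; [apply: l0|apply: ml]; rewrite inE cl orbT.
  rewrite -[X in measurable X]setTI.
  have a0 : 0 <= a.1 by apply: l0; exact: mem_head.
  exact: (measurable_eval a0 measurableT (ml _ (mem_head _ _))).
apply/seteqP; split => w /=.
  move=> wa; split; first by apply: wa; exact: mem_head.
  by move=> c cl; apply: wa; rewrite inE cl orbT.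
by move=> [wa wl] c; rewrite inE => /predU1P[->//|]; exact: wl.
Qed.

Lemma cylinders_setI : setI_closed cylinders.
Proof.
move=> _ _ [l1 [l10 ml1 ->]] [l2 [l20 ml2 ->]]; exists (l1 ++ l2); split.
- by move=> a; rewrite mem_cat => /orP[/l10|/l20].
- by move=> a; rewrite mem_cat => /orP[/ml1|/ml2].
- apply/seteqP; split => w /=.
    by move=> [w1 w2] a; rewrite mem_cat => /orP[/w1|/w2].
  by move=> w12; split => a al; apply: w12; rewrite mem_cat al ?orbT.
Qed.

Lemma cylinders_setT : cylinders setT.
Proof. by exists [::]; split => //; apply/seteqP; split. Qed.

Lemma measurable_path_cylinders (D : set (@path R)) : measurable D -> <<s cylinders >> D.
Proof.
apply: smallest_sub; first exact: smallest_sigma_algebra.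
move=> _ [t [A [t0 mA ->]]]; apply: sub_gen_smallest.
exists [:: (t, A)]; split.
- by move=> a; rewrite inE => /eqP ->.
- by move=> a; rewrite inE => /eqP ->.
- apply/seteqP; split => w /=; first by move=> wt a; rewrite inE => /eqP ->.
  by move=> /(_ (t, A)); apply; rewrite mem_head.
Qed.

Fixpoint increments u l : seq (R * set R) :=
  if l is a :: l' then (a.1 - u, a.2) :: increments a.1 l' else [::].

Fixpoint follows b u c l : Prop :=
  if l is a :: l' then a.2 (b (u + a.1) - c) /\ follows b (u + a.1) c l' else True.

Lemma follows_increments b u c l :
  follows b u c (increments u l) <-> forall a, a \in l -> a.2 (b a.1 - c).
Proof.
elim: l u => [|a l ih] u //=; rewrite (_ : u + (a.1 - u) = a.1) ?ih; last ring.
split.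
  by move=> [ba bl] e; rewrite inE => /predU1P[->//|]; exact: bl.
move=> bl; split; first by apply: bl; exact: mem_head.
by move=> e el; apply: bl; rewrite inE el orbT.
Qed.

Lemma sorted_increments u l : path.path (fun x y => x <= y) u (map fst l) ->
  nonneg_times (increments u l).
Proof.
elim: l u => [|a l ih] u //= /andP[ua la] e.
by rewrite inE => /predU1P[->/=|]; [rewrite subr_ge0|exact: ih].
Qed.

Lemma borel_increments u l : borel_cyl l -> borel_cyl (increments u l).
Proof.
elim: l u => [|a l ih] u //= ml e.
rewrite inE => /predU1P[->/=|]; first by apply: ml; exact: mem_head.
by apply: ih => c cl; apply: ml; rewrite inE cl orbT.
Qed.

(* The probability that a Brownian motion started from z meets the successive
   constraints at the successive increments of time. *)
Fixpoint gauss_chain l z : \bar R :=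
  if l is a :: l' then
    (if a.1 == 0%R then (\1_(a.2) z)%:E * gauss_chain l' z
     else \int[normal_prob 0%R (Num.sqrt a.1)]_y
       ((\1_(a.2) (z + y)%R)%:E * gauss_chain l' (z + y)%R))%E
  else 1%E.

Lemma gauss_chain_ge0 l z : (0 <= gauss_chain l z)%E.
Proof.
elim: l z => [|a l ih] z //=; case: ifP => _; first by rewrite mule_ge0 ?lee_fin.
by apply: integral_ge0 => y _; rewrite mule_ge0 ?lee_fin.
Qed.

Lemma measurable_gauss_chain l : borel_cyl l -> measurable_fun setT (gauss_chain l).
Proof.
elim: l => [|a l ih] ml; first exact: measurable_cst.
have ma : measurable (a.2 : set (measurableTypeR R)) by apply: ml; exact: mem_head.
have mi : measurable_fun setT (fun z : R => (\1_(a.2) z : R)%:E).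
  by apply/measurable_EFinP; exact: measurable_indic.
have ml' : measurable_fun setT (gauss_chain l).
  by apply: ih => c cl; apply: ml; rewrite inE cl orbT.
have mil : measurable_fun setT (fun z : R => ((\1_(a.2) z : R)%:E * gauss_chain l z)%E).
  exact: emeasurable_funM.
have [a0|a0] := boolP (a.1 == 0).
  by rewrite (_ : gauss_chain _ = fun z => (\1_(a.2) z)%:E * gauss_chain l z)%E//;
    apply/funext => z /=; rewrite a0.
rewrite (_ : gauss_chain _ = fun z => \int[normal_prob 0%R (Num.sqrt a.1)]_y
       ((\1_(a.2) (z + y)%R)%:E * gauss_chain l (z + y)%R))%E; last first.
  by apply/funext => z /=; rewrite (negbTE a0).
pose f (zy : measurableTypeR R * measurableTypeR R) : \bar R :=
  ((\1_(a.2) (zy.1 + zy.2)%R : R)%:E * gauss_chain l (zy.1 + zy.2)%R)%E.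
have mD : measurable_fun setT (fun zy : measurableTypeR R * measurableTypeR R => (zy.1 + zy.2 : R)).
  by apply: measurable_funD; [exact: measurable_fst|exact: measurable_snd].
have mf : measurable_fun setT f by exact: (measurableT_comp mil mD).
apply: (@measurable_fun_fubini_tonelli_F _ _ _ _ R (normal_prob 0 (Num.sqrt a.1)) f mf).
by move=> zy; rewrite mule_ge0 ?lee_fin ?gauss_chain_ge0.
Qed.

End cylinders.

Section brownian_law.
Context d (Omega : measurableType d) (R : realType) (P : probability Omega R).
Variables (x : R) (B : R -> Omega -> R).
Hypothesis BM : brownian_motion P x B.

Definition past_events (s : R) : set (set Omega) :=
  [set C | exists t, exists A : set (measurableTypeR R),
     [/\ (`[0, s]%classic : set R) t, measurable A & C = B t @^-1` A]].

Let past (s : R) := g_sigma_algebraType (past_events s).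

Lemma measurable_B t : 0 <= t -> measurable_fun setT (B t).
Proof. by have [mB _ _ _] := BM; exact: mB. Qed.

Lemma past_measurable s : process_sigma `[0, s] B `<=` measurable.
Proof.
apply: smallest_sub; first exact: sigma_algebra_measurable.
move=> _ [t [A [/= ts mA ->]]]; rewrite -[X in measurable X]setTI.
by apply: (@measurable_B t) => //; move: ts; rewrite in_itv/= => /andP[].
Qed.

Lemma past_mono s s' : s <= s' -> process_sigma `[0, s] B `<=` process_sigma `[0, s'] B.
Proof.
move=> ss'; apply: sub_smallest2r; first exact: smallest_sigma_algebra.
move=> _ [t [A [/= ts mA ->]]]; exists t, A; split => //.
by move: ts; rewrite /= !in_itv/= => /andP[-> /le_trans]; exact.
Qed.

Lemma measurable_past s t : 0 <= t <= s -> measurable_fun setT (B t : past s -> R).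
Proof.
move=> ts _ A mA; rewrite setTI; apply: sub_gen_smallest; exists t, A; split => //=.
Qed.

(** Induction on the constraints, each absorbed into the event [E] of the past: the next increment
    is Gaussian, independent of the past, and can be integrated out. The offset [c] may be random
    but known at time [s]; a constant offset yields the finite-dimensional laws and the offset [B s]
    the Markov property. *)
Lemma chain_law l : nonneg_times l -> borel_cyl l ->
  forall s c (E : set Omega), 0 <= s ->
  measurable_fun setT (c : past s -> R) -> process_sigma `[0, s] B E ->
  P (E `&` [set w | follows (B ^~ w) s (c w) l]) =
  (\int[P]_(w in E) gauss_chain l (B s w - c w)%R)%E.
Proof.
have [mB cB lawB indB] := BM.
elim: l => [|a l ih] l0 ml s c E s0 mc FE.
  rewrite /= (_ : [set _ | True] = setT); last by apply/seteqP; split.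
  by rewrite setIT integral_cst ?mul1e//; exact: past_measurable FE.
have a0 : 0 <= a.1 by apply: l0; exact: mem_head.
have ma : measurable (a.2 : set (measurableTypeR R)) by apply: ml; exact: mem_head.
have l0' : nonneg_times l by move=> e el; apply: l0; rewrite inE el orbT.
have ml' : borel_cyl l by move=> e el; apply: ml; rewrite inE el orbT.
have sa0 : 0 <= s + a.1 by rewrite addr_ge0.
have mc' : measurable_fun setT (c : past (s + a.1) -> R).
  move=> _ C mC; rewrite setTI; apply: (@past_mono s); first by rewrite lerDl.
  by have := mc measurableT C mC; rewrite setTI.
pose E1 := E `&` [set w | a.2 (B (s + a.1) w - c w)].
have FE1 : process_sigma `[0, s + a.1] B E1.
  have m1 : measurable (E : set (past (s + a.1))).
    by apply: (@past_mono s) FE; rewrite lerDl.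
  have m2 : measurable ([set w | a.2 (B (s + a.1) w - c w)] : set (past (s + a.1))).
    rewrite -[X in measurable X]setTI.
    have m3 : measurable_fun setT (fun w : past (s + a.1) => B (s + a.1) w - c w : R).
      by apply: measurable_funB => //; apply: measurable_past; rewrite sa0 lexx.
    exact: m3.
  exact: (measurableI _ _ m1 m2).
have -> : E `&` [set w | follows (B^~ w) s (c w) (a :: l)] =
    E1 `&` [set w | follows (B^~ w) (s + a.1) (c w) l].
  by apply/seteqP; split => w /=; [case=> ? []|case=> -[]].
have mE : measurable E by exact: past_measurable FE.
have mE1 : measurable E1 by exact: past_measurable FE1.
rewrite (ih l0' ml' _ _ _ sa0 mc' FE1).
rewrite [LHS]integral_mkcond [RHS]integral_mkcond.
have [a1|a1] := eqVneq a.1 0.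
  apply: eq_integral => w _; rewrite !patchE /= a1 eqxx addr0 indicE.
  have -> : (w \in E1) = (w \in E) && (B s w - c w \in a.2).
    by apply/idP/andP; rewrite !inE/E1/= a1 addr0 => -[].
  by case: (w \in E) => //=; case: (_ \in a.2); rewrite ?mul1e ?mul0e.
have {}a0 : 0 < a.1 by rewrite lt0r a1.
pose D w := B (s + a.1) w - B s w.
pose f (z : past s * measurableTypeR R) : \bar R :=
  ((\1_E z.1)%:E * ((\1_(a.2) (B s z.1 - c z.1 + z.2)%R)%:E *
   gauss_chain l (B s z.1 - c z.1 + z.2)%R))%E.
have mil : measurable_fun setT (fun z : R => ((\1_(a.2) z : R)%:E * gauss_chain l z)%E).
  apply: emeasurable_funM; last exact: measurable_gauss_chain.
  by apply/measurable_EFinP; exact: measurable_indic.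
have mBc : measurable_fun setT (fun w : past s => B s w - c w : R).
  by apply: measurable_funB => //; apply: measurable_past; rewrite s0 lexx.
have mf : measurable_fun setT f.
  apply: emeasurable_funM.
    apply/measurable_EFinP; apply: measurableT_comp; last exact: measurable_fst.
    by apply: measurable_indic; exact: FE.
  have mz : measurable_fun setT (fun z : past s * measurableTypeR R => B s z.1 - c z.1 + z.2 : R).
    apply: measurable_funD; last exact: measurable_snd.
    exact: (measurableT_comp mBc (@measurable_fst _ _ (past s) (measurableTypeR R))).
  exact: (measurableT_comp mil mz).
have f0 z : (0 <= f z)%E by rewrite !mule_ge0 ?lee_fin ?gauss_chain_ge0.
transitivity (\int[P]_w f (w, D w))%E.
  apply: eq_integral => w _; rewrite !patchE /f /D /= !indicE.
  have -> : B s w - c w + (B (s + a.1) w - B s w) = B (s + a.1) w - c w by ring.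
  have -> : (w \in E1) = (w \in E) && (B (s + a.1) w - c w \in a.2).
    by apply/idP/andP; rewrite !inE/E1/= => -[].
  by case: (w \in E) => //=; case: (_ \in a.2); rewrite ?mul1e ?mul0e.
have ss : s < s + a.1 by rewrite ltrDl.
have mDw : measurable_fun setT (D : Omega -> measurableTypeR R).
  by apply: measurable_funB; exact: measurable_B.
(* The first variable is the identity into the space with the sigma-algebra of the past, so that the
   integrand may depend on the whole past. *)
rewrite (indep2_fubini (X := idfun : Omega -> past s) (Y := D : Omega -> measurableTypeR R)
  _ _ (indB _ _ s0 ss) _ _ mf f0); last 4 first.
- exact: past_measurable.
- apply: smallest_sub; first exact: sigma_algebra_measurable.
  move=> _ [t [A [_ mA ->]]]; rewrite -[X in measurable X]setTI; exact: mDw.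
- by move=> A mA.
- by move=> A mA; apply: sub_gen_smallest; exists 0, A.
apply: eq_integral => w _; rewrite patchE.
pose D' : {mfun Omega >-> measurableTypeR R} :=
  HB.pack (D : Omega -> measurableTypeR R) (isMeasurableFun.Build _ _ _ _ _ mDw).
have mfw : measurable_fun setT (fun y : measurableTypeR R => f (w, y)).
  apply: (measurableT_comp mf); exact: measurable_pair1.
transitivity (\int[distribution P D']_y f (w, y))%E.
  by rewrite ge0_integral_pushforward.
rewrite (eq_measure_integral (normal_prob 0 (Num.sqrt a.1))); last first.
  move=> A mA _; have := lawB _ _ s0 ss A mA.
  by rewrite (_ : s + a.1 - s = a.1)//; ring.
rewrite /f/= (negbTE a1) indicE; case: ifPn => wE; last first.
  by under eq_integral do rewrite mul0e; rewrite integral0.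
by under eq_integral do rewrite mul1e.
Qed.

End brownian_law.

Section path_maps.
Context {R : realType}.

Definition shift_path (t : R) (w : path) : @path R := fun u : R => w (t + u).
Definition stop_path (t : R) (w : path) : @path R := fun u : R => w (Num.min u t).
Definition add_path (z : R) (w : path) : @path R := fun u : R => z + w u.

Lemma measurable_shift_path t : 0 <= t -> measurable_fun setT (shift_path t).
Proof.
move=> t0; apply: measurable_path => u u0; apply: measurable_eval.
by rewrite addr_ge0.
Qed.

Lemma measurable_stop_path t : 0 <= t -> measurable_fun setT (stop_path t).
Proof.
move=> t0; apply: measurable_path => u u0; apply: measurable_eval.
by rewrite le_min u0.
Qed.

Lemma measurable_add_path d (T : measurableType d) (z : T -> R) (w : T -> path) :
  measurable_fun setT z -> measurable_fun setT w ->
  measurable_fun setT (fun x => add_path (z x) (w x)).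
Proof.
move=> mz mw; apply: measurable_path => u u0; apply: measurable_funD => //.
exact: (measurableT_comp (measurable_eval u0) mw).
Qed.

Lemma clock_stop_path (kappa : {sigma_finite_measure set (measurableTypeR R) -> \bar R})
  t (w : @path R) : clock kappa t (stop_path t w) = clock kappa t w.
Proof.
apply: eq_integral => y _; rewrite /loctime; congr limn_esup; apply/funext => k.
congr (_ * _)%E; congr lebesgue_measure; apply/seteqP.
have E u : 0 <= u <= t -> left_eval (stop_path t w) u = left_eval w u.
  move=> /andP[u0 ut]; apply: eq_left_eval; rewrite /stop_path.
    by rewrite min_l// (le_trans u0).
  by move=> v v0 vu; rewrite min_l// (le_trans (ltW vu)).
by split => u /= [ut]; rewrite E.
Qed.

Lemma avoids_stop_path s t t' (w : @path R) : t' <= t ->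
  avoids s (stop_path t w) t' <-> avoids s w t'.
Proof.
move=> tt'; split=> -[m wm]; exists m => q q0 qt; have := wm q q0 qt;
  by rewrite /stop_path min_l// (le_trans qt).
Qed.

End path_maps.

Lemma follows_shift (R : realType) (b : R -> R) s u c l :
  follows b (s + u) c l <-> follows (fun t : R => b (s + t)) u c l.
Proof.
elim: l u => [|a l ih] u //=; rewrite -[s + u + _]addrA.
by split=> -[ba /ih bl]; split.
Qed.

(** The constraints are sorted by time. Repeated times give zero waiting times, where [gauss_chain]
    imposes the constraint without a Gaussian step. *)
Definition chain_of (R : realType) (l : seq (R * set R)) : seq (R * set R) :=
  increments 0 (sort (fun a b => a.1 <= b.1) l).

Lemma nonneg_chain_of (R : realType) (l : seq (R * set R)) :
  nonneg_times l -> nonneg_times (chain_of l).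
Proof.
move=> l0; apply: sorted_increments.
rewrite path_sortedE; last exact: le_trans.
apply/andP; split.
  by apply/allP => _ /mapP[a + ->]; rewrite mem_sort => /l0.
by rewrite sorted_map; apply: sort_sorted => a b; exact: le_total.
Qed.

Lemma borel_chain_of (R : realType) (l : seq (R * set R)) :
  borel_cyl l -> borel_cyl (chain_of l).
Proof. by move=> ml; apply: borel_increments => a; rewrite mem_sort => /ml. Qed.

Lemma follows_chain_of (R : realType) (b : R -> R) c (l : seq (R * set R)) :
  follows b 0 c (chain_of l) <-> forall a, a \in l -> a.2 (b a.1 - c).
Proof.
rewrite follows_increments; split=> ba a al; apply: ba; last by rewrite mem_sort in al.
by rewrite mem_sort.
Qed.

Section brownian_paths.
Context d (Omega : measurableType d) (R : realType) (P : probability Omega R).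
Variables (x : R) (B : R -> Omega -> R).
Hypothesis BM : brownian_motion P x B.

Definition centered (w : Omega) : @path R := fun t : R => B t w - x.
Definition increment (s : R) (w : Omega) : @path R := fun t : R => B (s + t) w - B s w.

Lemma measurable_centered : measurable_fun setT centered.
Proof.
apply: measurable_path => t t0; apply: measurable_funB => //.
exact: (measurable_B BM).
Qed.

Lemma measurable_increment s : 0 <= s -> measurable_fun setT (increment s).
Proof.
move=> s0; apply: measurable_path => t t0; apply: measurable_funB.
  by apply: (measurable_B BM); rewrite addr_ge0.
exact: (measurable_B BM).
Qed.

Lemma cylinder_prob l : nonneg_times l -> borel_cyl l ->
  P (centered @^-1` cylinder l) = gauss_chain (chain_of l) 0.
Proof.
move=> l0 ml; have [mB cB _ _] := BM.
have c0 := nonneg_chain_of l0; have cm := borel_chain_of ml.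
have mx : measurable_fun setT (cst x : g_sigma_algebraType (past_events B 0) -> R) by exact: measurable_cst.
have FT : process_sigma `[0, 0] B setT.
  exact: (@measurableT _ (g_sigma_algebraType (past_events B 0))).
have := chain_law BM c0 cm (lexx 0) mx FT.
rewrite setTI => E; transitivity (P [set w | follows (B^~ w) 0 (cst x w) (chain_of l)]).
  by congr (P _); apply/seteqP; split => w /=; rewrite follows_chain_of.
rewrite E /=; transitivity (\int[P]_w gauss_chain (chain_of l) 0)%E; last first.
  rewrite integral_cst// [X in (_ * X)%E](_ : _ = 1%E) ?mule1//.
  exact: probability_setT.
have mg := measurable_gauss_chain cm.
have mBx : measurable_fun setT (fun w => B 0 w - x).
  by apply: measurable_funB => //; exact: mB.
apply: ge0_ae_eq_integral => //.
- exact: (measurableT_comp mg mBx).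
- by move=> w _; exact: gauss_chain_ge0.
- by move=> w _; exact: gauss_chain_ge0.
- by apply: filterS cB => w [-> _] _; rewrite subrr.
Qed.

Lemma markov_cylinder s E l : 0 <= s -> process_sigma `[0, s] B E ->
  nonneg_times l -> borel_cyl l ->
  P (E `&` increment s @^-1` cylinder l) = (P E * gauss_chain (chain_of l) 0)%E.
Proof.
move=> s0 FE l0 ml.
have c0 := nonneg_chain_of l0; have cm := borel_chain_of ml.
have mE : measurable E by exact: (past_measurable BM) FE.
have ms : measurable_fun setT (B s : g_sigma_algebraType (past_events B s) -> R).
  by apply: measurable_past; rewrite s0 lexx.
have := chain_law BM c0 cm s0 ms FE.
under eq_integral do rewrite subrr.
rewrite integral_cst// muleC => <-; congr (P (_ `&` _)).
apply/seteqP; split => w /=.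
  move=> wl; rewrite -[s in follows _ s]addr0 follows_shift.
  by apply/follows_chain_of.
by rewrite -[s in follows _ s]addr0 follows_shift => /follows_chain_of.
Qed.

End brownian_paths.

Lemma brownian_law_unique d1 d2 (O1 : measurableType d1) (O2 : measurableType d2)
    (R : realType) (P1 : probability O1 R) (P2 : probability O2 R)
    x1 x2 B1 B2 (D : set (@path R)) :
  brownian_motion P1 x1 B1 -> brownian_motion P2 x2 B2 -> measurable D ->
  P1 (centered x1 B1 @^-1` D) = P2 (centered x2 B2 @^-1` D).
Proof.
move=> BM1 BM2 mD.
pose X1 : {mfun O1 >-> @path R} := HB.pack (centered x1 B1)
  (isMeasurableFun.Build _ _ _ _ _ (measurable_centered BM1)).
pose X2 : {mfun O2 >-> @path R} := HB.pack (centered x2 B2)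
  (isMeasurableFun.Build _ _ _ _ _ (measurable_centered BM2)).
have := @finite_measure_unique _ _ _ cylinders (distribution P1 X1) (distribution P2 X2)
  measurable_cylinders cylinders_setI cylinders_setT _ _ D (measurable_path_cylinders mD).
apply.
  apply: (@le_lt_trans _ _ 1%E); last exact: ltry.
  exact: (@probability_le1 _ _ _ (distribution P1 X1)).
move=> _ [l [l0 ml ->]].
exact: etrans (cylinder_prob BM1 l0 ml) (esym (cylinder_prob BM2 l0 ml)).
Qed.

Lemma markov_property d (O : measurableType d) (R : realType) (P : probability O R)
    x B s E (D : set (@path R)) :
  brownian_motion P x B -> 0 <= s -> process_sigma `[0, s] B E -> measurable D ->
  P (E `&` increment B s @^-1` D) = (P E * P (centered x B @^-1` D))%E.
Proof.
move=> BM s0 FE mD.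
have mE : measurable E by exact: (past_measurable BM) FE.
pose X1 : {mfun O >-> @path R} := HB.pack (increment B s)
  (isMeasurableFun.Build _ _ _ _ _ (measurable_increment BM s0)).
pose X2 : {mfun O >-> @path R} := HB.pack (centered x B)
  (isMeasurableFun.Build _ _ _ _ _ (measurable_centered BM)).
have Ps : (0 <= fine (P E))%R by rewrite fine_ge0.
pose c : {nonneg R} := NngNum Ps.
have PE : P E = (fine (P E))%:E by rewrite fineK// fin_num_measure.
transitivity (pushforward (mrestr P mE) X1 D).
  by rewrite /pushforward /mrestr/= setIC.
transitivity (mscale c (distribution P X2) D); last by rewrite /mscale/= -PE.
apply: (finite_measure_unique measurable_cylinders cylinders_setI cylinders_setT _ _
  (measurable_path_cylinders mD)).
  suff H : pushforward (mrestr P mE) X1 setT = P E by rewrite [ltLHS]H PE ltry.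
  by congr (P _); apply/seteqP; split => w // [].
move=> _ [l [l0 ml ->]]; rewrite /= /pushforward /mscale /mrestr/= -PE setIC.
apply: etrans (markov_cylinder BM s0 FE l0 ml) _; congr (_ * _)%E.
exact: esym (cylinder_prob BM l0 ml).
Qed.

Lemma integral_cst_prob d (T : measurableType d) (R : realType)
  (P : probability T R) (c : \bar R) : (\int[P]_w c = c)%E.
Proof.
rewrite integral_cst// [X in (_ * X)%E](_ : _ = 1%E) ?mule1//.
exact: probability_setT.
Qed.

(** * The killed motion from an arbitrary point and its simple Markov property *)

Section killed_motion.
Context {R : realType} (kappa : {sigma_finite_measure set (measurableTypeR R) -> \bar R}).
Context d (Omega : measurableType d) (P : probability Omega R).
Variables (x : R) (B : R -> Omega -> R) (e : Omega -> R).

(* A Brownian motion with local times together with an independent exponential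
   clock; the starting point is moved around by translation. *)
Record motion_with_clock : Prop := MotionWithClock {
  mwc_radon : radon_measure kappa ;
  mwc_BM : brownian_motion P x B ;
  mwc_good : {ae P, forall w, exists ell, good_path (B ^~ w) ell} ;
  mwc_me : measurable_fun setT (e : Omega -> measurableTypeR R) ;
  mwc_elaw : forall A : set (measurableTypeR R), measurable A ->
    P (e @^-1` A) = exponential_prob 1 A ;
  mwc_indep : independent2 P (process_sigma `[0, +oo[ B)
    (process_sigma [set: R] (fun _ => e)) }.

Hypothesis mwc : motion_with_clock.

Definition started (z : R) (w : Omega) : @path R := add_path z (centered x B w).

Lemma measurable_started (z : R) : measurable_fun setT (started z).
Proof.
apply: measurable_add_path; first exact: measurable_cst.
exact: measurable_centered (mwc_BM mwc).
Qed.

Lemma started_good : {ae P, forall w, [/\ forall z, exists ell, good_path (started z w) ell,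
  forall z, started z w 0 = z & 0 < e w]}.
Proof.
have [_ cB _ _] := mwc_BM mwc.
have e0 : {ae P, forall w, 0 < e w}.
  exists [set w | e w <= 0]; split.
  - rewrite -[X in measurable X]setTI; have := mwc_me mwc.
    by move=> /(_ measurableT `]-oo, 0]%classic (measurable_itv _)); rewrite set_itvNyc.
  - exact: (exp_le0 (mwc_elaw mwc)).
  - by move=> w /= /negP; rewrite -leNgt.
apply: filterS3 cB e0 (mwc_good mwc) => w [B0 _] ew [ell gw]; split => // z.
  exists (fun y t => ell (y - (z - x)) t).
  have -> : started z w = fun t : R => (z - x) + B t w.
    by apply/funext => t; rewrite /started /add_path /centered; ring.
  exact: good_translate.
by rewrite /started /add_path /centered B0 subrr addr0.
Qed.

Section with_phi.
Variable phi : R -> \bar R.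
Hypothesis mphi : measurable_fun setT phi.
Hypothesis phi0 : forall y, (0 <= phi y)%E.

(** The value is 0 when the motion is neither stopped nor killed; that this has probability zero is
    only established later. *)
Definition exit_value (s : seq (R * R)) (w : @path R) (u : R) : \bar R :=
  if (exit_time s w (killing_time kappa w u) < +oo)%E
  then phi (exit_point s w (killing_time kappa w u)) else 0%E.

Lemma exit_value_ge0 s w u : (0 <= exit_value s w u)%E.
Proof. by rewrite /exit_value; case: ifP. Qed.

Lemma measurable_exit_value d' (T : measurableType d') (s : T -> seq (R * R))
    (w : T -> path) (u : T -> R) :
  mstate s -> measurable_fun setT w -> measurable_fun setT u ->
  measurable_fun setT (fun t => exit_value (s t) (w t) (u t)).
Proof.
move=> ms mw mu.
have mk := measurable_killing_time kappa mw mu.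
apply: measurable_fun_ifT => //.
- apply: (measurable_fun_bool true); rewrite setTI.
  rewrite (_ : _ @^-1` _ = [set t | (exit_time (s t) (w t) (killing_time kappa (w t) (u t)) < cst +oo t)%E]).
    by apply: measurable_lteE => //; exact: measurable_exit_time.
  by apply/seteqP; split.
- exact: (measurableT_comp mphi (measurable_exit_point ms mw mk)).
Qed.

Definition exit_mean (s : seq (R * R)) (z : R) : \bar R :=
  (\int[P]_w exit_value s (started z w) (e w))%E.

Lemma exit_mean_ge0 s z : (0 <= exit_mean s z)%E.
Proof. by apply: integral_ge0 => w _; exact: exit_value_ge0. Qed.

Lemma measurable_started_pair d' (T : measurableType d') (z : T -> R) :
  measurable_fun setT z ->
  measurable_fun setT (fun tw : T * Omega => started (z tw.1) tw.2).
Proof.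
move=> mz; apply: measurable_add_path.
  exact: (measurableT_comp mz (@measurable_fst _ _ T Omega)).
exact: (measurableT_comp (measurable_centered (mwc_BM mwc)) (@measurable_snd _ _ T Omega)).
Qed.

Lemma measurable_exit_mean d' (T : measurableType d') (s : T -> seq (R * R))
    (z : T -> R) : mstate s -> measurable_fun setT z ->
  measurable_fun setT (fun t => exit_mean (s t) (z t)).
Proof.
move=> ms mz.
pose f (tw : T * Omega) := exit_value (s tw.1) (started (z tw.1) tw.2) (e tw.2).
have mf : measurable_fun setT f.
  apply: measurable_exit_value.
  - exact: (mstate_comp ms (@measurable_fst _ _ T Omega)).
  - exact: measurable_started_pair.
  - exact: (measurableT_comp (mwc_me mwc) (@measurable_snd _ _ T Omega)).
exact: (@measurable_fun_fubini_tonelli_F _ _ T Omega R P f mf (fun _ => exit_value_ge0 _ _ _)).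
Qed.

Lemma process_measurable (z : R) (A : set (@path R)) : measurable A ->
  process_sigma `[0, +oo[ B (started z @^-1` A).
Proof.
move=> mA.
pose T := g_sigma_algebraType [set C | exists t, exists A : set (measurableTypeR R),
     [/\ (`[0, +oo[%classic : set R) t, measurable A & C = B t @^-1` A]].
have m : measurable_fun setT (started z : T -> path).
  apply: measurable_path => t t0; apply: measurable_funD => //.
  apply: measurable_funB => //.
  move=> _ C mC; rewrite setTI; apply: sub_gen_smallest; exists t, C; split => //.
  by rewrite /= in_itv/= t0.
by have := m measurableT A mA; rewrite setTI.
Qed.

Lemma process_sigma_sub : process_sigma `[0, +oo[ B `<=` measurable.
Proof.
apply: smallest_sub; first exact: sigma_algebra_measurable.
move=> _ [t [A [/= t0 mA ->]]]; rewrite -[X in measurable X]setTI.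
by apply: (measurable_B (mwc_BM mwc)) => //; move: t0; rewrite in_itv/= andbT.
Qed.

Lemma clock_sigma_sub : process_sigma [set: R] (fun _ => e) `<=` measurable.
Proof.
apply: smallest_sub; first exact: sigma_algebra_measurable.
move=> _ [t [A [/= _ mA ->]]]; rewrite -[X in measurable X]setTI.
exact: (mwc_me mwc measurableT mA).
Qed.

Lemma started_clock_fubini (z : R) (f : path * R -> \bar R) :
  measurable_fun setT f -> (forall y, (0 <= f y)%E) ->
  (\int[P]_w f (started z w, e w) = \int[P]_w \int[P]_w' f (started z w, e w'))%E.
Proof.
move=> mf f0.
apply: (indep2_fubini process_sigma_sub clock_sigma_sub (mwc_indep mwc)) => //.
  by move=> A mA; exact: process_measurable.
by move=> A mA; apply: sub_gen_smallest; exists 0, A.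
Qed.

Lemma integral_increment (t : R) (g : path -> \bar R) : 0 <= t ->
  measurable_fun setT g -> (forall y, (0 <= g y)%E) ->
  (\int[P]_w g (increment B t w) = \int[P]_w g (centered x B w))%E.
Proof.
move=> t0 mg g0.
have mI := measurable_increment (mwc_BM mwc) t0.
have mC := measurable_centered (mwc_BM mwc).
pose X1 : {mfun Omega >-> @path R} := HB.pack (increment B t)
  (isMeasurableFun.Build _ _ _ _ _ mI).
pose X2 : {mfun Omega >-> @path R} := HB.pack (centered x B)
  (isMeasurableFun.Build _ _ _ _ _ mC).
transitivity (\int[distribution P X1]_y g y)%E.
  by rewrite ge0_integral_pushforward.
transitivity (\int[distribution P X2]_y g y)%E; last first.
  by rewrite ge0_integral_pushforward.
apply: eq_measure_integral => A mA _.
have FT : process_sigma `[0, t] B setT.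
  exact: (@measurableT _ (g_sigma_algebraType (past_events B t))).
have := markov_property (mwc_BM mwc) t0 FT mA.
rewrite setTI => H; apply: etrans H _.
by rewrite (_ : P setT = 1%E) ?mul1e//; exact: probability_setT.
Qed.

Definition clock_mean (s : seq (R * R)) (w : @path R) : \bar R :=
  (\int[P]_w' exit_value s w (e w'))%E.

Lemma clock_mean_ge0 s w : (0 <= clock_mean s w)%E.
Proof. by apply: integral_ge0 => w' _; exact: exit_value_ge0. Qed.

Lemma measurable_clock_mean s : measurable_fun setT (clock_mean s).
Proof.
pose f (tw : path * Omega) := exit_value s tw.1 (e tw.2).
have mf : measurable_fun setT f.
  apply: measurable_exit_value.
  - exact: mstate_cst.
  - exact: measurable_fst.
  - exact: (measurableT_comp (mwc_me mwc) (@measurable_snd _ _ path Omega)).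
exact: (@measurable_fun_fubini_tonelli_F _ _ path Omega R P f mf (fun _ => exit_value_ge0 _ _ _)).
Qed.

Lemma exit_meanE s z : exit_mean s z = (\int[P]_w clock_mean s (started z w))%E.
Proof.
apply: (started_clock_fubini z (f := fun y => exit_value s y.1 y.2)).
  apply: (measurable_exit_value (s := fun=> s) (w := fst) (u := snd)).
  - exact: mstate_cst.
  - exact: measurable_fst.
  - exact: measurable_snd.
by move=> y; exact: exit_value_ge0.
Qed.

Lemma exit_value_shift s w ell t u : good_path w ell -> 0 <= t -> 0 < u ->
  avoids s w t -> (clock kappa t w < u%:E)%E ->
  exit_value s w u = exit_value s (shift_path t w) (u - fine (clock kappa t w)).
Proof.
move=> gw t0 u0 sw cu; have cw := good_cpath gw; have kr := mwc_radon mwc.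
have tZ : (t%:E < killing_time kappa w u)%E by apply/(killing_timeP kr gw).
have tT : (t%:E < exit_time s w (killing_time kappa w u))%E.
  by apply/exit_timeP => //; split => //; exact/avoidsP.
have ZZ r : 0 <= r -> ((t + r)%R%:E < killing_time kappa w u)%E <->
    (r%:E < killing_time kappa (shift_path t w) (u - fine (clock kappa t w)))%E.
  by move=> r0; exact: (killing_time_shift u kr gw t0 r0).
rewrite /exit_value.
have TE := exit_time_shift cw t0 tT ZZ.
have -> : (exit_time s (shift_path t w) (killing_time kappa (shift_path t w)
    (u - fine (clock kappa t w))) < +oo)%E =
    (exit_time s w (killing_time kappa w u) < +oo)%E.
  by rewrite TE; case: exit_time => //= r; rewrite -EFinD !ltry.
case: ifP => // Too; congr phi.
exact: exit_point_shift.
Qed.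

(** The event [D] is decided by the path up to time [t] and keeps it off the segments of [s]. The
    exponential variable is integrated out first: by lack of memory, surviving the clock costs a
    factor [expR (- a w)], again decided up to time [t], and leaves a fresh exponential variable for
    the shifted path. *)
Lemma simple_markov (t : R) s z (D : set path) : 0 <= t -> measurable D ->
  (forall w, D (stop_path t w) <-> D w) -> (forall w, D w -> avoids s w t) ->
  (\int[P]_w ((\1_D (started z w))%:E * (if (clock kappa t (started z w) < (e w)%:E)%E
     then exit_value s (started z w) (e w) else 0)) =
   \int[P]_w ((\1_D (started z w))%:E * (if (clock kappa t (started z w) < (e w)%:E)%E
     then exit_mean s (started z w t) else 0)))%E.
Proof.
move=> t0 mD Dstop Dav; have kr := mwc_radon mwc.
pose a (w : @path R) := fine (clock kappa t w).
have a0 w : 0 <= a w by rewrite fine_ge0// clock_ge0.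
have ma : measurable_fun setT a.
  by apply: measurableT_comp; [exact: fine_measurable|exact: measurable_clock].
have m1D : measurable_fun setT (fun w : @path R => (\1_D w : R)%:E).
  by apply/measurable_EFinP; exact: measurable_indic.
pose F1 (y : path * R) : \bar R := ((\1_D y.1)%:E * (if (a y.1 < y.2)%R then
  exit_value s (shift_path t y.1) (y.2 - a y.1) else 0))%E.
pose F2 (y : path * R) : \bar R := ((\1_D y.1)%:E * (if (a y.1 < y.2)%R then
  exit_mean s (y.1 t) else 0))%E.
have mfst := @measurable_fst _ _ (@path R) R.
have msnd := @measurable_snd _ _ (@path R) R.
have mif (f : path * R -> \bar R) : measurable_fun setT f ->
    measurable_fun setT (fun y => ((\1_D y.1 : R)%:E * (if (a y.1 < y.2)%R then f y else 0))%E).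
  move=> mf; apply: emeasurable_funM; first exact: (measurableT_comp m1D mfst).
  apply: measurable_fun_ifT => //.
  exact: (measurable_fun_ltr (measurableT_comp ma mfst) msnd).
have mev : measurable_fun setT (fun y : path * R => exit_value s (shift_path t y.1) (y.2 - a y.1)).
  apply: measurable_exit_value; first exact: mstate_cst.
    exact: (measurableT_comp (measurable_shift_path t0) mfst).
  exact: (measurable_funB msnd (measurableT_comp ma mfst)).
have mem : measurable_fun setT (fun y : path * R => exit_mean s (y.1 t)).
  apply: measurable_exit_mean; first exact: mstate_cst.
  exact: (measurableT_comp (measurable_eval t0) mfst).
have mF1 : measurable_fun setT F1 by exact: mif.
have mF2 : measurable_fun setT F2 by exact: mif.
have F10 y : (0 <= F1 y)%E.
  by rewrite mule_ge0 ?lee_fin//; case: ifP => // _; exact: exit_value_ge0.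
have F20 y : (0 <= F2 y)%E.
  by rewrite mule_ge0 ?lee_fin//; case: ifP => // _; exact: exit_mean_ge0.
have msz := measurable_started z.
have mpair : measurable_fun setT (fun w => (started z w, e w) : path * R).
  by apply: measurable_fun_pair => //; exact: mwc_me mwc.
have mcl : measurable_fun setT (fun w => (clock kappa t (started z w) < (e w)%:E)%E).
  apply: measurable_fun_lte; first exact: measurable_clock.
  by apply/measurable_EFinP; exact: mwc_me mwc.
have m1Dz := measurableT_comp m1D msz.
pose G1 w : \bar R := ((\1_D (started z w))%:E * (if (clock kappa t (started z w) < (e w)%:E)%E
     then exit_value s (started z w) (e w) else 0))%E.
pose G2 w : \bar R := ((\1_D (started z w))%:E * (if (clock kappa t (started z w) < (e w)%:E)%E
     then exit_mean s (started z w t) else 0))%E.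
have mG1 : measurable_fun setT G1.
  apply: emeasurable_funM; first exact: m1Dz.
  apply: (measurable_fun_ifT mcl) => //.
  exact: (measurable_exit_value (mstate_cst _ s) msz (mwc_me mwc)).
have mG2 : measurable_fun setT G2.
  apply: emeasurable_funM; first exact: m1Dz.
  apply: (measurable_fun_ifT mcl) => //.
  exact: (measurable_exit_mean (mstate_cst _ s) (measurableT_comp (measurable_eval t0) msz)).
have G10 w : setT w -> (0 <= G1 w)%E.
  by move=> _; rewrite mule_ge0 ?lee_fin//; case: ifP => // _; exact: exit_value_ge0.
have G20 w : setT w -> (0 <= G2 w)%E.
  by move=> _; rewrite mule_ge0 ?lee_fin//; case: ifP => // _; exact: exit_mean_ge0.
have L1 : (\int[P]_w G1 w = \int[P]_w F1 (started z w, e w))%E.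
  apply: (ge0_ae_eq_integral measurableT mG1 (measurableT_comp mF1 mpair) G10 (fun w _ => F10 _)).
  apply: filterS started_good => w [gz _ ew] _.
  have [ell gw] := gz z; rewrite /G1 /F1/= indicE.
  have [wD|_] := boolP (_ \in D); last by rewrite !mul0e.
  have cf := clock_fin kr gw t0.
  rewrite -[clock kappa t (started z w)]fineK// lte_fin -/(a _).
  case: ifP => // cl; congr (_ * _)%E.
  apply: (exit_value_shift gw) => //; first by apply: Dav; rewrite inE in wD.
  by rewrite -[clock kappa t (started z w)]fineK// lte_fin.
have L2 : (\int[P]_w G2 w = \int[P]_w F2 (started z w, e w))%E.
  apply: (ge0_ae_eq_integral measurableT mG2 (measurableT_comp mF2 mpair) G20 (fun w _ => F20 _)).
  apply: filterS started_good => w [gz _ ew] _.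
  have [ell gw] := gz z; rewrite /G2 /F2/=.
  by rewrite -[clock kappa t (started z w)]fineK ?(clock_fin kr gw)// lte_fin.
rewrite -[LHS]/(\int[P]_w G1 w)%E -[RHS]/(\int[P]_w G2 w)%E.
rewrite L1 L2 (started_clock_fubini z mF1 F10) (started_clock_fubini z mF2 F20).
pose h (w : @path R) : \bar R := ((\1_D w)%:E * (expR (- a w))%:E)%E.
have mh : measurable_fun setT h.
  apply: (emeasurable_funM m1D); apply/measurable_EFinP.
  exact: (measurableT_comp (@measurable_expR R) (measurable_funN ma)).
have h0 w : (0 <= h w)%E by rewrite mule_ge0 ?lee_fin// expR_ge0.
have hstop w : h (stop_path t w) = h w.
  rewrite /h /a clock_stop_path; congr (_ * _)%E; rewrite !indicE.
  by congr (EFin (nat_of_bool _)%:R); apply/idP/idP; rewrite !inE; [exact: (Dstop w).1|exact: (Dstop w).2].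
have I0 (y : @path R) (f : R -> \bar R) : measurable_fun setT f -> (forall u, 0 <= f u)%E ->
    (\int[P]_w ((\1_D y)%:E * (if (a y < e w)%R then f (e w - a y)%R else 0)) =
     h y * \int[P]_w f (e w))%E.
  move=> mf f0.
  pose J w := (if (a y < e w)%R then f (e w - a y)%R else 0)%E.
  have mJ : measurable_fun setT J.
    apply: (measurable_fun_ifT (measurable_fun_ltr (measurable_cst _) (mwc_me mwc))) => //.
    exact: (measurableT_comp mf (measurable_funB (mwc_me mwc) (measurable_cst _))).
  have J0 w : setT w -> (0 <= J w)%E by rewrite /J; case: ifP.
  rewrite (@ge0_integralZl_EFin _ _ _ P setT measurableT J J0 mJ)//.
  by rewrite /h -muleA -(exp_memoryless (mwc_me mwc) (mwc_elaw mwc)).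
have I1 w : (\int[P]_w' F1 (started z w, e w') =
    h (started z w) * clock_mean s (shift_path t (started z w)))%E.
  apply: (I0 (started z w) (exit_value s (shift_path t (started z w)))).
    exact: (measurable_exit_value (mstate_cst _ s) (measurable_cst (shift_path t (started z w)))
      (@measurable_id _ R setT)).
  by move=> u; exact: exit_value_ge0.
have I2 w : (\int[P]_w' F2 (started z w, e w') =
    h (started z w) * exit_mean s (started z w t))%E.
  apply: etrans (I0 (started z w) (fun=> exit_mean s (started z w t)) (measurable_cst _)
    (fun=> exit_mean_ge0 _ _)) _.
  by rewrite integral_cst_prob.
under eq_integral => w _ do rewrite I1.
under [RHS]eq_integral => w _ do rewrite I2.
pose G (y : path * path) : \bar R := (h y.1 * clock_mean s (add_path (y.1 t) y.2))%E.
have mfst2 := @measurable_fst _ _ (@path R) (@path R).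
have msnd2 := @measurable_snd _ _ (@path R) (@path R).
have mG : measurable_fun setT G.
  apply: emeasurable_funM; first exact: (measurableT_comp mh mfst2).
  apply: (measurableT_comp (measurable_clock_mean s)).
  exact: (measurable_add_path (measurableT_comp (measurable_eval t0) mfst2) msnd2).
have G0 y : (0 <= G y)%E by exact: (mule_ge0 (h0 _) (clock_mean_ge0 _ _)).
have mX : measurable_fun setT (fun w => stop_path t (started z w)).
  exact: (measurableT_comp (measurable_stop_path t0) msz).
have mY := measurable_increment (mwc_BM mwc) t0.
(* The path is now split into its part stopped at [t] and its increments after [t], two independent
   variables. *)
transitivity (\int[P]_w G (stop_path t (started z w), increment B t w))%E.
  apply: eq_integral => w _; rewrite /G/= hstop; congr (_ * clock_mean s _)%E.
  apply/funext => u; rewrite /shift_path /add_path /stop_path /started /add_path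
    /centered /increment minxx; ring.
have indXY A C : measurable A -> measurable C ->
    P ((fun w => stop_path t (started z w)) @^-1` A `&` increment B t @^-1` C) =
    (P ((fun w => stop_path t (started z w)) @^-1` A) * P (increment B t @^-1` C))%E.
  move=> mA mC.
  have FA : process_sigma `[0, t] B ((fun w => stop_path t (started z w)) @^-1` A).
    have m : measurable_fun setT ((fun w => stop_path t (started z w)) :
        g_sigma_algebraType (past_events B t) -> path).
      apply: measurable_path => u u0.
      have mb : measurable_fun setT (B (Num.min u t) : g_sigma_algebraType (past_events B t) -> R).
        by apply: measurable_past; rewrite le_min u0 t0/= ge_min lexx orbT.
      exact: (measurable_funD (measurable_cst _) (measurable_funB mb (measurable_cst _))).
    by have := m measurableT A mA; rewrite setTI.
  have FT : process_sigma `[0, t] B setT.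
    exact: (@measurableT _ (g_sigma_algebraType (past_events B t))).
  rewrite (markov_property (mwc_BM mwc) t0 FA mC); congr (_ * _)%E.
  have := markov_property (mwc_BM mwc) t0 FT mC.
  rewrite setTI => ->; rewrite (_ : P setT = 1%E) ?mul1e//.
  exact: probability_setT.
apply: etrans (indep_fubini mX mY indXY mG G0) _.
apply: eq_integral => w _; rewrite /G/= hstop.
have mcm (v : R) : measurable_fun setT (fun y : @path R => clock_mean s (add_path v y)).
  apply: (measurableT_comp (measurable_clock_mean s)).
  exact: (measurable_add_path (measurable_cst v) (@measurable_id _ path setT)).
have cm0 v (w' : Omega) : setT w' -> (0 <= clock_mean s (add_path v (increment B t w')))%E.
  by move=> _; exact: clock_mean_ge0.
apply: etrans (ge0_integralZl P measurableT (measurableT_comp (mcm _) mY) (cm0 _) (h0 _)) _.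
congr (_ * _)%E; rewrite exit_meanE /stop_path minxx.
exact: (integral_increment t0 (mcm _) (fun=> clock_mean_ge0 _ _)).
Qed.

End with_phi.

End killed_motion.

Lemma continuous_gt (R : realType) (f : R -> R) (v c : R) : {for v, continuous f} ->
  c < f v -> exists2 a, 0 < a & forall y, `|y - v| < a -> c < f y.
Proof.
move=> /cvgrPdist_lt cf cv; have : 0 < f v - c by rewrite subr_gt0.
move=> /cf /nbhs_ballP[a /= a0 Ha]; exists a => // y yv.
have /Ha : ball v a y by rewrite /ball/= distrC.
by rewrite /= => /(le_lt_trans (ler_norm _)); rewrite ltrD2l ltrN2.
Qed.

Lemma ae_le_prob d (T : measurableType d) (R : realType) (P : probability T R) (A B : set T) :
  measurable A -> measurable B -> {ae P, forall w, A w -> B w} -> (P A <= P B)%E.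
Proof.
move=> mA mB [N [mN N0 sN]].
apply: (@le_trans _ _ (P (B `|` N))).
  apply: le_measure; rewrite ?inE//; first exact: measurableU.
  move=> w Aw; have [Bw|nB] := pselect (B w); [by left|right].
  by apply: sN => /(_ Aw).
have N0' : (P N <= 0)%E by rewrite (N0 : P N = 0%E).
apply: (le_trans (measureU2 P mB mN)); rewrite -[leRHS]adde0.
by apply: leeD; [exact: lexx|exact: N0'].
Qed.

Lemma small_loctime (R : realType) w ell (eta : R) : good_path w ell -> 0 < eta ->
  exists2 N : nat, True & forall n, (N <= n)%N -> forall v, ell v n.+1%:R^-1 <= eta.
Proof.
move=> gw eta0; have [M [C [M0 C0 dom]]] := ell_dominated gw ler01.
pose K : set R := `[- M, M]%classic.
have /compact_near_coveringP/(_ R (nbhs (0 : R))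
    (fun t v => ell v (Num.max 0 t) <= eta)) : compact K by exact: segment_compact.
case.
  move=> v _; have /cvgrPdist_le/(_ _ eta0) := @good_ell _ _ _ gw (v, 0).
  have -> : ell (v, 0).1 (Num.max 0 (v, 0).2) = 0 by rewrite /= max_r ?lexx// (ell0 gw).
  move=> H.
  apply: filterS H => -[v' t]; rewrite sub0r normrN; apply: le_trans.
  exact: ler_norm.
move=> r /= r0 Hr.
exists (Num.truncn r^-1) => // n Nn v; have n0 : 0 < n.+1%:R^-1 :> R by rewrite invr_gt0.
have nr : n.+1%:R^-1 < r.
  rewrite -[r]invrK ltf_pV2 ?posrE ?invr_gt0//.
  by rewrite (lt_le_trans (truncnS_gt _))// ler_nat.
have [vK|vK] := boolP (v \in K).
  have := Hr n.+1%:R^-1; rewrite /= sub0r normrN gtr0_norm// => /(_ nr v).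
  by rewrite max_r ?(ltW n0)//; apply; rewrite inE in vK.
apply: (le_trans (dom n.+1%:R^-1 v _)).
  by rewrite (ltW n0)/= invf_le1// ler1n.
by rewrite indicE (negbTE vK) mulr0 ltW.
Qed.

(** * Exits in a short time are unlikely *)

Section early_exit.
Context {R : realType} (kappa : {sigma_finite_measure set (measurableTypeR R) -> \bar R}).
Context d (Omega : measurableType d) (P : probability Omega R).
Variables (x : R) (B : R -> Omega -> R) (e : Omega -> R).
Hypothesis mwc : motion_with_clock kappa P x B e.
Local Notation started := (started x B).
Local Notation X0 := (centered x B).

Let kr := mwc_radon mwc.

Definition max_loctime (t : R) (w : Omega) : \bar R :=
  ereal_sup [set loctime (ratr q) t (X0 w) | q in [set: rat]].

(** An event built on the centred path, hence independent of the starting point. [C] will be the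
    mass given by [kappa] to an interval of radius [r]; while the path stays inside, the clock is at
    most [C] times the maximal local time. *)
Definition early_event (r C t : R) : set Omega :=
  [set w | (exists q : rat, [/\ 0 <= (ratr q : R), ratr q <= t & r / 2 <= `|X0 w (ratr q)|]) \/
     ((e w)%:E <= C%:E * max_loctime t w)%E].

Lemma measurable_early_event r C t : measurable (early_event r C t).
Proof.
have mX := measurable_centered (mwc_BM mwc).
apply: measurableU.
  apply: measurable_exists => q.
  rewrite (_ : [set w | _] = [set w | 0 <= (ratr q : R) -> (ratr q <= t /\ r / 2 <= `|X0 w (ratr q)|)] `&`
     [set _ | 0 <= (ratr q : R)]).
    apply: measurableI; last exact: measurable_cst_event.
    apply: measurable_imply => q0; apply: measurable_and; first exact: measurable_cst_event.
    apply: measurable_ler; first exact: measurable_cst.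
    exact: (measurableT_comp (@normr_measurable R setT) (measurableT_comp (measurable_eval q0) mX)).
  by apply/seteqP; split => w /= [] => [q0 qt rq|h q0]; [|have [] := h q0; split].
have mm : measurable_fun setT (max_loctime t).
  apply: (measurability _ (ErealGenOInfty.measurableE R)) => _ [_ [c ->] <-].
  rewrite setTI (_ : _ @^-1` _ = [set w | exists q : rat, (c%:E < loctime (ratr q) t (X0 w))%E]).
    apply: measurable_exists => q; apply: measurable_lteE; first exact: measurable_cst.
    exact: (measurable_loctime t mX (measurable_cst _)).
  apply/seteqP; split => w /=; rewrite in_itv/= andbT.
    by move=> /ereal_sup_gt[_ [q _ <-] cq]; exists q.
  by move=> [q cq]; apply: (lt_le_trans cq); apply: ereal_sup_ubound; exists q.
rewrite -[X in measurable X]setCK; apply: measurableC.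
rewrite (_ : ~` _ = [set w | (C%:E * max_loctime t w < (e w)%:E)%E]).
  apply: measurable_lteE; first exact: (measurable_funeM _ mm).
  by apply/measurable_EFinP; exact: mwc_me mwc.
by apply/seteqP; split => w /=; rewrite ltNge => /negP.
Qed.

Lemma max_loctimeE w ell t v : good_path (X0 w) ell -> 0 <= t ->
  ((ell v t)%:E <= max_loctime t w)%E.
Proof.
move=> gw t0; rewrite leNgt; apply/negP => lt.
have fin : max_loctime t w \is a fin_num.
  rewrite ge0_fin_numE; first exact: (lt_trans lt (ltry _)).
  apply: le_trans (ereal_sup_ubound _); last by exists 0%Q.
  exact: loctime_ge0.
rewrite -(fineK fin) lte_fin in lt.
have [r r0 Hr] := continuous_gt (cts_ell gw t0 (x := v)) lt.
have [q] : exists q : rat, (ratr q : R) \in `]v, v + r[.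
  by apply: rat_in_itvoo; rewrite ltrDl.
rewrite in_itv/= => /andP[vq qr].
have /Hr : `|ratr q - v| < r by rewrite gtr0_norm ?subr_gt0// ltrBlDl.
apply/negP; rewrite -leNgt -lee_fin fineK// -(loctimeE gw)//.
by apply: ereal_sup_ubound; exists q.
Qed.

(** Off the bad event the path started at [z] stays within [3 / 4 * r] of [z0]. It meets no segment,
    charges [kappa] only inside the interval of radius [r], and so its clock has not yet reached the
    exponential variable. *)
Lemma early_exit_sub w ell z0 z s r (C t : R) : good_path (X0 w) ell -> X0 w 0 = 0 ->
  0 < r -> (forall y, `|y - z0| < r -> ~ covered s y) ->
  kappa `[z0 - r, z0 + r]%classic = C%:E ->
  `|z - z0| < r / 4 -> 0 <= t -> ~ early_event r C t w ->
  (t%:E < exit_time s (started z w) (killing_time kappa (started z w) (e w)))%E.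
Proof.
move=> gw w0 r0 Us kC zz t0 /not_orP[noq ec].
have {}noq u : 0 <= u <= t -> `|X0 w u| <= r / 2.
  move=> /andP[u0 ut]; have [u0'|u_gt0] := eqVneq u 0.
    by rewrite u0' w0 normr0 divr_ge0 ?ltW.
  have {u_gt0}u_gt0 : 0 < u by rewrite lt_neqAle eq_sym u_gt0.
  rewrite leNgt; apply/negP => lt.
  have c : continuous (fun v : R => `|X0 w (Num.max 0 v)|).
    by move=> v; apply: cvg_norm; exact: (good_cpath gw).
  have lt' : r / 2 < `|X0 w (Num.max 0 u)| by rewrite max_r ?ltW.
  have [a a0 Ha] := continuous_gt (f := fun v : R => `|X0 w (Num.max 0 v)|) (c u) lt'.
  have [q] : exists q : rat, (ratr q : R) \in `]Num.max 0 (u - a), u[.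
    by apply: rat_in_itvoo; rewrite gt_max u_gt0 ltrBlDr ltrDl.
  rewrite in_itv/= gt_max => /andP[/andP[q0 aq] qu]; apply: noq; exists q; split.
  - exact: ltW.
  - by rewrite (le_trans (ltW qu)).
  - have qa : `|ratr q - u| < a.
      by rewrite distrC gtr0_norm ?subr_gt0// ltrBlDl -ltrBlDr.
    by have := Ha _ qa; rewrite (max_r (ltW q0)) => /ltW.
have gz : good_path (started z w) (fun y u => ell (y - z) u) by exact: good_translate.
have near u : 0 <= u <= t -> `|started z w u - z0| <= 3 / 4 * r.
  move=> ut; rewrite /started /add_path addrAC.
  have := ler_normD (z - z0) (X0 w u); have := noq _ ut; move: zz; lra.
apply/(exit_timeP _ _ (good_cpath gz) t0); split; last first.
  by move=> u ut; apply: Us; have := near _ ut; lra.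
apply/(killing_timeP kr gz) => //; move: ec => /negP; rewrite -ltNge; apply: le_lt_trans.
rewrite (clockE kappa gz)//.
apply: (@le_trans _ _ (\int[kappa]_y (max_loctime t w * (\1_(`[z0 - r, z0 + r]%classic) y)%:E))%E).
  apply: ge0_le_integral => //.
  - by move=> y _; rewrite lee_fin; exact: (ell_ge0 gz).
  - exact: (measurable_ell gz t0).
  - apply: measurable_funeM; apply/measurable_EFinP; exact: measurable_indic.
  - move=> y _; have [yK|yK] := boolP (y \in `[z0 - r, z0 + r]%classic).
      by rewrite indicE yK mule1; exact: max_loctimeE.
    rewrite (ell_out gz)// ?indicE ?(negbTE yK) ?mule0//.
    (* The gap between the range [3 / 4 * r] of the path and the radius [r]. *)
    exists (r / 4); first by rewrite divr_gt0.
    move=> u ut /andP[h1 h2]; move: yK; rewrite notin_setE/= in_itv/=; apply.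
    by have := near _ ut; rewrite ler_norml; lra.
rewrite ge0_integralZl//.
- rewrite integral_indic// setIT muleC le_eqVlt; apply/orP; left; apply/eqP.
  by congr (_ * _)%E; exact: kC.
- by apply/measurable_EFinP; exact: measurable_indic.
- by apply: le_trans (max_loctimeE 0 gw t0); rewrite lee_fin; exact: (ell_ge0 gw).
Qed.

Lemma early_event_vanish r C w ell : good_path (X0 w) ell -> X0 w 0 = 0 -> 0 < e w ->
  0 < r -> 0 <= C -> exists N, forall n, (N <= n)%N -> ~ early_event r C n.+1%:R^-1 w.
Proof.
move=> gw w0 ew r0 C0.
have C1 : 0 < C + 1 by rewrite ltr_wpDl.
(* Local times below [e w / (C + 1)] keep [C] times them strictly below [e w], also when [C] is
   0. *)
have [N1 _ H1] := small_loctime gw (divr_gt0 ew C1).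
have r2 : 0 < r / 2 by rewrite divr_gt0.
have /cvgrPdist_lt/(_ _ r2) := good_cpath gw (x := 0).
have -> : X0 w (Num.max 0 0) = 0 by rewrite max_r ?lexx// w0.
move=> /nbhs_ballP[a /= a0 Ha].
exists (maxn N1 (Num.truncn a^-1)) => n; rewrite geq_max => /andP[n1 n2].
have na : n.+1%:R^-1 < a.
  rewrite -[a]invrK ltf_pV2 ?posrE ?invr_gt0//.
  by rewrite (lt_le_trans (truncnS_gt _))// ler_nat.
case.
  move=> [q [q0 qn]]; apply/negP; rewrite -ltNge.
  have := Ha (ratr q); rewrite /ball/= max_r// sub0r normrN ger0_norm// sub0r normrN; apply.
  exact: (le_lt_trans qn).
apply/negP; rewrite -ltNge.
have n0 : 0 <= n.+1%:R^-1 :> R by rewrite invr_ge0.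
apply: (@le_lt_trans _ _ (C%:E * (e w / (C + 1))%:E)%E); last first.
  by rewrite -EFinM lte_fin mulrA ltr_pdivrMr// mulrC ltr_pM2l// ltrDl.
apply: lee_wpmul2l; first by rewrite lee_fin.
apply: ge_ereal_sup => _ [q _ <-]; rewrite (loctimeE gw)// lee_fin; exact: H1.
Qed.

End early_exit.

Lemma bounded_integral_cvg d (T : measurableType d) (R : realType) (P : probability T R)
    (f : nat -> T -> \bar R) (g : T -> \bar R) (C : R) :
  (forall n, measurable_fun setT (f n)) -> measurable_fun setT g ->
  {ae P, forall w, forall n, (0 <= f n w <= C%:E)%E} ->
  {ae P, forall w, f n w @[n --> \oo] --> g w} ->
  (\int[P]_w f n w)%E @[n --> \oo] --> (\int[P]_w g w)%E.
Proof.
move=> mf mg fC ae.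
have ae' : {ae P, forall w, setT w -> f n w @[n --> \oo] --> g w}.
  by apply: filterS ae => w h _.
have iC : P.-integrable setT (fun=> C%:E).
  by apply: finite_measure_integrable_cst.
have fC' : {ae P, forall x (n : nat), setT x -> (`|f n x| <= C%:E)%E}.
  apply: filterS fC => w h n _; have /andP[f0 fc] := h n.
  by rewrite gee0_abs.
have [_ _ h] := @dominated_convergence _ T R P setT measurableT f g (fun=> C%:E)
  mf mg ae' iC fC'.
exact: h.
Qed.

Lemma eventually_null d (T : measurableType d) (R : realType) (P : probability T R)
    (E : nat -> set T) : (forall n, measurable (E n)) ->
  {ae P, forall w, exists N, forall n, (N <= n)%N -> ~ E n w} ->
  P (E n) @[n --> \oo] --> 0%E.
Proof.
move=> mE ae.
have H : (\int[P]_w (\1_(E n) w)%:E)%E @[n --> \oo] --> (\int[P]_w 0)%E.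
  apply: (@bounded_integral_cvg _ T R P (fun n w => (\1_(E n) w)%:E) (fun=> 0%E) 1).
  - by move=> n; apply/measurable_EFinP; exact: measurable_indic.
  - exact: measurable_cst.
  - by apply: aeW => w n; rewrite !lee_fin indicE ler0n lern1 leq_b1.
  - apply: filterS ae => w [N HN]; apply: cvg_near_cst; exists N => // n /= Nn.
    by rewrite indicE memNset//; exact: HN.
rewrite integral0 in H; apply: cvg_trans H; apply: near_eq_cvg; apply: nearW => n.
by rewrite integral_indic// setIT.
Qed.

Lemma not_covered_ball (R : realType) (s : seq (R * R)) (z : R) : ~ covered s z ->
  exists2 r, 0 < r & forall y, `|y - z| < r -> ~ covered s y.
Proof.
move=> /dist_cov_gt0 d0; exists (dist_cov s z) => // y yz /coveredE y0.
have := dist_covP s z y; rewrite y0 add0r distrC => h.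
by move: (le_lt_trans h yz); rewrite ltxx.
Qed.

(** The bound is uniform in [z] near [z0] because a single bad event, whose probability tends to 0
    with the time, contains the early exits from all these points. *)
Lemma early_exit (R : realType) (kappa : {sigma_finite_measure set (measurableTypeR R) -> \bar R})
    d (Omega : measurableType d) (P : probability Omega R) x B e
    (mwc : motion_with_clock kappa P x B e) s z0 (eps : R) :
  ~ covered s z0 -> 0 < eps -> exists t r, [/\ 0 < t, 0 < r &
    forall z, `|z - z0| < r -> (P [set w | (exit_time s (started x B z w)
      (killing_time kappa (started x B z w) (e w)) <= t%:E)%E] <= eps%:E)%E].
Proof.
move=> /not_covered_ball[r r0 Us] eps0.
have kK : kappa `[z0 - r, z0 + r]%classic \is a fin_num.
  by rewrite ge0_fin_numE//; apply: (mwc_radon mwc); exact: segment_compact.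
pose C := fine (kappa `[z0 - r, z0 + r]%classic).
have C0 : 0 <= C by rewrite fine_ge0.
have mE n : measurable (early_event x B e r C n.+1%:R^-1) by exact: (measurable_early_event mwc).
have vanish : {ae P, forall w, exists N, forall n, (N <= n)%N -> ~ early_event x B e r C n.+1%:R^-1 w}.
  apply: filterS (started_good mwc) => w [g0 s0 ew]; have [ell gw] := g0 0.
  have E0 : started x B 0 w = centered x B w.
    by apply/funext => u; rewrite /started /add_path add0r.
  rewrite E0 in gw; have := s0 0; rewrite E0 => w0.
  exact: (early_event_vanish gw w0 ew r0 C0).
have := eventually_null mE vanish.
move=> /fine_cvgP[_ /cvgrPdist_le/(_ _ eps0)[N _ /(_ N (leqnn N))]].
rewrite /= sub0r normrN ger0_norm ?fine_ge0// => PN.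
exists N.+1%:R^-1, (r / 4); split; [by rewrite invr_gt0|by rewrite divr_gt0|].
move=> z zz; have PNE : (P (early_event x B e r C N.+1%:R^-1) <= eps%:E)%E.
  rewrite -[X in (X <= _)%E]fineK ?lee_fin//.
  exact: fin_num_measure.
apply: le_trans PNE; apply: ae_le_prob; [|exact: mE|].
  rewrite -[X in measurable X]setCK; apply: measurableC.
  rewrite (_ : ~` _ = [set w | (N.+1%:R^-1%:E < exit_time s (started x B z w)
      (killing_time kappa (started x B z w) (e w)))%E]).
    apply: measurable_lteE; first exact: measurable_cst.
    have mk := measurable_killing_time kappa (measurable_started mwc z) (mwc_me mwc).
    exact: (measurable_exit_time (mstate_cst _ s) (measurable_started mwc z) mk).
  by apply/seteqP; split => w /=; rewrite ltNge => /negP.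
apply: filterS (started_good mwc) => w [g0 s0 ew]; have [ell gw] := g0 0.
have E0 : started x B 0 w = centered x B w.
  by apply/funext => u; rewrite /started /add_path add0r.
rewrite E0 in gw; have := s0 0; rewrite E0 => w0.
apply: contraPP => nE; apply/negP; rewrite -ltNge.
apply: (early_exit_sub mwc gw w0 r0 Us _ zz _ nE); last by rewrite invr_ge0.
by rewrite /C fineK.
Qed.

Lemma fine_dist_le (R : realType) (a b : \bar R) (eps : R) : a \is a fin_num ->
  b \is a fin_num -> (a <= b + eps%:E)%E -> (b <= a + eps%:E)%E ->
  `|fine a - fine b| <= eps.
Proof.
move: a b => [a| |] [b| |] // _ _; rewrite -!EFinD !lee_fin ler_norml /=; lra.
Qed.

Lemma normal_shift_lee (R : realType) (sd : R) (g : R -> \bar R) z z' : sd != 0 ->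
  measurable_fun setT g -> (forall y, (0 <= g y <= 1)%E) ->
  (\int[normal_prob 0 sd]_y g (z + y)%R <=
   \int[normal_prob 0 sd]_y g (z' + y)%R + (`|z - z'| * normal_peak sd)%:E)%E.
Proof.
move=> sd0 mg g01.
have gE y : (fine (g y))%:E = g y.
  by rewrite fineK//; have /andP[g0 g1] := g01 y; rewrite ge0_fin_numE// (le_lt_trans g1)// ltry.
have E v : (\int[normal_prob 0 sd]_y (fine (g (v + y)%R))%:E = \int[normal_prob 0 sd]_y g (v + y)%R)%E.
  by apply: eq_integral => y _; rewrite gE.
rewrite -(E z) -(E z').
apply: (normal_shift_le sd0 (g := fun y => fine (g y))).
  exact: (measurableT_comp (fine_measurable measurableT) mg).
by move=> y; rewrite -!lee_fin gE.
Qed.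

(** * Continuity of exit means in the starting point *)

Section exit_mean_continuity.
Context {R : realType} (kappa : {sigma_finite_measure set (measurableTypeR R) -> \bar R}).
Context d (Omega : measurableType d) (P : probability Omega R).
Variables (x : R) (B : R -> Omega -> R) (e : Omega -> R).
Hypothesis mwc : motion_with_clock kappa P x B e.
Local Notation started := (started x B).
Variable phi : R -> \bar R.
Hypothesis mphi : measurable_fun setT phi.
Hypothesis phi01 : forall y, (0 <= phi y <= 1)%E.

Let phi0 y : (0 <= phi y)%E. Proof. by have /andP[] := phi01 y. Qed.

Lemma exit_value_le1 s w u : (exit_value kappa phi s w u <= 1)%E.
Proof. by rewrite /exit_value; case: ifP => // _; have /andP[] := phi01 (exit_point s w (killing_time kappa w u)). Qed.

Lemma exit_mean_le1 s z : (exit_mean kappa P x B e phi s z <= 1)%E.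
Proof.
rewrite -(integral_cst_prob P 1%E); apply: ge0_le_integral => //.
- by move=> w _; exact: exit_value_ge0.
- exact: (measurable_exit_value kappa mphi (mstate_cst _ s) (measurable_started mwc z) (mwc_me mwc)).
- by move=> w _; exact: exit_value_le1.
Qed.

Lemma started_gauss z t (g : R -> \bar R) : 0 < t -> measurable_fun setT g ->
  (forall y, (0 <= g y)%E) ->
  (\int[P]_w g (started z w t) = \int[normal_prob 0 (Num.sqrt t)]_y g (z + y)%R)%E.
Proof.
move=> t0 mg g0; have [mB cB law _] := mwc_BM mwc.
have mI : measurable_fun setT (fun w => B t w - B 0 w).
  exact: (measurable_funB (measurable_B (mwc_BM mwc) (ltW t0)) (measurable_B (mwc_BM mwc) (lexx 0))).
pose X : {mfun Omega >-> measurableTypeR R} := HB.pack (fun w => B t w - B 0 w)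
  (isMeasurableFun.Build _ _ _ (measurableTypeR R) _ mI).
have mgz : measurable_fun setT (fun y : measurableTypeR R => g (z + y)%R).
  exact: (measurableT_comp mg (measurable_funD (measurable_cst z) (@measurable_id _ _ setT))).
transitivity (\int[P]_w g (z + X w)%R)%E.
  have me t' : 0 <= t' -> measurable_fun setT (fun w => g (started z w t')).
    by move=> t'0; exact: (measurableT_comp mg (measurableT_comp (measurable_eval t'0) (measurable_started mwc z))).
  apply: ge0_ae_eq_integral => //.
  - exact: (me _ (ltW t0)).
  - exact: (measurableT_comp mgz mI).
  - by apply: filterS cB => w [B0 _] _; rewrite /started /add_path /centered /= B0.
transitivity (\int[distribution P X]_y g (z + y)%R)%E.
  by rewrite ge0_integral_pushforward.
apply: eq_measure_integral => A mA _.
have := law 0 t (lexx _) t0 A mA; rewrite subr0; exact.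
Qed.

(** Outside an event of probability at most [eps] the motion is still running at time [t], and the
    simple Markov property at [t] turns the exit mean into its own Gaussian average. All integrands
    lie in [[0, 1]], so discarding that event costs at most [eps] in either direction. *)
Lemma exit_mean_gauss z s t (eps : R) : 0 < t ->
  (P [set w | (exit_time s (started z w)
      (killing_time kappa (started z w) (e w)) <= t%:E)%E] <= eps%:E)%E ->
  let g y := exit_mean kappa P x B e phi s y in
  (g z <= \int[normal_prob 0 (Num.sqrt t)]_y g (z + y)%R + eps%:E)%E /\
  (\int[normal_prob 0 (Num.sqrt t)]_y g (z + y)%R <= g z + eps%:E)%E.
Proof.
move=> t0 Peps g.
set E := [set w | _] in Peps.
have t0' := ltW t0.
have kr := mwc_radon mwc.
have mk := measurable_killing_time kappa (measurable_started mwc z) (mwc_me mwc).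
have mE : measurable E.
  rewrite -[X in measurable X]setCK; apply: measurableC.
  rewrite (_ : ~` _ = [set w | (t%:E < exit_time s (started z w)
      (killing_time kappa (started z w) (e w)))%E]).
    apply: measurable_lteE; first exact: measurable_cst.
    exact: (measurable_exit_time (mstate_cst _ s) (measurable_started mwc z) mk).
  by apply/seteqP; split => w /=; rewrite ltNge => /negP.
pose D : set (@path R) := [set w | avoids s w t].
have mD : measurable D by exact: (measurable_avoids t (mstate_cst _ s) (@measurable_id _ path setT)).
have mg : measurable_fun setT g.
  exact: (measurable_exit_mean mwc mphi phi0 (mstate_cst _ s) (@measurable_id _ _ setT)).
have g0 y : (0 <= g y)%E by exact: exit_mean_ge0.
have g1 y : (g y <= 1)%E by exact: exit_mean_le1.
have SM := simple_markov mwc mphi phi0 (s := s) z t0' mD (fun w => avoids_stop_path s w (lexx t)) (fun w h => h).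
have M1 : measurable_fun setT (fun w => exit_value kappa phi s (started z w) (e w)).
  exact: (measurable_exit_value kappa mphi (mstate_cst _ s) (measurable_started mwc z) (mwc_me mwc)).
have M2 : measurable_fun setT (fun w => g (started z w t)).
  exact: (measurableT_comp mg (measurableT_comp (measurable_eval t0') (measurable_started mwc z))).
have mI : measurable_fun setT (fun w => (\1_E w : R)%:E).
  by apply/measurable_EFinP; exact: measurable_indic.
have mcut (f : Omega -> \bar R) : measurable_fun setT f ->
    measurable_fun setT (fun w => ((\1_D (started z w))%:E *
      (if (clock kappa t (started z w) < (e w)%:E)%E then f w else 0))%E).
  move=> mf; apply: emeasurable_funM.
    by apply/measurable_EFinP; exact: (measurableT_comp (measurable_indic mD) (measurable_started mwc z)).
  apply: measurable_fun_ifT => //; apply: measurable_fun_lte.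
    exact: (measurable_clock kappa t (measurable_started mwc z)).
  by apply/measurable_EFinP; exact: mwc_me mwc.
have cut (f : Omega -> \bar R) : measurable_fun setT f -> (forall w, 0 <= f w <= 1)%E ->
    (\int[P]_w ((\1_D (started z w))%:E * (if (clock kappa t (started z w) < (e w)%:E)%E then f w else 0)) <= \int[P]_w f w)%E /\
    (\int[P]_w f w <= \int[P]_w ((\1_D (started z w))%:E * (if (clock kappa t (started z w) < (e w)%:E)%E then f w else 0)) + eps%:E)%E.
  move=> mf f01.
  have f0 w : (0 <= f w)%E by have /andP[] := f01 w.
  have h0 w : (0 <= (\1_D (started z w))%:E * (if (clock kappa t (started z w) < (e w)%:E)%E then f w else 0))%E.
    by rewrite mule_ge0 ?lee_fin//; case: ifP.
  split.
    apply: ge0_le_integral => //; first exact: mcut.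
    move=> w _; rewrite indicE; case: (_ \in D); rewrite ?mul1e ?mul0e//.
    by case: ifP.
  apply: (@le_trans _ _ (\int[P]_w ((\1_D (started z w))%:E * (if (clock kappa t (started z w) < (e w)%:E)%E then f w else 0) + (\1_E w)%:E))%E).
    apply: ae_ge0_le_integral => //.
    - by move=> w _; rewrite adde_ge0// lee_fin.
    - by apply: emeasurable_funD => //; exact: mcut.
    - apply: filterS (started_good mwc) => w [gz _ ew] _; have [ell gw] := gz z.
      have [wE|/negP wE] := pselect (E w).
        have -> : \1_E w = 1 :> R by rewrite indicE mem_set.
        rewrite (le_trans (_ : f w <= 1)%E)//.
          by have /andP[] := f01 w.
        by rewrite leeDr.
      move: wE; rewrite /E/= -ltNge => /(exit_timeP _ _ (good_cpath gw) t0')[kt av].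
      rewrite indicE mem_set; last by apply/avoidsP => //; exact: good_cpath gw.
      rewrite mul1e ifT; last by apply/(killing_timeP kr gw).
      by rewrite leeDl// lee_fin.
  rewrite ge0_integralD//; last exact: mcut.
  by rewrite leeD2l// integral_indic// setIT.
have [a1 a2] := cut _ M1 (fun w => introT andP (conj (exit_value_ge0 kappa phi0 s _ _) (exit_value_le1 s _ _))).
have [b1 b2] := cut _ M2 (fun w => introT andP (conj (g0 _) (g1 _))).
rewrite (started_gauss z t0 mg g0) in b1 b2.
rewrite -/(exit_mean kappa P x B e phi s z) -/(g z) SM in a1 a2.
split.
  by apply: (le_trans a2); rewrite leeD2r.
by apply: (le_trans b2); rewrite leeD2r.
Qed.

(** The strong Feller argument: an exit mean is close to its Gaussian average, which is Lipschitz in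
    the centre however irregular [phi] may be. *)
Lemma exit_mean_near s z0 (eps : R) : ~ covered s z0 -> 0 < eps ->
  exists2 r, 0 < r & forall z z', `|z - z0| < r -> `|z' - z0| < r ->
  (exit_mean kappa P x B e phi s z <= exit_mean kappa P x B e phi s z' + eps%:E)%E.
Proof.
move=> Uz eps0; have eps4 : 0 < eps / 4 by rewrite divr_gt0.
have [t [r [t0 r0 H]]] := early_exit mwc Uz eps4.
have st0 : Num.sqrt t != 0 by rewrite gt_eqF// sqrtr_gt0.
set pk := normal_peak (Num.sqrt t).
have pk0 : 0 <= pk by exact: normal_peak_ge0.
pose g y := exit_mean kappa P x B e phi s y.
have mg : measurable_fun setT g.
  exact: (measurable_exit_mean mwc mphi phi0 (mstate_cst _ s) (@measurable_id _ _ setT)).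
have g0 y : (0 <= g y)%E by exact: exit_mean_ge0.
have g1 y : (g y <= 1)%E by exact: exit_mean_le1.
have gfin y : g y \is a fin_num by rewrite ge0_fin_numE// (le_lt_trans (g1 y))// ltry.
have gE y : g y = (fine (g y))%:E by rewrite fineK.
(* Two points within [a] of [z0] are at most [2 * a] apart, and [2 * a * (pk + 1) = eps / 2]. *)
pose a := eps / (4 * (pk + 1)).
have a0 : 0 < a by rewrite divr_gt0// mulr_gt0// ltr_wpDl.
exists (Num.min r a); first by rewrite lt_min r0.
move=> z z'; rewrite !lt_min => /andP[zr za] /andP[z'r z'a].
have [h1 _] := exit_mean_gauss t0 (H z zr).
have [_ h2] := exit_mean_gauss t0 (H z' z'r).
have h3 : (\int[normal_prob 0 (Num.sqrt t)]_y g (z + y)%R <=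
    \int[normal_prob 0 (Num.sqrt t)]_y g (z' + y)%R + (eps / 2)%:E)%E.
  have g01 y : (0 <= g y <= 1)%E by rewrite g0 g1.
  have hN := normal_shift_lee z z' st0 mg g01.
  apply: le_trans; first exact: hN.
  rewrite leeD2l// lee_fin.
  have zz : `|z - z'| <= 2 * a.
    have := ler_distD z0 z z'; rewrite (distrC z0) => hh.
    by apply: (le_trans hh); move: za z'a; lra.
  apply: (@le_trans _ _ (2 * a * (pk + 1))).
    by apply: ler_pM => //; rewrite lerDl.
  by rewrite /a le_eqVlt; apply/orP; left; apply/eqP; field; rewrite gt_eqF// ltr_wpDl.
apply: (le_trans h1); apply: (le_trans (leeD2r _ h3)).
apply: (@le_trans _ _ (g z' + (eps/4)%:E + (eps/2)%:E + (eps/4)%:E)%E).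
  by rewrite leeD2r// leeD2r.
by rewrite -/(g z') gE -!EFinD lee_fin; lra.
Qed.

Lemma exit_mean_cvg s (u : nat -> R) z0 : ~ covered s z0 -> u @ \oo --> z0 ->
  exit_mean kappa P x B e phi s (u n) @[n --> \oo] --> exit_mean kappa P x B e phi s z0.
Proof.
move=> Uz uz.
have g0 y : (0 <= exit_mean kappa P x B e phi s y)%E by exact: exit_mean_ge0.
have g1 y : (exit_mean kappa P x B e phi s y <= 1)%E by exact: exit_mean_le1.
have gfin y : exit_mean kappa P x B e phi s y \is a fin_num.
  by rewrite ge0_fin_numE// (le_lt_trans (g1 y))// ltry.
rewrite -[X in _ --> X](fineK (gfin z0)); apply/fine_cvgP; split; first by apply: nearW => n; exact: gfin.
apply/cvgrPdist_le => eps eps0.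
have [r r0 H] := exit_mean_near Uz eps0.
have /cvgrPdist_lt/(_ _ r0) := uz.
apply: filterS => n; rewrite distrC => un.
have zz : `|z0 - z0| < r by rewrite subrr normr0.
exact: (fine_dist_le (gfin _) (gfin _) (H _ _ zz un) (H _ _ un zz)).
Qed.

End exit_mean_continuity.

Lemma ltNyy (R : realType) : ((-oo : \bar R) < +oo)%E = true.
Proof. by rewrite ltNye. Qed.

(** * Strong Markov property and hitting probabilities *)

Section strong_markov.
Context {R : realType} (kappa : {sigma_finite_measure set (measurableTypeR R) -> \bar R}).
Context d (Omega : measurableType d) (P : probability Omega R).
Variables (x : R) (B : R -> Omega -> R) (e : Omega -> R).
Hypothesis mwc : motion_with_clock kappa P x B e.
Local Notation started := (started x B).
Local Notation Em := (exit_mean kappa P x B e).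
Local Notation Ev := (exit_value kappa).
Local Notation stime s z w := (exit_time s (started z w) (killing_time kappa (started z w) (e w))).
Variable phi : R -> \bar R.
Hypothesis mphi : measurable_fun setT phi.
Hypothesis phi01 : forall y, (0 <= phi y <= 1)%E.
Variables s s' : seq (R * R).
Hypothesis ss' : forall y, covered s y -> covered s' y.

Let phi0 y : (0 <= phi y)%E. Proof. by have /andP[] := phi01 y. Qed.

(* Stop the motion on the larger set covered by s', then let it run until s. *)
Definition redirect (y : R) : \bar R :=
  if dist_cov s' y == 0 then Em phi s y else phi y.

Lemma measurable_redirect : measurable_fun setT redirect.
Proof.
apply: measurable_fun_ifT => //.
  have m : measurable_fun setT (dist_cov s').
    exact: (measurable_dist_cov (mstate_cst _ s') (@measurable_id _ _ setT)).
  apply: measurable_fun_eqr => //; exact: measurable_cst.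
exact: (measurable_exit_mean mwc mphi phi0 (mstate_cst _ s) (@measurable_id _ _ setT)).
Qed.

Lemma redirect01 y : (0 <= redirect y <= 1)%E.
Proof. by rewrite /redirect; case: ifP => // _; rewrite exit_mean_ge0// (exit_mean_le1 mwc). Qed.

(** With the path frozen, a tie forces the exponential variable to take the single value
    [exit_clock], an event of probability zero. At a tie [redirect] would restart a motion that is
    already dead. *)
Lemma killing_tie_null z : exists2 N : set Omega, P.-negligible N &
  forall w ell t, good_path (started z w) ell -> 0 < t ->
    exit_time s' (started z w) +oo = t%:E ->
    killing_time kappa (started z w) (e w) = t%:E -> N w.
Proof.
pose N := [set w | exit_clock kappa s' (started z w) = (e w)%:E].
exists N; last first.
  move=> w ell t gw t0 h1 h2; exact: (exit_killing_tie (mwc_radon mwc) gw t0 h1 h2).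
pose D : set (path * R) := [set y | exit_clock kappa s' y.1 = y.2%:E].
have mD : measurable D.
  rewrite -[X in measurable X]setTI; apply: emeasurable_fun_eq.
  - exact: measurableT.
  - exact: (measurable_exit_clock kappa s' (@measurable_fst _ _ (@path R) R)).
  - by apply/measurable_EFinP; exact: measurable_snd.
have mpair : measurable_fun setT (fun w => (started z w, e w) : path * R).
  by apply: measurable_fun_pair; [exact: (measurable_started mwc z)|exact: (mwc_me mwc)].
have mN : measurable N by rewrite -[X in measurable X]setTI; exact: (mpair measurableT D mD).
apply/negligibleP => //.
have m1D : measurable_fun setT (fun y => (\1_D y : R)%:E).
  by apply/measurable_EFinP; exact: measurable_indic.
transitivity (\int[P]_w (\1_N w)%:E)%E; first by rewrite integral_indic// setIT.
apply: etrans (started_clock_fubini mwc z (f := fun y => (\1_D y : R)%:E) m1D _) _.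
  by move=> y; rewrite lee_fin.
rewrite (_ : (fun w => _) = fun=> 0%E) ?integral0//; apply/funext => w.
have mDw : measurable [set w' | D (started z w, e w')].
  have : measurable_fun setT (fun w' => (started z w, e w') : path * R).
    by apply: measurable_fun_pair; [exact: measurable_cst|exact: (mwc_me mwc)].
  by move=> /(_ measurableT D mD); rewrite setTI.
rewrite (eq_integral (fun w' => (\1_[set w' | D (started z w, e w')] w')%:E)); last first.
  by move=> w' _; rewrite !indicE; congr (EFin (nat_of_bool _)%:R); apply/idP/idP; rewrite !inE.
rewrite integral_indic// setIT.
have mS (c : R) : measurable [set w' | e w' = c].
  have mc : measurable ([set c] : set (measurableTypeR R)) by exact: measurable_set1.
  by have := mwc_me mwc measurableT mc; rewrite setTI.
apply: (subset_measure0 (mu := P) (B := [set w' | e w' = fine (exit_clock kappa s' (started z w))])).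
- exact: mDw.
- exact: mS.
- by move=> w' /= ->.
- exact: (exp_singleton (mwc_elaw mwc)).
Qed.

Lemma sum_select (N g : nat) (Q : nat -> bool) (X : nat -> \bar R) :
  (\sum_(i < N) (if (g == i) && Q i then X i else 0) =
   if (g < N)%N && Q g then X g else 0)%E.
Proof.
have [gN|Ng] := ltnP g N.
  rewrite (bigD1 (Ordinal gN))//= eqxx /= big1 ?adde0// => i /negP ig.
  by case: eqP => // gi; exfalso; apply: ig; apply/eqP/val_inj.
by rewrite big1// => i _; case: eqP => // gi; move: (ltn_ord i); rewrite -gi ltnNge Ng.
Qed.

Let tm n i : R := i.+1%:R / 2 ^+ n.
Let tm0 n i : 0 < tm n i. Proof. by rewrite divr_gt0// exprn_gt0. Qed.

(** The path first meets [s'] during the dyadic cell that ends at [tm n i], and is still off [s] at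
    that end. This is decided by the path up to time [tm n i], as [simple_markov] demands. *)
Let step n i : set (@path R) := [set w | avoids s' w (i%:R / 2 ^+ n) /\
  (~ avoids s' w (tm n i) /\ avoids s w (tm n i))].

Let measurable_step n i : measurable (step n i).
Proof.
apply: measurable_and; first exact: (measurable_avoids _ (mstate_cst _ s') (@measurable_id _ path setT)).
apply: measurable_and; last exact: (measurable_avoids _ (mstate_cst _ s) (@measurable_id _ path setT)).
by apply: measurableC; exact: (measurable_avoids _ (mstate_cst _ s') (@measurable_id _ path setT)).
Qed.

Let cut n i z (f : R -> \bar R) w := ((\1_(step n i) (started z w))%:E *
  (if (clock kappa (tm n i) (started z w) < (e w)%:E)%E then f (tm n i) else 0))%E.

Let cutE n i z (f : R -> \bar R) w ell : good_path (started z w) ell -> 0 < e w ->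
  ~ covered s' (started z w 0) -> (stime s' z w < +oo)%E ->
  cut n i z f w = if (grid n (fine (stime s' z w)) == i) &&
    [&& (stime s' z w < stime s z w)%E & ((tm n i)%:E < stime s z w)%E] then f (tm n i) else 0%E.
Proof.
move=> gw ew nc Tfin; have cw := good_cpath gw; have kr := mwc_radon mwc.
set Z := killing_time _ _ _.
have Z0 : (0 < Z)%E by exact: (killing_time_gt0 kr gw).
have [t [Tt t0 _ _ _]] := exit_pointP cw nc Z0 Tfin.
have t1 := tm0 n i; have t1' := ltW t1.
have i0 : 0 <= i%:R / 2 ^+ n :> R by rewrite divr_ge0// exprn_ge0.
have it : i%:R / 2 ^+ n <= tm n i by rewrite ler_pM2r ?invr_gt0 ?exprn_gt0// ler_nat.
have TP := exit_timeP s Z cw t1'.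
have TP' := exit_timeP s' Z cw t1'.
have TPi := exit_timeP s' Z cw i0.
have kP := killing_timeP kr gw (e w) t1'.
rewrite /cut -/Z Tt /= (gridP n i t0) indicE.
set Th := exit_time s _ Z in TP *.
have -> : (i%:R / 2 ^+ n < t <= i.+1%:R / 2 ^+ n) && ((t%:E < Th)%E && ((tm n i)%:E < Th)%E) =
    (started z w \in step n i) && (clock kappa (tm n i) (started z w) < (e w)%:E)%E.
  apply/idP/idP.
    move=> /andP[/andP[it1 it2] /andP[tT /TP[tZ av]]].
    apply/andP; split; last exact/kP.
    rewrite inE; split; [|split].
    - apply/avoidsP => //; apply: (TPi.1 _).2; rewrite Tt lte_fin//.
    - move=> /(avoidsP s' cw t1') h.
      have : ((tm n i)%:E < exit_time s' (started z w) Z)%E by apply/TP'.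
      by rewrite Tt lte_fin ltNge it2.
    - exact/avoidsP.
  move=> /andP[]; rewrite inE => -[a1 [a2 a3]] /kP kZ.
  have tT : ((tm n i)%:E < Th)%E by apply/TP; split => //; exact/avoidsP.
  rewrite tT andbT.
  have t2 : t <= tm n i.
    rewrite leNgt; apply/negP => h; apply: a2; apply/avoidsP => //.
    by apply: (TP'.1 _).2; rewrite Tt lte_fin.
  rewrite t2 andbT (le_lt_trans _ tT) ?lee_fin// andbT.
  have : ((i%:R / 2 ^+ n)%:E < exit_time s' (started z w) Z)%E.
    apply/TPi; split; last exact/avoidsP.
    by apply: le_lt_trans kZ; rewrite lee_fin.
  by rewrite Tt lte_fin.
by case: (_ \in _) => /=; rewrite ?mul1e ?mul0e.
Qed.

Lemma measurable_cut n i z (f : Omega -> R -> \bar R) : measurable_fun setT (f ^~ (tm n i)) ->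
  measurable_fun setT (fun w => cut n i z (f w) w).
Proof.
move=> mf; apply: emeasurable_funM.
  apply/measurable_EFinP.
  exact: (measurableT_comp (measurable_indic (measurable_step n i)) (measurable_started mwc z)).
apply: (measurable_fun_ifT _ mf (measurable_cst _)); apply: measurable_fun_lte.
  exact: (measurable_clock kappa (tm n i) (measurable_started mwc z)).
by apply/measurable_EFinP; exact: mwc_me mwc.
Qed.

Lemma cut_ge0 n i z w (f : R -> \bar R) : (forall t, 0 <= f t)%E -> (0 <= cut n i z f w)%E.
Proof. by move=> f0; rewrite /cut mule_ge0 ?lee_fin//; case: ifP. Qed.

Lemma cut_oo n i z (f : R -> \bar R) w ell : good_path (started z w) ell ->
  stime s' z w = +oo%E -> cut n i z f w = 0%E.
Proof.
move=> gw T1; rewrite /cut indicE; case: (boolP (_ \in _)); last by rewrite mul0e.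
rewrite inE => -[_ [a2 _]]; exfalso; apply: a2; apply/(avoidsP _ (good_cpath gw) (ltW (tm0 n i))).
by apply: ((exit_timeP s' (killing_time kappa (started z w) (e w)) (good_cpath gw) (ltW (tm0 n i))).1 _).2; rewrite T1 ltry.
Qed.

Lemma grid_next_cvg t : 0 < t -> tm n (grid n t) @[n --> \oo] --> t.
Proof.
move=> t0; rewrite -[t in _ --> t]addr0.
have -> : (fun n => tm n (grid n t)) = (fun n => lgrid n t + (2^-1) ^+ n).
  by apply/funext => n; rewrite /tm /lgrid exprVn -[in LHS]addn1 natrD mulrDl mul1r.
apply: cvgD; first exact: (cvg_lgrid (ltW t0)).
by apply: cvg_expr; rewrite gtr0_norm ?invr_gt0// invf_lt1// ltr1n.
Qed.

Lemma grid_small (t : R) : 0 < t -> \forall n \near \oo, (grid n t < 4 ^ n)%N.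
Proof.
move=> t0; exists (Num.truncn t) => // n /= Nn.
have /andP[h _] : (grid n t)%:R / 2 ^+ n < t <= (grid n t).+1%:R / 2 ^+ n.
  by rewrite -(gridP n _ t0).
have p0 : 0 < 2 ^+ n :> R by exact: exprn_gt0.
rewrite -(ltr_nat R) (_ : 4 ^ n = 2 ^ n * 2 ^ n)%N; last by rewrite -expnMn.
rewrite natrM natrX; move: h; rewrite ltr_pdivrMr// => h; apply: (lt_le_trans h).
rewrite ler_pM2r//; apply: (le_trans (ltW (truncnS_gt _))).
by rewrite -natrX ler_nat; apply: (leq_ltn_trans Nn); exact: ltn_expl.
Qed.

Lemma cvg_lt_ereal (u : nat -> R) (t : R) (T : \bar R) : u @ \oo --> t -> (t%:E < T)%E ->
  \forall n \near \oo, ((u n)%:E < T)%E.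
Proof.
move=> ut; case: T => [r| |]//; last by move=> _; apply: nearW => n; exact: ltry.
rewrite lte_fin => tr; near=> n; rewrite lte_fin; near: n.
exact: (cvgr_lt _ ut _ tr).
Unshelve. all: by end_near. Qed.

(** The time when [s'] is reached is approximated from the right by dyadic times, and the simple
    Markov property is applied at each of them. The limit is taken by continuity of the exit mean,
    available because the point reached is not covered by [s] when [s'] is left strictly before
    [s]. *)
Lemma exit_mean_strong z : Em phi s z = Em redirect s' z.
Proof.
have kr := mwc_radon mwc.
have mred := measurable_redirect.
have red0 y : (0 <= redirect y)%E by have /andP[] := redirect01 y.
have msz := measurable_started mwc z.
have mk := measurable_killing_time kappa msz (mwc_me mwc).
have mT : measurable_fun setT (fun w => stime s z w).
  exact: (measurable_exit_time (mstate_cst _ s) msz mk).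
have mT' : measurable_fun setT (fun w => stime s' z w).
  exact: (measurable_exit_time (mstate_cst _ s') msz mk).
pose ep w := exit_point s' (started z w) (killing_time kappa (started z w) (e w)).
have mp' : measurable_fun setT ep by exact: (measurable_exit_point (mstate_cst _ s') msz mk).
have mem : measurable_fun setT (Em phi s).
  exact: (measurable_exit_mean mwc mphi phi0 (mstate_cst _ s) (@measurable_id _ _ setT)).
have mV1 : measurable_fun setT (fun w => Ev phi s (started z w) (e w)).
  exact: (measurable_exit_value kappa mphi (mstate_cst _ s) msz (mwc_me mwc)).
have mV2 : measurable_fun setT (fun w => Ev redirect s' (started z w) (e w)).
  exact: (measurable_exit_value kappa mred (mstate_cst _ s') msz (mwc_me mwc)).
have ev0 w : (0 <= Ev redirect s' (started z w) (e w))%E by exact: exit_value_ge0.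
have [cz|ncz] := pselect (covered s' z).
  apply/esym.
  transitivity (\int[P]_w Em phi s z)%E; last by rewrite integral_cst_prob.
  have em0 (w : Omega) : setT w -> (0 <= Em phi s z)%E by move=> _; exact: exit_mean_ge0.
  have mc : measurable_fun setT (fun _ : Omega => Em phi s z) by exact: measurable_cst.
  rewrite {1}/exit_mean; have hae := ge0_ae_eq_integral (mu := P) measurableT mV2 mc (fun w _ => ev0 w) em0.
 apply: hae.
  apply: filterS (started_good mwc) => w [gz s0 ew] _; have [ell gw] := gz z.
  have cw := good_cpath gw.
  have cz' : covered s' (started z w 0) by rewrite s0.
  rewrite /exit_value exit_time_covered// (ltNyy R) exit_point_covered// s0 /redirect.
  by rewrite (coveredE s' z).1// eqxx.
pose hit w := (stime s' z w < stime s z w)%E.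
have mR : measurable_fun setT hit by exact: (measurable_fun_lte mT' mT).
have key : (\int[P]_w (if hit w then Ev phi s (started z w) (e w) else 0) =
            \int[P]_w (if hit w then Em phi s (ep w) else 0))%E.
  pose X1 w (t : R) := Ev phi s (started z w) (e w).
  pose X2 w (t : R) := Em phi s (started z w t).
  (* The [4 ^ n] cells of length [2 ^- n] extend to time [2 ^ n], which eventually exceeds any
     finite exit time. *)
  pose F (X : Omega -> R -> \bar R) n w := (\sum_(i < 4 ^ n) cut n i z (X w) w)%E.
  have mX2 t : 0 <= t -> measurable_fun setT (X2 ^~ t).
    by move=> t0; exact: (measurableT_comp mem (measurableT_comp (measurable_eval t0) msz)).
  have mc1 n i : measurable_fun setT (fun w => cut n i z (X1 w) w) by apply: measurable_cut.
  have mc2 n i : measurable_fun setT (fun w => cut n i z (X2 w) w).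
    by apply: measurable_cut; apply: mX2; rewrite ltW.
  have X10 w t : (0 <= X1 w t)%E by exact: exit_value_ge0.
  have X20 w t : (0 <= X2 w t)%E by exact: exit_mean_ge0.
  have X11 w t : (X1 w t <= 1)%E by exact: exit_value_le1.
  have X21 w t : (X2 w t <= 1)%E by exact: (exit_mean_le1 mwc).
  have FE n : (\int[P]_w F X1 n w = \int[P]_w F X2 n w)%E.
    have S1 := ge0_integral_sum P measurableT (fun i : 'I_(4 ^ n) => mc1 n i)
      (fun i w _ => cut_ge0 n i z w (X10 w)) (index_enum 'I_(4 ^ n)).
    have S2 := ge0_integral_sum P measurableT (fun i : 'I_(4 ^ n) => mc2 n i)
      (fun i w _ => cut_ge0 n i z w (X20 w)) (index_enum 'I_(4 ^ n)).
    apply: (etrans S1); apply: (etrans _ (esym S2)).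
    apply: eq_bigr => i _; apply: (simple_markov mwc mphi phi0 z (ltW (tm0 n i)) (measurable_step n i)).
      move=> w; have it : i%:R / 2 ^+ n <= tm n i by rewrite ler_pM2r ?invr_gt0 ?exprn_gt0// ler_nat.
      by rewrite /step/= !avoids_stop_path.
    by move=> w [_ []].
  have L (X : Omega -> R -> \bar R) (Y : Omega -> \bar R) :
      (forall n i, measurable_fun setT (fun w => cut n i z (X w) w)) ->
      (forall w t, 0 <= X w t <= 1)%E -> measurable_fun setT (fun w => if hit w then Y w else 0%E) ->
      (forall w ell t, good_path (started z w) ell -> stime s' z w = t%:E -> 0 < t -> ep w = started z w t ->
        (stime s' z w < stime s z w)%E -> forall u, u @ \oo --> t -> (forall n, 0 <= u n) -> X w (u n) @[n --> \oo] --> Y w) ->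
      (\int[P]_w F X n w)%E @[n --> \oo] --> (\int[P]_w if hit w then Y w else 0)%E.
    move=> mc X01 mY cvX.
    have FX : {ae P, forall w, (forall n, (0 <= F X n w <= 1)%E) /\
        F X n w @[n --> \oo] --> (if hit w then Y w else 0)%E}.
      apply: filterS (started_good mwc) => w [gz s0 ew]; have [ell gw] := gz z.
      have nc' : ~ covered s' (started z w 0) by rewrite s0.
      have [T1|T1] := ltP (stime s' z w) +oo%E; last first.
        have FX0 n : F X n w = 0%E.
          rewrite /F big1// => i _; apply: (cut_oo _ _ _ gw).
          by apply/eqP; rewrite eq_le leey T1.
        have -> : hit w = false by apply/negbTE; rewrite /hit -leNgt (le_trans (leey _)).
        by split; [move=> n; rewrite FX0 lexx lee01|under eq_fun do rewrite FX0; exact: cvg_cst].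
      have [t [Tt t0 [pt _] _ _]] := exit_pointP (good_cpath gw) nc' (killing_time_gt0 kr gw ew) T1.
      have FXE n : F X n w = if (grid n t < 4 ^ n)%N && (hit w && ((tm n (grid n t))%:E < stime s z w)%E)
          then X w (tm n (grid n t)) else 0%E.
        rewrite -(sum_select (4 ^ n) (grid n t) (fun i => hit w && ((tm n i)%:E < stime s z w)%E) (fun i => X w (tm n i))).
        by apply: eq_bigr => i _; rewrite (cutE n i (X w) gw ew nc' T1) /hit Tt.
      split; first by move=> n; rewrite FXE; case: ifP => _; rewrite ?X01 ?lexx ?lee01.
      under eq_fun do rewrite FXE.
      case: ifP => Rw; last by under eq_fun do rewrite andbF; exact: cvg_cst.
      have ct := grid_next_cvg t0.
      have hX := cvX _ _ _ gw Tt t0 pt Rw _ ct (fun n => ltW (tm0 n _)).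
      apply: cvg_trans hX; apply: near_eq_cvg.
      near=> n; rewrite ifT//=; apply/andP; split.
        by near: n; exact: grid_small.
      by near: n; apply: (cvg_lt_ereal ct); rewrite -Tt.
    apply: (@bounded_integral_cvg _ Omega R P (F X) _ 1) => //.
    - by move=> n; apply: emeasurable_sum => i; exact: mc.
    - by apply: filterS FX => w [].
    - by apply: filterS FX => w [].
  have L1 := L X1 (fun w => Ev phi s (started z w) (e w)) mc1
    (fun w t => introT andP (conj (X10 w t) (X11 w t))) (measurable_fun_ifT mR mV1 (measurable_cst _)).
  have L2 := L X2 (fun w => Em phi s (ep w)) mc2
    (fun w t => introT andP (conj (X20 w t) (X21 w t))) (measurable_fun_ifT mR (measurableT_comp mem mp') (measurable_cst _)).
  have {}L1 : (\int[P]_w F X1 n w)%E @[n --> \oo] -->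
      (\int[P]_w if hit w then Ev phi s (started z w) (e w) else 0)%E.
    by apply: L1 => w ell t _ _ _ _ _ u _ _; exact: cvg_cst.
  have {}L2 : (\int[P]_w F X2 n w)%E @[n --> \oo] --> (\int[P]_w if hit w then Em phi s (ep w) else 0)%E.
    apply: L2 => w ell t gw Tt t0 pt lt u ut u0; rewrite pt; apply: (exit_mean_cvg mwc mphi phi01).
      have t0' := ltW t0.
      move: lt; rewrite Tt => /(exit_timeP s _ (good_cpath gw) t0')[_]; apply.
      by rewrite t0' lexx.
    have := good_cpath gw (x := t); rewrite /continuous_at (max_r (ltW t0)) => ct.
    have := cvg_comp _ _ ut ct; apply: cvg_trans; apply: near_eq_cvg; apply: nearW => n /=.
    by rewrite max_r.
  have LE : (fun n => \int[P]_w F X1 n w)%E = (fun n => \int[P]_w F X2 n w)%E by apply/funext.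
  have E1 := cvg_lim (@ereal_hausdorff R) L1; have E2 := cvg_lim (@ereal_hausdorff R) L2.
  by rewrite -E2 -LE -E1.
(* As [s] is contained in [s'], the remaining paths leave both at the same time. There [redirect]
   returns the value of [phi] already obtained, except at a tie. *)
pose V w := (if hit w then 0 else Ev phi s (started z w) (e w))%E.
have mV : measurable_fun setT V by exact: (measurable_fun_ifT mR (measurable_cst _) mV1).
have mA : measurable_fun setT (fun w => if hit w then Ev phi s (started z w) (e w) else 0%E).
  exact: (measurable_fun_ifT mR mV1 (measurable_cst _)).
have mB : measurable_fun setT (fun w => if hit w then Em phi s (ep w) else 0%E).
  exact: (measurable_fun_ifT mR (measurableT_comp mem mp') (measurable_cst _)).
have A0 w : (0 <= if hit w then Ev phi s (started z w) (e w) else 0)%E.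
  by case: ifP => // _; exact: exit_value_ge0.
have B0 w : (0 <= if hit w then Em phi s (ep w) else 0)%E.
  by case: ifP => // _; exact: exit_mean_ge0.
have V0 w : (0 <= V w)%E by rewrite /V; case: ifP => // _; exact: exit_value_ge0.
transitivity (\int[P]_w ((if hit w then Ev phi s (started z w) (e w) else 0) + V w))%E.
  by apply: eq_integral => w _; rewrite /V; case: ifP; rewrite ?adde0 ?add0e.
rewrite (ge0_integralD P measurableT (fun w _ => A0 w) mA (fun w _ => V0 w) mV) key.
rewrite -(ge0_integralD P measurableT (fun w _ => B0 w) mB (fun w _ => V0 w) mV).
apply: (ge0_ae_eq_integral measurableT (emeasurable_funD mB mV) mV2
  (fun w _ => adde_ge0 (B0 w) (V0 w)) (fun w _ => ev0 w)).
have [N [N' [mN' N'0 NN']] HN] := killing_tie_null z.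
have aeN : {ae P, forall w, ~ N w}.
  by exists N'; split => // w /= /contrapT /NN'.
apply: filterS2 (started_good mwc) aeN => w [gz s0 ew] nN _; have [ell gw] := gz z.
have cw := good_cpath gw.
have nc' : ~ covered s' (started z w 0) by rewrite s0.
have nc : ~ covered s (started z w 0) by move=> /ss'.
have Z0 := killing_time_gt0 kr gw ew.
rewrite /V /hit /ep /exit_value; set Z := killing_time _ _ _ in Z0 *.
set T := exit_time s _ Z; set T' := exit_time s' _ Z.
have TT : (T' <= T)%E.
  rewrite leNgt; apply/negP => lt.
  have [T1|T1] := ltP T +oo%E; last by move: (lt_le_trans lt (leey _)); rewrite ltNge T1.
  have [t [Tt t0 _ _ [Zt|ct]]] := exit_pointP cw nc Z0 T1.
    by move: lt; rewrite /T Tt -Zt ltNge exit_timeW.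
  have t0' := ltW t0.
  move: lt; rewrite /T Tt => /(exit_timeP s' Z cw t0')[_ /(_ t)].
  by rewrite lexx t0' => /(_ isT); apply; exact: ss'.
have [T1|T1] := ltP T' +oo%E; last first.
  have -> : T' = +oo%E by apply/eqP; rewrite eq_le leey T1.
  have -> : T = +oo%E by apply/eqP; rewrite eq_le leey (le_trans T1 TT).
  by rewrite ltxx/= addr0.
have [t [Tt t0 [pt tZ] before tc]] := exit_pointP cw nc' Z0 T1.
rewrite -/T' in Tt; rewrite -/T' pt.
have t0' := ltW t0.
have [lt|ge] := ltP T' T.
  rewrite adde0 /redirect; case: tc => [Zt|ct].
    by move: lt; rewrite Tt -Zt /T ltNge exit_timeW.
  by rewrite (coveredE s' _).1// eqxx.
have TE : T = T' by apply/eqP; rewrite eq_le ge.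
rewrite add0e TE T1 /exit_point -/T TE -/(exit_point s' _ Z) pt.
rewrite /redirect; case: eqP => // /coveredE ct.
have [cs|ncs] := pselect (covered s (started z w t)).
  apply/esym; rewrite -[RHS](integral_cst_prob P).
  have mV3 := measurable_exit_value kappa mphi (mstate_cst _ s) (measurable_started mwc (started z w t)) (mwc_me mwc).
  apply: (ge0_ae_eq_integral measurableT mV3 (measurable_cst _)
    (fun w' _ => exit_value_ge0 kappa phi0 s _ _) (fun w _ => phi0 _)).
  - apply: filterS (started_good mwc) => w' [gz' s0' ew'] _; have [ell' gw'] := gz' (started z w t).
    have cw' := good_cpath gw'.
    have cz' : covered s (started (started z w t) w' 0) by rewrite s0'.
    by rewrite /exit_value exit_time_covered// (ltNyy R) exit_point_covered// s0'.
(* The exit from [s] takes place at a point not covered by [s], so it is a killing, while the same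
   point is covered by [s']: a tie. *)
exfalso; apply: nN; apply: (HN w ell t gw t0); last first.
  have T1' : (T < +oo)%E by rewrite TE.
  have [t' [Tt' _ _ _ [//|ct']]] := exit_pointP cw nc Z0 T1'.
    by rewrite -/T TE Tt in Tt'; case: Tt' => ->.
  by rewrite -/T TE Tt in Tt'; case: Tt' => tt; rewrite -tt in ct'.
have H0 : (0 < +oo :> \bar R)%E by exact: ltry.
rewrite -Tt /T'; apply: eq_exit_time => // u u0; split=> -[_ av]; split => //; last exact: ltry.
apply: lt_le_trans tZ; rewrite lte_fin ltNge; apply/negP => tu.
by apply: (av t) => //; rewrite t0'.
Unshelve. all: by end_near. Qed.

End strong_markov.

Definition btw (R : realType) (a b c : R) : Prop := Num.min a b <= c <= Num.max a b.

Lemma btwxx (R : realType) (a c : R) : btw a a c -> c = a.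
Proof. by rewrite /btw minxx maxxx => h; apply/esym/eqP; rewrite eq_le. Qed.

Lemma btw_sym (R : realType) (a b c : R) : btw a b c -> btw b a c.
Proof. by rewrite /btw minC maxC. Qed.

Lemma btwr (R : realType) (a b : R) : btw a b b.
Proof. by rewrite /btw ge_min le_max lexx !orbT. Qed.

Lemma btwl (R : realType) (a b : R) : btw a b a.
Proof. by rewrite /btw ge_min le_max lexx. Qed.

Lemma btwP (R : realType) (a b c : R) : btw a b c <-> (a <= c <= b) \/ (b <= c <= a).
Proof.
rewrite /btw; have [ab|ba] := leP a b; split.
- by left.
- by case=> // /andP[h1 h2]; rewrite (le_trans ab h1) (le_trans h2 ab).
- by right.
- by case=> // /andP[h1 h2]; rewrite (le_trans (ltW ba) h1) (le_trans h2 (ltW ba)).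
Qed.

Lemma cpath_IVT (R : realType) (w : R -> R) (t c : R) : cpath w -> 0 <= t ->
  btw (w 0) (w t) c -> exists2 u, 0 <= u <= t & w u = c.
Proof.
move=> cw t0 h.
have [] := @IVT R (fun u : R => w (Num.max 0 u)) 0 t c t0.
- by apply: continuous_subspaceT; exact: cw.
- by rewrite maxxx (max_r t0).
- move=> u; rewrite in_itv/= => /andP[u0 ut] wu; exists u; first by rewrite u0.
  by rewrite -wu max_r.
Qed.

(** * Exit points and hitting probabilities *)

Section exits.
Context {R : realType} (kappa : {sigma_finite_measure set (measurableTypeR R) -> \bar R}).
Context d (Omega : measurableType d) (P : probability Omega R).
Variables (x : R) (B : R -> Omega -> R) (e : Omega -> R).
Local Notation started := (started x B).

Definition exit_at (s : seq (R * R)) z w : \bar R :=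
  exit_time s (started z w) (killing_time kappa (started z w) (e w)).
Definition exit (s : seq (R * R)) z w : R :=
  exit_point s (started z w) (killing_time kappa (started z w) (e w)).
Definition regular w : Prop := [/\ forall z, exists ell, good_path (started z w) ell,
  forall z, started z w 0 = z & 0 < e w].

Hypothesis kr : radon_measure kappa.

Lemma exit_covered s z w : regular w -> covered s z -> exit s z w = z /\ exit_at s z w = -oo%E.
Proof.
move=> [gz s0 ew] cz; have [ell gw] := gz z; have cw := good_cpath gw.
have cz' : covered s (started z w 0) by rewrite s0.
by rewrite /exit /exit_at exit_point_covered// exit_time_covered.
Qed.

Lemma exitP s z w : regular w -> ~ covered s z -> (exit_at s z w < +oo)%E ->
  exists t, [/\ exit_at s z w = t%:E, 0 < t, exit s z w = started z w t,
    (forall u, 0 <= u < t -> ~ covered s (started z w u)) &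
    killing_time kappa (started z w) (e w) = t%:E \/ covered s (exit s z w)].
Proof.
move=> [gz s0 ew] cz T1; have [ell gw] := gz z; have cw := good_cpath gw.
have nc : ~ covered s (started z w 0) by rewrite s0.
have [t [Tt t0 [pt _] av Zt]] := exit_pointP cw nc (killing_time_gt0 kr gw ew) T1.
by exists t; split => //; rewrite /exit pt.
Qed.

Lemma exit_skip s z w u : regular w -> (exit_at s z w < +oo)%E -> covered s u ->
  btw z (exit s z w) u -> exit s z w = u.
Proof.
move=> rw T1 cu; have [cz|ncz] := pselect (covered s z).
  by have [-> _] := exit_covered rw cz; move=> /btwxx.
have [t [_ t0 -> av _]] := exitP rw ncz T1; have [gz s0 ew] := rw; have [ell gw] := gz z.
rewrite -[X in btw X]s0 => /(cpath_IVT (good_cpath gw) (ltW t0))[v /andP[v0 vt] wv].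
have [vt'|vt'] := eqVneq v t; first by rewrite -vt'.
have : v < t by rewrite lt_neqAle vt'.
by move=> {}vt; exfalso; apply: (av v); rewrite ?v0// wv.
Qed.

(** By continuity the path cannot leave [C] without crossing a covered point of [C], so only the
    part of the state inside [C] matters. *)
Lemma exit_local (C : set R) s1 s2 z w : regular w -> C z ->
  (forall y, C y -> (covered s1 y <-> covered s2 y)) ->
  (forall y, ~ C y -> exists u, [/\ C u, covered s1 u & btw z y u]) ->
  exit s1 z w = exit s2 z w /\ exit_at s1 z w = exit_at s2 z w.
Proof.
move=> rw Cz C12 Cout; have [gz s0 ew] := rw; have [ell gw] := gz z.
have cw := good_cpath gw.
have H s s' t : (forall y, C y -> (covered s y <-> covered s' y)) ->
    (forall y, ~ C y -> exists u, [/\ C u, covered s u & btw z y u]) ->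
    0 <= t -> (forall u, 0 <= u <= t -> ~ covered s (started z w u)) ->
    forall u, 0 <= u <= t -> ~ covered s' (started z w u).
  move=> Cs Cs' t0 av u /andP[u0 ut].
  have [Cu|nCu] := pselect (C (started z w u)).
    by move=> /(Cs _ Cu); apply: av; rewrite u0.
  exfalso; have [v [Cv cv]] := Cs' _ nCu; rewrite -[X in btw X]s0.
  move=> /(cpath_IVT cw u0)[a /andP[a0 au] wa]; apply: (av a).
    by rewrite a0 (le_trans au).
  by rewrite wa.
have TE : exit_at s1 z w = exit_at s2 z w.
  apply: eq_exit_time => // t t0; split => -[tZ av]; split => //.
    exact: (H s1 s2).
  apply: (H s2 s1) => //; first by move=> y Cy; split => /(C12 _ Cy).
  by move=> y /Cout[u [Cu cu bu]]; exists u; split => //; exact/C12.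
split; last exact: TE.
by rewrite /exit /exit_point; move: TE; rewrite /exit_at => ->.
Qed.

Lemma eq_exit s1 s2 z w : regular w -> (forall y, covered s1 y <-> covered s2 y) ->
  exit s1 z w = exit s2 z w /\ exit_at s1 z w = exit_at s2 z w.
Proof. by move=> rw s12; apply: (@exit_local setT) => // y /(_ I). Qed.

(** With [y] added to the state as a degenerate segment, this is the probability that the motion
    from [z] stops at [y], having met neither the killing nor another segment before. *)
Definition root_mass s z y : \bar R :=
  exit_mean kappa P x B e (fun p => (\1_[set y] p : R)%:E) ((y, y) :: s) z.

End exits.

Lemma covered_cons (R : realType) (a b : R) s y :
  covered ((a, b) :: s) y <-> btw a b y \/ covered s y.
Proof.
split=> [[c]|[h|[c cs h]]].
- rewrite inE => /orP[/eqP->|cs h]; first by left.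
  by right; exists c.
- by exists (a, b) => //; rewrite inE eqxx.
- by exists c => //; rewrite inE cs orbT.
Qed.

Lemma covered_nil (R : realType) (y : R) : ~ covered [::] y.
Proof. by case. Qed.

Lemma covered_pt (R : realType) (a : R) s y :
  covered ((a, a) :: s) y <-> y = a \/ covered s y.
Proof.
by rewrite covered_cons; split => -[h|h]; [left; exact: btwxx|right|left; rewrite h; exact: btwl|right].
Qed.

Section exit_laws.
Context {R : realType} (kappa : {sigma_finite_measure set (measurableTypeR R) -> \bar R}).
Context d (Omega : measurableType d) (P : probability Omega R).
Variables (x : R) (B : R -> Omega -> R) (e : Omega -> R).
Hypothesis mwc : motion_with_clock kappa P x B e.
Local Notation started := (started x B).
Local Notation Em := (exit_mean kappa P x B e).
Local Notation Ev := (exit_value kappa).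
Local Notation H := (root_mass kappa P x B e).
Local Notation Xt := (exit kappa x B e).
Local Notation Tt := (exit_at kappa x B e).
Implicit Types (phi psi : R -> \bar R) (s : seq (R * R)) (z y c : R).

Let kr := mwc_radon mwc.

Lemma regular_ae : {ae P, forall w, regular x B e w}.
Proof. exact: started_good mwc. Qed.

Lemma eq_exit_mean phi psi s s' z z' : measurable_fun setT phi -> measurable_fun setT psi ->
  (forall y, 0 <= phi y)%E -> (forall y, 0 <= psi y)%E ->
  {ae P, forall w, regular x B e w -> Ev phi s (started z w) (e w) = Ev psi s' (started z' w) (e w)} ->
  Em phi s z = Em psi s' z'.
Proof.
move=> mphi mpsi phi0 psi0 h.
have m1 := measurable_exit_value kappa mphi (mstate_cst _ s) (measurable_started mwc z) (mwc_me mwc).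
have m2 := measurable_exit_value kappa mpsi (mstate_cst _ s') (measurable_started mwc z') (mwc_me mwc).
apply: (ge0_ae_eq_integral measurableT m1 m2 (fun w _ => exit_value_ge0 kappa phi0 s _ _)
  (fun w _ => exit_value_ge0 kappa psi0 s' _ _)).
by apply: filterS2 regular_ae h => w rw h _; exact: h.
Qed.

Lemma exit_meanZ phi (k : R) s z : measurable_fun setT phi -> (forall y, 0 <= phi y)%E -> 0 <= k ->
  Em (fun p => k%:E * phi p)%E s z = (k%:E * Em phi s z)%E.
Proof.
move=> mphi phi0 k0.
have m1 := measurable_exit_value kappa mphi (mstate_cst _ s) (measurable_started mwc z) (mwc_me mwc).
rewrite -(ge0_integralZl_EFin P measurableT (fun w _ => exit_value_ge0 kappa phi0 s _ _) m1 k0).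
by apply: eq_integral => w _; rewrite /exit_value; case: ifP => _; rewrite ?mule0.
Qed.

Lemma measurable_pt (y : R) : measurable_fun setT (fun p : R => (\1_[set y] p : R)%:E).
Proof. by apply/measurable_EFinP; apply: measurable_indic; exact: measurable_set1. Qed.

Lemma pt01 (y p : R) : (0 <= (\1_[set y] p : R)%:E <= 1)%E.
Proof. by rewrite !lee_fin indicE ler0n lern1 leq_b1. Qed.

Let pt0 (y p : R) : (0 <= (\1_[set y] p : R)%:E)%E.
Proof. by have /andP[] := pt01 y p. Qed.

Lemma root_mass_ge0 s z y : (0 <= H s z y)%E.
Proof. exact: exit_mean_ge0. Qed.

Lemma root_mass_le1 s z y : (H s z y <= 1)%E.
Proof. exact: (exit_mean_le1 mwc (measurable_pt y) (pt01 y)). Qed.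

Lemma root_mass_fin s z y : H s z y \is a fin_num.
Proof. by rewrite ge0_fin_numE ?root_mass_ge0// (le_lt_trans (root_mass_le1 _ _ _))// ltry. Qed.

Lemma exit_mean_covered phi s z : measurable_fun setT phi -> (forall y, 0 <= phi y)%E ->
  covered s z -> Em phi s z = phi z.
Proof.
move=> mphi phi0 cz; rewrite -[RHS](integral_cst_prob P).
have m1 := measurable_exit_value kappa mphi (mstate_cst _ s) (measurable_started mwc z) (mwc_me mwc).
apply: (ge0_ae_eq_integral measurableT m1 (measurable_cst _) (fun w _ => exit_value_ge0 kappa phi0 s _ _)
  (fun _ _ => phi0 _)).
apply: filterS regular_ae => w rw _.
have [pz Tz] := exit_covered kappa rw cz.
by rewrite /exit_value -/(Tt _ _ _) -/(Xt _ _ _) Tz pz ltNyy.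
Qed.

(** A continuous path from [z] to [y] passes through the intermediate point [c]; the strong Markov
    property is applied with [c] added to the state. *)
Lemma root_mass_mul s z y c : btw z y c -> H s z y = (H s z c * H s c y)%E.
Proof.
move=> zyc; pose phi p : \bar R := (\1_[set y] p)%:E.
have ss' p : covered ((y, y) :: s) p -> covered ((c, c) :: (y, y) :: s) p.
  by move=> h; apply/covered_pt; right.
rewrite /root_mass (exit_mean_strong mwc (measurable_pt y) (pt01 y) ss').
have Hf := fineK (root_mass_fin s c y).
have H0 : 0 <= fine (H s c y) by rewrite fine_ge0// root_mass_ge0.
rewrite -[X in (_ * X)%E]/(H s c y) -Hf muleC -(exit_meanZ _ _ (measurable_pt c) (pt0 c) H0).
have rd01 := redirect01 mwc (measurable_pt y) (pt01 y) ((y, y) :: s) ((c, c) :: (y, y) :: s).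
have mrd := measurable_redirect mwc (measurable_pt y) (pt01 y) ((y, y) :: s) ((c, c) :: (y, y) :: s).
apply: eq_exit_mean => //.
- apply: emeasurable_funM; first exact: measurable_cst.
  exact: measurable_pt.
- by move=> p; have /andP[] := rd01 p.
- by move=> p; rewrite mule_ge0// ?lee_fin.
apply: aeW => w rw; rewrite /exit_value.
have [] := @exit_local R kappa _ Omega x B e [set y' | btw z y' c -> y' = c]
  ((c, c) :: (y, y) :: s) ((c, c) :: s) z w rw.
- by move=> /= /btwxx ->.
- move=> y' /= h; rewrite !covered_pt; split=> [[->|[yy|]]|[->|]]; [by left| |by right|by left|by right; right].
  by left; apply: h; rewrite yy.
- move=> y' /= /not_implyP[h1 h2]; exists c; split => //.
  by apply/covered_pt; left.
rewrite /exit /exit_at => <- <-.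
rewrite -/(Tt _ _ _) -/(Xt _ _ _).
case: ifP => // T1.
have cc : covered ((c, c) :: (y, y) :: s) c by apply/covered_pt; left.
have skip := exit_skip kr rw T1 cc.
move: skip; set p := Xt _ _ _ => skip.
rewrite Hf /redirect; have [pc|pc] := eqVneq p c.
  rewrite pc (coveredE _ c).1// eqxx indicE mem_set// mule1.
  by [].
rewrite [in RHS]indicE memNset; last by move=> /= /eqP; apply/negP.
rewrite mule0; case: eqP => [/coveredE cp|ncp].
  have py : p <> y.
    by move=> py; move/eqP: pc; apply; apply: skip; rewrite py.
  have cp' : covered ((y, y) :: s) p.
    by move: cp; rewrite covered_pt => -[pc'|//]; move/eqP: pc.
  by rewrite (exit_mean_covered (measurable_pt y) (pt0 y) cp') indicE memNset.
rewrite indicE memNset// => py; apply: ncp; apply/coveredE.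
by apply/covered_pt; right; apply/covered_pt; left.
Qed.

Lemma root_mass_refl s z : H s z z = 1%E.
Proof.
rewrite /root_mass (exit_mean_covered (measurable_pt z) (pt0 z)).
  by rewrite indicE mem_set.
by apply/covered_pt; left.
Qed.

End exit_laws.

Lemma measurable_preim d d' (T : measurableType d) (T' : measurableType d') (f : T -> T') (A : set T') :
  measurable_fun setT f -> measurable A -> measurable [set w | A (f w)].
Proof. by move=> mf mA; have := mf measurableT A mA; rewrite setTI. Qed.

Lemma measurable_btw (R : realType) (z y : R) : y != z -> measurable ([set v | btw z v y] : set R).
Proof.
move=> yz; apply: is_interval_measurable => a b /= /btwP ha /btwP hb c /andP[ac cb]; apply/btwP.
case: (ltgtP y z) yz => // lt _; [right|left]; move: ha hb; lra.
Qed.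

Lemma eq_pt_value (R : realType) (T1 T2 : \bar R) (p1 p2 a1 a2 : R) : T1 = T2 ->
  ((T1 < +oo)%E -> (p1 = a1 <-> p2 = a2)) ->
  (if (T1 < +oo)%E then (\1_[set a1] p1 : R)%:E else 0%E) =
  (if (T2 < +oo)%E then (\1_[set a2] p2 : R)%:E else 0%E).
Proof.
move=> <-; case: ifP => // _ /(_ isT) h; rewrite !indicE; congr (EFin (nat_of_bool _)%:R).
by apply/idP/idP; rewrite !inE/= => /h.
Qed.

Section early_hitting.
Context {R : realType} (kappa : {sigma_finite_measure set (measurableTypeR R) -> \bar R}).
Context d (Omega : measurableType d) (P : probability Omega R).
Variables (x : R) (B : R -> Omega -> R) (e : Omega -> R).
Hypothesis mwc : motion_with_clock kappa P x B e.
Local Notation started := (started x B).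
Local Notation H := (root_mass kappa P x B e).
Local Notation Xt := (exit kappa x B e).
Local Notation Tt := (exit_at kappa x B e).

Let kr := mwc_radon mwc.

Lemma measurable_exit d' (T : measurableType d') (s : T -> seq (R * R)) (z : T -> R) :
  mstate s -> measurable_fun setT z ->
  measurable_fun setT (fun y : T * Omega => Xt (s y.1) (z y.1) y.2).
Proof.
move=> ms mz; have msp := measurable_started_pair mwc mz.
have mk := measurable_killing_time kappa msp (measurableT_comp (mwc_me mwc) (@measurable_snd _ _ T Omega)).
exact: (measurable_exit_point (mstate_comp ms (@measurable_fst _ _ T Omega)) msp mk).
Qed.

Lemma measurable_exit_at1 s z : measurable_fun setT (Tt s z).
Proof.
have mk := measurable_killing_time kappa (measurable_started mwc z) (mwc_me mwc).
exact: (measurable_exit_time (mstate_cst _ s) (measurable_started mwc z) mk).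
Qed.

Lemma measurable_exit1 s z : measurable_fun setT (Xt s z).
Proof.
have mk := measurable_killing_time kappa (measurable_started mwc z) (mwc_me mwc).
exact: (measurable_exit_point (mstate_cst _ s) (measurable_started mwc z) mk).
Qed.

Lemma root_massE s z y : H s z y =
  P [set w | (Tt ((y, y) :: s) z w < +oo)%E /\ Xt ((y, y) :: s) z w = y].
Proof.
have mE : measurable [set w | (Tt ((y, y) :: s) z w < +oo)%E /\ Xt ((y, y) :: s) z w = y].
  apply: measurable_and.
    by apply: measurable_lteE; [exact: measurable_exit_at1|exact: measurable_cst].
  have m1 : measurable ([set y] : set R) by exact: measurable_set1.
  by have := measurable_exit1 ((y, y) :: s) z measurableT m1; rewrite setTI.
rewrite -[in RHS](setIT [set w | _]) -integral_indic//; apply: eq_integral => w _.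
rewrite /exit_value -/(Tt ((y, y) :: s) z w) -/(Xt ((y, y) :: s) z w) [in RHS]indicE.
case: ifP => T1.
  by rewrite indicE; congr (EFin (nat_of_bool _)%:R); apply/idP/idP; rewrite !inE => // -[].
by rewrite memNset// => -[]; rewrite T1.
Qed.

Lemma gauss_tail z y (t : R) : 0 < t -> y != z ->
  ((2^-1 - `|y - z| * normal_peak (Num.sqrt t))%:E <=
   P [set w | btw z (started z w t) y])%E.
Proof.
move=> t0 yz; have st0 : Num.sqrt t != 0 by rewrite gt_eqF// sqrtr_gt0.
set N := normal_prob 0 (Num.sqrt t).
pose A : set R := [set v | btw z v y].
have mA : measurable A by exact: measurable_btw.
have mE : measurable [set w | A (started z w t)].
  exact: (measurable_preim (measurableT_comp (measurable_eval (ltW t0)) (measurable_started mwc z)) mA).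
have mI : measurable_fun setT (fun v : R => (\1_A v : R)%:E).
  by apply/measurable_EFinP; exact: measurable_indic.
have I0 v : (0 <= (\1_A v : R)%:E)%E by rewrite lee_fin.
have -> : P [set w | btw z (started z w t) y] = (\int[N]_v (\1_A (z + v))%:E)%E.
  rewrite -(started_gauss mwc z t0 mI I0).
  transitivity (\int[P]_w (\1_[set w | A (started z w t)] w)%:E)%E.
    by rewrite integral_indic// setIT.
  apply: eq_integral => w _; rewrite !indicE; congr (EFin (nat_of_bool _)%:R).
apply: (le_trans (normal_prob_ray st0 (normr_ge0 (y - z)))).
rewrite normal_probE//; have mray : measurable_fun setT (fun v : R => (\1_(`]`|y - z|, +oo[%classic : set R) v : R)%:E).
  by apply/measurable_EFinP; apply: measurable_indic; exact: measurable_itv.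
have mAz : measurable_fun setT (fun v : R => (\1_A (z + v) : R)%:E).
  exact: (measurableT_comp mI (measurable_funD (measurable_cst z) (@measurable_id _ R setT))).
have mAz' : measurable_fun setT (fun v : R => (\1_A (z - v) : R)%:E).
  exact: (measurableT_comp mI (measurable_funB (measurable_cst z) (@measurable_id _ R setT))).
have r0 (v : R) : (0 <= (\1_(`]`|y - z|, +oo[%classic : set R) v : R)%:E)%E by rewrite lee_fin.
have [lt|gt] := ltP z y.
  apply: ge0_le_integral => // v _.
  rewrite lee_fin !indicE ler_nat; case: (boolP (v \in _)) => //; rewrite inE/= in_itv/= andbT => h.
  rewrite mem_set//=; apply/btwP; left; move: h; rewrite gtr0_norm ?subr_gt0//; lra.
have {}gt : y < z by rewrite lt_neqAle yz.
rewrite -(ge0_integral_normal_sym st0 (f := fun v => (\1_A (z + v) : R)%:E) mAz) => [|v]; last first.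
  by rewrite lee_fin.
apply: ge0_le_integral => // v _.
rewrite lee_fin !indicE ler_nat; case: (boolP (v \in _)) => //; rewrite inE/= in_itv/= andbT => h.
rewrite mem_set//=; apply/btwP; right; move: h; rewrite ltr0_norm ?subr_lt0//; lra.
Qed.

Lemma hit_by z y (t : R) w : regular x B e w -> 0 <= t -> btw z (started z w t) y ->
  exists2 u, 0 <= u <= t & started z w u = y.
Proof.
move=> [gz s0 ew] t0; have [ell gw] := gz z; rewrite -[X in btw X]s0.
exact: cpath_IVT (good_cpath gw) t0.
Qed.

(** A motion found beyond [y] at time [t] has passed through [y] before, and is then stopped there
    unless it had been killed or had met [s] by time [t]. *)
Lemma root_mass_lower s z y (t : R) : 0 < t -> y != z -> ~ covered s z ->
  ((2^-1 - `|y - z| * normal_peak (Num.sqrt t))%:E <=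
   H s z y + P [set w | (Tt s z w <= t%:E)%E])%E.
Proof.
move=> t0 yz ncz; apply: (le_trans (gauss_tail t0 yz)); rewrite root_massE.
set E1 := [set w | btw _ _ _]; set E2 := [set w | _ /\ _]; set E3 := [set w | _].
have mE2 : measurable E2.
  apply: measurable_and.
    by apply: measurable_lteE; [exact: measurable_exit_at1|exact: measurable_cst].
  have m1 : measurable ([set y] : set R) by exact: measurable_set1.
  by have := measurable_exit1 ((y, y) :: s) z measurableT m1; rewrite setTI.
have mE3 : measurable E3.
  rewrite -[X in measurable X]setCK; apply: measurableC.
  rewrite (_ : ~` _ = [set w | (t%:E < Tt s z w)%E]).
    by apply: measurable_lteE; [exact: measurable_cst|exact: measurable_exit_at1].
  by apply/seteqP; split => w /=; rewrite ltNge => /negP.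
have mE1 : measurable E1.
  exact: (measurable_preim (measurableT_comp (measurable_eval (ltW t0)) (measurable_started mwc z)) (measurable_btw yz)).
apply: le_trans (measureU2 P mE2 mE3).
apply: (ae_le_prob mE1 (measurableU _ _ mE2 mE3)).
apply: filterS (regular_ae mwc) => w rw E1w.
have [ltT|geT] := ltP t%:E (Tt s z w); last by right.
left; have [gz s0 ew] := rw; have [ell gw] := gz z; have cw := good_cpath gw.
have [u /andP[u0 ut] wu] := hit_by rw (ltW t0) E1w.
have ncy : ~ covered ((y, y) :: s) z.
  by move=> /covered_pt[zy|//]; move/eqP: yz; rewrite zy.
have Tu : (Tt ((y, y) :: s) z w <= u%:E)%E.
  rewrite leNgt; apply/negP => /(exit_timeP _ _ cw u0)[_ /(_ u)].
  by rewrite u0 lexx wu => /(_ isT); apply; apply/covered_pt; left.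
have T1 : (Tt ((y, y) :: s) z w < +oo)%E by apply: (le_lt_trans Tu); exact: ltry.
split => //.
have [v [Tv v0 -> _ [Zv|cv]]] := exitP kr rw ncy T1.
  have W := exit_timeW s (started z w) (killing_time kappa (started z w) (e w)).
  have vt : v <= t by move: Tu; rewrite Tv lee_fin => vu; exact: le_trans vu ut.
  rewrite -/(Tt s z w) Zv in W; move: (lt_le_trans ltT W); rewrite lte_fin.
  by rewrite ltNge vt.
case/covered_pt: cv => [//|cs].
have vt : v <= t by move: Tu; rewrite Tv lee_fin => vu; exact: le_trans vu ut.
move: ltT => /(exit_timeP _ _ cw (ltW t0))[_ /(_ v)].
by rewrite vt (ltW v0) => /(_ isT).
Qed.

End early_hitting.

(** * Recurrence of the motion without killing *)

Section recurrence.
Context {R : realType} d (Omega : measurableType d) (P : probability Omega R).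
Variables (x : R) (B : R -> Omega -> R) (e : Omega -> R).
Local Notation m0 := (@mzero _ (measurableTypeR R) R).
Hypothesis mwc : motion_with_clock m0 P x B e.
Local Notation started := (started x B).
Local Notation H := (root_mass m0 P x B e).

Lemma never_killed z w : regular x B e w -> killing_time m0 (started z w) (e w) = +oo%E.
Proof.
move=> [gz s0 ew]; have [ell gw] := gz z.
apply/eqP; rewrite eq_le leey /= leNgt; apply/negP => lt.
have gt0 := killing_time_gt0 (mwc_radon mwc) gw ew.
have fin : killing_time m0 (started z w) (e w) \is a fin_num.
  by rewrite ge0_fin_numE// ltW.
have t0 : 0 <= fine (killing_time m0 (started z w) (e w)) by rewrite fine_ge0// ltW.
have := (killing_timeP (mwc_radon mwc) gw (e w) t0).2; rewrite fineK// ltxx => h.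
suff : false by []; apply: h; rewrite /clock integral_measure_zero.
by rewrite lte_fin.
Qed.

(** With zero killing measure and the empty state nothing interrupts the motion, and the Gaussian
    bound tends to one half as the time grows. *)
Lemma half_root_mass z y : (2^-1%:E <= H [::] z y)%E.
Proof.
have [->|yz] := eqVneq y z.
  by rewrite (root_mass_refl mwc) lee_fin invf_le1// ler1n.
rewrite -(fineK (root_mass_fin mwc _ _ _)) lee_fin; apply/ler_addgt0Pr => eps eps0.
(* At time [c ^+ 2] the peak is at most [c^-1], so the error is at most [|y - z| / c = eps]. *)
pose c := `|y - z| / eps.
have c0 : 0 < c by rewrite divr_gt0// normr_gt0 subr_eq0.
have t0 : 0 < c ^+ 2 by rewrite exprn_gt0.
have := root_mass_lower mwc (s := [::]) (z := z) (y := y) t0 yz (@covered_nil R z).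
rewrite (_ : P _ = 0%E); last first.
  have aeF : {ae P, forall w, ~ (exit_at m0 x B e [::] z w <= (c ^+ 2)%:E)%E}.
    apply: filterS (regular_ae mwc) => w rw; apply/negP; rewrite -ltNge.
    have [gz s0 ew] := rw; have [ell gw] := gz z.
    apply/(exit_timeP _ _ (good_cpath gw) (ltW t0)); split.
      by rewrite (never_killed z rw) ltry.
    by move=> u _; exact: covered_nil.
  have [N [mN N0 sN]] := aeF; apply: subset_measure0 (N0) => //.
    rewrite -[X in measurable X]setCK; apply: measurableC.
    rewrite (_ : ~` _ = [set w | ((c ^+ 2)%:E < exit_at m0 x B e [::] z w)%E]).
      by apply: measurable_lteE; [exact: measurable_cst|exact: (measurable_exit_at1 mwc)].
    by apply/seteqP; split => w /=; rewrite ltNge => /negP.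
  by move=> w /= h; apply: sN => /(_ h).
rewrite adde0 -(fineK (root_mass_fin mwc _ _ _)) lee_fin sqrtr_sqr (gtr0_norm c0).
rewrite lerBlDr => h; apply: (le_trans h); rewrite lerD2l.
apply: (@le_trans _ _ (`|y - z| / c)); last by rewrite /c invf_div mulrCA divff ?mulr1// normr_eq0 subr_eq0.
apply: (ler_wpM2l (normr_ge0 _)); rewrite /normal_peak lef_pV2 ?posrE//; last first.
  by rewrite sqrtr_gt0 mulrn_wgt0// mulr_gt0 ?pi_gt0// exprn_gt0.
apply: (@le_trans _ _ (Num.sqrt (c ^+ 2))); first by rewrite sqrtr_sqr gtr0_norm.
apply: ler_wsqrtr; rewrite -mulr_natr -mulrA ler_peMr ?exprn_ge0 ?ltW//.
have := pi_ge2 R; lra.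
Qed.

Lemma root_mass_translate z y a : H [::] (z + a) (y + a) = H [::] z y.
Proof.
apply: (eq_exit_mean mwc).
- exact: measurable_pt.
- exact: measurable_pt.
- by move=> p; have /andP[] := pt01 (y + a) p.
- by move=> p; have /andP[] := pt01 y p.
apply: aeW => w rw; have [gz s0 ew] := rw; rewrite /exit_value !(never_killed _ rw).
have [ell gw] := gz z; have [ell' gw'] := gz (z + a).
have cw := good_cpath gw; have cw' := good_cpath gw'.
have E u : started (z + a) w u = started z w u + a by rewrite /started /add_path addrAC.
have cov u : covered [:: (y + a, y + a)] (started (z + a) w u) <-> covered [:: (y, y)] (started z w u).
  rewrite !covered_pt E; split=> -[h|/covered_nil//]; left; last by rewrite h.
  by apply: (@addIr _ a).
have TE : exit_time [:: (y + a, y + a)] (started (z + a) w) +oo = exit_time [:: (y, y)] (started z w) +oo.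
  apply: eq_exit_time => // t t0; split => -[tZ h]; split => // u ut c; apply: (h u ut); exact/cov.
apply: eq_pt_value => [|T1]; first exact: TE.
have aI (v : R) : v + a = y + a <-> v = y.
  split; last by move=> ->.
  move=> h; have : v + a - a = y + a - a by rewrite h.
  by rewrite !addrK.
have [c0|nc0] := pselect (covered [:: (y, y)] (started z w 0)).
  have c0' : covered [:: (y + a, y + a)] (started (z + a) w 0) by apply/cov.
  by rewrite !exit_point_covered// E; exact: aI.
have nc0' : ~ covered [:: (y + a, y + a)] (started (z + a) w 0) by move=> /(cov 0).1 h; exact: nc0.
have T1' : (exit_time [:: (y, y)] (started z w) +oo < +oo)%E by rewrite -TE.
have [t [Tt' t0 [-> _] _ _]] := exit_pointP cw nc0 (ltry 0) T1'.
have [t' [Tt'' _ [-> _] _ _]] := exit_pointP cw' nc0' (ltry 0) T1.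
have -> : t' = t by move: Tt'; rewrite -TE Tt'' => -[].
by rewrite E; exact: aI.
Qed.

(** By translation invariance and multiplicativity, the probability of reaching [z + n * a] is the
    [n]-th power of the probability of reaching [y]. All these powers are at least one half, so the
    base is 1. *)
Lemma sure_hit z y : H [::] z y = 1%E.
Proof.
pose a := y - z.
have Hn n : H [::] z (z + n%:R * a) = (fine (H [::] z y) ^+ n)%:E.
  elim: n => [|n IH]; first by rewrite mul0r addr0 (root_mass_refl mwc) expr0.
  have bt : btw z (z + n.+1%:R * a) (z + n%:R * a).
    apply/btwP; have n0 : 0 <= n%:R :> R by [].
    have [a0|a0] := leP 0 a; [left|right]; rewrite -natr1.
      have : 0 <= n%:R * a by exact: mulr_ge0.
      by nra.
    have : n%:R * a <= 0 by rewrite mulr_ge0_le0// ltW.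
    by nra.
  have En : H [::] (z + n%:R * a) (z + n.+1%:R * a) = H [::] z y.
    have -> : z + n.+1%:R * a = y + n%:R * a by rewrite /a -natr1; ring.
    exact: root_mass_translate.
  have fE := esym (fineK (root_mass_fin mwc [::] z y)).
  apply: (etrans (root_mass_mul mwc [::] bt)).
  by rewrite IH En exprSr EFinM -fE.
apply/eqP; rewrite eq_le (root_mass_le1 mwc) /= leNgt; apply/negP.
rewrite -(fineK (root_mass_fin mwc [::] z y)) lte_fin; set r := fine _ => r1.
have r0 : 0 <= r by rewrite fine_ge0// root_mass_ge0.
have : (r ^+ n)%R @[n --> \oo] --> 0 by apply: cvg_expr; rewrite ger0_norm.
move=> /cvgr_lt /(_ (2^-1)); rewrite invr_gt0 ltr0n => /(_ isT)[N _ /(_ N (leqnn N))] /=.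
apply/negP; rewrite -leNgt -lee_fin; apply: (le_trans (half_root_mass z (z + N%:R * a))).
by rewrite Hn.
Qed.

Lemma hits_ae z y : {ae P, forall w, exists2 t, 0 <= t & started z w t = y}.
Proof.
have := sure_hit z y; rewrite (root_massE mwc); set E := [set w | _] => PE.
have mE : measurable E.
  apply: measurable_and.
    by apply: measurable_lteE; [exact: (measurable_exit_at1 mwc)|exact: measurable_cst].
  have m1 : measurable ([set y] : set R) by exact: measurable_set1.
  by have := measurable_exit1 mwc [:: (y, y)] z measurableT m1; rewrite setTI.
have aeE : {ae P, forall w, E w}.
  exists (~` E); split => //; first exact: measurableC.
  by rewrite probability_setC// PE subee.
apply: filterS2 (regular_ae mwc) aeE => w rw [T1 Xy].
have [zy|nzy] := pselect (covered [:: (y, y)] z).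
  have [_ s0 _] := rw; exists 0; rewrite ?s0 ?lexx//.
  by move: zy; rewrite covered_pt => -[//|/covered_nil].
have [t [_ t0 Xt _ _]] := exitP (mwc_radon mwc) rw nzy T1.
by exists t; [exact: ltW|rewrite -Xt].
Qed.

End recurrence.

Lemma prob_ae1 d (T : measurableType d) (R : realType) (P : probability T R) (E : set T) :
  measurable E -> P E = 1%E -> {ae P, forall w, E w}.
Proof.
move=> mE PE; exists (~` E); split => //; first exact: measurableC.
by rewrite probability_setC// PE subee.
Qed.

Lemma mutual_scale (R : realType) (a b p q : R) : 0 <= a <= 1 -> 0 <= b <= 1 ->
  q = a * p -> p = b * q -> 0 < p -> q = p.
Proof.
move=> /andP[a0 a1] /andP[b0 b1] qa pb p0.
have q0 : 0 <= q by rewrite qa mulr_ge0// ltW.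
apply/eqP; rewrite eq_le; apply/andP; split; first by rewrite qa ler_piMl// ltW.
by rewrite pb ler_piMl.
Qed.

(** * The motion is almost surely killed *)

Section finite_exit.
Context {R : realType} (kappa : {sigma_finite_measure set (measurableTypeR R) -> \bar R}).
Context d (Omega : measurableType d) (P : probability Omega R).
Variables (x : R) (B : R -> Omega -> R) (e : Omega -> R).
Hypothesis mwc : motion_with_clock kappa P x B e.
Hypothesis kappa0 : kappa setT != 0%E.
Local Notation started := (started x B).
Local Notation H := (root_mass kappa P x B e).
Local Notation Xt := (exit kappa x B e).
Local Notation Tt := (exit_at kappa x B e).
Local Notation mu := (@lebesgue_measure R).
Local Notation m0 := (@mzero _ (measurableTypeR R) R).

Let kr := mwc_radon mwc.

Let mwc0 : motion_with_clock m0 P x B e.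
Proof.
case: mwc => _ h1 h2 h3 h4 h5; split => //.
by move=> K _; rewrite /mzero ltry.
Qed.

Lemma exit_finite_covered s z y : covered s y -> {ae P, forall w, (Tt s z w < +oo)%E}.
Proof.
move=> cy; apply: filterS2 (regular_ae mwc) (hits_ae mwc0 z y) => w rw [t t0 wt].
have [gz s0 ew] := rw; have [ell gw] := gz z.
apply: (@le_lt_trans _ _ t%:E); last exact: ltry.
rewrite leNgt; apply/negP => /(exit_timeP _ _ (good_cpath gw) t0)[_ /(_ t)].
by rewrite t0 lexx wt => /(_ isT).
Qed.

Lemma exit_valueE phi s z w : (Tt s z w < +oo)%E ->
  exit_value kappa phi s (started z w) (e w) = phi (Xt s z w).
Proof. by rewrite /exit_value -/(Tt s z w) => ->. Qed.

Let mass z : \bar R := exit_mean kappa P x B e (fun=> 1%E) [::] z.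

Let mass01 z : (0 <= mass z <= 1)%E.
Proof.
have m1 : measurable_fun setT (fun _ : R => 1%E : \bar R) by exact: measurable_cst.
have c01 (p : R) : (0 <= (1%E : \bar R) <= 1)%E by rewrite lee01 lexx.
by rewrite exit_mean_ge0//= (exit_mean_le1 mwc m1 c01).
Qed.

Let massfin z : mass z \is a fin_num.
Proof. by have /andP[h1 h2] := mass01 z; rewrite ge0_fin_numE// (le_lt_trans h2)// ltry. Qed.

Let massE z : mass z = P [set w | (Tt [::] z w < +oo)%E].
Proof.
have mE : measurable [set w | (Tt [::] z w < +oo)%E].
  by apply: measurable_lteE; [exact: (measurable_exit_at1 mwc)|exact: measurable_cst].
rewrite -[in RHS](setIT [set w | _]) -integral_indic//; apply: eq_integral => w _.
rewrite /exit_value -/(Tt [::] z w) indicE; case: ifP => T1; first by rewrite mem_set.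
by rewrite memNset//=; apply/negP; rewrite T1.
Qed.

(** By recurrence the motion from [z] is killed or reaches [y]. Surviving for ever thus means
    reaching [y] alive and surviving from there. *)
Let mass_step z y : 1 - fine (mass z) = fine (H [::] z y) * (1 - fine (mass y)).
Proof.
have m1 : measurable_fun setT (fun _ : R => 1%E : \bar R) by exact: measurable_cst.
have c01 (p : R) : (0 <= (1%E : \bar R) <= 1)%E by rewrite lee01 lexx.
have c0 (p : R) : (0 <= (1%E : \bar R))%E by exact: lee01.
have ss' (p : R) : covered [::] p -> covered [:: (y, y)] p by move=> /covered_nil.
pose a := fine (mass y).
have /andP[a0 a1] : 0 <= a <= 1 by rewrite -!lee_fin (fineK (massfin y)).
have fa := fineK (massfin y).
pose I w : R := \1_[set y] (Xt [:: (y, y)] z w).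
have mI : measurable_fun setT I.
  exact: (measurableT_comp (measurable_indic (measurable_set1 y)) (measurable_exit1 mwc _ _)).
have red p : redirect kappa P x B e (fun=> 1%E) [::] [:: (y, y)] p = (1 - (1 - a) * \1_[set y] p)%:E.
  have cy : covered [:: (y, y)] y by apply/covered_pt; left.
  rewrite /redirect; have [dp|dp] := eqVneq (dist_cov [:: (y, y)] p) 0.
    have py : p = y by have /coveredE/covered_pt[//|/covered_nil] := dp.
    rewrite py (_ : \1_[set y] y = 1); last by rewrite indicE mem_set.
    by rewrite mulr1 opprB addrC subrK fa.
  rewrite (_ : \1_[set y] p = 0); first by rewrite mulr0 subr0.
  rewrite indicE memNset//= => h; move/eqP: dp; apply; apply/coveredE; rewrite h; exact: cy.
have mS : mass z = (\int[P]_w (1 - (1 - a) * I w)%:E)%E.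
  rewrite /mass (exit_mean_strong mwc m1 c01 ss').
  have mrd := measurable_redirect mwc m1 c01 [::] [:: (y, y)].
  have rd0 p : (0 <= redirect kappa P x B e (fun=> 1%E) [::] [:: (y, y)] p)%E.
    by have /andP[] := redirect01 mwc m1 c01 [::] [:: (y, y)] p.
  have mv := measurable_exit_value kappa mrd (mstate_cst _ [:: (y, y)]) (measurable_started mwc z) (mwc_me mwc).
  have mJ : measurable_fun setT (fun w => (1 - (1 - a) * I w)%:E).
    by apply/measurable_EFinP; apply: measurable_funB => //; apply: measurable_funM.
  apply: (ge0_ae_eq_integral measurableT mv mJ (fun w _ => exit_value_ge0 kappa rd0 _ _ _)) => [w _|].
    rewrite lee_fin /I indicE; case: (_ \in _); last by rewrite mulr0 subr0.
    by rewrite mulr1 opprB addrC subrK.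
  have cy : covered [:: (y, y)] y by apply/covered_pt; left.
  apply: filterS (exit_finite_covered z cy) => w T1 _.
  exact: (etrans (exit_valueE _ T1) (red _)).
have mI' : measurable_fun setT (EFin \o I) by apply/measurable_EFinP.
have HI : H [::] z y = (\int[P]_w (I w)%:E)%E.
  have pt0 p : (0 <= (\1_[set y] p : R)%:E)%E by rewrite lee_fin.
  have mv := measurable_exit_value kappa (measurable_pt y) (mstate_cst _ [:: (y, y)]) (measurable_started mwc z) (mwc_me mwc).
  apply: (ge0_ae_eq_integral measurableT mv mI' (fun w _ => exit_value_ge0 kappa pt0 _ _ _)) => [w _|].
    by rewrite lee_fin.
  have cy : covered [:: (y, y)] y by apply/covered_pt; left.
  apply: filterS (exit_finite_covered z cy) => w T1 _.
  by rewrite /exit_value -/(Tt [:: (y, y)] z w) -/(Xt [:: (y, y)] z w) T1.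
have iI : P.-integrable setT (EFin \o I).
  apply/integrableP; split => //.
  apply: (@le_lt_trans _ _ (\int[P]_w 1)%E); last by rewrite integral_cst_prob ltry.
  apply: ge0_le_integral => //.
    by apply/measurableT_comp.
  by move=> w _ /=; rewrite /I indicE normr_nat lee_fin lern1 leq_b1.
have key : mass z = (1 - (1 - a)%:E * H [::] z y)%E.
  rewrite mS HI -(integralZl measurableT iI) -[X in (X - _)%E](integral_cst_prob P).
  rewrite -integralB//; last first.
  - exact: integrableZl.
  - exact: finite_measure_integrable_cst.
have fH := fineK (root_mass_fin mwc [::] z y).
have key2 : mass z = (1 - (1 - a) * fine (H [::] z y))%:E :=
  etrans key (congr1 (fun u => 1 - (1 - a)%:E * u)%E (esym fH)).
have alg h : 1 - (1 - (1 - a) * h) = h * (1 - a) by ring.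
exact: (etrans (congr1 (fun u => 1 - fine u) key2) (alg _)).
Qed.

(** If survival had positive probability, [mass_step] in both directions would make it the same from
    all points and all hitting probabilities equal to 1. The clock would then vanish at time 1 from
    every starting point, which contradicts its integral over the starting points. *)
Lemma sure_killing z : {ae P, forall w, (Tt [::] z w < +oo)%E}.
Proof.
apply: prob_ae1.
  by apply: measurable_lteE; [exact: (measurable_exit_at1 mwc)|exact: measurable_cst].
rewrite -massE; apply/eqP; rewrite eq_le; have /andP[mz0 ->] /= := mass01 z.
rewrite leNgt; apply/negP => mz1.
have q0 : 0 < 1 - fine (mass z) by rewrite subr_gt0 -lte_fin fineK.
have Hfin v y := root_mass_fin mwc [::] v y.
have H01 v y : 0 <= fine (H [::] v y) <= 1.
  by rewrite -!lee_fin (fineK (Hfin v y)) root_mass_ge0 (root_mass_le1 mwc).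
have qq v : 1 - fine (mass v) = 1 - fine (mass z).
  exact: (mutual_scale (H01 v z) (H01 z v) (mass_step v z) (mass_step z v) q0).
have H1 v y : H [::] v y = 1%E.
  have h : fine (H [::] v y) = 1.
    have h0 : 1 - fine (mass z) = fine (H [::] v y) * (1 - fine (mass z)) :=
      etrans (esym (qq v)) (etrans (mass_step v y) (congr1 (fun u => fine (H [::] v y) * u) (qq y))).
    by apply: (mulIf (lt0r_neq0 q0)); rewrite mul1r; exact: esym h0.
  exact: (etrans (esym (fineK (Hfin v y))) (congr1 EFin h)).
(* A path bounded by [M] up to time 1 can reach an integer above [M] only after time 1, and it
   reaches it alive. *)
have clk v : {ae P, forall w, (clock kappa 1 (started v w) < (e w)%:E)%E}.
  have hn : {ae P, forall w, forall n : nat, (Tt [:: (n%:R, n%:R)] v w < +oo)%E /\ Xt [:: (n%:R, n%:R)] v w = n%:R}.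
    apply/ae_foralln => n; have := H1 v n%:R; rewrite (root_massE mwc) => h.
    apply: prob_ae1 h; apply: measurable_and.
      by apply: measurable_lteE; [exact: (measurable_exit_at1 mwc)|exact: measurable_cst].
    exact: (measurable_preim (measurable_exit1 mwc _ _) (measurable_set1 _)).
  apply: filterS2 (regular_ae mwc) hn => w rw hw.
  have [gz s0 ew] := rw; have [ell gw] := gz v; have cw := good_cpath gw.
  have [M M0 HM] := cpath_bounded cw ler01.
  pose n := (Num.truncn M).+1.
  have nM : M < n%:R by exact: truncnS_gt.
  have [T1 Xn] := hw n.
  apply/(killing_timeP kr gw (e w) ler01).
  have nc : ~ covered [:: (n%:R, n%:R)] v.
    move=> /covered_pt[vn|/covered_nil//]; have := HM 0; rewrite lexx ler01 s0 vn ger0_norm// => /(_ isT).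
    by rewrite leNgt nM.
  have [t [Tt' t0 Xt' _ _]] := exitP kr rw nc T1.
  have t1 : 1 < t.
    rewrite ltNge; apply/negP => t1; have := HM t; rewrite (ltW t0) t1 -Xt' Xn ger0_norm// => /(_ isT).
    by rewrite leNgt nM.
  have W := exit_timeW [:: (n%:R, n%:R)] (started v w) (killing_time kappa (started v w) (e w)).
  by rewrite -/(Tt _ v w) Tt' in W; apply: lt_le_trans W; rewrite lte_fin.
have clk0 v : (\int[P]_w clock kappa 1 (started v w) = 0)%E.
  pose a (w : @path R) := fine (clock kappa 1 w).
  have ma : measurable_fun setT a.
    by apply: measurableT_comp; [exact: fine_measurable|exact: measurable_clock].
  have msz := measurable_started mwc v.
  have a0 w : 0 <= a w by rewrite fine_ge0// clock_ge0.
  pose f (y : path * R) : \bar R := if (a y.1 < y.2)%R then 1%E else 0%E.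
  have mf : measurable_fun setT f.
    apply: measurable_fun_ifT => //.
    exact: (measurable_fun_ltr (measurableT_comp ma (@measurable_fst _ _ (@path R) R)) (@measurable_snd _ _ (@path R) R)).
  have f0 y : (0 <= f y)%E by rewrite /f; case: ifP.
  have mpair : measurable_fun setT (fun w => (started v w, e w) : path * R).
    by apply: measurable_fun_pair => //; exact: mwc_me mwc.
  have E1 : (\int[P]_w f (started v w, e w) = 1)%E.
    rewrite -[RHS](integral_cst_prob P).
    apply: (ge0_ae_eq_integral measurableT (measurableT_comp mf mpair) (measurable_cst _) (fun w _ => f0 _)) => //.
    apply: filterS2 (regular_ae mwc) (clk v) => w [gz s0 ew] cw _; have [ell gw] := gz v.
    by rewrite /f/= ifT// -lte_fin /a fineK// (clock_fin kr gw).
  have mex : measurable_fun setT (fun w => (expR (- a (started v w)))%:E).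
    apply/measurable_EFinP.
    exact: (measurableT_comp (@measurable_expR R) (measurable_funN (measurableT_comp ma msz))).
  (* Given the path, the probability that the exponential variable exceeds the clock is the
     exponential of minus the clock. Mean 1 forces this exponential to be 1, hence the clock to be
     0. *)
  have E2 : (\int[P]_w (expR (- a (started v w)))%:E = 1)%E.
    rewrite -E1 (started_clock_fubini mwc v mf f0); apply: eq_integral => w _.
    rewrite /f/= (exp_memoryless (mwc_me mwc) (mwc_elaw mwc) (f := fun=> 1%E))//.
    by rewrite integral_cst_prob mule1.
  have E3 : (\int[P]_w (1 - expR (- a (started v w)))%:E = 0)%E.
    have i1 : P.-integrable setT (EFin \o (fun w => expR (- a (started v w)))).
      apply/integrableP; split => //.
      rewrite (eq_integral (fun w => (expR (- a (started v w)))%:E)); first by rewrite E2 ltry.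
      by move=> w _ /=; rewrite ger0_norm// expR_ge0.
    under eq_integral do rewrite EFinB.
    rewrite integralB//; last exact: finite_measure_integrable_cst.
    by rewrite E2 integral_cst_prob subee.
  have mE3 : measurable_fun setT (fun w => (1 - expR (- a (started v w)))%:E).
    by apply/measurable_EFinP; apply: measurable_funB => //; apply/measurable_EFinP.
  have := ae_eq_integral_abs P measurableT mE3.
  rewrite (eq_integral (fun w => (1 - expR (- a (started v w)))%:E)); last first.
    move=> w _; rewrite gee0_abs// lee_fin subr_ge0 -expR0 ler_expR oppr_le0; exact: a0.
  move=> /iffLR /(_ E3) ae0.
  have mc : measurable_fun setT (fun w => clock kappa 1 (started v w)) by exact: measurable_clock.
  rewrite -[RHS](integral0 P setT).
  apply: (ge0_ae_eq_integral measurableT mc (measurable_cst _) (fun w _ => clock_ge0 _ _ _)) => //.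
  apply: filterS2 (regular_ae mwc) ae0 => w [gz s0 ew] h _; have [ell gw] := gz v.
  have /= [h1] := h I.
  have : expR (- a (started v w)) = expR 0 by rewrite expR0; lra.
  move=> /expR_inj/eqP; rewrite oppr_eq0 => /eqP h2.
  by rewrite -[LHS](fineK (clock_fin kr gw ler01)) -/(a _) h2.
have mst : measurable_fun setT (fun y : (measurableTypeR R) * Omega => started y.1 y.2).
  exact: (measurable_started_pair mwc (@measurable_id _ (measurableTypeR R) setT)).
have mc2 : measurable_fun setT (fun y : (measurableTypeR R) * Omega => clock kappa 1 (started y.1 y.2)).
  exact: measurable_clock.
have I0 : (\int[mu]_v \int[P]_w clock kappa 1 (started v w) = 0)%E.
  by under eq_integral do rewrite clk0; exact: integral0.
(* Moving the starting point at a fixed level amounts to moving the level at a fixed path, so the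
   inner integral is the total occupation time during [[0, 1]], which is 1. *)
have Ik : (\int[mu]_v \int[P]_w clock kappa 1 (started v w) = kappa setT)%E.
  rewrite (@fubini_tonelli _ _ (measurableTypeR R) Omega R mu P _ mc2 (fun y => clock_ge0 _ _ _)).
  rewrite -[RHS](integral_cst_prob P).
  have m12 : measurable_fun setT (fun w => \int[mu]_v clock kappa 1 (started v w))%E.
    exact: (@measurable_fun_fubini_tonelli_G _ _ (measurableTypeR R) Omega R mu _ mc2 (fun y => clock_ge0 _ _ _)).
  apply: (ge0_ae_eq_integral measurableT m12 (measurable_cst _)) => [w _|//|].
    by apply: integral_ge0 => v _; exact: clock_ge0.
  apply: filterS (regular_ae mwc) => w [gz _ _] _; have [ell gw] := gz 0.
  have E0 : started 0 w = centered x B w.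
    by apply/funext => u; rewrite /started /add_path add0r.
  rewrite E0 in gw.
  pose g (y : (measurableTypeR R) * (measurableTypeR R)) := loctime y.2 1 (started y.1 w).
  have mg : measurable_fun setT g.
    apply: (@measurable_loctime _ _ _ (fun y : (measurableTypeR R) * (measurableTypeR R) => started y.1 w)).
      exact: (measurable_add_path (@measurable_fst _ _ (measurableTypeR R) (measurableTypeR R)) (measurable_cst (centered x B w))).
    exact: (@measurable_snd _ _ (measurableTypeR R) (measurableTypeR R)).
  have g0 y : (0 <= g y)%E by exact: loctime_ge0.
  rewrite -[LHS]/(\int[mu]_v \int[kappa]_y g (v, y))%E (@fubini_tonelli _ _ (measurableTypeR R) (measurableTypeR R) R mu kappa g mg g0).
  transitivity (\int[kappa]_y 1)%E; last by rewrite integral_cst// mul1e.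
  apply: eq_integral => y _.
  have gwv v : good_path (started v w) (fun y r => ell (y - v) r) by exact: good_translate.
  have mell : measurable_fun setT (fun u : R => (ell u 1)%:E) by exact: (measurable_ell gw ler01).
  have ell0 u : (0 <= (ell u 1)%:E)%E by rewrite lee_fin (ell_ge0 gw)//.
  have mell' : measurable_fun setT (fun u : R => (ell (u + y) 1)%:E).
    exact: (measurableT_comp mell (measurable_funD (@measurable_id _ R setT) (measurable_cst y))).
  transitivity (\int[mu]_v (ell (- v + y) 1)%:E)%E.
    apply: eq_integral => v _; rewrite /g/= (loctimeE (gwv v)) ?ler01// addrC.
    by [].
  rewrite (ge0_integral_opp (f := fun u => (ell (u + y) 1)%:E) mell' (fun u => ell0 _)).
  rewrite (ge0_integral_addr y mell ell0).
  have := @good_occ _ _ _ gw 1 ler01 setT measurableT.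
  rewrite (_ : [set u | _] = `[0, 1]%classic); last first.
    by apply/seteqP; split => u /=; rewrite in_itv/=; [case|].
  by rewrite lebesgue_measure_itv/= lte_fin ltr01 oppr0 adde0 => <-.
by move: kappa0; rewrite -Ik I0 eqxx.
Qed.

Lemma exit_finite s z : {ae P, forall w, (Tt s z w < +oo)%E}.
Proof.
case: s => [|[a b] s]; first exact: sure_killing.
by apply: (@exit_finite_covered _ _ a); apply/covered_cons; left; exact: btwl.
Qed.

Lemma exit_meanX phi s z : measurable_fun setT phi -> (forall y, 0 <= phi y)%E ->
  exit_mean kappa P x B e phi s z = (\int[P]_w phi (Xt s z w))%E.
Proof.
move=> mphi phi0.
have mv := measurable_exit_value kappa mphi (mstate_cst _ s) (measurable_started mwc z) (mwc_me mwc).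
apply: (ge0_ae_eq_integral measurableT mv (measurableT_comp mphi (measurable_exit1 mwc s z))
  (fun w _ => exit_value_ge0 kappa phi0 _ _ _) (fun w _ => phi0 _)).
by apply: filterS (exit_finite s z) => w T1 _; exact: exit_valueE T1.
Qed.

End finite_exit.

Definition bdd (R : realType) (phi : R -> R) : Prop :=
  measurable_fun setT phi /\ exists C, forall v, 0 <= phi v <= C.

Lemma bdd_mul (R : realType) (f g : R -> R) : bdd f -> bdd g -> bdd (fun v => f v * g v).
Proof.
move=> [mf [C hC]] [mg [D hD]]; split; first exact: measurable_funM.
exists (C * D) => v; have /andP[f0 fC] := hC v; have /andP[g0 gD] := hD v.
by rewrite mulr_ge0//= ler_pM.
Qed.

Lemma bdd_add (R : realType) (f g : R -> R) : bdd f -> bdd g -> bdd (fun v => f v + g v).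
Proof.
move=> [mf [C hC]] [mg [D hD]]; split; first exact: measurable_funD.
exists (C + D) => v; have /andP[f0 fC] := hC v; have /andP[g0 gD] := hD v.
by rewrite addr_ge0//= lerD.
Qed.

Lemma bdd_cst (R : realType) (k : R) : 0 <= k -> bdd (fun=> k).
Proof. by move=> k0; split; [exact: measurable_cst|exists k => v; rewrite k0 lexx]. Qed.

Lemma bdd_indic (R : realType) (A : set R) : measurable A -> bdd (\1_A).
Proof.
move=> mA; split; first exact: measurable_indic.
by exists 1 => v; rewrite indicE ler0n lern1 leq_b1.
Qed.

Lemma scaled_gap (R : realType) (p q eps : R) : p <= 1 -> 4^-1 <= q ->
  q <= p * q + eps / 4 -> 1 - eps <= p.
Proof.
move=> p1 q4 h; have : (1 - p) * 4^-1 <= (1 - p) * q by rewrite ler_wpM2l// subr_ge0.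
move: h; lra.
Qed.

(** * Commutation of two steps of the algorithm *)

Section kernels.
Context {R : realType} (kappa : {sigma_finite_measure set (measurableTypeR R) -> \bar R}).
Context d (Omega : measurableType d) (P : probability Omega R).
Variables (x : R) (B : R -> Omega -> R) (e : Omega -> R).
Hypothesis mwc : motion_with_clock kappa P x B e.
Hypothesis kappa0 : kappa setT != 0%E.
Local Notation started := (started x B).
Local Notation H := (root_mass kappa P x B e).
Local Notation Xt := (exit kappa x B e).
Local Notation Tt := (exit_at kappa x B e).
Local Notation Em := (exit_mean kappa P x B e).
Implicit Types (s : seq (R * R)) (z y c : R) (phi psi : R -> R).

Let kr := mwc_radon mwc.

Definition kern s z phi : R := fine (\int[P]_w (phi (Xt s z w))%:E)%E.
(* The probability that the motion from z, killed on the segments of s, reaches y. *)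
Definition hit s z y : R := fine (H s z y).

Lemma exit_ae s z : {ae P, forall w, regular x B e w /\ (Tt s z w < +oo)%E}.
Proof. by apply: filterS2 (regular_ae mwc) (exit_finite mwc kappa0 s z). Qed.

Lemma measurable_kern s z phi : measurable_fun setT phi ->
  measurable_fun setT (fun w => (phi (Xt s z w))%:E).
Proof.
by move=> mphi; apply/measurable_EFinP; exact: (measurableT_comp mphi (measurable_exit1 mwc s z)).
Qed.

Lemma kernE s z phi : bdd phi -> (\int[P]_w (phi (Xt s z w))%:E = (kern s z phi)%:E)%E.
Proof.
move=> [mphi [C hC]]; rewrite /kern fineK// ge0_fin_numE; last first.
  by apply: integral_ge0 => w _; rewrite lee_fin; have /andP[] := hC (Xt s z w).
apply: (@le_lt_trans _ _ (\int[P]_w C%:E)%E); last by rewrite integral_cst_prob ltry.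
apply: ge0_le_integral => //.
- by move=> w _; rewrite lee_fin; have /andP[] := hC (Xt s z w).
- exact: measurable_kern.
- by move=> w _; rewrite lee_fin; have /andP[] := hC (Xt s z w).
Qed.

Lemma kern_ge0 s z phi : bdd phi -> 0 <= kern s z phi.
Proof.
move=> [_ [C hC]]; apply: fine_ge0; apply: integral_ge0 => w _.
by rewrite lee_fin; have /andP[] := hC (Xt s z w).
Qed.

Lemma kern_le s z phi psi : bdd phi -> bdd psi ->
  {ae P, forall w, regular x B e w -> (Tt s z w < +oo)%E -> phi (Xt s z w) <= psi (Xt s z w)} ->
  kern s z phi <= kern s z psi.
Proof.
move=> bp bq h; rewrite -lee_fin -!kernE//; have [mp [C hC]] := bp; have [mq [D hD]] := bq.
apply: (ae_ge0_le_integral measurableT).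
- by move=> w _; rewrite lee_fin; have /andP[] := hC (Xt s z w).
- exact: measurable_kern.
- by move=> w _; rewrite lee_fin; have /andP[] := hD (Xt s z w).
- exact: measurable_kern.
- by apply: filterS2 (exit_ae s z) h => w [rw T1] h _; rewrite lee_fin; exact: h.
Qed.

Lemma kern_eq s z s' z' phi psi : bdd phi -> bdd psi ->
  {ae P, forall w, regular x B e w -> (Tt s z w < +oo)%E -> phi (Xt s z w) = psi (Xt s' z' w)} ->
  kern s z phi = kern s' z' psi.
Proof.
move=> bp bq h; rewrite /kern; congr fine; have [mp [C hC]] := bp; have [mq [D hD]] := bq.
apply: (ge0_ae_eq_integral measurableT (measurable_kern s z mp) (measurable_kern s' z' mq)).
- by move=> w _; rewrite lee_fin; have /andP[] := hC (Xt s z w).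
- by move=> w _; rewrite lee_fin; have /andP[] := hD (Xt s' z' w).
- by apply: filterS2 (exit_ae s z) h => w [rw T1] h _; rewrite h.
Qed.

Lemma kernD s z phi psi : bdd phi -> bdd psi ->
  kern s z (fun v => phi v + psi v) = kern s z phi + kern s z psi.
Proof.
move=> bp bq; apply/eqP; rewrite -eqe EFinD -!kernE//; last exact: bdd_add.
have [mp [C hC]] := bp; have [mq [D hD]] := bq; apply/eqP.
have p0 w : setT w -> (0 <= (phi (Xt s z w))%:E)%E.
  by move=> _; rewrite lee_fin; have /andP[] := hC (Xt s z w).
have q0 w : setT w -> (0 <= (psi (Xt s z w))%:E)%E.
  by move=> _; rewrite lee_fin; have /andP[] := hD (Xt s z w).
exact: (ge0_integralD P measurableT p0 (measurable_kern s z mp) q0 (measurable_kern s z mq)).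
Qed.

Lemma kernZ s z phi k : bdd phi -> 0 <= k -> kern s z (fun v => k * phi v) = k * kern s z phi.
Proof.
move=> bp k0; apply/eqP; rewrite -eqe EFinM -!kernE//; last first.
  by apply: bdd_mul => //; exact: bdd_cst.
have [mp [C hC]] := bp; apply/eqP.
have p0 w : setT w -> (0 <= (phi (Xt s z w))%:E)%E.
  by move=> _; rewrite lee_fin; have /andP[] := hC (Xt s z w).
exact: (ge0_integralZl_EFin P measurableT p0 (measurable_kern s z mp) k0).
Qed.

Lemma kern_covered s z phi : bdd phi -> covered s z -> kern s z phi = phi z.
Proof.
move=> bp cz; have [mp [C hC]] := bp.
have p0 : 0 <= phi z by have /andP[] := hC z.
apply/eqP; rewrite -eqe -kernE// -[X in _ == X](integral_cst_prob P); apply/eqP.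
apply: (ge0_ae_eq_integral measurableT (measurable_kern s z mp) (measurable_cst _)) => //.
- by move=> w _; rewrite lee_fin; have /andP[] := hC (Xt s z w).
- by apply: filterS (regular_ae mwc) => w rw _; have [-> _] := exit_covered kappa rw cz.
Qed.

Lemma hitE s z y : hit s z y = kern ((y, y) :: s) z (\1_[set y]).
Proof.
rewrite /hit /root_mass (exit_meanX mwc kappa0 _ _ (measurable_pt y))//.
Qed.

Let kern_split1 s z c phi : measurable_fun setT phi -> (forall v, 0 <= phi v <= 1) ->
  kern s z phi = kern ((c, c) :: s) z (fun p => phi p * (p != c)%:R) + hit s z c * kern s c phi.
Proof.
move=> mphi phi01.
have bp : bdd phi by split => //; exists 1.
have mE : measurable_fun setT (fun p => (phi p)%:E) by apply/measurable_EFinP.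
have E01 p : (0 <= (phi p)%:E <= 1)%E by rewrite !lee_fin.
have E0 p : (0 <= (phi p)%:E)%E by have /andP[] := E01 p.
have mc : measurable ([set c] : set R) by exact: measurable_set1.
have b1 : bdd (fun p => phi p * (p != c)%:R).
  apply: bdd_mul => //; rewrite (_ : (fun p => _) = \1_(~` [set c])); first by apply: bdd_indic; exact: measurableC.
  apply/funext => p; rewrite indicE; congr (nat_of_bool _)%:R.
  by apply/idP/idP; rewrite ?inE => /eqP //= h; rewrite inE/=; apply/eqP.
have b2 : bdd (fun p => kern s c phi * \1_[set c] p).
  by apply: bdd_mul; [apply: bdd_cst; exact: kern_ge0|exact: bdd_indic].
have EmK s' z' : Em (fun p => (phi p)%:E) s' z' = (kern s' z' phi)%:E.
  by rewrite (exit_meanX mwc kappa0 _ _ mE E0) kernE.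
have ss' p : covered s p -> covered ((c, c) :: s) p by move=> h; apply/covered_pt; right.
have red p : redirect kappa P x B e (fun p => (phi p)%:E) s ((c, c) :: s) p =
    (phi p * (p != c)%:R + kern s c phi * \1_[set c] p)%:E.
  rewrite /redirect; have [dp|dp] := eqVneq (dist_cov ((c, c) :: s) p) 0.
    have /coveredE/covered_pt := dp; have [->|pc] := eqVneq p c => cp.
      rewrite EmK (_ : \1_[set c] c = 1); last by rewrite indicE mem_set.
      by rewrite mulr0 add0r mulr1.
    case: cp => [/eqP|cp]; first by rewrite (negbTE pc).
    rewrite EmK (kern_covered bp cp) (_ : \1_[set c] p = 0); first by rewrite mulr1 mulr0 addr0.
    by rewrite indicE memNset//= => /eqP; rewrite (negbTE pc).
  have pc : p != c.
    by apply/eqP => pc; move/eqP: dp; apply; apply/coveredE/covered_pt; left.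
  rewrite pc (_ : \1_[set c] p = 0); first by rewrite mulr1 mulr0 addr0.
  by rewrite indicE memNset//= => /eqP; rewrite (negbTE pc).
have mrd := measurable_redirect mwc mE E01 s ((c, c) :: s).
have rd0 p : (0 <= redirect kappa P x B e (fun p => (phi p)%:E) s ((c, c) :: s) p)%E.
  by have /andP[] := redirect01 mwc mE E01 s ((c, c) :: s) p.
have := exit_mean_strong mwc mE E01 ss' z.
rewrite EmK (exit_meanX mwc kappa0 _ _ mrd rd0).
under eq_integral do rewrite red.
rewrite (kernE _ _ (bdd_add b1 b2)) kernD// (kernZ _ _ (bdd_indic mc) (kern_ge0 _ _ bp)) => -[->].
by rewrite hitE; congr (_ + _); rewrite mulrC.
Qed.

(** The strong Markov property at [c], separating the motions that end without visiting [c] from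
    those that visit it. The function is scaled into [[0, 1]], where that property was stated. *)
Lemma kern_split s z c phi : bdd phi ->
  kern s z phi = kern ((c, c) :: s) z (fun p => phi p * (p != c)%:R) + hit s z c * kern s c phi.
Proof.
move=> bp; have [mp [C0 hC0]] := bp.
pose C := Num.max C0 1; have C1 : 0 < C by rewrite lt_max ltr01 orbT.
pose psi v := C^-1 * phi v.
have psi01 v : 0 <= psi v <= 1.
  have /andP[h1 h2] := hC0 v; rewrite /psi mulr_ge0 ?invr_ge0 ?(ltW C1)//=.
  by rewrite mulrC ler_pdivrMr// mul1r le_max h2.
have mpsi : measurable_fun setT psi by apply: measurable_funM => //; exact: measurable_cst.
have bpsi : bdd psi by split => //; exists 1.
have mc : measurable ([set c] : set R) by exact: measurable_set1.
have bn : bdd (fun p : R => (p != c)%:R : R).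
  rewrite (_ : (fun p => _) = \1_(~` [set c])); first by apply: bdd_indic; exact: measurableC.
  apply/funext => p; rewrite indicE; congr (nat_of_bool _)%:R.
  by apply/idP/idP; rewrite ?inE => /eqP //= h; rewrite inE/=; apply/eqP.
have phiE : phi = fun v => C * psi v.
  by apply/funext => v; rewrite /psi mulVKf// gt_eqF.
have C0' := ltW C1.
rewrite phiE !(kernZ _ _ bpsi C0').
under [fun p => _]eq_fun do rewrite -mulrA.
rewrite (kernZ _ _ (bdd_mul bpsi bn) C0') (kern_split1 s z c mpsi psi01); ring.
Qed.

Lemma bdd_neq phi c : bdd phi -> bdd (fun p => phi p * (p != c)%:R).
Proof.
move=> bp; apply: bdd_mul => //.
rewrite (_ : (fun p => _) = \1_(~` [set c])); first by apply: bdd_indic; apply: measurableC; exact: measurable_set1.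
apply/funext => p; rewrite indicE; congr (nat_of_bool _)%:R.
by apply/idP/idP; rewrite ?inE => /eqP //= h; rewrite inE/=; apply/eqP.
Qed.

Lemma hit_ge0 s z y : 0 <= hit s z y.
Proof. by rewrite fine_ge0// root_mass_ge0. Qed.

Lemma hit_le1 s z y : hit s z y <= 1.
Proof. by rewrite -lee_fin fineK ?(root_mass_fin mwc)// (root_mass_le1 mwc). Qed.

Lemma hit_refl s z : hit s z z = 1.
Proof. by rewrite /hit (root_mass_refl mwc). Qed.

Lemma hit_mul s z y c : btw z y c -> hit s z y = hit s z c * hit s c y.
Proof. by move=> h; rewrite /hit (root_mass_mul mwc s h) fineM ?(root_mass_fin mwc). Qed.

Lemma kern_ge s z c phi : bdd phi -> hit s z c * kern s c phi <= kern s z phi.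
Proof. by move=> bp; rewrite (kern_split s z c bp) lerDr; apply: kern_ge0; exact: bdd_neq. Qed.

(** When [phi] lives beyond [c], the part that ends before visiting [c] contributes nothing, since a
    path crossing [c] is stopped there. *)
Lemma kern_skip s z c phi : bdd phi -> (forall p, phi p != 0 -> btw z p c) ->
  kern s z phi = hit s z c * kern s c phi.
Proof.
move=> bp sup; rewrite (kern_split s z c bp) -[RHS]add0r; congr (_ + _).
have z0 : kern ((c, c) :: s) z (fun=> 0) = 0.
  rewrite (_ : (fun=> 0) = fun v : R => 0 * (0 : R)); last by apply/funext => v; rewrite mul0r.
  by rewrite kernZ ?mul0r//; exact: bdd_cst.
rewrite -z0; apply: kern_eq; [exact: bdd_neq|exact: bdd_cst|].
apply: aeW => w rw T1; have [pc|pc] := eqVneq (Xt ((c, c) :: s) z w) c; first by rewrite pc mulr0.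
rewrite mulr1; apply/eqP; apply: contraTT pc => /sup h; rewrite negbK; apply/eqP.
by apply: (exit_skip kr rw T1 _ h); apply/covered_pt; left.
Qed.

(** The constant is [1/2 - 1/8 - 1/8]: the Gaussian bound, less the error due to the distance, less
    the probability of an early exit. *)
Lemma hit_local_lower s z : ~ covered s z -> exists2 r, 0 < r &
  forall a b, `|a - z| < r -> `|b - z| < r -> 4^-1 <= hit s a b.
Proof.
move=> ncz; have [r0 r00 Hr] := not_covered_ball ncz.
have e8 : 0 < 8^-1 :> R by rewrite invr_gt0.
have [t [r1 [t0 r10 early]]] := early_exit mwc ncz e8.
set pk := normal_peak (Num.sqrt t).
have pk0 : 0 <= pk by exact: normal_peak_ge0.
pose r2 := (16 * (pk + 1))^-1.
have r20 : 0 < r2 by rewrite invr_gt0 mulr_gt0// ltr_wpDl.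
exists (Num.min r0 (Num.min r1 r2)); first by rewrite !lt_min r00 r10 r20.
move=> a b; rewrite !lt_min => /and3P[a0 a1 a2] /and3P[b0 b1 b2].
have [->|ab] := eqVneq b a; first by rewrite hit_refl invf_le1// ler1n.
have := root_mass_lower mwc t0 ab (Hr a a0); rewrite -/pk.
have -> : H s a b = (hit s a b)%:E by rewrite fineK// (root_mass_fin mwc).
have := early a a1; set Q := P _ => hQ.
move=> /le_trans/(_ (leeD2l _ hQ)); rewrite -EFinD lee_fin.
have : `|b - a| * pk <= 8^-1.
  have ba : `|b - a| <= 2 * r2.
    have := ler_distD z b a; rewrite (distrC z) => h.
    by apply: (le_trans h); move: a2 b2; lra.
  apply: (@le_trans _ _ (2 * r2 * (pk + 1))); first by apply: ler_pM => //; rewrite lerDl.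
  rewrite /r2 le_eqVlt; apply/orP; left; apply/eqP; field.
  by rewrite gt_eqF// ltr_wpDl.
lra.
Qed.

(** The bound 1/4 improves itself. For a target [d] beyond [b], continuity gives
    [h b d <= h a d + eps / 4] while multiplicativity gives [h a d = h a b * h b d]; since [h b d]
    is at least 1/4, [h a b] is at least [1 - eps]. *)
Lemma hit_near s z (eps : R) : ~ covered s z -> 0 < eps -> exists2 r, 0 < r &
  forall a b, `|a - z| < r -> `|b - z| < r -> 1 - eps <= hit s a b.
Proof.
move=> ncz eps0; have [r0 r00 low] := hit_local_lower ncz.
have r02 : 0 < r0 / 2 by rewrite divr_gt0.
have rr : r0 / 2 < r0 by rewrite ltr_pdivrMr// ltr_pMr// ltr1n.
have eps4 : 0 < eps / 4 by rewrite divr_gt0.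
have near dl : `|dl| = r0 / 2 -> exists2 r, 0 < r & forall a b, `|a - z| < r -> `|b - z| < r ->
    hit s b (z + dl) <= hit s a (z + dl) + eps / 4.
  move=> dlE; have ncd : ~ covered ((z + dl, z + dl) :: s) z.
    move=> /covered_pt[zd|//]; have : dl = 0 by rewrite -(addrI z (_ : z + dl = z + 0)) ?addr0.
    by move=> dl0; move: r02; rewrite -dlE dl0 normr0 ltxx.
  have [r rgt hr] := exit_mean_near mwc (measurable_pt (z + dl)) (pt01 (z + dl)) ncd eps4.
  exists r => // a b ar br; have := hr b a br ar.
  rewrite -[X in (X <= _)%E]/(H s b (z + dl)) -[X in (_ <= X + _)%E]/(H s a (z + dl)).
  by rewrite -(fineK (root_mass_fin mwc s b (z + dl))) -(fineK (root_mass_fin mwc s a (z + dl))) lee_fin.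
have [r1 r10 h1] := near (r0 / 2) (ger0_norm (ltW r02)).
have [r2 r20 h2] := near (- (r0 / 2)) (etrans (normrN _) (ger0_norm (ltW r02))).
exists (Num.min (r0 / 2) (Num.min r1 r2)); first by rewrite !lt_min r02 r10 r20.
move=> a b; rewrite !lt_min => /and3P[a0 a1 a2] /and3P[b0 b1 b2].
have fin dl : `|dl| = r0 / 2 -> `|b - z| < r0 / 2 -> btw a (z + dl) b ->
    hit s b (z + dl) <= hit s a (z + dl) + eps / 4 -> 1 - eps <= hit s a b.
  move=> dlE bz bt hle; rewrite (hit_mul s bt) in hle.
  have lb : 4^-1 <= hit s b (z + dl).
    apply: low; first exact: (lt_trans bz rr).
    by rewrite addrC addKr dlE.
  exact: (scaled_gap (hit_le1 s a b) lb hle).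
have [ab|ba] := leP a b.
  apply: (fin (r0 / 2) (ger0_norm (ltW r02)) b0 _ (h1 _ _ a1 b1)).
  by apply/btwP; left; rewrite ab /=; move: b0; rewrite ltr_norml; lra.
apply: (fin (- (r0 / 2)) (etrans (normrN _) (ger0_norm (ltW r02))) b0 _ (h2 _ _ a2 b2)).
by apply/btwP; right; rewrite (ltW ba) andbT; move: b0; rewrite ltr_norml; lra.
Qed.

End kernels.

Lemma le_of_scaled (R : realType) (a b : R) : 0 <= a ->
  (forall eps, 0 < eps < 1 -> (1 - eps) * a <= b) -> a <= b.
Proof.
move=> a0 h; apply/ler_addgt0Pr => t t0.
have [a00|a00] := eqVneq a 0.
  have := h (2^-1); rewrite a00 mulr0 => hb; apply: (le_trans (hb _)); last by rewrite lerDl ltW.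
  by rewrite invr_gt0 ltr0n /= invf_lt1// ltr1n.
have {a00}a1 : 0 < a by rewrite lt_neqAle eq_sym a00.
pose eps := Num.min (2^-1) (t / a).
have eps01 : 0 < eps < 1.
  rewrite lt_min invr_gt0 ltr0n divr_gt0//= gt_min.
  by rewrite invf_lt1// ltr1n.
have : eps * a <= t by rewrite -ler_pdivlMr// ge_min lexx orbT.
have := h _ eps01; lra.
Qed.

(** * Densities of exit laws on a free interval *)

Section density_of_exit.
Context {R : realType} (kappa : {sigma_finite_measure set (measurableTypeR R) -> \bar R}).
Context d (Omega : measurableType d) (P : probability Omega R).
Variables (x : R) (B : R -> Omega -> R) (e : Omega -> R).
Hypothesis mwc : motion_with_clock kappa P x B e.
Hypothesis kappa0 : kappa setT != 0%E.
Local Notation Xt := (exit kappa x B e).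
Local Notation Tt := (exit_at kappa x B e).
Local Notation K := (kern kappa P x B e).
Local Notation h := (hit kappa P x B e).

Lemma measurable_kern_param d' (T : measurableType d') (s : T -> seq (R * R)) (z : T -> R)
    (phi : T * R -> R) : mstate s -> measurable_fun setT z -> measurable_fun setT phi ->
  (forall y, 0 <= phi y) ->
  measurable_fun setT (fun t => K (s t) (z t) (fun p => phi (t, p))).
Proof.
move=> ms mz mphi phi0.
pose f (y : T * Omega) := (phi (y.1, Xt (s y.1) (z y.1) y.2))%:E.
have mf : measurable_fun setT f.
  apply/measurable_EFinP; apply: (measurableT_comp mphi).
  by apply: measurable_fun_pair; [exact: measurable_fst|exact: (measurable_exit mwc ms mz)].
have f0 y : (0 <= f y)%E by rewrite lee_fin.
have m := @measurable_fun_fubini_tonelli_F _ _ T Omega R P f mf f0.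
exact: (measurableT_comp (fine_measurable measurableT) m).
Qed.

Lemma measurable_hit (s : seq (R * R)) z : measurable_fun setT (fun y : R => h s z y).
Proof.
pose phi (t : R * R) : R := if t.2 == t.1 then 1 else 0.
have mphi : measurable_fun setT phi.
  apply: measurable_fun_ifT; [|exact: measurable_cst|exact: measurable_cst].
  by apply: measurable_fun_eqr; [exact: measurable_snd|exact: measurable_fst].
have phi0 t : 0 <= phi t by rewrite /phi; case: ifP.
have := measurable_kern_param (mstate_cons (@measurable_id _ R setT) (@measurable_id _ R setT) (mstate_cst _ s))
  (measurable_cst z) mphi phi0.
apply: eq_measurable_fun => y _; rewrite (hitE mwc kappa0).
rewrite /kern; congr (fine _); apply: eq_integral => w _; rewrite /phi/= indicE.
congr EFin; case: eqP => h; first by rewrite mem_set.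
by rewrite memNset.
Qed.

End density_of_exit.

Section exit_density.
Context {R : realType}.
Variables (h : R -> R -> R) (K : R -> (R -> R) -> R) (l r : R).
Hypothesis lr : l < r.
Hypothesis h_ge0 : forall a b, 0 <= h a b.
Hypothesis h_le1 : forall a b, h a b <= 1.
Hypothesis h_refl : forall a, h a a = 1.
Hypothesis h_mul : forall a b c, btw a b c -> h a b = h a c * h c b.
Hypothesis h_meas : forall a, measurable_fun setT (h a).
Hypothesis h_low : forall z, l <= z <= r -> exists2 rr, 0 < rr &
  forall a b, `|a - z| < rr -> `|b - z| < rr -> 4^-1 <= h a b.
Hypothesis h_near : forall z eps, l <= z <= r -> 0 < eps -> exists2 rr, 0 < rr &
  forall a b, `|a - z| < rr -> `|b - z| < rr -> 1 - eps <= h a b.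
Hypothesis K_ge0 : forall z phi, bdd phi -> 0 <= K z phi.
Hypothesis K_le : forall z phi psi, bdd phi -> bdd psi -> (forall v, phi v <= psi v) ->
  K z phi <= K z psi.
Hypothesis KD : forall z phi psi, bdd phi -> bdd psi ->
  K z (fun v => phi v + psi v) = K z phi + K z psi.
Hypothesis KZ : forall z phi k, bdd phi -> 0 <= k -> K z (fun v => k * phi v) = k * K z phi.
Hypothesis K_ge : forall z c phi, bdd phi -> h z c * K c phi <= K z phi.
Hypothesis K_skip : forall z c phi, bdd phi -> (forall p, phi p != 0 -> btw z p c) ->
  K z phi = h z c * K c phi.

Lemma h_gt0 a b : l <= a <= r -> l <= b <= r -> 0 < h a b.
Proof.
have main a' b' : l <= a' -> a' <= b' -> b' <= r -> 0 < h a' b' /\ 0 < h b' a'.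
  move=> la ab br; apply: (@interval_induction R (fun a b => 0 < h a b /\ 0 < h b a) a' b' ab).
    move=> u v w u1 uv vw w1 [h1 h2] [h3 h4].
    have b1 : btw u w v by apply/btwP; left; rewrite uv vw.
    rewrite (h_mul b1) (h_mul (btw_sym b1)).
    by split; apply: mulr_gt0.
  move=> z /andP[az zb]; have zlr : l <= z <= r by rewrite (le_trans la az) (le_trans zb br).
  have [rr rr0 hh] := h_low zlr; exists rr => // u v _ _ _ uz vz.
  have q0 : 0 < 4^-1 :> R by rewrite invr_gt0.
  by split; apply: lt_le_trans q0 (hh _ _ _ _).
move=> /andP[la ar] /andP[lb br]; have [ab|ba] := leP a b.
  by have [] := main a b la ab br.
by have [] := main b a lb (ltW ba) ar.
Qed.

Definition clip (v : R) : R := Num.max l (Num.min v r).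

Lemma clip_in v : l <= clip v <= r.
Proof. by rewrite /clip le_max lexx ge_max (ltW lr) ge_min lexx orbT. Qed.

Lemma clip_id v : l <= v <= r -> clip v = v.
Proof. by move=> /andP[h1 h2]; rewrite /clip min_l// max_r. Qed.

Lemma clip_l v : v <= l -> clip v = l.
Proof. by move=> h1; rewrite /clip min_l ?max_l// (le_trans h1)// ltW. Qed.

Lemma clip_r v : r <= v -> clip v = r.
Proof. by move=> h1; rewrite /clip min_r// max_r// ltW. Qed.

Lemma measurable_clip : measurable_fun setT clip.
Proof.
by apply: measurable_maxr; [exact: measurable_cst|apply: measurable_minr; [exact: measurable_id|exact: measurable_cst]].
Qed.

Let hl v := h l (clip v).
Let hr v := h r (clip v).

Let bhl : bdd hl.
Proof.
split; first exact: (measurableT_comp (h_meas l) measurable_clip).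
by exists 1 => v; rewrite h_ge0 h_le1.
Qed.

Let bhr : bdd hr.
Proof.
split; first exact: (measurableT_comp (h_meas r) measurable_clip).
by exists 1 => v; rewrite h_ge0 h_le1.
Qed.

(** If the law from [l] were [h l v] times a common measure, and that from [r] were [h r v] times
    the same one, then weighting each by the factor of the other would give equal measures. [mu1]
    and [mu2] are these weighted laws, with [v] brought back into [[l, r]]. *)
Let mu1 phi := K l (fun v => phi v * hr v).
Let mu2 phi := K r (fun v => phi v * hl v).

Let mu1D phi psi : bdd phi -> bdd psi -> mu1 (fun v => phi v + psi v) = mu1 phi + mu1 psi.
Proof.
move=> b1 b2; rewrite /mu1 -(KD _ (bdd_mul b1 bhr) (bdd_mul b2 bhr)).
by congr (K _ _); apply/funext => v; rewrite mulrDl.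
Qed.

Let mu2D phi psi : bdd phi -> bdd psi -> mu2 (fun v => phi v + psi v) = mu2 phi + mu2 psi.
Proof.
move=> b1 b2; rewrite /mu2 -(KD _ (bdd_mul b1 bhl) (bdd_mul b2 bhl)).
by congr (K _ _); apply/funext => v; rewrite mulrDl.
Qed.

Let supp_scale (phi f g : R -> R) : bdd phi ->
  (forall v, phi v != 0 -> f v <= g v) -> forall v, phi v * f v <= phi v * g v.
Proof.
move=> [_ [C hC]] fg v; have [->|p0] := eqVneq (phi v) 0; first by rewrite !mul0r.
by apply: ler_wpM2l; [have /andP[] := hC v|exact: fg].
Qed.

(** For a function living beyond [a] and up to [b], the motion from [l] enters the cell through [a]
    and the motion from [r] through [b]. Exchanging the point of entry, or replacing [h] at [v] by
    its value at an end of the cell, costs only factors [h a b] and [h b a]. *)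
Let cell a b phi : l <= a -> a <= b -> b <= r -> bdd phi ->
  (forall v, phi v != 0 -> a < v <= b) ->
  h a b * h b a * mu1 phi <= mu2 phi /\ h a b * h b a * mu2 phi <= mu1 phi.
Proof.
move=> la ab br bp sup.
have h0 u v := h_ge0 u v.
have Kl : K l phi = h l a * K a phi.
  apply: K_skip => // p /sup /andP[ap pb]; apply/btwP; left.
  by rewrite la ltW.
have Kr : K r phi = h r b * K b phi.
  by apply: K_skip => // p /sup /andP[ap pb]; apply/btwP; right; rewrite pb.
have Kab := K_ge a b bp.
have Kba := K_ge b a bp.
have Ka0 := K_ge0 a bp; have Kb0 := K_ge0 b bp.
have cl v : phi v != 0 -> clip v = v.
  by move=> /sup/andP[av vb]; apply: clip_id; rewrite (le_trans la (ltW av)) (le_trans vb br).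
have bk k : 0 <= k -> bdd (fun v => phi v * k) by move=> k0; apply: bdd_mul => //; exact: bdd_cst.
have Kk z k : 0 <= k -> K z (fun v => phi v * k) = k * K z phi.
  by move=> k0; rewrite -(KZ z bp k0); congr (K _ _); apply/funext => v; rewrite mulrC.
have up1 : mu1 phi <= h r b * (h l a * K a phi).
  rewrite -Kl -(Kk l _ (h0 _ _)); apply: K_le; [exact: bdd_mul|exact: bk|].
  apply: supp_scale => // v v0; rewrite /hr (cl v v0); have /andP[av vb] := sup v v0.
  rewrite (h_mul (a := r) (b := v) (c := b)); last by apply/btwP; right; rewrite vb.
  by rewrite ler_piMr// h_le1.
have lo1 : h r b * h b a * (h l a * K a phi) <= mu1 phi.
  rewrite -Kl -Kk; last by rewrite mulr_ge0.
  apply: K_le; [by apply: bk; rewrite mulr_ge0|exact: bdd_mul|].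
  apply: supp_scale => // v v0; rewrite /hr (cl v v0); have /andP[av vb] := sup v v0.
  rewrite -(h_mul); last by apply/btwP; right; rewrite ab.
  rewrite (h_mul (a := r) (b := a) (c := v)); last by apply/btwP; right; rewrite (ltW av) (le_trans vb br).
  by rewrite ler_piMr// h_le1.
have up2 : mu2 phi <= h l a * (h r b * K b phi).
  rewrite -Kr -(Kk r _ (h0 _ _)); apply: K_le; [exact: bdd_mul|exact: bk|].
  apply: supp_scale => // v v0; rewrite /hl (cl v v0); have /andP[av vb] := sup v v0.
  rewrite (h_mul (a := l) (b := v) (c := a)); last by apply/btwP; left; rewrite la ltW.
  by rewrite ler_piMr// h_le1.
have lo2 : h l a * h a b * (h r b * K b phi) <= mu2 phi.
  rewrite -Kr -Kk; last by rewrite mulr_ge0.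
  apply: K_le; [by apply: bk; rewrite mulr_ge0|exact: bdd_mul|].
  apply: supp_scale => // v v0; rewrite /hl (cl v v0); have /andP[av vb] := sup v v0.
  rewrite -(h_mul); last by apply/btwP; left; rewrite la.
  rewrite (h_mul (a := l) (b := b) (c := v)); last by apply/btwP; left; rewrite vb (le_trans la (ltW av)).
  by rewrite ler_piMr// h_le1.
move: up1 lo1 up2 lo2 Kab Kba; move: (h0 a b) (h0 b a) (h0 r b) (h0 l a).
move: (h a b) (h b a) (h r b) (h l a) (K a phi) (K b phi) (mu1 phi) (mu2 phi).
move=> p q t u ka kb m1 m2 p0 q0 t0 u0 up1 lo1 up2 lo2 Kab Kba; split.
  apply: le_trans lo2; apply: (@le_trans _ _ (p * q * (t * (u * ka)))).
    by rewrite ler_wpM2l// mulr_ge0.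
  have -> : p * q * (t * (u * ka)) = u * p * t * (q * ka) by ring.
  have -> : u * p * (t * kb) = u * p * t * kb by ring.
  by rewrite ler_wpM2l// !mulr_ge0.
apply: le_trans lo1; apply: (@le_trans _ _ (p * q * (u * (t * kb)))).
  by rewrite ler_wpM2l// mulr_ge0.
have -> : p * q * (u * (t * kb)) = t * q * u * (p * kb) by ring.
have -> : t * q * (u * ka) = t * q * u * ka by ring.
by rewrite ler_wpM2l// !mulr_ge0.
Qed.

Let cut (phi : R -> R) (A : set R) (v : R) : R := phi v * \1_A v.

Let bcut phi (A : set R) : measurable A -> bdd phi -> bdd (cut phi A).
Proof. by move=> mA bp; apply: bdd_mul => //; exact: bdd_indic. Qed.

Let cut_supp phi (A : set R) v : cut phi A v != 0 -> A v /\ phi v != 0.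
Proof.
rewrite /cut indicE mulf_eq0 negb_or => /andP[p0]; case: (boolP (v \in A)) => vA.
  by split => //; rewrite inE in vA.
by rewrite eqxx.
Qed.

Let close (eps : R) a b : Prop := forall phi, bdd phi -> (forall v, phi v != 0 -> a < v <= b) ->
  (1 - eps) * mu1 phi <= mu2 phi /\ (1 - eps) * mu2 phi <= mu1 phi.

(** The error does not accumulate over the cells: it is a factor [1 - eps] on each of them, and the
    two sides are additive. *)
Let close_lr eps : 0 < eps < 1 -> close eps l r.
Proof.
move=> /andP[eps0 eps1]; apply: (@interval_induction R (close eps) l r (ltW lr)).
  move=> a b c la ab bc cr Qab Qbc phi bp sup.
  have m1 : measurable (`]a, b]%classic : set R) by exact: measurable_itv.
  have m2 : measurable (`]b, c]%classic : set R) by exact: measurable_itv.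
  have phiE : phi = fun v => cut phi `]a, b] v + cut phi `]b, c] v.
    apply/funext => v; rewrite /cut -mulrDr !indicE.
    have [->|v0] := eqVneq (phi v) 0; first by rewrite mul0r.
    have /andP[av vc] := sup v v0; have [vb|bv] := leP v b.
      rewrite mem_set/= ?in_itv/= ?av// memNset/= ?addr0 ?mulr1// in_itv/=.
      by rewrite ltNge vb.
    rewrite memNset/= ?in_itv/= ?av//= 1?leNgt ?bv// mem_set/= ?add0r ?mulr1//.
    by rewrite in_itv/= bv.
  have [||p1 p2] := Qab (cut phi `]a, b]).
  - exact: bcut.
  - by move=> v /cut_supp[] /=; rewrite in_itv.
  have [||q1 q2] := Qbc (cut phi `]b, c]).
  - exact: bcut.
  - by move=> v /cut_supp[] /=; rewrite in_itv.
  rewrite phiE (mu1D (bcut m1 bp) (bcut m2 bp)) (mu2D (bcut m1 bp) (bcut m2 bp)) !mulrDr.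
  by split; apply: lerD.
move=> z lzr; have e2 : 0 < eps / 2 by rewrite divr_gt0.
have [rr rr0 hh] := h_near lzr e2; exists rr => // a b la ab br az bz phi bp sup.
have [c1 c2] := cell la ab br bp sup.
have hab := hh a b az bz; have hba := hh b a bz az.
have pe : 1 - eps <= h a b * h b a.
  have : (1 - eps / 2) * (1 - eps / 2) <= h a b * h b a by apply: ler_pM => //; lra.
  by apply: le_trans; nra.
have m10 : 0 <= mu1 phi by apply: K_ge0; exact: bdd_mul.
have m20 : 0 <= mu2 phi by apply: K_ge0; exact: bdd_mul.
by split; [apply: le_trans c1|apply: le_trans c2]; rewrite ler_wpM2r.
Qed.

(** Inside the interval [eps] tends to 0. On either side the weights are constant and the equality
    is an instance of [K_skip]. *)
Let mu_eq phi : bdd phi -> mu1 phi = mu2 phi.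
Proof.
move=> bp.
have mA : measurable (`]-oo, l]%classic : set R) by exact: measurable_itv.
have mB : measurable (`]l, r]%classic : set R) by exact: measurable_itv.
have mC : measurable (`]r, +oo[%classic : set R) by exact: measurable_itv.
have phiE : phi = fun v => (cut phi `]-oo, l] v + cut phi `]l, r] v) + cut phi `]r, +oo[ v.
  apply/funext => v; rewrite /cut -!mulrDr !indicE.
  have iE (i : interval R) : (v \in [set` i]%classic) = (v \in i).
    by apply/idP/idP => [/set_mem //|vi]; apply/mem_set.
  rewrite !iE !in_itv/= !andbT; have [vl|lv] := leP v l.
    by rewrite [r < v]ltNge (le_trans vl (ltW lr)) /= !addr0 mulr1.
  by have [vr|rv] := leP v r; rewrite /= ?addr0 ?add0r mulr1.
have bA := bcut mA bp; have bB := bcut mB bp; have bC := bcut mC bp.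
rewrite phiE (mu1D (bdd_add bA bB) bC) (mu1D bA bB) (mu2D (bdd_add bA bB) bC) (mu2D bA bB).
have Kk z k psi : bdd psi -> 0 <= k -> K z (fun v => psi v * k) = k * K z psi.
  by move=> b k0; rewrite -(KZ z b k0); congr (K _ _); apply/funext => v; rewrite mulrC.
have EA : mu1 (cut phi `]-oo, l]) = mu2 (cut phi `]-oo, l]).
  have c v f : cut phi `]-oo, l] v * f (clip v) = cut phi `]-oo, l] v * f l :> R.
    have [->|/cut_supp[/= vl _]] := eqVneq (cut phi `]-oo, l] v) 0; first by rewrite !mul0r.
    by rewrite clip_l//; move: vl; rewrite in_itv.
  rewrite /mu1 /mu2 (_ : (fun v => _ * hr v) = fun v => cut phi `]-oo, l] v * h r l); last first.
    by apply/funext => v; rewrite /hr (c v (h r)).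
  rewrite (_ : (fun v => _ * hl v) = fun v => cut phi `]-oo, l] v * h l l); last first.
    by apply/funext => v; rewrite /hl (c v (h l)).
  rewrite !Kk ?h_ge0// h_refl mul1r; apply/esym; apply: K_skip => // p.
  by move=> /cut_supp[/=]; rewrite in_itv/= => pl _; apply/btwP; right; rewrite pl ltW.
have EC : mu1 (cut phi `]r, +oo[) = mu2 (cut phi `]r, +oo[).
  have c v f : cut phi `]r, +oo[ v * f (clip v) = cut phi `]r, +oo[ v * f r :> R.
    have [->|/cut_supp[/= vl _]] := eqVneq (cut phi `]r, +oo[ v) 0; first by rewrite !mul0r.
    by rewrite clip_r//; move: vl; rewrite in_itv/= andbT => /ltW.
  rewrite /mu1 /mu2 (_ : (fun v => _ * hr v) = fun v => cut phi `]r, +oo[ v * h r r); last first.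
    by apply/funext => v; rewrite /hr (c v (h r)).
  rewrite (_ : (fun v => _ * hl v) = fun v => cut phi `]r, +oo[ v * h l r); last first.
    by apply/funext => v; rewrite /hl (c v (h l)).
  rewrite !Kk ?h_ge0// h_refl mul1r; apply: K_skip => // p.
  by move=> /cut_supp[/=]; rewrite in_itv/= andbT => pl _; apply/btwP; left; rewrite !ltW.
rewrite EA EC; congr (_ + _ + _).
have sup v : cut phi `]l, r] v != 0 -> l < v <= r by move=> /cut_supp[] /=; rewrite in_itv.
have m10 : 0 <= mu1 (cut phi `]l, r]) by apply: K_ge0; exact: bdd_mul.
have m20 : 0 <= mu2 (cut phi `]l, r]) by apply: K_ge0; exact: bdd_mul.
by apply/eqP; rewrite eq_le; apply/andP; split; apply: le_of_scaled => // eps /close_lr/(_ _ bB sup)[].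
Qed.

(** The density of the exit law from [l] with respect to the one from [r]; it is nonincreasing on
    [[l, r]] and constant on each side of it. *)
Definition exit_density (v : R) : R := h l (clip v) / h r (clip v).

Let hr_gt0 v : 0 < hr v.
Proof. by apply: h_gt0; [rewrite lexx ltW|exact: clip_in]. Qed.

Let measurable_inv_hr : measurable_fun setT (fun v => (hr v)^-1).
Proof.
rewrite (_ : (fun v => _) = (fun v => expR (- ln (hr v)))).
  apply: (measurableT_comp (@measurable_expR R)); apply: measurable_funN.
  by apply: (measurableT_comp (@measurable_ln R)); have [] := bhr.
by apply/funext => v; rewrite expRN lnK// posrE.
Qed.

Lemma bdd_exit_density : bdd exit_density.
Proof.
have rl0 : 0 < h r l by apply: h_gt0; rewrite lexx ltW.
split.
  apply: measurable_funM; first by have [] := bhl.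
  by exact: measurable_inv_hr.
exists (h r l)^-1 => v; rewrite divr_ge0 ?h_ge0//=.
rewrite -[leRHS]mul1r; apply: ler_pM; rewrite ?h_ge0 ?h_le1//.
  by rewrite invr_ge0 h_ge0.
rewrite lef_pV2 ?posrE// ?hr_gt0//.
have /andP[lc cr] := clip_in v.
rewrite (h_mul (a := r) (b := l) (c := clip v)); last by apply/btwP; right; rewrite lc cr.
by rewrite ler_piMr ?h_ge0// h_le1.
Qed.

Lemma exit_densityE f : bdd f -> K l f = K r (fun v => f v * exit_density v).
Proof.
move=> bf; have rl0 : 0 < h r l by apply: h_gt0; rewrite lexx ltW.
pose phi v := f v / hr v.
have bphi : bdd phi.
  have [mf [C hC]] := bf; split.
    by apply: measurable_funM => //; exact: measurable_inv_hr.
  exists (C / h r l) => v; have /andP[f0 fC] := hC v.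
  rewrite divr_ge0 ?(ltW (hr_gt0 v))//=; apply: ler_pM => //; first by rewrite invr_ge0 ltW ?hr_gt0.
  rewrite lef_pV2 ?posrE// ?hr_gt0//; have /andP[lc cr] := clip_in v.
  rewrite /hr (h_mul (a := r) (b := l) (c := clip v)); last by apply/btwP; right; rewrite lc cr.
  by rewrite ler_piMr ?h_ge0// h_le1.
have := mu_eq bphi; rewrite /mu1 /mu2.
rewrite (_ : (fun v => phi v * hr v) = f); last first.
  by apply/funext => v; rewrite /phi divfK// gt_eqF ?hr_gt0.
move=> ->; congr (K _ _); apply/funext => v.
by rewrite /phi /exit_density /hl /hr mulrAC mulrA.
Qed.

Lemma exit_density_mono a b : l <= a -> a <= b -> b <= r ->
  exit_density b <= exit_density a.
Proof.
move=> la ab br; rewrite /exit_density !clip_id; last 2 first.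
- by rewrite la (le_trans ab).
- by rewrite br (le_trans la).
have ai : l <= a <= r by rewrite la (le_trans ab).
have bi : l <= b <= r by rewrite br (le_trans la).
have ri : l <= r <= r by rewrite lexx ltW.
apply: ler_pM; rewrite ?h_ge0 ?invr_ge0 ?h_ge0//.
  rewrite (h_mul (a := l) (b := b) (c := a)); last by apply/btwP; left; rewrite la.
  by rewrite ler_piMr ?h_ge0// h_le1.
rewrite lef_pV2 ?posrE ?h_gt0//.
rewrite (h_mul (a := r) (b := a) (c := b)); last by apply/btwP; right; rewrite ab.
by rewrite ler_piMr ?h_ge0// h_le1.
Qed.

End exit_density.

(** * States up to their covered set and roots *)

Section states.
Context {R : realType}.
Implicit Types (s : seq (R * R)) (a b l r p q y : R).

(* The points of Y_n: ends of segments that were disjoint from the older ones. *)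
Fixpoint root s y : Prop :=
  if s is c :: s' then root s' y \/ (y = c.2 /\ ~ covered s' c.2) else False.

Definition same_state s1 s2 : Prop :=
  (forall y, covered s1 y <-> covered s2 y) /\ (forall y, root s1 y <-> root s2 y).

Lemma same_state_sym s1 s2 : same_state s1 s2 -> same_state s2 s1.
Proof. by move=> [h1 h2]; split => y; [split => /h1|split => /h2]. Qed.

Lemma same_state_cons a b s1 s2 : same_state s1 s2 -> same_state ((a, b) :: s1) ((a, b) :: s2).
Proof.
move=> [h1 h2]; split => y.
  by rewrite !covered_cons; split => -[h|/h1 h]; by [left|right].
by split => -[/h2 h|[yb nc]]; [left|right; split => // /h1|left|right; split => // /h1].
Qed.

Lemma root_absorb a b s y : covered s b -> root ((a, b) :: s) y <-> root s y.
Proof. by move=> cb; split => [[//|[_ /= nc]]|]; [exfalso; exact: nc|left]. Qed.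

Lemma same_state_pt a s : covered s a -> same_state ((a, a) :: s) s.
Proof.
move=> ca; split => y; last exact: root_absorb.
by rewrite covered_pt; split => [[->|]|]//; right.
Qed.

(** Whether an end point is a root depends only on its being covered when its segment is drawn.
    Under these hypotheses neither segment can change that for the other. *)
Lemma same_state_swap a p b q s : (btw a p q -> covered s q) -> (btw b q p -> covered s p) ->
  same_state ((b, q) :: (a, p) :: s) ((a, p) :: (b, q) :: s).
Proof.
move=> hq hp; split => y.
  by rewrite !covered_cons; split => -[|[]] h; by [left|right; left|right; right].
have nq : covered ((a, p) :: s) q <-> covered s q.
  by rewrite covered_cons; split => [[/hq|]|]//; right.
have np : covered ((b, q) :: s) p <-> covered s p.
  by rewrite covered_cons; split => [[/hp|]|]//; right.
split => /= -[[h|[yp nc]]|[yp nc]].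
- by left; left.
- by right; split => // /np.
- by left; right; split => // /nq; exact: nc.
- by left; left.
- by right; split => // /nq.
- by left; right; split => // /np; exact: nc.
Qed.

Lemma same_state_join a b p s1 s2 : (forall y, covered s1 y <-> btw a p y \/ btw b p y \/ covered s2 y) ->
  (forall y, root s1 y <-> root ((a, p) :: s2) y) ->
  same_state s1 ((a, p) :: (b, p) :: s2).
Proof.
move=> h1 h2; split => y; first by rewrite h1 !covered_cons.
have cp : covered ((b, p) :: s2) p by apply/covered_cons; left; exact: btwr.
exact: (iff_trans (h2 y) (iff_sym (root_absorb a y cp))).
Qed.

(** The four [join] lemmas put all outcomes in which the segments from [l < r] meet into one form,
    with the common end [p]. The motion drawn second is absent if its start is already covered, and
    otherwise stops at the near edge of the first segment. *)
Lemma join_right l r p s : l < r -> r <= p -> same_state ((r, r) :: (l, p) :: s) ((l, p) :: (r, p) :: s).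
Proof.
move=> lr rp; apply: same_state_join => y.
  rewrite covered_pt covered_cons; split => [[->|[h|h]]|[h|[/btwP h|h]]].
  - by right; left; exact: btwl.
  - by left.
  - by right; right.
  - by right; left.
  - right; left; apply/btwP; left; case: h => /andP[h1 h2]; apply/andP; split; lra.
  - by right; right.
by apply: root_absorb; apply/covered_cons; left; apply/btwP; left; rewrite ltW.
Qed.

Lemma join_max l r p s : l < r -> p < r ->
  same_state ((r, Num.max l p) :: (l, p) :: s) ((l, p) :: (r, p) :: s).
Proof.
move=> lr pr; apply: same_state_join => y.
  rewrite !covered_cons; split.
    move=> [/btwP h|[h|h]]; [right; left|by left|by right; right].
    move: h; have [lp|pl] := leP l p => h; apply/btwP; right.
      by case: h => /andP[h1 h2]; apply/andP; split; lra.
    by case: h => /andP[h1 h2]; apply/andP; split; lra.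
  move=> [h|[/btwP h|h]]; [by right; left| |by right; right].
  have [lp|pl] := leP l p.
    by left; apply/btwP; right; case: h => /andP[h1 h2]; apply/andP; split; lra.
  have [yl|ly] := leP y l.
    by right; left; apply/btwP; right; case: h => /andP[h1 h2]; apply/andP; split; lra.
  by left; apply/btwP; right; case: h => /andP[h1 h2]; apply/andP; split; lra.
apply: root_absorb; apply/covered_cons; left.
by have [lp|pl] := leP l p; [exact: btwr|exact: btwl].
Qed.

Lemma join_left l r p s : l < r -> p <= l -> same_state ((l, l) :: (r, p) :: s) ((l, p) :: (r, p) :: s).
Proof.
move=> lr pl; apply: same_state_join => y.
  rewrite covered_pt covered_cons; split => [[->|[h|h]]|[/btwP h|[h|h]]].
  - by left; exact: btwl.
  - by right; left.
  - by right; right.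
  - right; left; apply/btwP; right; case: h => /andP[h1 h2]; apply/andP; split; lra.
  - by right; left.
  - by right; right.
have cl : covered ((r, p) :: s) l.
  by apply/covered_cons; left; apply/btwP; right; rewrite pl ltW.
exact: (root_absorb l y cl).
Qed.

Lemma join_min l r p s : l < r -> l < p ->
  same_state ((l, Num.min p r) :: (r, p) :: s) ((l, p) :: (r, p) :: s).
Proof.
move=> lr lp; apply: same_state_join => y.
  rewrite !covered_cons; split.
    move=> [/btwP h|[h|h]]; [left|by right; left|by right; right].
    move: h; have [pr|rp] := leP p r => h; apply/btwP; left.
      by case: h => /andP[h1 h2]; apply/andP; split; lra.
    by case: h => /andP[h1 h2]; apply/andP; split; lra.
  move=> [/btwP h|[h|h]]; [|by right; left|by right; right].
  have [pr|rp] := leP p r.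
    by left; apply/btwP; left; case: h => /andP[h1 h2]; apply/andP; split; lra.
  have [yr|ry] := leP y r.
    by left; apply/btwP; left; case: h => /andP[h1 h2]; apply/andP; split; lra.
  by right; left; apply/btwP; left; case: h => /andP[h1 h2]; apply/andP; split; lra.
have cm : covered ((r, p) :: s) (Num.min p r).
  by apply/covered_cons; left; have [pr|rp] := leP p r; [exact: btwr|exact: btwl].
exact: (root_absorb l y cm).
Qed.

(** The first clause, over all random states with measurable entries, takes the place of a
    sigma-algebra on lists of segments. *)
Definition state_fun (g : seq (R * R) -> R) : Prop :=
  [/\ forall d (T : measurableType d) (s : T -> seq (R * R)), mstate s ->
        measurable_fun setT (fun t => g (s t)),
      forall s, 0 <= g s <= 1 &
      forall s1 s2, same_state s1 s2 -> g s1 = g s2].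

End states.

Lemma split_above (R : realType) (f : R -> R) (c q : R) : c <= q ->
  f q = f q * (if c < q then 1 else 0) + f q * \1_[set c] q.
Proof.
rewrite le_eqVlt => /orP[/eqP <-|cq].
  by rewrite ltxx mulr0 add0r indicE mem_set// mulr1.
rewrite cq mulr1 indicE memNset ?mulr0 ?addr0//= => qc.
by move: cq; rewrite qc ltxx.
Qed.

Lemma split_below (R : realType) (f : R -> R) (c q : R) : q <= c ->
  f q = f q * (if q < c then 1 else 0) + f q * \1_[set c] q.
Proof.
rewrite le_eqVlt => /orP[/eqP ->|qc].
  by rewrite ltxx mulr0 add0r indicE mem_set// mulr1.
rewrite qc mulr1 indicE memNset ?mulr0 ?addr0//= => cq.
by move: qc; rewrite cq ltxx.
Qed.

Lemma cut_diff (R : realType) (b : bool) (g u v : R) :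
  (if b then g * (u - v) else 0) + g * (if b then 1 else 0) * v = u * (g * (if b then 1 else 0)) /\
  (if b then g * (u - v) else 0) + v * (g * (if b then 1 else 0)) = g * (if b then 1 else 0) * u.
Proof. by case: b; split; ring. Qed.

Lemma collect_right (R : realType) (k con h u j : R) :
  (k + con * h) * u = u * h * con + (u * (k + h * j) - u * h * j).
Proof. by ring. Qed.

Lemma collect_left (R : realType) (k con h u j : R) :
  k + con * (u * h) = u * h * con + (k + u * h * j - u * (h * j)).
Proof. by ring. Qed.

(** * The exchange of two steps *)

Section exchange.
Context {R : realType} (kappa : {sigma_finite_measure set (measurableTypeR R) -> \bar R}).
Context d (Omega : measurableType d) (P : probability Omega R).
Variables (x : R) (B : R -> Omega -> R) (e : Omega -> R).
Hypothesis mwc : motion_with_clock kappa P x B e.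
Hypothesis kappa0 : kappa setT != 0%E.
Local Notation Xt := (exit kappa x B e).
Local Notation Tt := (exit_at kappa x B e).
Local Notation K := (kern kappa P x B e).
Local Notation h := (hit kappa P x B e).
Implicit Types (s : seq (R * R)) (g : seq (R * R) -> R).

Let kr := mwc_radon mwc.

(* One step of the algorithm from z, acting on functionals of the state. *)
Definition attach (z : R) g s : R := K s z (fun p => g ((z, p) :: s)).

Lemma bdd_state_fun g s a b : state_fun g -> bdd (fun p => g ((a, p) :: (b s))).
Proof.
move=> [mg g01 _]; split; last by exists 1.
exact: (mg _ _ _ (mstate_cons (measurable_cst a) (@measurable_id _ R setT) (mstate_cst _ (b s)))).
Qed.

Lemma kern_cst s z (k : R) : 0 <= k -> K s z (fun=> k) = k.
Proof.
by move=> k0; apply/eqP; rewrite -eqe -(kernE mwc s z (bdd_cst k0)) integral_cst_prob.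
Qed.

Lemma kern01 s z (phi : R -> R) : measurable_fun setT phi -> (forall v, 0 <= phi v <= 1) -> 0 <= K s z phi <= 1.
Proof.
move=> mphi phi01; have bp : bdd phi by split => //; exists 1.
rewrite kern_ge0//= -(kern_cst s z ler01); apply: (kern_le mwc kappa0) => //; first exact: bdd_cst.
by apply: aeW => w _ _; have /andP[] := phi01 (Xt s z w).
Qed.

Lemma state_fun_attach z g : state_fun g -> state_fun (attach z g).
Proof.
move=> sg; have [mg g01 ig] := sg; split.
- move=> d' T s ms.
  apply: (measurable_kern_param mwc (phi := fun y : T * R => g ((z, y.2) :: s y.1)) ms (measurable_cst z)).
    apply: mg; apply: mstate_cons; [exact: measurable_cst|exact: measurable_snd|].
    exact: (mstate_comp ms (@measurable_fst _ _ T R)).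
  by move=> y; have /andP[] := g01 ((z, y.2) :: s y.1).
- move=> s; apply: kern01; first by have [] := bdd_state_fun s z id sg.
  by move=> v; exact: g01.
- move=> s1 s2 ss; have [cs _] := ss.
  apply: (kern_eq mwc kappa0); [exact: (bdd_state_fun s1 z id sg)|exact: (bdd_state_fun s2 z id sg)|].
  apply: aeW => w rw _; have [<- _] := eq_exit kappa z rw cs.
  by apply: ig; exact: same_state_cons.
Qed.

Lemma attach_covered z g s : state_fun g -> covered s z -> attach z g s = g s.
Proof.
move=> sg cz; rewrite /attach (kern_covered mwc _ cz); last exact: (bdd_state_fun s z id sg).
by have [_ _ ig] := sg; apply: ig; exact: same_state_pt.
Qed.

Lemma kern_fubini s z s' z' (F : R * R -> R) (C : R) : measurable_fun setT F ->
  (forall y, 0 <= F y <= C) ->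
  K s z (fun p => K s' z' (fun q => F (p, q))) = K s' z' (fun q => K s z (fun p => F (p, q))).
Proof.
move=> mF F0.
pose f (y : Omega * Omega) := (F (Xt s z y.1, Xt s' z' y.2))%:E.
have mf : measurable_fun setT f.
  apply/measurable_EFinP; apply: (measurableT_comp mF); apply: measurable_fun_pair.
    exact: (measurableT_comp (measurable_exit1 mwc s z) (@measurable_fst _ _ Omega Omega)).
  exact: (measurableT_comp (measurable_exit1 mwc s' z') (@measurable_snd _ _ Omega Omega)).
have f0 y : (0 <= f y)%E by rewrite lee_fin; have /andP[] := F0 (Xt s z y.1, Xt s' z' y.2).
have b1 p : bdd (fun q => F (p, q)).
  split; last by exists C.
  exact: (measurableT_comp mF (measurable_fun_pair (measurable_cst p) (@measurable_id _ R setT))).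
have b2 q : bdd (fun p => F (p, q)).
  split; last by exists C.
  exact: (measurableT_comp mF (measurable_fun_pair (@measurable_id _ R setT) (measurable_cst q))).
have E1 : (\int[P]_w (K s' z' (fun q => F (Xt s z w, q)))%:E = \int[P]_w \int[P]_w' f (w, w'))%E.
  by apply: eq_integral => w _; exact: esym (kernE mwc s' z' (b1 _)).
have E2 : (\int[P]_w' (K s z (fun p => F (p, Xt s' z' w')))%:E = \int[P]_w' \int[P]_w f (w, w'))%E.
  by apply: eq_integral => w _; exact: esym (kernE mwc s z (b2 _)).
exact: (congr1 fine (etrans E1 (etrans (@fubini_tonelli _ _ Omega Omega R P P f mf f0) (esym E2)))).
Qed.

Lemma measurable_kern2 s z (F : R * R -> R) : measurable_fun setT F -> (forall y, 0 <= F y) ->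
  measurable_fun setT (fun p : R => K s z (fun q => F (p, q))).
Proof.
move=> mF F0.
exact: (measurable_kern_param mwc (mstate_cst R s) (measurable_cst z) mF F0).
Qed.

Lemma bdd_kern2 s z (F : R * R -> R) : measurable_fun setT F -> (forall y, 0 <= F y <= 1) ->
  bdd (fun p : R => K s z (fun q => F (p, q))).
Proof.
move=> mF F01; split; first by apply: measurable_kern2 => // y; have /andP[] := F01 y.
exists 1 => p; apply: kern01; last by move=> v; exact: F01.
exact: (measurableT_comp mF (measurable_fun_pair (measurable_cst p) (@measurable_id _ R setT))).
Qed.

Lemma exit_le s z u w : regular x B e w -> (Tt s z w < +oo)%E -> covered s u -> z <= u ->
  Xt s z w <= u.
Proof.
move=> rw T1 cu zu; rewrite leNgt; apply/negP => lt.
have bt : btw z (Xt s z w) u by apply/btwP; left; rewrite zu ltW.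
by move: lt; rewrite (exit_skip kr rw T1 cu bt) ltxx.
Qed.

Lemma exit_ge s z u w : regular x B e w -> (Tt s z w < +oo)%E -> covered s u -> u <= z ->
  u <= Xt s z w.
Proof.
move=> rw T1 cu uz; rewrite leNgt; apply/negP => lt.
have bt : btw z (Xt s z w) u by apply/btwP; right; rewrite uz ltW.
by move: lt; rewrite (exit_skip kr rw T1 cu bt) ltxx.
Qed.

(** A covered point between [l] and [r] screens each motion from the segment of the other, so the
    two exit points are drawn independently and Tonelli exchanges them. *)
Lemma attach_separated g s l r u : state_fun g -> l <= u <= r -> covered s u ->
  attach l (attach r g) s = attach r (attach l g) s.
Proof.
move=> sg /andP[lu ur] cu; have [mg g01 ig] := sg.
pose F (y : R * R) := g ((l, y.1) :: (r, y.2) :: s).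
have mF : measurable_fun setT F.
  apply: mg; apply: mstate_cons; [exact: measurable_cst|exact: measurable_fst|].
  by apply: mstate_cons; [exact: measurable_cst|exact: measurable_snd|exact: mstate_cst].
have F01 y : 0 <= F y <= 1 by exact: g01.
pose F' (y : R * R) := F (y.2, y.1).
have mF' : measurable_fun setT F'.
  exact: (measurableT_comp mF (measurable_fun_pair (@measurable_snd _ _ R R) (@measurable_fst _ _ R R))).
have skl w (rw : regular x B e w) T1 := exit_le rw T1 cu lu.
have skr w (rw : regular x B e w) T1 := exit_ge rw T1 cu ur.
have sw p q : p <= u -> u <= q -> g ((r, q) :: (l, p) :: s) = F (p, q).
  move=> pu uq; apply: ig; apply: same_state_swap => /btwP bt.
    by rewrite (_ : q = u)//; apply/eqP; rewrite eq_le uq andbT; case: bt => /andP[]; lra.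
  by rewrite (_ : p = u)//; apply/eqP; rewrite eq_le pu /=; case: bt => /andP[]; lra.
have bg p : bdd (fun q => g ((r, q) :: (l, p) :: s)) by exact: (bdd_state_fun s r (cons (l, p)) sg).
have bF p : bdd (fun q => F (p, q)).
  split; last by exists 1.
  exact: (measurableT_comp mF (measurable_fun_pair (measurable_cst p) (@measurable_id _ R setT))).
have bF' q : bdd (fun p => F (p, q)).
  split; last by exists 1.
  exact: (measurableT_comp mF (measurable_fun_pair (@measurable_id _ R setT) (measurable_cst q))).
have bA z y : bdd (fun p => attach y g ((z, p) :: s)).
  exact: (bdd_state_fun s z id (state_fun_attach y sg)).
have E1 : attach l (attach r g) s = K s l (fun p => K s r (fun q => F (p, q))).
  apply: (kern_eq mwc kappa0); [exact: bA|exact: bdd_kern2|].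
  apply: aeW => w rw T1; have pu := skl w rw T1; move: (Xt s l w) pu => p pu.
  apply/esym; apply: (kern_eq mwc kappa0 (bF p) (bg p)); apply: aeW => w' rw' T1'.
  rewrite -(sw _ _ pu (skr w' rw' T1')).
  have [||<- _//] := @exit_local R kappa _ Omega x B e [set y | u <= y] s ((l, p) :: s) r w' rw' ur.
  - move=> y /= uy; rewrite covered_cons; split; first by right.
    move=> [/btwP bt|//]; rewrite (_ : y = u)//; apply/eqP; rewrite eq_le uy andbT.
    by case: bt => /andP[]; lra.
  - move=> y /= /negP; rewrite -ltNge => yu; exists u; split => //; apply/btwP; right.
    by rewrite ur ltW.
have E2 : attach r (attach l g) s = K s r (fun q => K s l (fun p => F (p, q))).
  clear E1.
  apply: (kern_eq mwc kappa0); [exact: bA|exact: (bdd_kern2 s l mF' (fun y => F01 _))|].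
  apply: aeW => w rw T1; have uq := skr w rw T1; move: (Xt s r w) uq => q uq.
  apply/esym; apply: (kern_eq mwc kappa0 (bF' q)); first exact: (bdd_state_fun s l (cons (r, q)) sg).
  apply: aeW => w' rw' T1'; rewrite /F/=.
  have [||<- _//] := @exit_local R kappa _ Omega x B e [set y | y <= u] s ((r, q) :: s) l w' rw' lu.
  - move=> y /= uy; rewrite covered_cons; split; first by right.
    move=> [/btwP bt|//]; rewrite (_ : y = u)//; apply/eqP; rewrite eq_le uy /=.
    by case: bt => /andP[]; lra.
  - move=> y /= /negP; rewrite -ltNge => yu; exists u; split => //; apply/btwP; left.
    by rewrite lu ltW.
by rewrite E1 E2; exact: (kern_fubini s l s r mF F01).
Qed.

Lemma kern_point s z c phi : bdd phi ->
  K ((c, c) :: s) z (fun p => phi p * \1_[set c] p) = phi c * h s z c.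
Proof.
move=> bp; have [mp [C hC]] := bp; have mc : measurable ([set c] : set R) by exact: measurable_set1.
have p0 : 0 <= phi c by have /andP[] := hC c.
rewrite (hitE mwc kappa0) -(kernZ mwc _ _ (bdd_indic mc) p0); congr (kern _ _ _ _ _ _ _ _).
apply/funext => p; rewrite indicE; case: (boolP (p \in _)); last by rewrite !mulr0.
by rewrite inE/= => ->.
Qed.

(** Both orders are integrated against the exit law from [r], the law from [l] being rewritten with
    the density [U]. In either order the outcomes where the segments join contribute
    [h s l (clip l r p) * Con p], and the disjoint ones the double integral of the same function
    [F]. *)
Lemma attach_free g s l r : state_fun g -> l < r -> (forall y, l <= y <= r -> ~ covered s y) ->
  attach l (attach r g) s = attach r (attach l g) s.
Proof.
move=> sg lr free; have [mg g01 ig] := sg.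
have hl_low z : l <= z <= r -> exists2 rr, 0 < rr &
  forall a b, `|a - z| < rr -> `|b - z| < rr -> 4^-1 <= h s a b.
  by move=> /free nz; exact: (hit_local_lower mwc nz).
have hl_near z eps : l <= z <= r -> 0 < eps -> exists2 rr, 0 < rr &
  forall a b, `|a - z| < rr -> `|b - z| < rr -> 1 - eps <= h s a b.
  by move=> /free nz e0; exact: (hit_near mwc nz e0).
have hge0 a b : 0 <= h s a b by exact: hit_ge0.
have hmul a b c : btw a b c -> h s a b = h s a c * h s c b by move=> bt; exact: (hit_mul mwc s bt).
have Kle z phi psi : bdd phi -> bdd psi -> (forall v, phi v <= psi v) -> K s z phi <= K s z psi.
  by move=> b1 b2 le; apply: (kern_le mwc kappa0) => //; apply: aeW => w _ _; exact: le.
have KD z phi psi := @kernD _ kappa _ _ P x B e mwc s z phi psi.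
have KZ z phi k := @kernZ _ kappa _ _ P x B e mwc s z phi k.
have Kge z c phi := @kern_ge _ kappa _ _ P x B e mwc kappa0 s z c phi.
have Ksk z c phi := @kern_skip _ kappa _ _ P x B e mwc kappa0 s z c phi.
have Kge0 z phi := @kern_ge0 _ kappa _ _ P x B e s z phi.
have hle1 a b := hit_le1 mwc s a b.
have hrefl a := hit_refl mwc s a.
have hmeas a := measurable_hit mwc kappa0 s a.
have hgt0 a b := @h_gt0 R (h s) l r hmul hl_low a b.
pose U := exit_density (h s) l r.
have bU : bdd U := @bdd_exit_density R (h s) l r lr hge0 hle1 hmul hmeas hl_low.
have dens f : bdd f -> K s l f = K s r (fun v => f v * U v).
  exact: (@exit_densityE R (h s) (K s) l r lr hge0 hle1 hrefl hmul hmeas hl_low hl_near Kge0 Kle KD KZ Kge Ksk f).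
have Umono a b : l <= a -> a <= b -> b <= r -> U b <= U a.
  exact: (@exit_density_mono R (h s) l r lr hge0 hle1 hmul hl_low a b).
have Uclip v : U (clip l r v) = U v by rewrite /U /exit_density (clip_id (clip_in lr v)).
have U0 v : 0 <= U v by have [_ [C hC]] := bU; have /andP[] := hC v.
(* The pairs of end points for which the segments from [l] and [r] stay disjoint. *)
pose D (y : R * R) : bool := [&& y.1 < r, l < y.2 & y.1 < y.2].
pose G (y : R * R) := g ((r, y.2) :: (l, y.1) :: s).
pose Con p := g ((l, p) :: (r, p) :: s).
(* [U p] is the weight of the first end point. The term [U q] removes the motions from [r] that
   touch the segment of [l] before ending at [q]: by multiplicativity their weight is the density at
   [q] of the law from [l]. *)
pose F (y : R * R) := if D y then G y * (U y.1 - U y.2) else 0.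
have mfst := @measurable_fst _ _ R R; have msnd := @measurable_snd _ _ R R.
have mG : measurable_fun setT G.
  apply: mg; apply: mstate_cons; [exact: measurable_cst|exact: msnd|].
  by apply: mstate_cons; [exact: measurable_cst|exact: mfst|exact: mstate_cst].
have mD : measurable_fun setT D.
  apply: measurable_function.measurable_and; first exact: (measurable_fun_ltr mfst (measurable_cst r)).
  apply: measurable_function.measurable_and; first exact: (measurable_fun_ltr (measurable_cst l) msnd).
  exact: (measurable_fun_ltr mfst msnd).
have mU : measurable_fun setT U by have [] := bU.
have mF : measurable_fun setT F.
  apply: measurable_fun_ifT => //; apply: measurable_funM => //.
  exact: (measurable_funB (measurableT_comp mU mfst) (measurableT_comp mU msnd)).
have DU y : D y -> 0 <= U y.1 - U y.2.
  move=> /and3P[h1 h2 h3]; rewrite subr_ge0 -(Uclip y.2) -(Uclip y.1).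
  have [/andP[c1 c2] /andP[c3 c4]] := (clip_in lr y.1, clip_in lr y.2).
  by apply: Umono => //; rewrite /clip ge_max le_max lexx/= le_max le_min !ge_min (ltW h3) lexx !orbT.
have [_ [C hC]] := bU.
have F0C y : 0 <= F y <= C.
  rewrite /F; case: ifP => [Dy|_]; last by rewrite lexx; have /andP[h1 h2] := hC 0; exact: le_trans h2.
  have := DU y Dy; have /andP[g0 g1] := g01 ((r, y.2) :: (l, y.1) :: s).
  have /andP[u0 u1] := hC y.1; have /andP[v0 v1] := hC y.2; rewrite /G => d0.
  rewrite mulr_ge0//=; apply: (@le_trans _ _ (1 * (U y.1 - U y.2))); first exact: ler_wpM2r.
  by rewrite mul1r lerBlDr (le_trans u1)// lerDl.
have F0 y : 0 <= F y by have /andP[] := F0C y.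
have bF1 p : bdd (fun q => F (p, q)).
  split; last by exists C.
  exact: (measurableT_comp mF (measurable_fun_pair (measurable_cst p) (@measurable_id _ R setT))).
have bF2 q : bdd (fun p => F (p, q)).
  split; last by exists C.
  exact: (measurableT_comp mF (measurable_fun_pair (@measurable_id _ R setT) (measurable_cst q))).
have KF1 : bdd (fun p => K s r (fun q => F (p, q))).
  split; first exact: (measurable_kern2 s r mF F0).
  exists C => p; rewrite kern_ge0//= -(kern_cst s r (le_trans (F0 (0, 0)) (proj2 (andP (F0C (0, 0)))))).
  apply: Kle => //; first by apply: bdd_cst; have /andP[h1 h2] := F0C (0, 0); exact: le_trans h2.
  by move=> q; have /andP[] := F0C (p, q).
have mF2 : measurable_fun setT (fun y : R * R => F (y.2, y.1)).
  exact: (measurableT_comp mF (measurable_fun_pair msnd mfst)).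
have KF2 : bdd (fun q => K s r (fun p => F (p, q))).
  split; first exact: (measurable_kern2 s r mF2 (fun y => F0 _)).
  exists C => p; rewrite kern_ge0//= -(kern_cst s r (le_trans (F0 (0, 0)) (proj2 (andP (F0C (0, 0)))))).
  apply: Kle => //; first by apply: bdd_cst; have /andP[h1 h2] := F0C (0, 0); exact: le_trans h2.
  by move=> q; have /andP[] := F0C (q, p).
have bhl : bdd (fun v => h s l (clip l r v)).
  split; first exact: (measurableT_comp (hmeas l) (measurable_clip l r)).
  by exists 1 => v; rewrite hge0 hle1.
have bCon : bdd Con.
  split; last by exists 1 => v; exact: g01.
  apply: mg; apply: mstate_cons; [exact: measurable_cst|exact: measurable_id|].
  by apply: mstate_cons; [exact: measurable_cst|exact: measurable_id|exact: mstate_cst].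
have bA z y : bdd (fun p => attach y g ((z, p) :: s)).
  exact: (bdd_state_fun s z id (state_fun_attach y sg)).
have inner1 p : attach r g ((l, p) :: s) * U p = h s l (clip l r p) * Con p + K s r (fun q => F (p, q)).
  have [rp|pr] := leP r p.
    have cr : covered ((l, p) :: s) r by apply/covered_cons; left; apply/btwP; left; rewrite ltW.
    have -> : (fun q => F (p, q)) = fun=> 0.
      by apply/funext => q; rewrite /F /D /= ltNge rp.
    rewrite (kern_cst s r (lexx 0)) addr0 (attach_covered sg cr) mulrC.
    rewrite /Con -(ig _ _ (join_right s lr rp)) (ig _ _ (same_state_pt cr)); congr (_ * _).
    by rewrite -(Uclip p) (clip_r lr rp) /U /exit_density (clip_id (introT andP (conj (ltW lr) (lexx r)))) hrefl divr1.
  (* The edge of the segment between [l] and [p] that faces [r]. *)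
  pose c := Num.max l p.
  have lc : l <= c by rewrite le_max lexx.
  have cr : c < r by rewrite gt_max lr pr.
  have cE : clip l r p = c by rewrite /clip min_l// ltW.
  have bGp : bdd (fun q => G (p, q)) := bdd_state_fun s r (cons (l, p)) sg.
  pose f q := G (p, q) * (if c < q then 1 else 0).
  have bf : bdd f.
    apply: bdd_mul => //; split; last by exists 1 => v; case: ifP => _; rewrite ?lexx ?ler01.
    by apply: measurable_fun_ifT; [apply: measurable_fun_ltr; [exact: measurable_cst|exact: measurable_id]|exact: measurable_cst|exact: measurable_cst].
  have mc : measurable ([set c] : set R) by exact: measurable_set1.
  have bpt : bdd (fun q => G (p, q) * \1_[set c] q) by apply: bdd_mul => //; exact: bdd_indic.
  have A1 : attach r g ((l, p) :: s) = K ((c, c) :: s) r f + G (p, c) * h s r c.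
    rewrite -(kern_point s r c bGp) -(kernD mwc _ _ bf bpt).
    apply: (kern_eq mwc kappa0 bGp (bdd_add bf bpt)).
    apply: aeW => w rw T1.
    have [||XE TE] := @exit_local R kappa _ Omega x B e [set y | c <= y] ((l, p) :: s) ((c, c) :: s) r w rw (ltW cr).
    - move=> y /= cy; rewrite covered_cons covered_pt; split => -[h1|h1]; [|by right| |by right].
        left; apply/eqP; rewrite eq_le cy andbT; move: cy h1; rewrite /c.
        by have [lp|pl] := leP l p => cy /btwP [] /andP[]; lra.
      by left; rewrite h1 /c; have [lp|pl] := leP l p; [exact: btwr|exact: btwl].
    - move=> y /= /negP; rewrite -ltNge => yc; exists c; split => //=.
        by apply/covered_cons; left; rewrite /c; have [lp|pl] := leP l p; [exact: btwr|exact: btwl].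
      by apply/btwP; right; rewrite !ltW.
    rewrite XE; rewrite TE in T1.
    have ccc : covered ((c, c) :: s) c by apply/covered_pt; left.
    exact: (split_above (fun q => G (p, q)) (exit_ge rw T1 ccc (ltW cr))).
  have A2 : K s r f = K ((c, c) :: s) r f + h s r c * K s c f.
    rewrite (kern_split mwc kappa0 s r c bf); congr (_ + _); congr (kern _ _ _ _ _ _ _ _).
    apply/funext => q; have [->|] := eqVneq q c; last by rewrite mulr1.
    by rewrite /f ltxx !mulr0.
  have A3 : K s l f = h s l c * K s c f.
    apply: Ksk => // q; rewrite /f; case: ifP => [cq _|]; last by rewrite mulr0 eqxx.
    by apply/btwP; left; rewrite lc ltW.
  have hrc : 0 < h s r c by apply: hgt0; rewrite ?lexx ?lc ?ltW.
  have Uc : U p * h s r c = h s l c.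
    by rewrite -(Uclip p) cE /U /exit_density (clip_id (introT andP (conj lc (ltW cr)))) divfK// gt_eqF.
  have bfU : bdd (fun q => f q * U q) by exact: bdd_mul.
  have A4 : K s r (fun q => F (p, q)) + K s r (fun q => f q * U q) = U p * K s r f.
    rewrite -(KD _ _ _ (bF1 p) bfU) -(KZ _ _ _ bf (U0 p)); congr (kern _ _ _ _ _ _ _ _).
    apply/funext => q; rewrite /F /D /f /= pr /=.
    have -> : (l < q) && (p < q) = (c < q) by rewrite /c gt_max.
    exact: (cut_diff _ _ _ _).1.
  have GE : G (p, c) = Con p by apply: ig; exact: join_max.
  rewrite (dens _ bf) in A3.
  have -> : K s r (fun q => F (p, q)) = U p * K s r f - K s r (fun q => f q * U q).
    by rewrite -A4 addrK.
  rewrite cE A1 GE A2 A3 -Uc; exact: collect_right.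
have inner2 q : attach l g ((r, q) :: s) = h s l (clip l r q) * Con q + K s r (fun p => F (p, q)).
  have [ql|lq] := leP q l.
    have cl : covered ((r, q) :: s) l by apply/covered_cons; left; apply/btwP; right; rewrite ql ltW.
    have -> : (fun p => F (p, q)) = fun=> 0.
      by apply/funext => p; rewrite /F /D /= [l < q]ltNge ql /= andbF.
    rewrite (kern_cst s r (lexx 0)) addr0 (attach_covered sg cl).
    by rewrite (clip_l lr ql) hrefl mul1r /Con -(ig _ _ (join_left s lr ql)) (ig _ _ (same_state_pt cl)).
  pose c := Num.min q r.
  have cr : c <= r by rewrite ge_min lexx orbT.
  have lc : l < c by rewrite lt_min lr lq.
  have cE : clip l r q = c by rewrite /clip max_r// ltW.
  pose G' p := g ((l, p) :: (r, q) :: s).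
  have bG : bdd G' := bdd_state_fun s l (cons (r, q)) sg.
  pose f p := G' p * (if p < c then 1 else 0).
  have bf : bdd f.
    apply: bdd_mul => //; split; last by exists 1 => v; case: ifP => _; rewrite ?lexx ?ler01.
    by apply: measurable_fun_ifT; [apply: measurable_fun_ltr; [exact: measurable_id|exact: measurable_cst]|exact: measurable_cst|exact: measurable_cst].
  have mc : measurable ([set c] : set R) by exact: measurable_set1.
  have bpt : bdd (fun p => G' p * \1_[set c] p) by apply: bdd_mul => //; exact: bdd_indic.
  have A1 : attach l g ((r, q) :: s) = K ((c, c) :: s) l f + G' c * h s l c.
    rewrite -(kern_point s l c bG) -(kernD mwc _ _ bf bpt).
    apply: (kern_eq mwc kappa0 bG (bdd_add bf bpt)).
    apply: aeW => w rw T1.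
    have [||XE TE] := @exit_local R kappa _ Omega x B e [set y | y <= c] ((r, q) :: s) ((c, c) :: s) l w rw (ltW lc).
    - move=> y /= yc; rewrite covered_cons covered_pt; split => -[h1|h1]; [|by right| |by right].
        left; apply/eqP; rewrite eq_le yc /=; move: yc h1; rewrite /c.
        by have [qr|rq] := leP q r => yc /btwP [] /andP[]; lra.
      by left; rewrite h1 /c; have [qr|rq] := leP q r; [exact: btwr|exact: btwl].
    - move=> y /= /negP; rewrite -ltNge => cy; exists c; split => //=.
        by apply/covered_cons; left; rewrite /c; have [qr|rq] := leP q r; [exact: btwr|exact: btwl].
      by apply/btwP; left; rewrite !ltW.
    rewrite XE; rewrite TE in T1.
    have ccc : covered ((c, c) :: s) c by apply/covered_pt; left.
    exact: (split_below G' (exit_le rw T1 ccc (ltW lc))).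
  have A2 : K s l f = K ((c, c) :: s) l f + h s l c * K s c f.
    rewrite (kern_split mwc kappa0 s l c bf); congr (_ + _); congr (kern _ _ _ _ _ _ _ _).
    apply/funext => p; have [->|] := eqVneq p c; last by rewrite mulr1.
    by rewrite /f ltxx !mulr0.
  have A3 : K s r f = h s r c * K s c f.
    apply: Ksk => // p; rewrite /f; case: ifP => [pc _|]; last by rewrite mulr0 eqxx.
    by apply/btwP; right; rewrite cr ltW.
  have Uc : U q * h s r c = h s l c.
    have hrc : 0 < h s r c by apply: hgt0; rewrite ?lexx ?cr ?ltW.
    by rewrite -(Uclip q) cE /U /exit_density (clip_id (introT andP (conj (ltW lc) cr))) divfK// gt_eqF.
  have A4 : K s r (fun p => F (p, q)) + U q * K s r f = K s r (fun p => f p * U p).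
    rewrite -(KZ _ _ _ bf (U0 q)) -(KD _ _ _ (bF2 q) (bdd_mul (bdd_cst (U0 q)) bf)).
    congr (kern _ _ _ _ _ _ _ _).
    apply/funext => p; rewrite /F /D /f /= lq /=.
    have -> : (p < r) && (p < q) = (p < c) by rewrite /c lt_min andbC.
    (* For disjoint segments the state does not depend on which was drawn last. *)
    have GG : p < c -> G (p, q) = G' p.
      move=> pc.
      apply: ig; apply: same_state_swap => /btwP bt; exfalso.
        move: pc; rewrite /c lt_min => /andP[pq pr]; case: bt => /andP[b1 b2].
          by move: (lt_le_trans pq b2); rewrite ltxx.
        by move: (lt_le_trans lq b2); rewrite ltxx.
      move: pc; rewrite /c lt_min => /andP[pq pr]; case: bt => /andP[b1 b2].
        by move: (lt_le_trans pr b1); rewrite ltxx.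
      by move: (lt_le_trans pq b1); rewrite ltxx.
    case: (boolP (p < c)) => [/GG ->|_]; first exact: (cut_diff true _ _ _).2.
    exact: (cut_diff false (G' p) (U p) (U q)).2.
  have GE : G' c = Con q by apply: ig; exact: join_min.
  rewrite -(dens _ bf) A2 A3 in A4.
  have -> : K s r (fun p => F (p, q)) = K ((c, c) :: s) l f + h s l c * K s c f - U q * (h s r c * K s c f).
    by rewrite -A4 addrK.
  rewrite cE A1 GE -Uc; exact: collect_left.
have EL : attach l (attach r g) s = K s r (fun p => h s l (clip l r p) * Con p + K s r (fun q => F (p, q))).
  exact: (etrans (dens _ (bA l r)) (congr1 (K s r) (funext inner1))).
have ER : attach r (attach l g) s = K s r (fun q => h s l (clip l r q) * Con q + K s r (fun p => F (p, q))).
  exact: (congr1 (K s r) (funext inner2)).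
apply: (etrans EL); apply: (etrans _ (esym ER)).
apply: (etrans (KD _ _ _ (bdd_mul bhl bCon) KF1)).
apply: (etrans _ (esym (KD _ _ _ (bdd_mul bhl bCon) KF2))).
exact: (congr1 (fun u => K s r (fun v => h s l (clip l r v) * Con v) + u) (kern_fubini s r s r mF F0C)).
Qed.

Lemma attach_exchange g s y z : state_fun g ->
  attach y (attach z g) s = attach z (attach y g) s.
Proof.
move=> sg; have main l r : l < r -> attach l (attach r g) s = attach r (attach l g) s.
  move=> lr; have [[u [lu cu]]|nex] := pselect (exists u, l <= u <= r /\ covered s u).
    exact: (attach_separated sg lu cu).
  by apply: attach_free => // u lu cu; apply: nex; exists u.
by have [yz|zy|->//] := ltgtP y z; [exact: main|exact: esym (main _ _ zy)].
Qed.

End exchange.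

(** * Coverage of intervals *)

Section coverage.
Context {R : realType}.
Implicit Types (s : seq (R * R)) (a b v y : R).

(** Rational points keep the event measurable; as the covered set is closed, all points follow when
    [a < b]. *)
Definition covers a b s : Prop := forall q : rat, btw a b (ratr q) -> covered s (ratr q).

Definition ncov a b s : R := if `[< covers a b s >] then 0 else 1.

Definition meas_fun (g : seq (R * R) -> R) : Prop :=
  (forall d (T : measurableType d) (s : T -> seq (R * R)), mstate s ->
     measurable_fun setT (fun t => g (s t))) /\ forall s, 0 <= g s <= 1.

Lemma state_fun_meas g : state_fun g -> meas_fun g.
Proof. by case. Qed.

Lemma measurable_covered d (T : measurableType d) (s : T -> seq (R * R)) (y : T -> R) :
  mstate s -> measurable_fun setT y -> measurable [set t | covered (s t) (y t)].
Proof.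
move=> ms my; rewrite (_ : [set t | _] = [set t | dist_cov (s t) (y t) = 0]).
  exact: (measurable_preim (measurable_dist_cov ms my) (measurable_set1 _)).
by apply/seteqP; split => t /= /coveredE.
Qed.

Lemma measurable_covers d (T : measurableType d) (s : T -> seq (R * R)) (a b : T -> R) :
  mstate s -> measurable_fun setT a -> measurable_fun setT b ->
  measurable [set t | covers (a t) (b t) (s t)].
Proof.
move=> ms ma mb; apply: measurable_forall => q.
rewrite (_ : [set t | _] = ~` [set t | btw (a t) (b t) (ratr q)] `|` [set t | covered (s t) (ratr q)]).
  apply: measurableU; last exact: (measurable_covered ms (measurable_cst _)).
  apply: measurableC; rewrite (_ : [set t | _] = [set t | Num.min (a t) (b t) <= ratr q] `&` [set t | ratr q <= Num.max (a t) (b t)]).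
    apply: measurableI; apply: measurable_ler; try exact: measurable_cst.
      exact: measurable_minr.
    exact: measurable_maxr.
  by apply/seteqP; split => t /=; rewrite /btw; [move=> /andP[]|move=> [-> ->]].
apply/seteqP; split => t /= h; last by case: h => [nb|//] /nb.
by have [bt|nb] := pselect (btw (a t) (b t) (ratr q)); [right; exact: h|left].
Qed.

Lemma measurable_if_prop d (T : measurableType d) (A : T -> Prop) (u v : R) :
  measurable [set t | A t] -> measurable_fun setT (fun t => if `[< A t >] then u else v).
Proof.
move=> mA; apply: measurable_fun_ifT; [|exact: measurable_cst|exact: measurable_cst].
apply: (measurable_fun_bool true); rewrite setTI.
rewrite (_ : _ @^-1` _ = [set t | A t])//.
by apply/seteqP; split => t /= /asboolP.
Qed.

Lemma eq_covers a b s1 s2 : (forall y, covered s1 y <-> covered s2 y) ->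
  covers a b s1 <-> covers a b s2.
Proof. by move=> h; split => c q /c /h. Qed.

Lemma state_fun_ncov a b : state_fun (ncov a b).
Proof.
split.
- move=> d T s ms; apply: measurable_if_prop.
  exact: (measurable_covers ms (measurable_cst a) (measurable_cst b)).
- by move=> s; rewrite /ncov; case: ifP; rewrite ?lexx ler01.
- move=> s1 s2 [c12 _]; rewrite /ncov; congr (if _ then _ else _).
  by apply/asboolP/asboolP => /(eq_covers a b c12).
Qed.

Lemma covers_all a b v s : a < b -> covers a b s -> btw a b v -> covered s v.
Proof.
move=> ab cab /btwP[/andP[av vb]|/andP[bv va]]; last by move: (lt_le_trans ab (le_trans bv va)); rewrite ltxx.
apply: contrapT => /not_covered_ball[r r0 hr].
have [q] : exists q : rat, (ratr q : R) \in `]Num.max a (v - r), Num.min b (v + r)[.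
  apply: rat_in_itvoo; rewrite lt_min !gt_max ab ltrBlDr /=.
  rewrite (le_lt_trans av) ?ltrDl//= (lt_le_trans (_ : v < b + r)) ?(le_lt_trans vb) ?ltrDl//=.
  lra.
rewrite in_itv/= gt_max lt_min => /andP[/andP[aq vq] /andP[qb qv]].
apply: (hr (ratr q)); first by rewrite ltr_norml; lra.
by apply: cab; apply/btwP; left; rewrite !ltW.
Qed.

Lemma covers_cons a b c s : covers a b s -> covers a b (c :: s).
Proof. by case: c => u v h q /h h'; apply/covered_cons; right. Qed.

Lemma covers_joined a b p : a < b -> p < b -> covers a b [:: (b, Num.max a p); (a, p)].
Proof.
move=> ab pb r /btwP bt; apply/covered_cons.
have [cr|rc] := leP (Num.max a p) (ratr r).
  by left; apply/btwP; right; rewrite cr /=; case: bt => /andP[h1 h2]; lra.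
right; apply/covered_cons; left; apply/btwP; left; move: rc.
have [lp|pl] := leP a p => rc; first by rewrite [_ <= p]ltW// andbT; case: bt => /andP[h1 h2]; lra.
by exfalso; case: bt => /andP[h1 h2]; lra.
Qed.

Lemma covered_above a p y : Num.max a p <= y ->
  covered [:: (a, p)] y <-> covered [:: (Num.max a p, Num.max a p)] y.
Proof.
move=> cy; rewrite covered_cons covered_pt; split => -[h1|h1]; [|by right| |by right].
  left; apply/eqP; rewrite eq_le cy andbT; move: cy h1.
  by have [lp|pl] := leP a p => cy /btwP [] /andP[]; lra.
by left; rewrite h1; have [lp|pl] := leP a p; [exact: btwr|exact: btwl].
Qed.

Definition uncov v s : R := if `[< covered s v >] then 0 else 1.

Lemma state_fun_uncov v : state_fun (uncov v).
Proof.
split.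
- by move=> d T s ms; apply: measurable_if_prop; exact: (measurable_covered ms (measurable_cst v)).
- by move=> s; rewrite /uncov; case: ifP; rewrite ?lexx ler01.
- move=> s1 s2 [c12 _]; rewrite /uncov; congr (if _ then _ else _).
  by apply/asboolP/asboolP => /c12.
Qed.

Definition incr_fun (g : seq (R * R) -> R) := forall c s, g s <= g (c :: s).
Definition decr_fun (g : seq (R * R) -> R) := forall c s, g (c :: s) <= g s.

Lemma decr_uncov v : decr_fun (uncov v).
Proof.
move=> [u w] s; rewrite /uncov; case: asboolP => h; case: asboolP => h' //.
by exfalso; apply: h; apply/covered_cons; right.
Qed.

End coverage.

(** * Iterated steps from a list of starting points *)

Section attachments.
Context {R : realType} (kappa : {sigma_finite_measure set (measurableTypeR R) -> \bar R}).
Context d (Omega : measurableType d) (P : probability Omega R).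
Variables (x : R) (B : R -> Omega -> R) (e : Omega -> R).
Hypothesis mwc : motion_with_clock kappa P x B e.
Hypothesis kappa0 : kappa setT != 0%E.
Local Notation Xt := (exit kappa x B e).
Local Notation Tt := (exit_at kappa x B e).
Local Notation K := (kern kappa P x B e).
Local Notation h := (hit kappa P x B e).
Local Notation att := (attach kappa P x B e).
Implicit Types (s : seq (R * R)) (g : seq (R * R) -> R) (l : seq R).

Let kr := mwc_radon mwc.

Definition attach_seq l g : seq (R * R) -> R := foldr att g l.

Lemma bdd_meas_fun g s a b : meas_fun g -> bdd (fun p => g ((a, p) :: (b s))).
Proof.
move=> [mg g01]; split; last by exists 1.
exact: (mg _ _ _ (mstate_cons (measurable_cst a) (@measurable_id _ R setT) (mstate_cst _ (b s)))).
Qed.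

Lemma meas_fun_attach z g : meas_fun g -> meas_fun (att z g).
Proof.
move=> sg; have [mg g01] := sg; split.
- move=> d' T s ms.
  apply: (measurable_kern_param mwc (phi := fun y : T * R => g ((z, y.2) :: s y.1)) ms (measurable_cst z)).
    apply: mg; apply: mstate_cons; [exact: measurable_cst|exact: measurable_snd|].
    exact: (mstate_comp ms (@measurable_fst _ _ T R)).
  by move=> y; have /andP[] := g01 ((z, y.2) :: s y.1).
- move=> s; apply: (kern01 mwc kappa0); first by have [] := bdd_meas_fun s z id sg.
  by move=> v; exact: g01.
Qed.

Lemma meas_fun_attach_seq l g : meas_fun g -> meas_fun (attach_seq l g).
Proof. by move=> mg; elim: l => //= z l IH; exact: meas_fun_attach. Qed.

Lemma state_fun_attach_seq l g : state_fun g -> state_fun (attach_seq l g).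
Proof. by move=> mg; elim: l => //= z l IH; exact: (state_fun_attach mwc kappa0). Qed.

Lemma attach_le z g g' s : meas_fun g -> meas_fun g' ->
  (forall p, g ((z, p) :: s) <= g' ((z, p) :: s)) -> att z g s <= att z g' s.
Proof.
move=> mg mg' le; apply: (kern_le mwc kappa0 (bdd_meas_fun s z id mg) (bdd_meas_fun s z id mg')).
by apply: aeW => w _ _; exact: le.
Qed.

Lemma attach_seq_le l g g' s : meas_fun g -> meas_fun g' -> (forall s, g s <= g' s) ->
  attach_seq l g s <= attach_seq l g' s.
Proof.
move=> mg mg' le; elim: l s => [|z l IH] s; first exact: le.
by apply: attach_le => [||p]; [exact: meas_fun_attach_seq|exact: meas_fun_attach_seq|exact: IH].
Qed.

Lemma attach_cst z s (k : R) : 0 <= k -> att z (fun=> k) s = k.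
Proof. exact: (kern_cst mwc). Qed.

Lemma attach_incr z g s : meas_fun g -> incr_fun g -> g s <= att z g s.
Proof.
move=> mg ig; have [_ g01] := mg; have /andP[g0 _] := g01 s.
rewrite -{1}(kern_cst mwc s z g0); apply: (kern_le mwc kappa0 (bdd_cst g0) (bdd_meas_fun s z id mg)).
by apply: aeW => w _ _; exact: ig.
Qed.

Lemma attach_decr z g s : meas_fun g -> decr_fun g -> att z g s <= g s.
Proof.
move=> mg ig; have [_ g01] := mg; have /andP[g0 _] := g01 s.
rewrite -[leRHS](kern_cst mwc s z g0); apply: (kern_le mwc kappa0 (bdd_meas_fun s z id mg) (bdd_cst g0)).
by apply: aeW => w _ _; exact: ig.
Qed.

Lemma attach_seq_incr l g s : meas_fun g -> incr_fun g -> g s <= attach_seq l g s.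
Proof.
move=> mg ig; elim: l s => [|z l IH] s //=.
apply: (le_trans (attach_incr z s mg ig)); by apply: attach_le => [||p]; [exact: mg|exact: meas_fun_attach_seq|exact: IH].
Qed.

Lemma attach_seq_decr l g s : meas_fun g -> decr_fun g -> attach_seq l g s <= g s.
Proof.
move=> mg ig; elim: l s => [|z l IH] s //=.
apply: (le_trans _ (attach_decr z s mg ig)); by apply: attach_le => [||p]; [exact: meas_fun_attach_seq|exact: mg|exact: IH].
Qed.

Lemma attach_seq_cat l1 l2 g : attach_seq (l1 ++ l2) g = attach_seq l1 (attach_seq l2 g).
Proof. by rewrite /attach_seq foldr_cat. Qed.

Lemma attach_seq_move l1 l2 z g : state_fun g ->
  attach_seq (l1 ++ z :: l2) g = attach_seq (z :: l1 ++ l2) g.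
Proof.
move=> sg; elim: l1 => [|y l1 IH]; first exact: erefl.
apply/funext => s; apply: (etrans (congr1 (fun f => att y f s) IH)).
exact: (attach_exchange mwc kappa0 s y z (state_fun_attach_seq (l1 ++ l2) sg)).
Qed.

Lemma attach_seq_perm l1 l2 g : state_fun g -> perm_eq l1 l2 ->
  attach_seq l1 g = attach_seq l2 g.
Proof.
move=> sg; elim: l1 l2 => [|z l1 IH] l2; first by rewrite perm_sym => /perm_nilP ->.
move=> p12; have zl2 : z \in l2 by rewrite -(perm_mem p12) mem_head.
case/splitPr: zl2 p12 => a b; rewrite perm_sym perm_catC /= perm_cons perm_catC perm_sym => p12.
by rewrite attach_seq_move//= (IH _ p12).
Qed.

Lemma attach_seq_sub l l' g s : state_fun g -> decr_fun g ->
  (exists l2, perm_eq l (l' ++ l2)) -> attach_seq l g s <= attach_seq l' g s.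
Proof.
move=> sg dg [l2 p]; rewrite (attach_seq_perm sg p) attach_seq_cat.
have mg := state_fun_meas sg.
apply: attach_seq_le => // [|s']; first exact: meas_fun_attach_seq.
exact: attach_seq_decr.
Qed.

(** If the segment from [a] does not already contain [b], its edge facing [b] is [max a p], and the
    second motion completes the coverage when it stops there. This has probability [h b (max a p)],
    at least [h b a] by multiplicativity. *)
Lemma pair_cover a b : a < b -> attach_seq [:: a; b] (ncov a b) [::] <= 1 - h [::] b a.
Proof.
move=> ab; have hab1 := hit_le1 mwc [::] b a.
have k0 : 0 <= 1 - h [::] b a by rewrite subr_ge0.
have sn := state_fun_ncov a b; have mn := state_fun_meas sn.
rewrite /= -[leRHS](kern_cst mwc [::] a k0).
apply: (kern_le mwc kappa0 (bdd_meas_fun [::] a id (meas_fun_attach b mn)) (bdd_cst k0)).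
apply: aeW => w _ _; move: (Xt [::] a w) => p.
have [bp|pb] := leP b p.
  have cb : covered [:: (a, p)] b by apply/covered_cons; left; apply/btwP; left; rewrite bp ltW.
  rewrite (attach_covered mwc sn cb) /ncov ifT//; apply/asboolP => q /btwP bt.
  apply/covered_cons; left; apply/btwP; left.
  by case: bt => /andP[h1 h2]; apply/andP; split; lra.
pose c := Num.max a p.
have ac : a <= c by rewrite le_max lexx.
have cb : c < b by rewrite gt_max ab pb.
have mc : measurable ([set c] : set R) by exact: measurable_set1.
have bc := bdd_indic mc.
have b1 : bdd (fun q : R => 1 - \1_[set c] q : R).
  split; first by apply: measurable_funB; [exact: measurable_cst|exact: measurable_indic].
  by exists 1 => v; rewrite indicE; case: (_ \in _); rewrite ?subrr ?subr0 ?lexx ?ler01.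
have le_c : 1 - h [::] b c <= 1 - h [::] b a.
  have bt : btw b a c by apply/btwP; right; rewrite ac ltW.
  rewrite lerD2l lerN2 (hit_mul mwc [::] bt).
  exact: (ler_piMr (hit_ge0 kappa P x B e _ _ _) (hit_le1 mwc _ _ _)).
have le_ncov q : ncov a b [:: (b, q); (a, p)] <= 1 - \1_[set c] q.
  have [->|qc] := eqVneq q c; last first.
    rewrite [X in 1 - X]indicE memNset/=; last by move/eqP: qc.
    by rewrite subr0; have [_ g01 _] := sn; have /andP[] := g01 [:: (b, q); (a, p)].
  rewrite /ncov ifT; first by rewrite indicE mem_set// subrr.
  by apply/asboolP; exact: covers_joined.
have agree y : c <= y -> covered [:: (a, p)] y <-> covered [:: (c, c)] y by exact: covered_above.
have outside y : ~ c <= y -> exists u, [/\ c <= u, covered [:: (a, p)] u & btw b y u].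
  move=> /negP; rewrite -ltNge => yc; exists c; split => //=.
    by apply/covered_cons; left; rewrite /c; have [lp|pl] := leP a p; [exact: btwr|exact: btwl].
  by apply/btwP; right; rewrite !ltW.
have bb : bdd (fun q => ncov a b [:: (b, q); (a, p)]) := bdd_meas_fun [::] b (cons (a, p)) mn.
have E : att b (ncov a b) [:: (a, p)] = K [:: (c, c)] b (fun q => ncov a b [:: (b, q); (a, p)]).
  apply: (kern_eq mwc kappa0 bb bb); apply: aeW => w' rw' T1'.
  have [XE _] := @exit_local R kappa _ Omega x B e [set y | c <= y] [:: (a, p)] [:: (c, c)] b w' rw' (ltW cb) agree outside.
  by rewrite XE.
have K1 : K [:: (c, c)] b (fun q => 1 - \1_[set c] q) + h [::] b c = 1.
  rewrite (hitE mwc kappa0) -(kernD mwc _ _ b1 bc).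
  rewrite (_ : (fun v => _) = fun=> 1); last by apply/funext => v; rewrite subrK.
  exact: (kern_cst mwc _ _ ler01).
rewrite E; apply: le_trans le_c; rewrite lerBrDr -K1 lerD2r.
by apply: (kern_le mwc kappa0 bb b1); apply: aeW => w' _ _; exact: le_ncov.
Qed.

Lemma dense_between (u : nat -> R) a b : dense (range u) -> a < b -> exists i, a < u i < b.
Proof.
move=> du ab; have [|y [/= yab [i _ iy]]] := du `]a, b[%classic _ (itv_open _ _).
  by exists ((a + b) / 2); rewrite /= in_itv/=; apply/andP; split; lra.
by exists i; rewrite iy; move: yab; rewrite in_itv.
Qed.

Definition first_points (u : nat -> R) n : seq R := map u (iota 0 n).

Lemma first_points_two (u : nat -> R) i j n : injective u -> i != j -> (i < n)%N -> (j < n)%N ->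
  exists l2, perm_eq (first_points u n) ([:: u i; u j] ++ l2).
Proof.
move=> iu ij im jm.
have inn : i \in iota 0 n by rewrite mem_iota.
have jnn : j \in rem i (iota 0 n).
  by rewrite mem_rem_uniq ?iota_uniq// inE eq_sym ij mem_iota.
exists (map u (rem j (rem i (iota 0 n)))).
rewrite /first_points -[_ ++ _]/(map u [:: i, j & rem j (rem i (iota 0 n))]); apply: perm_map.
apply: (perm_trans (perm_to_rem inn)); rewrite perm_cons; exact: perm_to_rem.
Qed.

(** The sequence has two starting points close to [v], one on each side. Treated first, which
    exchangeability allows, they already cover [v] with probability close to 1. *)
Lemma uncovered_vanish (u : nat -> R) v eps : injective u -> dense (range u) -> 0 < eps ->
  exists N, forall n, (N <= n)%N -> attach_seq (first_points u n) (uncov v) [::] <= eps.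
Proof.
move=> iu du eps0; have [r r0 hr] := hit_near mwc (@covered_nil R v) eps0.
have lt1 : v - r < v by rewrite ltrBlDr ltrDl.
have lt2 : v < v + r by rewrite ltrDl.
have [i /andP[i1 i2]] := dense_between du lt1.
have [j /andP[j1 j2]] := dense_between du lt2.
have ij : i != j by apply/eqP => ij; move: (lt_trans i2 j1); rewrite ij ltxx.
exists (maxn i j).+1 => n; rewrite gtn_max => /andP[im jm].
have su := state_fun_uncov v; have sn := state_fun_ncov (u i) (u j).
apply: (le_trans (attach_seq_sub [::] su (@decr_uncov R v) (first_points_two iu ij im jm))).
apply: (@le_trans _ _ (attach_seq [:: u i; u j] (ncov (u i) (u j)) [::])).
  apply: attach_seq_le => [||s]; [exact: state_fun_meas su|exact: state_fun_meas sn|].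
  rewrite /uncov /ncov; case: asboolP => // nc; case: asboolP => // cc; exfalso; apply: nc.
  by apply: (covers_all (lt_trans i2 j1) cc); apply/btwP; left; rewrite !ltW.
apply: (le_trans (pair_cover (lt_trans i2 j1))).
rewrite lerBlDr addrC -lerBlDr; apply: hr; rewrite ltr_norml; apply/andP; split; lra.
Qed.

Lemma attach_seq_add l f f1 f2 s : meas_fun f -> meas_fun f1 -> meas_fun f2 ->
  (forall s, f s <= f1 s + f2 s) -> attach_seq l f s <= attach_seq l f1 s + attach_seq l f2 s.
Proof.
move=> mf m1 m2 le; elim: l s => [|z l IH] s; first exact: le.
have b0 := bdd_meas_fun s z id (meas_fun_attach_seq l mf).
have b1 := bdd_meas_fun s z id (meas_fun_attach_seq l m1).
have b2 := bdd_meas_fun s z id (meas_fun_attach_seq l m2).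
rewrite /= -[leRHS](kernD mwc s z b1 b2); apply: (kern_le mwc kappa0 b0 (bdd_add b1 b2)).
by apply: aeW => w _ _; exact: IH.
Qed.

(** The points of [l] are placed after the first [n] points of the sequence, where each is already
    covered with probability close to 1 and then changes nothing. Moving them to the front and using
    that [g] is increasing gives the comparison. *)
Lemma attach_limit g (u : nat -> R) l eps : state_fun g -> incr_fun g -> injective u ->
  dense (range u) -> 0 < eps -> exists N, forall n, (N <= n)%N ->
  attach_seq l g [::] <= attach_seq (first_points u n) g [::] + eps.
Proof.
move=> sg ig iu du eps0; have mg := state_fun_meas sg.
have [N HN] : exists N, forall n, (N <= n)%N ->
    attach_seq (first_points u n) (attach_seq l g) [::] <= attach_seq (first_points u n) g [::] + eps.
  elim: l eps eps0 => [|v l IH] eps eps0; first by exists 0%N => n _; rewrite /= lerDl ltW.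
  have e2 : 0 < eps / 2 by rewrite divr_gt0.
  have [N1 H1] := IH _ e2; have [N2 H2] := uncovered_vanish v iu du e2.
  exists (maxn N1 N2) => n; rewrite geq_max => /andP[n1 n2].
  have sl := state_fun_attach_seq l sg; have ml := state_fun_meas sl.
  have mu := state_fun_meas (state_fun_uncov v).
  apply: (le_trans (attach_seq_add _ _ (meas_fun_attach v ml) ml mu _)) => [s|].
    rewrite /uncov; case: asboolP => cv; first by rewrite (attach_covered mwc sl cv) addr0.
    have [_ f01] := meas_fun_attach v ml; have /andP[_ h1] := f01 s.
    have [_ g01] := ml; have /andP[h0 _] := g01 s.
    by apply: (le_trans h1); rewrite lerDr.
  apply: (le_trans (lerD (H1 n n1) (H2 n n2))).
  by rewrite -addrA lerD2l -splitr.
exists N => n Nn; apply: le_trans (HN n Nn).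
have pc : perm_eq (l ++ first_points u n) (first_points u n ++ l) by rewrite perm_catC.
rewrite -attach_seq_cat -(attach_seq_perm sg pc) attach_seq_cat.
apply: attach_seq_le => [||s]; [exact: mg|exact: meas_fun_attach_seq|exact: attach_seq_incr].
Qed.

End attachments.

Lemma eq_law_integral d1 d2 d (O1 : measurableType d1) (O2 : measurableType d2)
    (T : measurableType d) (R : realType) (P1 : probability O1 R) (P2 : probability O2 R)
    (X1 : O1 -> T) (X2 : O2 -> T) (g : T -> \bar R) :
  measurable_fun setT X1 -> measurable_fun setT X2 ->
  (forall A, measurable A -> P1 (X1 @^-1` A) = P2 (X2 @^-1` A)) ->
  measurable_fun setT g -> (forall y, (0 <= g y)%E) ->
  (\int[P1]_w g (X1 w) = \int[P2]_w g (X2 w))%E.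
Proof.
move=> m1 m2 h mg g0.
pose Y1 : {mfun O1 >-> T} := HB.pack X1 (isMeasurableFun.Build _ _ _ _ _ m1).
pose Y2 : {mfun O2 >-> T} := HB.pack X2 (isMeasurableFun.Build _ _ _ _ _ m2).
transitivity (\int[distribution P1 Y1]_y g y)%E.
  by rewrite ge0_integral_pushforward.
transitivity (\int[distribution P2 Y2]_y g y)%E; last first.
  by rewrite ge0_integral_pushforward.
by apply: eq_measure_integral => A mA _; exact: h.
Qed.

(** * Wilson's algorithm as a sequence of states *)

Section law_of_exit.
Context {R : realType} (kappa : {sigma_finite_measure set (measurableTypeR R) -> \bar R}).
Context d1 (O1 : measurableType d1) (P1 : probability O1 R).
Variables (x1 : R) (B1 : R -> O1 -> R) (e1 : O1 -> R).
Hypothesis mwc1 : motion_with_clock kappa P1 x1 B1 e1.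
Context d2 (O2 : measurableType d2) (P2 : probability O2 R).
Variables (x2 : R) (B2 : R -> O2 -> R) (e2 : O2 -> R).
Hypothesis mwc2 : motion_with_clock kappa P2 x2 B2 e2.

(** An exit point is a fixed measurable functional of the path and the exponential variable, whose
    joint law does not depend on the space. Every step can thus be computed in one reference
    model. *)
Lemma kern_law s z phi : bdd phi ->
  kern kappa P1 x1 B1 e1 s z phi = kern kappa P2 x2 B2 e2 s z phi.
Proof.
move=> [mphi [C hC]]; rewrite /kern; congr fine.
pose f (y : path * R) := (phi (exit_point s y.1 (killing_time kappa y.1 y.2)))%:E.
have mk := measurable_killing_time kappa (@measurable_fst _ _ (@path R) R) (@measurable_snd _ _ (@path R) R).
have mf : measurable_fun setT f.
  apply/measurable_EFinP; apply: (measurableT_comp mphi).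
  exact: (measurable_exit_point (mstate_cst _ s) (@measurable_fst _ _ (@path R) R) mk).
have f0 y : (0 <= f y)%E.
  by rewrite lee_fin; have /andP[] := hC (exit_point s y.1 (killing_time kappa y.1 y.2)).
apply: (etrans (started_clock_fubini mwc1 z mf f0)).
apply: (etrans _ (esym (started_clock_fubini mwc2 z mf f0))).
pose G (y : path) := (\int[P1]_w' f (y, e1 w'))%E.
have G2 y : G y = (\int[P2]_w' f (y, e2 w'))%E.
  apply: (@eq_law_integral _ _ _ O1 O2 (measurableTypeR R) R P1 P2 e1 e2 (fun u => f (y, u))
    (mwc_me mwc1) (mwc_me mwc2)).
  - by move=> A mA; rewrite (mwc_elaw mwc1 mA) (mwc_elaw mwc2 mA).
  - exact: (measurableT_comp mf (measurable_fun_pair (measurable_cst y) (@measurable_id _ R setT))).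
  - by move=> u; exact: f0.
have mG : measurable_fun setT G.
  pose F (y : path * O1) := f (y.1, e1 y.2).
  have mF : measurable_fun setT F.
    apply: (measurableT_comp mf); apply: measurable_fun_pair; first exact: measurable_fst.
    exact: (measurableT_comp (mwc_me mwc1) (@measurable_snd _ _ (@path R) O1)).
  exact: (@measurable_fun_fubini_tonelli_F _ _ (@path R) O1 R P1 F mF (fun=> f0 _)).
have G0 y : (0 <= G y)%E by apply: integral_ge0.
have mGz : measurable_fun setT (fun y : path => G (add_path z y)).
  exact: (measurableT_comp mG (measurable_add_path (measurable_cst z) (@measurable_id _ path setT))).
transitivity (\int[P1]_w G (add_path z (centered x1 B1 w)))%E; first by [].
transitivity (\int[P2]_w G (add_path z (centered x2 B2 w)))%E; last first.
  by apply: eq_integral => w _; rewrite G2.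
apply: (eq_law_integral (measurable_centered (mwc_BM mwc1)) (measurable_centered (mwc_BM mwc2)) _ mGz) => [A mA|y].
  exact: (brownian_law_unique (mwc_BM mwc1) (mwc_BM mwc2) mA).
exact: G0.
Qed.

Lemma attach_law z g s : meas_fun g ->
  attach kappa P1 x1 B1 e1 z g s = attach kappa P2 x2 B2 e2 z g s.
Proof. by move=> mg; apply: kern_law; exact: (bdd_meas_fun s z id mg). Qed.

End law_of_exit.

(** The passage from the given description to the functionals of paths: the given local times are a
    good density of the path, and the given lifetime agrees with [killing_time] almost surely. *)
Lemma killed_brownian_clock (R : realType) (kappa : {sigma_finite_measure set (measurableTypeR R) -> \bar R})
    d (Omega : measurableType d) (P : probability Omega R) x B zeta :
  radon_measure kappa -> killed_brownian_motion P kappa x B zeta ->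
  exists2 e, motion_with_clock kappa P x B e &
    {ae P, forall w, zeta w = killing_time kappa (started x B x w) (e w)}.
Proof.
move=> kr [ell [e [BM lt [me elaw] ind [mz zE]]]]; have [_ cB _ _] := BM.
have good : {ae P, forall w, good_path (B ^~ w) (fun y t => ell y t w)}.
  apply: filterS2 cB lt => w [_ cw] [cl occ]; split.
  - exact: within_cpath cw.
  - apply: (within_continuous_retract (A := [set yt : R * R | 0 <= yt.2]) (f := fun yt : R * R => ell yt.1 yt.2 w)
      (g := fun yt : R * R => (yt.1, Num.max 0 yt.2)) cl).
      apply: continuous_pair2; first by move=> y; exact: cvg_fst.
      move=> y; apply: (@continuous_comp _ _ _ snd (fun t : R => Num.max 0 t)); first exact: cvg_snd.
      exact: continuous_max0.
    by move=> y /=; rewrite le_max lexx.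
  - exact: occ.
have mwc : motion_with_clock kappa P x B e.
  by split => //; apply: filterS good => w gw; exists (fun y t => ell y t w).
exists e => //.
apply: filterS3 good (started_good mwc) zE => w gw [_ _ ew] ->.
have E : started x B x w = B ^~ w.
  by apply/funext => u; rewrite /started /add_path /centered addrC subrK.
rewrite E (killing_timeE kr gw ew); congr ereal_inf; apply/seteqP.
by split => _ [t [t0 h] <-]; exists t => //; split => //; move: h; rewrite (clockE kappa gw t0).
Qed.

(** * Comparison of one step with the algorithm *)

Section killed_exit.
Context {R : realType}.
Implicit Types (s : seq (R * R)) (w : R -> R) (Z : \bar R).

Lemma killed_exit_time s w Z : (0 < Z)%E ->
  exit_time s (fun t => if (t%:E < Z)%E then w t else 0) (Order.max 0%E Z) = exit_time s w Z.
Proof.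
move=> Z0; rewrite max_r ?ltW// /exit_time; congr ereal_sup; apply/seteqP.
split => _ [q [q0 qZ [m av]] <-]; exists q => //; split => //; exists m => q' q'0 q'q.
  have := av q' q'0 q'q; rewrite ifT//; apply: le_lt_trans qZ; by rewrite lee_fin.
by rewrite ifT; [exact: av|apply: le_lt_trans qZ; rewrite lee_fin].
Qed.

Lemma killed_exit_point s w Z : (0 < Z)%E ->
  exit_point s (fun t => if (t%:E < Z)%E then w t else 0) (Order.max 0%E Z) = exit_point s w Z.
Proof.
move=> Z0; rewrite /exit_point killed_exit_time//.
have W := exit_timeW s w Z; apply: eq_left_eval; first by rewrite Z0.
move=> u u0; case: (exit_time s w Z) W => [t| |] /= W ut; last 2 first.
- by move: (le_lt_trans u0 ut); rewrite ltxx.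
- by move: (le_lt_trans u0 ut); rewrite ltxx.
by rewrite ifT//; apply: lt_le_trans W; rewrite lte_fin.
Qed.

Lemma exit_time_sub s s' w Z : cpath w -> (forall y, covered s y -> covered s' y) ->
  (exit_time s' w Z <= exit_time s w Z)%E.
Proof.
move=> cw ss'; apply: ge_ereal_sup => _ [q [q0 qZ av] <-]; apply: ereal_sup_ubound; exists q => //.
split => //; apply/(avoidsP _ cw q0) => u uq cu; exact: ((avoidsP _ cw q0).1 av u uq (ss' _ cu)).
Qed.

(** The list keeps every segment drawn, not the components of the algorithm: the union and the roots
    are all that the next step sees. *)
Definition tracks (YJ : set R * set (set R)) s : Prop :=
  YJ.1 = [set y | root s y] /\ Defs.support YJ.2 = [set y | covered s y].

Lemma left_limit_cpath w t : cpath w -> 0 < t -> left_limit w t%:E = w t.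
Proof.
move=> cw t0; rewrite /left_limit/=.
apply: cvg_lim => //; apply: cvg_at_left_filter.
have := cw t; rewrite /continuous_at (max_r (ltW t0)); apply: cvg_trans.
apply: near_eq_cvg; near=> u; rewrite max_r//; apply: ltW; near: u.
exact: lt_nbhsr.
Unshelve. all: by end_near. Qed.

Lemma wilson_step_tracks x w Z s YJ : cpath w -> w 0 = x -> (0 < Z)%E ->
  (exit_time s w Z < +oo)%E -> tracks YJ s ->
  tracks (wilson_step x w Z YJ) ((x, exit_point s w Z) :: s).
Proof.
case: YJ => Y J cw w0 Z0 T1 [/= YE JE].
have seg a b y : segment a b y <-> btw a b y by rewrite /segment /btw /= in_itv.
rewrite /wilson_step JE; case: asboolP => [/= cx|/= ncx].
  have cw0 : covered s (w 0) by rewrite w0.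
  rewrite (exit_point_covered _ cw cw0) w0; have [h1 h2] := same_state_pt cx.
  by split => /=; rewrite ?YE ?JE; apply/seteqP; split => y /=; [move=> /h2|move=> /h2|move=> /h1|move=> /h1].
have ncw0 : ~ covered s (w 0) by rewrite w0.
have [t [Tt t0 [pt tZ] av end_]] := exit_pointP cw ncw0 Z0 T1.
have -> : Order.min Z (hitting_time w Z [set y | covered s y]) = t%:E.
  case: end_ => [Zt|ct].
    rewrite min_l ?Zt// /hitting_time; apply: le_ereal_inf_tmp => _ [u [u0 uZ cu] <-].
    rewrite lee_fin leNgt; apply/negP => ut; apply: (av u) => //.
    by rewrite u0.
  have [->|tZ'] := eqVneq Z t%:E.
    rewrite min_l// /hitting_time; apply: le_ereal_inf_tmp => _ [u [u0 uZ cu] <-].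
    rewrite lee_fin leNgt; apply/negP => ut; apply: (av u) => //.
    by rewrite u0.
  have ltZ : (t%:E < Z)%E by rewrite lt_neqAle eq_sym tZ'.
  have -> : hitting_time w Z [set y | covered s y] = t%:E.
    apply/eqP; rewrite eq_le; apply/andP; split.
      by apply: ereal_inf_lbound; exists t => //; split => //; exact: ltW.
    apply: le_ereal_inf_tmp => _ [u [u0 uZ cu] <-].
    rewrite lee_fin leNgt; apply/negP => ut; apply: (av u) => //.
    by rewrite u0.
  by rewrite min_r// ltW.
rewrite (left_limit_cpath cw t0) -pt; set p := exit_point s w Z.
case: asboolP => [/= cp|/= ncp].
  have [I [JI Ip]] : exists I, J I /\ I p.
    have : Defs.support J p by rewrite JE.
    by move=> [I JI Ip]; exists I.
  (* Whichever component containing [p] is selected, the union after the step is the same. *)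
  have [JI' I'p] : [set I | J I /\ I p] (xget set0 [set I | J I /\ I p]).
    exact: (@xgetPex _ set0 [set I | J I /\ I p] (ex_intro _ I (conj JI Ip))).
  set I' := xget _ _ in JI' I'p *.
  split => /=.
    rewrite YE; apply/seteqP; split => y /= h; first by left.
    by case: h => [//|[_ /= nc]]; exfalso; exact: nc.
  apply/seteqP; split => y.
    move=> [I'' [[JI'' _] Iy|-> [Iy|/seg sy]]].
    - by apply/covered_cons; right; have : Defs.support J y by [exists I''|]; rewrite JE.
    - by apply/covered_cons; right; have : Defs.support J y by [exists I'|]; rewrite JE.
    - by apply/covered_cons; left.
  move=> /covered_cons[/seg sy|cy].
    by exists (I' `|` segment x p); [right|right].
  have : Defs.support J y by rewrite JE.
  move=> [I'' JI'' Iy]; have [II|nII] := pselect (I'' = I').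
    by exists (I' `|` segment x p); [right|left; rewrite -II].
  by exists I'' => //; left; split.
split => /=.
  rewrite YE; apply/seteqP; split => y /=; first by move=> [h|->]; [left|right].
  by move=> [h|[-> _]]; [left|right].
apply/seteqP; split => y.
  move=> [I'' [JI'' Iy|-> /seg sy]]; apply/covered_cons; last by left.
  by right; have : Defs.support J y by [exists I''|]; rewrite JE.
move=> /covered_cons[/seg sy|cy]; first by exists (segment x p) => //; right.
have : Defs.support J y by rewrite JE.
by move=> [I'' JI'' Iy]; exists I'' => //; left.
Qed.

Lemma wilson_start_tracks x w Z : cpath w -> w 0 = x -> (0 < Z)%E ->
  (exit_time [::] w Z < +oo)%E ->
  tracks ([set left_limit w Z], [set segment x (left_limit w Z)]) [:: (x, exit_point [::] w Z)].
Proof.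
move=> cw w0 Z0 T1.
have [t [Tt t0 [pt tZ] _ [Zt|/covered_nil//]]] := exit_pointP cw (@covered_nil R (w 0)) Z0 T1.
rewrite [in left_limit w Z]Zt (left_limit_cpath cw t0) -pt; set p := exit_point _ _ _.
split => /=; apply/seteqP; split => y /=.
- by move=> ->; right; split => //; exact: covered_nil.
- by case=> [//|[->]].
- move=> [_ -> sy]; apply/covered_cons; left; move: sy.
  by rewrite /segment /btw /= in_itv.
- by move=> /covered_cons[sy|/covered_nil//]; exists (segment x p) => //.
Qed.

End killed_exit.

(** * The random state after [n] steps and its law *)

Section run.
Context {R : realType} (kappa : {sigma_finite_measure set (measurableTypeR R) -> \bar R}).
Hypothesis kr : radon_measure kappa.
Hypothesis kappa0 : kappa setT != 0%E.
Context d (Omega : measurableType d) (P : probability Omega R).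
Variables (x : nat -> R) (B : nat -> R -> Omega -> R) (zeta : nat -> Omega -> \bar R).
Hypothesis kbm : forall n, killed_brownian_motion P kappa (x n) (B n) (zeta n).
Hypothesis ind : mutually_independent P (fun n => killed_path_sigma (B n) (zeta n)).
Local Notation F := (fun n => killed_path_sigma (B n) (zeta n)).

(* The motion after its lifetime is replaced by 0, so that the independence of the
   killed paths applies. *)
Definition kpath n w : @path R := fun t : R => if (t%:E < zeta n w)%E then B n t w else 0.
Definition kzeta n w : \bar R := Order.max 0%E (zeta n w).

(** [run n] has treated [n] starting points, so stage [n] of the algorithm corresponds to
    [run n.+1]. *)
Fixpoint run n w : seq (R * R) :=
  if n is m.+1 then (x m, exit_point (run m w) (kpath m w) (kzeta m w)) :: run m w else [::].

Lemma killed_sigma n : sigma_algebra setT (F n).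
Proof. exact: smallest_sigma_algebra. Qed.

Lemma killed_measurable n : F n `<=` measurable.
Proof.
have [ell [e [[mB _ _ _] _ _ _ [mz _]]]] := kbm n.
apply: smallest_sub; first exact: sigma_algebra_measurable.
move=> _ [t [A [t0 mA ->]]]; apply: measurable_and.
  by apply: measurable_lteE => //; exact: measurable_cst.
exact: (measurable_preim (mB t t0) mA).
Qed.

Definition past_type n := g_sigma_algebraType (\bigcup_(i in `I_n) F i).

Lemma past_measurable_fun n m d' (T : measurableType d') (f : Omega -> T) : (n < m)%N ->
  (forall A, measurable A -> F n (f @^-1` A)) -> measurable_fun setT (f : past_type m -> T).
Proof.
move=> nm h _ A mA; rewrite setTI; apply: sub_gen_smallest; exists n => //; exact: h.
Qed.

Lemma killed_kzeta n A : measurable A -> F n (kzeta n @^-1` A).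
Proof.
pose T := g_sigma_algebraType [set C | exists t, exists A : set (measurableTypeR R),
  [/\ 0 <= t, measurable A & C = [set w | (t%:E < zeta n w)%E /\ A (B n t w)]] ].
have m : measurable_fun setT (kzeta n : T -> \bar R).
  apply: (measurability _ (ErealGenOInfty.measurableE R)) => _ [_ [c ->] <-]; rewrite setTI.
  have [c0|c0] := leP 0 c.
    apply: sub_gen_smallest; exists c, setT; split => //.
    by apply/seteqP; split => w /=; rewrite in_itv/= andbT /kzeta lt_max lte_fin [c < 0]ltNge c0 /=; [move=> h|case].
  rewrite (_ : _ @^-1` _ = setT); first exact: measurableT.
  by apply/seteqP; split => w //= _; rewrite in_itv/= andbT /kzeta lt_max lte_fin c0.
by move=> mA; have := m measurableT A mA; rewrite setTI.
Qed.

Lemma killed_kpath n A : measurable A -> F n (kpath n @^-1` A).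
Proof.
pose T := g_sigma_algebraType [set C | exists t, exists A : set (measurableTypeR R),
  [/\ 0 <= t, measurable A & C = [set w | (t%:E < zeta n w)%E /\ A (B n t w)]] ].
have m : measurable_fun setT (kpath n : T -> path).
  apply: measurable_path => t t0 _ C mC; rewrite setTI.
  have gen (D : set R) : measurable (D : set (measurableTypeR R)) ->
      measurable ([set w | (t%:E < zeta n w)%E /\ D (B n t w)] : set T).
    by move=> mD; apply: sub_gen_smallest; exists t, D.
  rewrite (_ : _ @^-1` _ = [set w | (t%:E < zeta n w)%E /\ C (B n t w)] `|`
      (~` [set w | (t%:E < zeta n w)%E /\ setT (B n t w)] `&` [set _ | C 0])).
    apply: measurableU; first exact: gen.
    apply: measurableI; last exact: measurable_cst_event.
    by apply: measurableC; exact: gen.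
  apply/seteqP; split => w /=; rewrite /kpath.
    case: ifP => h Cw; [by left|right; split => //].
    by move=> [hh _]; rewrite hh in h.
  case=> [[-> //]|[nh C0]]; case: ifP => // h.
  by exfalso; apply: nh.
by move=> mA; have := m measurableT A mA; rewrite setTI.
Qed.

Lemma mstate_run n m : (n <= m)%N -> mstate (run n : past_type m -> seq (R * R)).
Proof.
elim: n => [|n IH] nm; first exact: mstate_nil.
have ms := IH (ltnW nm).
have mk : measurable_fun setT (kpath n : past_type m -> path).
  by apply: (past_measurable_fun nm) => A; exact: killed_kpath.
have mz : measurable_fun setT (kzeta n : past_type m -> \bar R).
  by apply: (past_measurable_fun nm) => A; exact: killed_kzeta.
exact: (mstate_cons (measurable_cst (x n)) (measurable_exit_point ms mk mz) ms).
Qed.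

Lemma past_type_measurable n (A : set (past_type n)) : measurable A -> measurable (A : set Omega).
Proof. exact: (past_sigma_measurable killed_measurable). Qed.

Lemma mstate_run_full n : mstate (run n : Omega -> seq (R * R)).
Proof.
apply: (@mstate_comp R _ _ (past_type n) Omega (run n) id (mstate_run (leqnn n))).
move=> _ A mA; rewrite setTI preimage_id; exact: (past_type_measurable mA).
Qed.

Context d0 (O0 : measurableType d0) (P0 : probability O0 R).
Variables (x0 : R) (B0 : R -> O0 -> R) (e0 : O0 -> R).
Hypothesis mwc0 : motion_with_clock kappa P0 x0 B0 e0.

(** The next killed path is independent of the past, so the current state can be frozen. What
    remains is one step from a fixed state, with the same law in the reference model. *)
Lemma run_attach n f : meas_fun f ->
  (\int[P]_w (f (run n.+1 w))%:E = \int[P]_w (attach kappa P0 x0 B0 e0 (x n) f (run n w))%:E)%E.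
Proof.
move=> mf; have [mff f01] := mf.
have [e mwc zE] := killed_brownian_clock kr (kbm n).
pose g (y : past_type n * (path * \bar R)) : \bar R :=
  (f ((x n, exit_point (run n y.1) y.2.1 y.2.2) :: run n y.1))%:E.
have m1 := @measurable_fst _ _ (past_type n) (@path R * \bar R)%type.
have m2 := @measurable_snd _ _ (past_type n) (@path R * \bar R)%type.
have ms := mstate_comp (mstate_run (leqnn n)) m1.
have mg : measurable_fun setT g.
  have m21 := measurableT_comp (@measurable_fst _ _ (@path R) (\bar R)) m2.
  have m22 := measurableT_comp (@measurable_snd _ _ (@path R) (\bar R)) m2.
  apply/measurable_EFinP; apply: mff.
  exact: (mstate_cons (measurable_cst (x n)) (measurable_exit_point ms m21 m22) ms).
have g0 y : (0 <= g y)%E.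
  by rewrite lee_fin; have /andP[] := f01 ((x n, exit_point (run n y.1) y.2.1 y.2.2) :: run n y.1).
have ip : independent2 P (past_sigma F n) (F n) :=
  mutually_independent_past killed_sigma killed_measurable ind.
have pm := @past_sigma_measurable _ _ _ killed_measurable n.
have mY A : measurable A -> F n ((fun w => (kpath n w, kzeta n w) : path * \bar R) @^-1` A).
  pose T := g_sigma_algebraType [set C | exists t, exists A : set (measurableTypeR R),
    [/\ 0 <= t, measurable A & C = [set w | (t%:E < zeta n w)%E /\ A (B n t w)]] ].
  have mk : measurable_fun setT (kpath n : T -> path) by move=> _ C mC; rewrite setTI; exact: killed_kpath.
  have mz : measurable_fun setT (kzeta n : T -> \bar R) by move=> _ C mC; rewrite setTI; exact: killed_kzeta.
  have mp := measurable_fun_pair mk mz.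
  by move=> mA; have := mp measurableT A mA; rewrite setTI.
transitivity (\int[P]_w g (w : past_type n, (kpath n w, kzeta n w)))%E; first by [].
rewrite (indep2_fubini (X := id : Omega -> past_type n) pm (@killed_measurable n) ip (fun A mA => mA) mY mg g0).
apply: eq_integral => w _; rewrite (attach_law mwc0 mwc _ _ mf) -(kernE mwc); last exact: (bdd_meas_fun (run n w) (x n) id mf).
have mr : measurable_fun setT (fun w' => (f ((x n, exit kappa (x n) (B n) e (run n w) (x n) w') :: run n w))%:E).
  apply: (measurable_kern mwc (run n w) (x n) (phi := fun p => f ((x n, p) :: run n w))).
  by have [] := bdd_meas_fun (run n w) (x n) id mf.
have mYT : measurable_fun setT (fun w' => (kpath n w', kzeta n w') : path * \bar R).
  by move=> _ A mA; rewrite setTI; apply: (@killed_measurable n); exact: mY.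
have ml : measurable_fun setT (fun w' => g (w : past_type n, (kpath n w', kzeta n w'))).
  exact: (measurableT_comp mg (measurable_fun_pair (measurable_cst (w : past_type n)) mYT)).
apply: (ge0_ae_eq_integral measurableT ml mr (fun _ _ => g0 _)) => [w' _|].
  by rewrite lee_fin; have /andP[] := f01 ((x n, exit kappa (x n) (B n) e (run n w) (x n) w') :: run n w).
apply: filterS2 (regular_ae mwc) zE => w' [gz s0 ew] zw _.
have [ell gw] := gz (x n).
have Z0 : (0 < zeta n w')%E by rewrite zw; exact: (killing_time_gt0 kr gw ew).
rewrite /g/= /kpath /kzeta killed_exit_point// zw.
have -> // : (fun t : R => B n t w') = started (x n) (B n) (x n) w'.
by apply/funext => u; rewrite /started /add_path /centered addrC subrK.
Qed.

Lemma run_law n f : meas_fun f ->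
  (\int[P]_w (f (run n w))%:E = (attach_seq kappa P0 x0 B0 e0 (first_points x n) f [::])%:E)%E.
Proof.
elim: n f => [|n IH] f mf; first by rewrite /= integral_cst_prob.
rewrite (run_attach n mf) (IH _ (meas_fun_attach mwc0 kappa0 (x n) mf)).
have -> : first_points x n.+1 = first_points x n ++ [:: x n].
  by rewrite /first_points -addn1 iotaD map_cat.
by rewrite attach_seq_cat.
Qed.

Lemma run_covers n m w : (m < n)%N -> covered (run n w) (x m).
Proof.
elim: n => // n IH; rewrite ltnS leq_eqVlt => /orP[/eqP ->|mn].
  by apply/covered_cons; left; exact: btwl.
by apply/covered_cons; right; exact: IH.
Qed.

Lemma wilson_run : {ae P, forall w, forall n,
  tracks (wilson x (fun n t => B n t w) (fun n => zeta n w) n) (run n.+1 w)}.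
Proof.
have step n : {ae P, forall w, [/\ cpath (fun t : R => B n t w), B n 0 w = x n,
    (0 < zeta n w)%E & (exit_time (run n w) (fun t : R => B n t w) (zeta n w) < +oo)%E]}.
  have [e mwc zE] := killed_brownian_clock kr (kbm n).
  (* [exit_finite] concerns fixed states; a fixed state contained in the random [run n] gives an
     upper bound for its exit time. *)
  have fin := exit_finite mwc kappa0 (if n is 0%N then [::] else [:: (x 0%N, x 0%N)]) (x n).
  apply: filterS3 (regular_ae mwc) zE fin => w rw zw f1; have [gz s0 ew] := rw.
  have [ell gw] := gz (x n); have cw := good_cpath gw.
  have E : (fun t : R => B n t w) = started (x n) (B n) (x n) w.
    by apply/funext => u; rewrite /started /add_path /centered addrC subrK.
  have s0' := s0 (x n); have b0 := congr1 (fun b : R -> R => b 0) E.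
  rewrite E; split; [exact: cw|exact: (etrans b0 s0')| |].
    by rewrite zw; exact: (killing_time_gt0 kr gw ew).
  rewrite zw; apply: (le_lt_trans _ f1); apply: exit_time_sub => //.
  case: (n) => [y /covered_nil//|k y /covered_pt[->|/covered_nil//]].
  exact: run_covers.
have all : {ae P, forall w, forall n, [/\ cpath (fun t : R => B n t w), B n 0 w = x n,
    (0 < zeta n w)%E & (exit_time (run n w) (fun t : R => B n t w) (zeta n w) < +oo)%E]}.
  exact: ae_foralln step.
apply: filterS all => w good; elim=> [|n IH].
  have [cw w0 Z0 T1] := good 0%N.
  rewrite [run 1 w]/= killed_exit_point//; exact: wilson_start_tracks.
have [cw w0 Z0 T1] := good n.+1.
rewrite [run n.+2 w]/= killed_exit_point//; exact: (wilson_step_tracks cw w0 Z0 T1 IH).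
Qed.

End run.

Lemma prob_near1 d (T : measurableType d) (R : realType) (P : probability T R) (E : set T) :
  measurable E -> (forall eps : R, 0 < eps -> ((1 - eps)%:E <= P E)%E) -> {ae P, forall w, E w}.
Proof.
move=> mE h; apply: prob_ae1 => //; apply/eqP; rewrite eq_le probability_le1//=.
apply/lee_addgt0Pr => eps eps0.
have fE : P E = (fine (P E))%:E by rewrite fineK// fin_num_measure.
by have := h _ eps0; rewrite fE -EFinD !lee_fin; lra.
Qed.

Lemma limn_einf_ge (R : realType) (u : nat -> \bar R) (m : \bar R) K :
  (forall k, (K <= k)%N -> (m <= u k)%E) -> (m <= limn_einf u)%E.
Proof.
move=> h; rewrite limn_einf_lim; apply: lime_ge; first exact: is_cvg_einfs.
near=> n; apply: le_ereal_inf_tmp => _ [k /= nk <-]; apply: h.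
by apply: leq_trans nk; near: n; exists K.
Unshelve. all: by end_near. Qed.

Lemma limn_einf_le (R : realType) (u : nat -> \bar R) (m : \bar R) :
  (forall k, (u k <= m)%E) -> (limn_einf u <= m)%E.
Proof.
move=> h; rewrite limn_einf_lim; apply: lime_le; first exact: is_cvg_einfs.
near=> n; apply: le_trans (h n); apply: ereal_inf_lbound; exists n => //=.
Unshelve. all: by end_near. Qed.

(** Divided by the product [p] of the factors, this bounds the sum of their defects by [1 / p - 1]
    whatever [n] is, and so the mean number of uncovered cells uniformly in the mesh. *)
Lemma sum_defect_le (R : realType) (h : nat -> R) n : (forall i, 0 <= h i <= 1) ->
  (\sum_(i < n) (1 - h i)) * \prod_(i < n) h i <= 1 - \prod_(i < n) h i /\
  0 <= \prod_(i < n) h i <= 1.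
Proof.
move=> h01; elim: n => [|n [IH /andP[p0 p1]]]; first by rewrite !big_ord0 mul0r subrr lexx ler01 lexx.
rewrite !big_ord_recr /=; move: IH p0 p1.
set S := \sum_(i < n) _; set p := \prod_(i < n) _ => IH p0 p1.
have /andP[a0 a1] := h01 n; split; last by rewrite mulr_ge0//= mulr_ile1.
have : S * p * h n <= (1 - p) * h n by rewrite ler_wpM2r.
have : 0 <= (1 - h n) * (1 - p * h n).
  by apply: mulr_ge0; rewrite subr_ge0// mulr_ile1.
by nra.
Qed.

Section state_events.
Context {R : realType}.
Implicit Types (s : seq (R * R)) (E : seq (R * R) -> Prop).

Definition state_event E : Prop :=
  [/\ forall d (T : measurableType d) (s : T -> seq (R * R)), mstate s -> measurable [set t | E (s t)],
      forall s1 s2, same_state s1 s2 -> E s1 -> E s2 &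
      forall c s, E s -> E (c :: s)].

Definition event_fun E s : R := if `[< E s >] then 1 else 0.

Lemma state_fun_event E : state_event E -> state_fun (event_fun E).
Proof.
move=> [mE sE iE]; split => [d T s ms|s|s1 s2 ss].
- exact: measurable_if_prop (mE _ _ _ ms).
- by rewrite /event_fun; case: ifP => _; rewrite ?lexx ?ler01.
- rewrite /event_fun (_ : E s1 = E s2)//; apply/propext.
  by split; apply: sE => //; exact: same_state_sym.
Qed.

Lemma incr_fun_event E : state_event E -> incr_fun (event_fun E).
Proof.
move=> [_ _ iE] c s; rewrite /event_fun; case: asboolP => [/(iE c)/asboolP -> //|_].
by case: ifP => _; rewrite ?ler01.
Qed.

Lemma state_event_covers a b : state_event (covers a b).
Proof.
split => [d T s ms|s1 s2 [ss _] /(eq_covers a b ss)//|c s].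
  exact: (measurable_covers ms (measurable_cst a) (measurable_cst b)).
exact: covers_cons.
Qed.

End state_events.

(** * Points that are never covered *)

Section breaks.
Context {R : realType} (kappa : {sigma_finite_measure set (measurableTypeR R) -> \bar R}).
Hypothesis kr : radon_measure kappa.
Hypothesis kappa0 : kappa setT != 0%E.
Context d (Omega : measurableType d) (P : probability Omega R).
Variables (x : nat -> R) (B : nat -> R -> Omega -> R) (zeta : nat -> Omega -> \bar R).
Hypothesis xinj : injective x.
Hypothesis xdense : dense (range x).
Hypothesis kbm : forall n, killed_brownian_motion P kappa (x n) (B n) (zeta n).
Hypothesis ind : mutually_independent P (fun n => killed_path_sigma (B n) (zeta n)).
Context d0 (O0 : measurableType d0) (P0 : probability O0 R).
Variables (x0 : R) (B0 : R -> O0 -> R) (e0 : O0 -> R).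
Hypothesis mwc0 : motion_with_clock kappa P0 x0 B0 e0.
Local Notation run := (run x B zeta).
Local Notation W := (attach_seq kappa P0 x0 B0 e0).
Local Notation h := (hit kappa P0 x0 B0 e0).

Lemma run_event_prob n E : state_event E ->
  P [set w | E (run n w)] = (W (first_points x n) (event_fun E) [::])%:E.
Proof.
move=> sE; rewrite -(run_law kr kappa0 kbm ind mwc0 n (state_fun_meas (state_fun_event sE))).
have [mE _ _] := sE; have mEn := mE _ _ _ (mstate_run_full kbm n).
rewrite -[X in P X]setIT -(integral_indic P measurableT mEn).
apply: eq_integral => w _; rewrite indicE /event_fun.
by case: asboolP => h; [rewrite mem_set|rewrite memNset].
Qed.

Lemma measurable_run_event E : state_event E -> measurable [set w | exists n, E (run n w)].
Proof. by move=> [mE _ _]; apply: measurable_exists => n; exact: mE (mstate_run_full kbm n). Qed.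

Lemma run_event_limit l E : state_event E ->
  ((W l (event_fun E) [::])%:E <= P [set w | exists n, E (run n w)])%E.
Proof.
move=> sE; have [mE _ _] := sE; apply/lee_addgt0Pr => eps eps0.
have [N hN] := attach_limit mwc0 kappa0 l (state_fun_event sE) (incr_fun_event sE) xinj xdense eps0.
have {hN} hN := hN N (leqnn N).
apply: (@le_trans _ _ ((W (first_points x N) (event_fun E) [::])%:E + eps%:E)%E).
  by rewrite -EFinD lee_fin.
rewrite -(run_event_prob N sE); apply: leeD2r; apply: le_measure; rewrite ?inE.
- exact: mE (mstate_run_full kbm N).
- exact: measurable_run_event.
- by move=> w EN; exists N.
Qed.

Definition joined a b w : Prop := exists n, covers a b (run n w).

Lemma measurable_joined a b : measurable [set w | joined a b w].
Proof. exact: measurable_run_event (state_event_covers a b). Qed.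

Lemma run_mono (E : seq (R * R) -> Prop) n m w : (forall c s, E s -> E (c :: s)) -> (n <= m)%N -> E (run n w) -> E (run m w).
Proof.
move=> iE; elim: m => [|m IH]; first by rewrite leqn0 => /eqP ->.
by rewrite leq_eqVlt => /orP[/eqP -> //|nm /(IH nm)]; exact: iE.
Qed.

Lemma joined_cat a b b' c w : a <= b' -> b' <= b -> b <= c -> joined a b w -> joined b' c w -> joined a c w.
Proof.
move=> ab bb bc [n hn] [m hm]; exists (maxn n m) => q /btwP[/andP[aq qc]|/andP[cq qa]].
  have [qb|bq] := leP (ratr q) b.
    have := run_mono (covers_cons (a := a) (b := b)) (leq_maxl n m) hn; apply; apply/btwP; left.
    by rewrite aq.
  have := run_mono (covers_cons (a := b') (b := c)) (leq_maxr n m) hm; apply; apply/btwP; left.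
  by rewrite qc andbT (le_trans bb (ltW bq)).
have := run_mono (covers_cons (a := a) (b := b)) (leq_maxl n m) hn; apply; apply/btwP; left.
by apply/andP; split; lra.
Qed.

Lemma joined_sub a b a' b' w : a <= a' -> a' <= b' -> b' <= b -> joined a b w -> joined a' b' w.
Proof.
move=> aa ab bb [n hn]; exists n => q /btwP[/andP[h1 h2]|/andP[h1 h2]]; apply: hn; apply/btwP; left;
  by apply/andP; split; lra.
Qed.

Lemma joined_prob a b : a < b -> ((h [::] b a)%:E <= P [set w | joined a b w])%E.
Proof.
move=> ab; apply: le_trans (run_event_limit [:: a; b] (state_event_covers a b)); rewrite lee_fin.
have mc := state_fun_meas (state_fun_event (state_event_covers a b)).
have mn := state_fun_meas (state_fun_ncov a b).
have m1 : meas_fun (fun _ : seq (R * R) => 1 : R).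
  by split => [? ? ? _|s]; [exact: measurable_cst|rewrite ler01 lexx].
have le s : 1 <= event_fun (covers a b) s + ncov a b s.
  by rewrite /event_fun /ncov; case: ifP => _; rewrite ?addr0 ?add0r.
have := attach_seq_add mwc0 kappa0 [:: a; b] [::] m1 mc mn le.
have -> : W [:: a; b] (fun=> 1) [::] = 1.
  have E z : attach kappa P0 x0 B0 e0 z (fun=> 1) = fun=> 1.
    by apply/funext => s; exact: (attach_cst mwc0 z s (@ler01 R)).
  by rewrite /attach_seq /= !E.
have := pair_cover mwc0 kappa0 ab; move: (W _ _ _) (W _ _ _) (h _ _ _) => u v k.
lra.
Qed.

Definition broken (v : R) w : Prop := forall a b : rat, ratr a < v < ratr b -> ~ joined (ratr a) (ratr b) w.

(** A rational interval around [v] is covered with probability at least the corresponding [h], which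
    is close to 1 when both ends are close to [v]. *)
Lemma fixed_unbroken v : {ae P, forall w, ~ broken v w}.
Proof.
pose E := [set w | exists ab : rat * rat, ratr ab.1 < v < ratr ab.2 /\ joined (ratr ab.1) (ratr ab.2) w].
have mE : measurable E.
  apply: measurable_exists => ab; apply: measurable_and; first exact: measurable_cst_event.
  exact: measurable_joined.
have : {ae P, forall w, E w}.
  apply: prob_near1 => // eps eps0.
  have [r r0 hr] := hit_near mwc0 (@covered_nil R v) eps0.
  have [a] := rat_in_itvoo (ltac:(lra) : v - r < v); rewrite in_itv/= => /andP[a1 a2].
  have [b] := rat_in_itvoo (ltac:(lra) : v < v + r); rewrite in_itv/= => /andP[b1 b2].
  apply: (@le_trans _ _ (P [set w | joined (ratr a) (ratr b) w])).
    apply: le_trans (joined_prob (lt_trans a2 b1)); rewrite lee_fin; apply: hr.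
      by rewrite ltr_norml; apply/andP; split; lra.
    by rewrite ltr_norml; apply/andP; split; lra.
  apply: le_measure; rewrite ?inE//; first exact: measurable_joined.
  by move=> w jw; exists (a, b); rewrite a2 b1.
by apply: filterS => w [[a b] [/= vab jab]] bw; exact: (bw a b vab jab).
Qed.

Section cells.
Variables (b c : R).
Hypothesis bc : b < c.
Definition mesh k i : R := b + (c - b) * i%:R / 2 ^+ k.

Lemma mesh0 k : mesh k 0 = b.
Proof. by rewrite /mesh mulr0 mul0r addr0. Qed.

Lemma meshT k : mesh k (2 ^ k) = c.
Proof. by rewrite /mesh natrX mulfK ?expf_neq0 ?pnatr_eq0// addrC subrK. Qed.

Lemma mesh_lt k i j : (mesh k i < mesh k j) = (i < j)%N.
Proof.
have p : 0 < (c - b) / 2 ^+ k by rewrite divr_gt0 ?exprn_gt0// subr_gt0.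
by rewrite /mesh ltrD2l mulrAC [ltRHS]mulrAC ltr_pM2l// ltr_nat.
Qed.

Lemma mesh_le k i j : (mesh k i <= mesh k j) = (i <= j)%N.
Proof. by rewrite leNgt mesh_lt -leqNgt. Qed.

Lemma mesh_hit k n : h [::] (mesh k n) b = \prod_(i < n) h [::] (mesh k i.+1) (mesh k i).
Proof.
elim: n => [|n IH]; first by rewrite mesh0 big_ord0; exact: (hit_refl mwc0).
rewrite big_ord_recr /= -IH mulrC; apply: (hit_mul mwc0).
by apply/btwP; right; rewrite mesh_le leqnSn -[leLHS](mesh0 k) mesh_le leq0n.
Qed.

Definition gaps k w : \bar R :=
  (\sum_(i < 2 ^ k) (\1_[set w | ~ joined (mesh k i) (mesh k i.+1) w] w : R)%:E)%E.

Lemma gaps_ge0 k w : (0 <= gaps k w)%E.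
Proof. by apply: sume_ge0 => i _; rewrite lee_fin. Qed.

Lemma measurable_not_joined y z : measurable [set w | ~ joined y z w].
Proof. by apply: measurableC; exact: measurable_joined. Qed.

Lemma measurable_gaps k : measurable_fun setT (gaps k).
Proof.
apply: emeasurable_sum => i; apply/measurable_EFinP.
exact: measurable_indic (measurable_not_joined _ _).
Qed.

(* Multiplicativity of h turns the mean number of gaps into a sum of 1 - h_i with
   the product of the h_i equal to h(c, b). *)
Lemma mean_gaps k : 0 < h [::] c b -> (\int[P]_w gaps k w <= ((h [::] c b)^-1 - 1)%:E)%E.
Proof.
move=> hp; pose a i := h [::] (mesh k i.+1) (mesh k i).
have a01 i : 0 <= a i <= 1 by rewrite /a (hit_ge0 kappa P0 x0 B0 e0)/= (hit_le1 mwc0).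
have [sa _] := sum_defect_le (2 ^ k) a01.
have pa : \prod_(i < 2 ^ k) a i = h [::] c b by rewrite -(mesh_hit k) meshT.
rewrite pa in sa.
apply: (@le_trans _ _ (\sum_(i < 2 ^ k) (1 - a i)%:E)%E).
  rewrite /gaps ge0_integral_sum; [|exact: measurableT| |]; last 2 first.
  - move=> i; apply/measurable_EFinP; exact: measurable_indic (measurable_not_joined _ _).
  - by move=> i w _; rewrite lee_fin.
  apply: lee_sum => i _; rewrite integral_indic//; last exact: measurable_not_joined.
  rewrite setIT; have PC := probability_setC P (measurable_joined (mesh k i) (mesh k i.+1)).
  apply: (le_trans (_ : _ <= 1 - P [set w | joined (mesh k i) (mesh k i.+1) w])%E).
    by rewrite -PC.
  rewrite EFinB; apply: leeB => //; apply: joined_prob; by rewrite mesh_lt.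
rewrite sumEFin lee_fin; move: sa hp; move: (\sum_(i < _) _) (h _ _ _) => S u su u0.
by rewrite lerBrDr -(ler_pM2r u0) mulrDl mul1r mulVf ?gt_eqF//; lra.
Qed.

(** Fatou's lemma: the means are bounded uniformly in the mesh, so the lower limit is integrable and
    hence finite almost surely. *)
Lemma gaps_finite : 0 < h [::] c b -> {ae P, forall w, (limn_einf (gaps ^~ w) < +oo)%E}.
Proof.
move=> hp.
have I : (\int[P]_w limn_einf (gaps ^~ w) <= ((h [::] c b)^-1 - 1)%:E)%E.
  apply: le_trans (fatou P measurableT measurable_gaps (fun k w _ => gaps_ge0 k w)) _.
  by apply: limn_einf_le => k; exact: mean_gaps.
have g0 w : (0 <= limn_einf (gaps ^~ w))%E by apply: (@limn_einf_ge _ _ _ 0%N) => k _; exact: gaps_ge0.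
have mg : measurable_fun setT (fun w => limn_einf (gaps ^~ w)).
  have m : measurable_fun setT (fun w => limn_esup (fun k => - gaps k w)%E).
    apply: (@measurable_fun_limn_esup _ _ _ setT (fun k w => - gaps k w)%E) => n.
    move: (measurable_gaps n) => mn.
    by apply: measurableT_comp => //; exact: mn.
  by apply: measurableT_comp => //; exact: m.
have ig : P.-integrable setT (fun w => limn_einf (gaps ^~ w)).
  apply/integrableP; split => //; under eq_integral do rewrite gee0_abs//.
  by apply: le_lt_trans I _; rewrite ltry.
by apply: filterS (integrable_ae measurableT ig) => w /(_ Logic.I); rewrite fin_numElt => /andP[].
Qed.

Lemma mesh_cell k v : b < v < c -> exists2 i : 'I_(2 ^ k), mesh k i <= v & v < mesh k i.+1.
Proof.
move=> /andP[bv vc].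
have ex : exists i, v < mesh k i by exists (2 ^ k)%N; rewrite meshT.
have := ex_minnP ex; case: (ex_minnP ex) => m vm min _.
case: m vm min => [|m] vm min; first by move: vm; rewrite mesh0 ltNge (ltW bv).
have mk : (m < 2 ^ k)%N by apply: min; rewrite meshT.
exists (Ordinal mk) => //=; rewrite leNgt; apply/negP => /min; by rewrite ltnn.
Qed.

(** Once the cells are shorter than the least distance between the given points, each point has a
    cell of its own, and that cell is never covered. *)
Lemma gaps_broken w (l : seq R) : uniq l -> (forall v, v \in l -> b < v < c /\ broken v w) ->
  (forall q : rat, ~ broken (ratr q) w) -> (exists q, b = ratr q) -> (exists q, c = ratr q) ->
  ((size l)%:R%:E <= limn_einf (gaps ^~ w))%E.
Proof.
move=> ul lP nq [qb bE] [qc cE].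
have mq k i : exists q : rat, mesh k i = ratr q.
  exists (qb + (qc - qb) * i%:R / 2 ^+ k).
  by rewrite /mesh bE cE rmorphD/= rmorphM/= rmorphM/= rmorphB/= fmorphV/= rmorphXn/= !ratr_nat.
have [eps eps0 sep] : exists2 eps : R, 0 < eps & forall u v, u \in l -> v \in l -> u < v -> eps <= v - u.
  have fin (F : R * R -> R) (L : seq (R * R)) : (forall y, y \in L -> 0 < F y) ->
      exists2 eps : R, 0 < eps & forall y, y \in L -> eps <= F y.
    elim: L => [_|y L IH F0]; first by exists 1.
    have [|eps eps0 he] := IH; first by move=> z zL; apply: F0; rewrite inE zL orbT.
    exists (Num.min eps (F y)); first by rewrite lt_min eps0 F0// mem_head.
    move=> z; rewrite inE => /orP[/eqP ->|/he h1]; first by rewrite ge_min lexx orbT.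
    by rewrite ge_min h1.
  have [|eps eps0 he] := fin (fun y => y.2 - y.1) [seq y <- allpairs pair l l | y.1 < y.2].
    by move=> y; rewrite mem_filter => /andP[yy _]; rewrite subr_gt0.
  exists eps => // u v ul' vl uv; apply: (he (u, v)); rewrite mem_filter uv/=.
  by apply/allpairsP; exists (u, v).
have [K hK] : exists K, forall k, (K <= k)%N -> (c - b) / 2 ^+ k < eps.
  have c0 : (fun k => (c - b) * (2^-1) ^+ k) @ \oo --> (0 : R).
    by rewrite -[X in _ --> X](mulr0 (c - b)); apply: cvgM; [exact: cvg_cst|apply: cvg_expr; rewrite ger0_norm; lra].
  have [K _ hK] : \forall k \near \oo, (c - b) * (2^-1) ^+ k < eps by exact: (cvgr_lt _ c0).
  by exists K => k Kk; rewrite -exprVn; exact: hK.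
apply: (@limn_einf_ge _ _ _ K) => k Kk.
pose bad (i : 'I_(2 ^ k)) := `[< ~ joined (mesh k i) (mesh k i.+1) w >].
have -> : gaps k w = (#|[pred i | bad i]|)%:R%:E.
  rewrite /gaps sumEFin -sum1_card natr_sum; congr EFin; rewrite [RHS]big_mkcond/=.
  apply: eq_bigr => i _.
  rewrite indicE inE/= /bad; case: asboolP => hh; first by rewrite mem_set.
  by rewrite memNset.
rewrite lee_fin ler_nat.
have ch v : v \in l -> exists i : 'I_(2 ^ k), mesh k i <= v < mesh k i.+1.
  by move=> /lP[vbc _]; have [i h1 h2] := mesh_cell k vbc; exists i; rewrite h1 h2.
have [f hf] : exists f : R -> 'I_(2 ^ k), forall v, v \in l -> mesh k (f v) <= v < mesh k (f v).+1.
  have i0 : 'I_(2 ^ k) by exists 0%N; rewrite expn_gt0.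
  exists (fun v => if pselect (v \in l) is left h then sval (cid (ch v h)) else i0) => v vl.
  by case: pselect => // h0; exact: (svalP (cid (ch v h0))).
have inj : {in l &, injective f}.
  move=> u v ul' vl fuv; have [uv|vu|//] := ltgtP u v; exfalso.
    have := sep _ _ ul' vl uv; have := hf _ ul'; have := hf _ vl; rewrite fuv.
    have := hK k Kk; rewrite /mesh -[(f v).+1%:R]natr1 mulrDr mulrDl mulr1; lra.
  have := sep _ _ vl ul' vu; have := hf _ ul'; have := hf _ vl; rewrite fuv.
  have := hK k Kk; rewrite /mesh -[(f v).+1%:R]natr1 mulrDr mulrDl mulr1; lra.
have uf : uniq (map f l) by rewrite map_inj_in_uniq.
rewrite -(size_map f l) -(card_uniqP uf); apply: subset_leq_card; apply/fintype.subsetP => i.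
move=> /mapP[v vl ->]; rewrite inE => jv.
have [_ bv] := lP v vl; have /andP[m1 m2] := hf v vl.
have [q1 E1] := mq k (f v); have [q2 E2] := mq k (f v).+1.
(* The subdivision points are rational, hence not broken, so [v] is interior to its cell. *)
move: m1; rewrite le_eqVlt => /orP[/eqP m1|m1]; first by apply: (nq q1); rewrite -E1 m1.
by apply: (bv q1 q2); rewrite -E1 -E2 ?m1.
Qed.

End cells.

(** If broken points accumulated at [v] from the left, an interval around [v] with rational ends and
    [h > 0] would contain arbitrarily many of them, against the finite lower limit of its gaps. *)
Lemma broken_isolated : {ae P, forall w, (forall q : rat, ~ broken (ratr q) w) /\
  forall v, broken v w -> exists2 u, u < v & forall y, u < y < v -> ~ broken y w}.
Proof.
have aq : {ae P, forall w, forall q : rat, ~ broken (ratr q) w}.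
  have := ae_foralln (fun n => fixed_unbroken (ratr (odflt 0 (unpickle n)) : R)).
  by apply: filterS => w hw q; have := hw (pickle q); rewrite pickleK.
have ag : {ae P, forall w, forall bc : rat * rat, ratr bc.1 < ratr bc.2 :> R ->
    0 < h [::] (ratr bc.2) (ratr bc.1) -> (limn_einf (gaps (ratr bc.1) (ratr bc.2) ^~ w) < +oo)%E}.
  have g n : {ae P, forall w, let bc := odflt (0, 0) (unpickle n) : rat * rat in ratr bc.1 < ratr bc.2 :> R ->
      0 < h [::] (ratr bc.2) (ratr bc.1) -> (limn_einf (gaps (ratr bc.1) (ratr bc.2) ^~ w) < +oo)%E}.
    move=> /=; set bc := odflt _ _.
    have [lt|nlt] := boolP (ratr bc.1 < ratr bc.2 :> R); last by apply: aeW => w h1; case: (negP nlt).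
    have [hp|hp] := pselect (0 < h [::] (ratr bc.2) (ratr bc.1)); last by apply: aeW => w _ /hp.
    by apply: filterS (gaps_finite lt hp) => w.
  have := ae_foralln g; apply: filterS => w hw bc; have := hw (pickle bc); by rewrite pickleK.
apply: filterS2 aq ag => w nq fin; split => // v bv; apply: contrapT => noiso.
have [r r0 hr] := hit_near mwc0 (@covered_nil R v) (ltac:(lra) : 0 < (2^-1 : R)).
have [b] := rat_in_itvoo (ltac:(lra) : v - r < v); rewrite in_itv/= => /andP[b1 b2].
have [c] := rat_in_itvoo (ltac:(lra) : v < v + r); rewrite in_itv/= => /andP[c1 c2].
have bc := lt_trans b2 c1.
have hp : 0 < h [::] (ratr c) (ratr b).
  apply: (@lt_le_trans _ _ (1 - 2^-1)); first by lra.
  by apply: hr; rewrite ltr_norml; apply/andP; split; lra.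
have := fin (b, c) bc hp => /= {}fin.
(* The points are chosen one after another towards [v]; [u] bounds those already chosen. *)
have big m : exists l : seq R, [/\ uniq l, size l = m, forall y, y \in l -> ratr b < y < ratr c /\ broken y w &
    exists2 u, ratr b <= u < v & forall y, y \in l -> y <= u].
  elim: m => [|m [l [ul sl lP [u /andP[bu uv] lu]]]].
    by exists [::]; split => //; exists (ratr b) => //; rewrite lexx.
  have [y [uy yv by_]] : exists y, [/\ u < y, y < v & broken y w].
    apply: contrapT => no; apply: noiso; exists u => // y /andP[uy yv] by_; apply: no.
    by exists y.
  exists (y :: l); split => /=; first by rewrite ul andbT; apply/negP => /lu; rewrite leNgt uy.
  - by rewrite sl.
  - move=> z; rewrite inE => /orP[/eqP ->|/lP//]; split => //.
    by rewrite (le_lt_trans bu uy) (lt_trans yv c1).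
  - exists y; first by rewrite yv (le_trans bu (ltW uy)).
    by move=> z; rewrite inE => /orP[/eqP ->//|/lu zu]; exact: le_trans zu (ltW uy).
have bound m : (m%:R%:E <= limn_einf (gaps (ratr b) (ratr c) ^~ w))%E.
  have [l [ul <- lP _]] := big m.
  by apply: (gaps_broken ul lP nq); [exists b|exists c].
move: fin bound; case: (limn_einf _) => [g| |] // _ bound; last by have := bound 0%N; rewrite leNgt ltNyr.
have := bound (Num.bound `|g|); rewrite lee_fin leNgt => /negP; apply.
exact: (le_lt_trans (ler_norm g) (archi_boundP (normr_ge0 g))).
Qed.

End breaks.

Lemma inv_succ_le (R : realType) (y : R) : 0 < y -> exists m : nat, m.+1%:R^-1 <= y.
Proof.
move=> y0; exists (Num.bound y^-1); rewrite -[leRHS]invrK lef_pV2 ?posrE ?invr_gt0//.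
apply: ltW; apply: lt_le_trans (archi_boundP _) _; first by rewrite invr_ge0 ltW.
by rewrite ler_nat.
Qed.

Lemma dense_tail (R : realType) (u : nat -> R) n a b : dense (range u) -> a < b ->
  exists2 j, (n <= j)%N & a < u j < b.
Proof.
move=> du; elim: n a b => [|n IH] a b ab; first by have [j hj] := dense_between du ab; exists j.
have [j nj /andP[aj jb]] := IH a b ab; have [jn|jn] := eqVneq j n; last first.
  by exists j; [rewrite ltn_neqAle eq_sym jn|rewrite aj].
rewrite jn in aj jb; have [k nk /andP[ak kn]] := IH a (u n) aj.
exists k; last by rewrite ak (lt_trans kn jb).
rewrite ltn_neqAle nk andbT; apply/eqP => E; move: kn; by rewrite -E ltxx.
Qed.

(** * One-sided neighbourhoods of end points *)

Section germs.
Context {R : realType}.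
Implicit Types (s : seq (R * R)) (p y sg : R).

(** [sg] is [1] or [-1] and selects the side. The offsets are rational rather than the points,
    because [p] will be a random end point. *)
Definition cov_side sg p s : Prop := exists m : nat, forall q : rat,
  0 < (ratr q : R) -> (ratr q : R) <= m.+1%:R^-1 -> covered s (p + sg * ratr q).

Lemma measurable_cov_side sg d (T : measurableType d) (s : T -> seq (R * R)) (p : T -> R) :
  mstate s -> measurable_fun setT p -> measurable [set t | cov_side sg (p t) (s t)].
Proof.
move=> ms mp; apply: measurable_exists => m; apply: measurable_forall => q.
apply: measurable_imply => _; apply: measurable_imply => _; apply: measurable_covered ms _.
exact: (measurable_funD mp (measurable_cst _)).
Qed.

Lemma state_event_cov_side sg p : state_event (cov_side sg p).
Proof.
split => [d T s ms|s1 s2 [ss _] [m hm]|c s [m hm]].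
- exact: (measurable_cov_side sg ms (measurable_cst p)).
- by exists m => q q0 qm; apply/ss; exact: hm.
- by exists m => q q0 qm; have [c' c's hc'] := hm q q0 qm; exists c' => //; rewrite inE c's orbT.
Qed.

Lemma cov_side_all sg p s : (sg = 1 \/ sg = -1) -> cov_side sg p s ->
  exists2 r, 0 < r & forall t, 0 < t < r -> covered s (p + sg * t).
Proof.
move=> sgE [m hm]; exists m.+1%:R^-1 => [|t /andP[t0 tm]]; first by rewrite invr_gt0 ltr0n.
apply: contrapT => nc; have [r r0 hr] := not_covered_ball nc.
have mt : Num.max 0 (t - r) < t by rewrite gt_max t0 ltrBlDr ltrDl.
have [q] := rat_in_itvoo mt.
rewrite in_itv/= gt_max => /andP[/andP[q0 q1] q2]; apply: (hr (p + sg * ratr q)).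
  by rewrite ltr_norml; case: sgE => ->; apply/andP; split; lra.
by apply: hm => //; exact: ltW (lt_trans q2 tm).
Qed.

(** A segment that has points on this side arbitrarily close to [p] contains a whole one-sided
    neighbourhood by convexity. The others stay away, and there are finitely many of them. *)
Lemma germ sg p s : (sg = 1 \/ sg = -1) -> cov_side sg p s \/
  exists2 r, 0 < r & forall y, 0 < y <= r -> ~ covered s (p + sg * y).
Proof.
move=> sgE; elim: s => [|[a b] s [[m hm]|[r r0 hr]]].
- by right; exists 1 => // y _; exact: covered_nil.
- by left; exists m => q q0 qm; apply/covered_cons; right; exact: hm.
have [[r' r'0 hr']|no] := pselect (exists2 r, 0 < r & forall y, 0 < y <= r -> ~ btw a b (p + sg * y)).
  right; exists (Num.min r r'); first by rewrite lt_min r0.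
  by move=> y; rewrite le_min => /and3P[y0 yr yr'] /covered_cons[]; [apply: hr'|apply: hr]; apply/andP.
have {}no t : 0 < t -> exists y, [/\ 0 < y, y <= t & btw a b (p + sg * y)].
  move=> t0; apply: contrapT => no'; apply: no; exists t => // y /andP[y0 yt] bt.
  by apply: no'; exists y.
left; have [y2 [y20 _ /andP[l2 u2]]] := no 1 ltr01; have [m hm] := inv_succ_le y20.
exists m => q q0 qm; apply/covered_cons; left; have [y1 [y10 y1q /andP[l1 u1]]] := no _ q0.
have q2 := le_trans qm hm; clear hm qm.
move: l1 u1 l2 u2; rewrite /btw; move: (Num.min a b) (Num.max a b) => k M l1 u1 l2 u2.
by case: sgE l1 u1 l2 u2 => ->; rewrite ?mul1r ?mulN1r => l1 u1 l2 u2; apply/andP; split; lra.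
Qed.

(* The end point p_i of the i-th segment; states list the newest segment first. *)
Definition endpoint i s : R := (nth (0, 0) s (size s - i.+1)).2.

Lemma endpoint_cons i c s : (i < size s)%N -> endpoint i (c :: s) = endpoint i s.
Proof. by move=> si; rewrite /endpoint /= subSn. Qed.

Lemma measurable_endpoint i d (T : measurableType d) (s : T -> seq (R * R)) :
  mstate s -> measurable_fun setT (fun t => endpoint i (s t)).
Proof.
move=> ms.
have [n hn] : exists n, forall t, size (s t) = n.
  elim: ms => [|x p s' _ _ _ [n hn]]; first by exists 0%N.
  by exists n.+1 => t /=; rewrite hn.
rewrite (_ : (fun t => _) = fun t => (nth (0, 0) (s t) (n - i.+1)).2); last first.
  by apply/funext => t; rewrite /endpoint hn.
elim: ms (n - i.+1)%N => [j|x p s' mx mp _ IH [|j]] /=; last exact: IH.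
  by rewrite (_ : (fun=> _) = fun=> 0); [exact: measurable_cst|apply/funext => t; rewrite nth_nil].
exact: mp.
Qed.

End germs.

Section germ_limit.
Context {R : realType} (kappa : {sigma_finite_measure set (measurableTypeR R) -> \bar R}).
Context d (Omega : measurableType d) (P : probability Omega R).
Variables (x : R) (B : R -> Omega -> R) (e : Omega -> R).
Hypothesis mwc : motion_with_clock kappa P x B e.
Hypothesis kappa0 : kappa setT != 0%E.
Local Notation K := (kern kappa P x B e).
Local Notation h := (hit kappa P x B e).
Local Notation att := (attach kappa P x B e).
Local Notation W := (attach_seq kappa P x B e).
Variable sg : R.
Hypothesis sgE : sg = 1 \/ sg = -1.
Let kr := mwc_radon mwc.
Let sg2 : sg * sg = 1. Proof. by case: sgE => ->; rewrite ?mulr1 ?mulrNN ?mulr1. Qed.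

(** Between [p] and the artificial barrier [b] there is nothing covered, so the motion from [z] sees
    only these two points until it meets one of them. Stopping it at [b] can only lower the
    probability of ending at [p]. *)
Lemma hit_germ s p r z : covered s p -> 0 < r -> (forall y, 0 < y <= r -> ~ covered s (p + sg * y)) ->
  (exists2 y, 0 < y < r & z = p + sg * y) ->
  h [:: (p + sg * r, p + sg * r)] z p <= K s z (\1_[set p]).
Proof.
move=> cp r0 free [y /andP[y0 yr] zE]; set b := p + sg * r.
have b1 : bdd (\1_[set p] : R -> R) := bdd_indic (measurable_set1 p).
have pb : p != b by rewrite /b; apply/eqP; case: sgE => ->; lra.
have zz : sg * (z - p) = y by rewrite zE addrAC subrr add0r mulrA sg2 mul1r.
apply: (@le_trans _ _ (K ((b, b) :: s) z (fun v => \1_[set p] v * (v != b)%:R))); last first.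
  rewrite (kern_split mwc kappa0 s z b b1) lerDl; apply: mulr_ge0.
    exact: (hit_ge0 kappa P x B e).
  exact: (kern_ge0 kappa P x B e s b b1).
rewrite (hitE mwc kappa0); rewrite le_eqVlt; apply/orP; left; apply/eqP.
apply: (kern_eq mwc kappa0 b1 (bdd_neq b b1)); apply: aeW => w rw _.
pose C := [set v : R | 0 <= sg * (v - p) <= r].
have vE v : v = p + sg * (sg * (v - p)) by rewrite mulrA sg2 mul1r addrC subrK.
have [-> _] : exit kappa x B e ((p, p) :: [:: (b, b)]) z w = exit kappa x B e ((b, b) :: s) z w /\
    exit_at kappa x B e ((p, p) :: [:: (b, b)]) z w = exit_at kappa x B e ((b, b) :: s) z w.
  apply: (@exit_local R kappa _ Omega x B e C _ _ _ _ rw).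
  - by rewrite /C/= zz (ltW y0) (ltW yr).
  - move=> v /andP[v0 vr]; split.
      by move=> /covered_pt[->|/covered_pt[->|/covered_nil//]]; apply/covered_pt; [right|left].
    move=> /covered_pt[->|cv]; first by apply/covered_pt; right; apply/covered_pt; left.
    apply/covered_pt; left; move: v0; rewrite le_eqVlt => /orP[/eqP v0|v0].
      by rewrite [LHS]vE -v0 mulr0 addr0.
    by exfalso; apply: (free (sg * (v - p))); rewrite ?v0 -?vE.
  - move=> v /negP; rewrite negb_and -!ltNge => /orP[vp|vb].
      exists p; split; first by rewrite /C/= subrr mulr0 lexx ltW.
        by apply/covered_pt; left.
      by rewrite zE; apply/btwP; case: sgE vp => -> vp; [right|left]; apply/andP; split; lra.
    exists b; split; first by rewrite /C/= /b addrAC subrr add0r mulrA sg2 mul1r lexx ltW.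
      by apply/covered_pt; right; apply/covered_pt; left.
    by rewrite zE /b; apply/btwP; case: sgE vb => -> vb; [left|right]; apply/andP; split; lra.
move: (exit kappa x B e ((b, b) :: s) z w) => v.
rewrite indicE; case: (pselect (v = p)) => [->|vp]; first by rewrite pb mulr1.
by rewrite memNset ?mul0r.
Qed.

(** The barrier stays fixed while the starting point approaches [p], so [p] is reached with
    probability close to 1; the segment then drawn covers a one-sided neighbourhood of [p]. *)
Lemma attach_germ s p (eps : R) : covered s p -> 0 < eps -> ~ cov_side sg p s ->
  exists2 r, 0 < r & forall y, 0 < y < r ->
    1 - eps <= att (p + sg * y) (event_fun (cov_side sg p)) s.
Proof.
move=> cp eps0 ncov; have [//|[r r0 free]] := germ p s sgE.
have nc : ~ covered [:: (p + sg * r, p + sg * r)] p.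
  by move=> /covered_pt[|/covered_nil//]; case: sgE => ->; lra.
have [r1 r10 hr1] := hit_near mwc nc eps0.
exists (Num.min r r1); first by rewrite lt_min r0.
move=> y /andP[y0]; rewrite lt_min => /andP[yr yr1].
have b1 : bdd (\1_[set p] : R -> R) := bdd_indic (measurable_set1 p).
have ys : exists2 y', 0 < y' < r & p + sg * y = p + sg * y' by exists y => //; rewrite y0.
apply: le_trans (hr1 (p + sg * y) p _ _) _.
- by rewrite addrAC subrr add0r ltr_norml; case: sgE => ->; apply/andP; split; lra.
- by rewrite subrr normr0.
apply: le_trans (hit_germ cp r0 free ys) _.
have mg := state_fun_meas (state_fun_event (state_event_cov_side sg p)).
apply: (kern_le mwc kappa0 b1 (bdd_meas_fun s (p + sg * y) id mg)).
apply: aeW => w _ _; move: (exit _ _ _ _ _ _ _) => v.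
have [_ g01] := mg; have /andP[g0 _] := g01 ((p + sg * y, v) :: s).
rewrite indicE; case: (pselect (v = p)) => [vp|vp]; last by rewrite memNset.
rewrite mem_set//= /event_fun ifT// vp; apply/asboolP; have [m hm] := inv_succ_le y0.
exists m => q q0 qm; apply/covered_cons; left; have qy := le_trans qm hm.
by apply/btwP; case: sgE => ->; [right|left]; apply/andP; split; lra.
Qed.

Lemma germ_tail (u : nat -> R) n s p (eps : R) : dense (range u) -> covered s p -> 0 < eps ->
  exists M, forall m, (M <= m)%N ->
  1 - eps <= W (map u (iota n m)) (event_fun (cov_side sg p)) s.
Proof.
move=> du cp eps0; have sE := state_event_cov_side sg p.
have sf := state_fun_event sE; have mf := state_fun_meas sf; have incf := incr_fun_event sE.
have [cs|ncs] := pselect (cov_side sg p s).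
  exists 0%N => m _; apply: le_trans (attach_seq_incr mwc kappa0 (map u (iota n m)) s mf incf).
  by rewrite /event_fun ifT; [lra|apply/asboolP].
have [r r0 hr] := attach_germ cp eps0 ncs.
have [j nj [y yr uE]] : exists2 j, (n <= j)%N & exists2 y, 0 < y < r & u j = p + sg * y.
  case: sgE => sgE1.
    have [j nj /andP[j1 j2]] := dense_tail n du (ltac:(lra) : p < p + r).
    by exists j => //; exists (u j - p); [apply/andP; split; lra|rewrite sgE1; lra].
  have [j nj /andP[j1 j2]] := dense_tail n du (ltac:(lra) : p - r < p).
  by exists j => //; exists (p - u j); [apply/andP; split; lra|rewrite sgE1; lra].
exists (j - n).+1 => m jm.
have jl : u j \in map u (iota n m).
  by apply: map_f; rewrite mem_iota nj/= -[j in (j < _)%N](subnKC nj) ltn_add2l.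
(* The starting point close to [p] is moved to the front of the remaining ones by exchangeability;
   the later steps only increase the coverage. *)
rewrite (attach_seq_perm mwc kappa0 sf (perm_to_rem jl)).
apply: le_trans (hr y yr) _; rewrite -uE.
have mr := meas_fun_attach_seq mwc kappa0 (rem (u j) (map u (iota n m))) mf.
apply: (attach_le mwc kappa0 mf mr) => v.
exact: (attach_seq_incr mwc kappa0 _ _ mf incf).
Qed.

(** A functional of the list of segments and not of the state alone, since end points are numbered
    by their order of appearance. Exchangeability does not apply to it directly. *)
Definition endpoint_germ i s : R := if `[< cov_side sg (endpoint i s) s >] then 1 else 0.

Lemma meas_fun_endpoint_germ i : meas_fun (endpoint_germ i).
Proof.
split => [d' T s ms|s].
  exact: (measurable_if_prop _ _ (measurable_cov_side sg ms (measurable_endpoint i ms))).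
by rewrite /endpoint_germ; case: ifP => _; rewrite ?lexx ?ler01.
Qed.

(** Later steps do not alter an end point already in the list. It can therefore be frozen, and the
    event becomes one about the state, to which exchangeability applies. *)
Lemma attach_seq_germ l i s : (i < size s)%N ->
  W l (endpoint_germ i) s = W l (event_fun (cov_side sg (endpoint i s))) s.
Proof.
elim: l s => [//|z l IH] s si; rewrite /= /attach; congr (kern _ _ _ _ _ _ _ _).
apply/funext => v; have si' : (i < size ((z, v) :: s))%N by exact: ltnW.
by have := IH _ si'; rewrite endpoint_cons.
Qed.

End germ_limit.

Section covered_points.
Context {R : realType} (kappa : {sigma_finite_measure set (measurableTypeR R) -> \bar R}).
Hypothesis kr : radon_measure kappa.
Hypothesis kappa0 : kappa setT != 0%E.
Context d (Omega : measurableType d) (P : probability Omega R).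
Variables (x : nat -> R) (B : nat -> R -> Omega -> R) (zeta : nat -> Omega -> \bar R).
Hypothesis xinj : injective x.
Hypothesis xdense : dense (range x).
Hypothesis kbm : forall n, killed_brownian_motion P kappa (x n) (B n) (zeta n).
Hypothesis ind : mutually_independent P (fun n => killed_path_sigma (B n) (zeta n)).
Local Notation run := (run x B zeta).

Lemma size_run n w : size (run n w) = n.
Proof. by elim: n => //= n ->. Qed.

Lemma endpoint_run i n w : (i < n)%N -> endpoint i (run n w) = endpoint i (run i.+1 w).
Proof.
elim: n => // n IH; rewrite ltnS leq_eqVlt => /orP[/eqP -> //|lt].
by rewrite [run n.+1 w]/= endpoint_cons ?size_run//; exact: IH.
Qed.

(** Given the state in which the end point appears, the later steps cover its side with a
    conditional probability that tends to 1; bounded convergence removes the conditioning. *)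
Lemma germ_covered sg i : (sg = 1 \/ sg = -1) ->
  {ae P, forall w, exists m, cov_side sg (endpoint i (run i.+1 w)) (run m w)}.
Proof.
move=> sgE; have [e mwc _] := killed_brownian_clock kr (kbm 0%N).
have mp := measurable_endpoint i (mstate_run_full kbm i.+1).
have mE m : measurable [set w | cov_side sg (endpoint i (run i.+1 w)) (run m w)].
  exact: (measurable_cov_side sg (mstate_run_full kbm m) mp).
apply: prob_near1 => [|eps eps0]; first exact: measurable_exists.
pose W l := attach_seq kappa P (x 0%N) (B 0%N) e l (endpoint_germ sg i).
have mg := meas_fun_endpoint_germ sg i.
pose F m w := (W (map x (iota i.+1 m)) (run i.+1 w))%:E.
have PE m : P [set w | cov_side sg (endpoint i (run i.+1 w)) (run (i.+1 + m) w)] = (\int[P]_w F m w)%E.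
  have sp : first_points x (i.+1 + m) = first_points x i.+1 ++ map x (iota i.+1 m).
    by rewrite /first_points iotaD map_cat add0n.
  transitivity (\int[P]_w (endpoint_germ sg i (run (i.+1 + m) w))%:E)%E.
    rewrite -[X in P X]setIT -(integral_indic P measurableT (mE _)).
    apply: eq_integral => w _; rewrite indicE /endpoint_germ (@endpoint_run i (i.+1 + m)) ?leq_addr//.
    by case: asboolP => h; [rewrite mem_set|rewrite memNset].
  rewrite (run_law kr kappa0 kbm ind mwc _ mg) sp attach_seq_cat.
  rewrite -(run_law kr kappa0 kbm ind mwc) //; exact: (meas_fun_attach_seq mwc kappa0 _ mg).
have F01 m w : (0 <= F m w <= 1%:E)%E.
  by have [_ h] := meas_fun_attach_seq mwc kappa0 (map x (iota i.+1 m)) mg; rewrite !lee_fin; exact: h.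
have mF m : measurable_fun setT (F m).
  have [h _] := meas_fun_attach_seq mwc kappa0 (map x (iota i.+1 m)) mg.
  by apply/measurable_EFinP; exact: h (mstate_run_full kbm i.+1).
have cF : (\int[P]_w F m w)%E @[m --> \oo] --> (\int[P]_w 1%:E)%E.
  apply: (@bounded_integral_cvg _ _ _ P F (fun=> 1%:E) 1) => //; first exact: aeW.
  apply: aeW => w; apply: cvg_EFin; first exact: nearW.
  apply/cvgrPdist_le => /= r r0.
  have cp : covered (run i.+1 w) (endpoint i (run i.+1 w)).
    rewrite /endpoint size_run subnn /=; apply/covered_cons; left; exact: btwr.
  have [M hM] := germ_tail mwc kappa0 sgE i.+1 xdense cp r0.
  exists M => // m /= /hM; rewrite -(attach_seq_germ kappa P (x 0%N) (B 0%N) e) ?size_run// => h.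
  have /andP[_] := F01 m w; rewrite lee_fin => h1; rewrite ger0_norm ?subr_ge0//.
  by rewrite lerBlDr -lerBlDl.
move: cF; rewrite integral_cst_prob => /fine_cvgP[_ /cvgrPdist_le/(_ _ eps0)[N _ /(_ N (leqnn N))]] h.
apply: (@le_trans _ _ (\int[P]_w F N w)%E); last first.
  rewrite -PE; apply: le_measure; rewrite ?inE//; first exact: measurable_exists.
  by move=> w hw; exists (i.+1 + N)%N.
have fI : (\int[P]_w F N w)%E = (fine (\int[P]_w F N w))%:E by rewrite -PE fineK// fin_num_measure.
by rewrite fI lee_fin; move: h; rewrite /= => /(le_trans (ler_norm _)); rewrite lerBlDr lerBlDl addrC.
Qed.

Lemma endpoint_unbroken i : {ae P, forall w, ~ broken x B zeta (endpoint i (run i.+1 w)) w}.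
Proof.
have g1 := germ_covered i (or_introl (erefl (1 : R))).
have g2 := germ_covered i (or_intror (erefl (-1 : R))).
apply: filterS2 g1 g2 => w [m1 h1] [m2 h2]; set p := endpoint _ _ in h1 h2 * => bp.
pose N := maxn i.+1 (maxn m1 m2).
have [_ _ i1] := state_event_cov_side 1 p; have [_ _ i2] := state_event_cov_side (-1) p.
have l1 : (m1 <= N)%N by rewrite /N !leq_max leqnn !orbT.
have l2 : (m2 <= N)%N by rewrite /N !leq_max leqnn !orbT.
have [r1 r10 c1] := cov_side_all (or_introl (erefl _)) (run_mono i1 l1 h1).
have [r2 r20 c2] := cov_side_all (or_intror (erefl _)) (run_mono i2 l2 h2).
have cp : covered (run N w) p.
  have l0 : (i.+1 <= N)%N by rewrite /N !leq_max leqnn.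
  apply: (run_mono (E := fun s => covered s p) _ l0) => [c s [c' cs hc]|].
    by exists c' => //; rewrite inE cs orbT.
  rewrite /p /endpoint size_run subnn /=; apply/covered_cons; left; exact: btwr.
have [a] := rat_in_itvoo (ltac:(lra) : p - r2 < p); rewrite in_itv/= => /andP[a1 a2].
have [b] := rat_in_itvoo (ltac:(lra) : p < p + r1); rewrite in_itv/= => /andP[b1 b2].
apply: (bp a b); first by rewrite a2.
exists N => q /btwP[/andP[q1 q2]|/andP[q1 q2]]; last by move: (lt_trans a2 b1); lra.
have [qp|pq|->//] := ltgtP (ratr q) p.
  rewrite (_ : ratr q = p + (-1) * (p - ratr q)); last by lra.
  by apply: c2; apply/andP; split; lra.
rewrite (_ : ratr q = p + 1 * (ratr q - p)); last by lra.
by apply: c1; apply/andP; split; lra.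
Qed.

(** A covered point is a starting point, which is fixed in advance, or an end point, covered on both
    sides, or interior to a segment, in which case a rational interval around it lies inside that
    segment. *)
Lemma covered_unbroken : {ae P, forall w, forall n v, covered (run n w) v -> ~ broken x B zeta v w}.
Proof.
have [e mwc _] := killed_brownian_clock kr (kbm 0%N).
have f1 := ae_foralln (fun i => fixed_unbroken kr kappa0 xinj xdense kbm ind mwc (x i)).
apply: filterS2 f1 (ae_foralln endpoint_unbroken) => w h1 h2 n v; elim: n => [/covered_nil//|n IH].
move=> /[dup] cv /covered_cons[/btwP bt|/IH//].
have Ep : exit_point (run n w) (kpath B zeta n w) (kzeta zeta n w) = endpoint n (run n.+1 w).
  by rewrite /endpoint size_run subnn.
have [->|vx] := eqVneq v (x n); first exact: h1.
have [->|vp] := eqVneq v (endpoint n (run n.+1 w)); first exact: h2.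
rewrite Ep in bt; set p := endpoint _ _ in bt vp.
have [m [M [mv vM seg]]] : exists m M, [/\ m < v, v < M & forall y, m <= y <= M -> btw (x n) p y].
  case: bt => /andP[b1 b2]; [exists (x n), p|exists p, (x n)]; split.
  - by rewrite lt_neqAle eq_sym vx.
  - by rewrite lt_neqAle vp.
  - by move=> y hy; apply/btwP; left.
  - by rewrite lt_neqAle eq_sym vp.
  - by rewrite lt_neqAle vx.
  - by move=> y hy; apply/btwP; right.
have [a] := rat_in_itvoo mv; rewrite in_itv/= => /andP[a1 a2].
have [b] := rat_in_itvoo vM; rewrite in_itv/= => /andP[b1 b2].
move=> /(_ a b); rewrite a2 b1 => /(_ isT); apply; exists n.+1 => q bq.
apply/covered_cons; left; rewrite Ep; apply: seg.
by case/btwP: bq => /andP[q1 q2]; apply/andP; split; lra.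
Qed.

Lemma wilson_Z_broken : {ae P, forall w,
  wilson_Z x (fun n t => B n t w) (fun n => zeta n w) = [set v | broken x B zeta v w]}.
Proof.
apply: filterS2 (wilson_run kr kappa0 kbm) covered_unbroken => w tr cu.
apply/seteqP; split => v /=.
  move=> nv a b vab [n hn]; apply: nv; exists n => //; have [_ ->] := tr n.
  have /andP[av vb] := vab; apply/covered_cons; right.
  by apply: (covers_all (lt_trans av vb) hn); apply/btwP; left; rewrite !ltW.
by move=> bv [n _]; have [_ ->] := tr n => /cu /(_ bv).
Qed.

End covered_points.

(** * Laws of configurations *)

Section counting.
Context {R : realType}.
Implicit Types (S I : set R) (k : nat).

(** Counts enter through lower bounds, which increase with the set. An exact count is the difference
    of two such events. *)
Definition atleast k S : Prop := exists l : seq R, [/\ uniq l, size l = k & forall v, v \in l -> S v].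

Lemma card_seq (l : seq R) : uniq l -> ([set` l] #= `I_(size l))%card.
Proof.
move=> ul; rewrite card_eq_sym; apply/card_set_bijP; exists (nth 0 l); split.
- by move=> i /= il; exact: mem_nth.
- by move=> i j; rewrite !inE /= => il jl /eqP; rewrite nth_uniq// => /eqP.
- by move=> v /= vl; exists (index v l); rewrite /= ?index_mem ?nth_index.
Qed.

Lemma atleast_seq k (l : seq R) : uniq l -> atleast k [set` l] <-> (k <= size l)%N.
Proof.
move=> ul; split => [[l' [ul' <- sub]]|kl]; first exact: uniq_leq_size.
exists (take k l); split; [exact: take_uniq|by rewrite size_takel|].
by move=> v /mem_take.
Qed.

Lemma card_atleast k S : (S #= `I_k)%card = (atleast k S /\ ~ atleast k.+1 S) :> Prop.
Proof.
apply/propext; split => [Sk|[[l [ul lk sub]] no]].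
  have /finite_seqP[l lE] : finite_set S by exists k.
  have uE : S = [set` undup l].
    by rewrite lE; apply/seteqP; split => v /=; rewrite mem_undup.
  have uu := undup_uniq l.
  have kE : size (undup l) = k.
    apply/card_eq_II; apply: card_eq_trans Sk; rewrite card_eq_sym uE; exact: card_seq.
  by rewrite uE !atleast_seq// kE leqnn ltnn; split.
suff -> : S = [set` l] by rewrite -lk; exact: card_seq.
apply/seteqP; split => [v Sv|v /sub//]; apply: contrapT => /negP vl; apply: no.
exists (v :: l); split => /=; [by rewrite vl|by rewrite lk|].
by move=> u; rewrite inE => /orP[/eqP ->|/sub].
Qed.

Lemma atleast_sub k S S' : S `<=` S' -> atleast k S -> atleast k S'.
Proof. by move=> SS' [l [ul lk sub]]; exists l; split => // v /sub/SS'. Qed.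

(** A random set listed by measurable points, the [i]-th being present on the event [D i].
    Repetitions are allowed. *)
Definition countable_random d (T : measurableType d) (A : T -> set R) : Prop :=
  exists (f : nat -> T -> R) (D : nat -> T -> Prop),
    [/\ forall i, measurable_fun setT (f i), forall i, measurable [set t | D i t] &
        forall t, A t = [set v | exists2 i, D i t & v = f i t]].

(** A union over finite lists of indices whose points are present, lie in [I] and are pairwise
    distinct. *)
Lemma measurable_atleast d (T : measurableType d) (A : T -> set R) (I : set (measurableTypeR R)) k :
  countable_random A -> measurable I -> measurable [set t | atleast k (A t `&` I)].
Proof.
move=> [f [D [mf mD AE]]] mI.
pose Q (l : seq nat) t := uniq (map (f ^~ t) l) /\ forall i, i \in l -> D i t /\ I (f i t).
have mQ l : measurable [set t | Q l t].
  elim: l => [|a l IH].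
    by rewrite (_ : [set t | _] = setT)//; apply/seteqP; split => // t _; split.
  rewrite (_ : [set t | _] = [set t | Q l t /\ ((D a t /\ I (f a t)) /\
    forall i, i \in l -> ~ (f a t <= f i t /\ f i t <= f a t))]).
    apply: measurable_and => //; apply: measurable_and.
      by apply: measurable_and => //; exact: measurable_preim (mf a) mI.
    apply: measurable_forall => i; apply: measurable_imply => _; apply: measurableC.
    by apply: measurable_and; apply: measurable_ler.
  apply/seteqP; split => t /=; rewrite /Q /=.
    move=> [/andP[fa ul] h]; split; first by split => // i il; apply: h; rewrite inE il orbT.
    split; first by apply: h; rewrite inE eqxx.
    move=> i il /andP; rewrite -eq_le => /eqP E; move/negP: fa; apply.
    by rewrite E; apply/mapP; exists i.
  move=> [[ul h] [h1 h2]]; split.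
    rewrite ul andbT; apply/negP => /mapP[i il E]; by apply: (h2 i il); rewrite E.
  by move=> i; rewrite inE => /orP[/eqP ->//|/h].
rewrite (_ : [set t | _] = [set t | exists l, (size l = k /\ Q l t)]).
  by apply: measurable_exists => l; apply: measurable_and => //; exact: measurable_cst_event.
apply/seteqP; split => t /=; rewrite AE.
  move=> [l [ul lk sub]].
  have [g hg] : exists g : R -> nat, forall v, v \in l -> D (g v) t /\ v = f (g v) t.
    have ch v : exists i, v \in l -> D i t /\ v = f i t.
      have [vl|_] := boolP (v \in l); last by exists 0%N.
      by have [[i Di vE] _] := sub v vl; exists i.
    by exists (fun v => sval (cid (ch v))) => v vl; exact: (svalP (cid (ch v)) vl).
  have gE : map (f ^~ t) (map g l) = l.
    by rewrite -map_comp -[RHS]map_id; apply/eq_in_map => v vl /=; have [_ <-] := hg v vl.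
  exists (map g l); rewrite size_map; split => //; split; first by rewrite gE.
  move=> _ /mapP[v vl ->]; have [Dv <-] := hg v vl; split => //; by have [] := sub v vl.
move=> [l [lk [ul h]]]; exists (map (f ^~ t) l); split => //; first by rewrite size_map.
by move=> _ /mapP[i il ->]; have [Di Ii] := h i il; split => //; exists i.
Qed.

Lemma measurable_config_card d (T : measurableType d) (A : T -> set R) :
  (forall (I : set (measurableTypeR R)) k, measurable I -> measurable [set t | atleast k (A t `&` I)]) ->
  measurable_fun setT (A : T -> config R).
Proof.
move=> mA; apply: (@measurability _ _ T (config R) setT A (@count_events R)) => // _ [_ [I [k [mI _ ->]]] <-].
rewrite setTI (_ : _ @^-1` _ = [set t | atleast k (A t `&` I) /\ ~ atleast k.+1 (A t `&` I)]).
  by apply: measurable_and; [exact: mA|apply: measurableC; exact: mA].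
by apply/seteqP; split => t /=; rewrite card_atleast.
Qed.

Lemma countable_random_root d (T : measurableType d) (s : T -> seq (R * R)) :
  mstate s -> countable_random (fun t => [set v | root (s t) v]).
Proof.
elim=> [|x p s' mx mp ms [f [D [mf mD AE]]]].
  exists (fun _ _ => 0), (fun _ _ => False); split => // [i|t]; first exact: measurable_cst_event.
  by apply/seteqP; split => v //= [].
exists (fun i t => if i is j.+1 then f j t else p t),
  (fun i t => if i is j.+1 then D j t else ~ covered (s' t) (p t)); split.
- by case.
- case=> [|i]; last exact: mD.
  by apply: measurableC; exact: (measurable_covered ms mp).
- move=> t; apply/seteqP; split => v /=.
    move=> [h|[-> h]]; last by exists 0%N.
    by have : [set v | root (s' t) v] v by []; rewrite AE => -[i Di ->]; exists i.+1.
  move=> [[h ->|i Di ->]]; first by right.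
  by left; have : [set v | root (s' t) v] (f i t) by rewrite AE; exists i.
Qed.

Lemma state_event_atleast (I : set (measurableTypeR R)) k : measurable I ->
  state_event (fun s => atleast k ([set v | root s v] `&` I)).
Proof.
move=> mI; split => [d T s ms|s1 s2 [_ rE]|c s].
- exact: measurable_atleast (countable_random_root ms) mI.
- by apply: atleast_sub => v [/rE h hI].
- by apply: atleast_sub => v [h hI]; split => //; left.
Qed.

End counting.

(** * Recovery of the configurations from countably many events *)

Section codes.
Context {R : realType}.
(* The roots, and the pairs of rationals whose interval is eventually covered. *)
Definition code : Type := (set R * set (rat * rat))%type.

Definition code_event (F : seq (rat * rat)) (C : seq (set R * nat)) : set code :=
  [set A | (forall ab, ab \in F -> A.2 ab) /\ (forall Ik, Ik \in C -> atleast Ik.2 (A.1 `&` Ik.1))].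

Definition code_events : set (set code) := [set E | exists F C,
  (forall Ik : set R * nat, Ik \in C -> measurable (Ik.1 : set (measurableTypeR R))) /\ E = code_event F C].

Lemma code_events_setI : setI_closed code_events.
Proof.
move=> _ _ [F1 [C1 [m1 ->]]] [F2 [C2 [m2 ->]]]; exists (F1 ++ F2), (C1 ++ C2); split.
  by move=> Ik; rewrite mem_cat => /orP[/m1|/m2].
apply/seteqP; split => [A [[h1 h2] [h3 h4]]|A [h1 h2]].
  by split => [ab|Ik]; rewrite mem_cat => /orP[]; [exact: h1|exact: h3|exact: h2|exact: h4].
by split; split => ? h; [apply: h1|apply: h2|apply: h1|apply: h2]; rewrite mem_cat h ?orbT.
Qed.

Lemma code_events_setT : code_events setT.
Proof. by exists [::], [::]; split => //; apply/seteqP; split => // A _; split. Qed.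

Definition codes := g_sigma_algebraType code_events.

Lemma measurable_code_joined ab : measurable ([set A | A.2 ab] : set codes).
Proof.
apply: sub_gen_smallest; exists [:: ab], [::]; split => //.
apply/seteqP; split => [A h|A [h _]]; last by apply: h; rewrite inE.
by split => // ab'; rewrite inE => /eqP ->.
Qed.

Lemma measurable_code_count (I : set (measurableTypeR R)) k : measurable I ->
  measurable ([set A | atleast k (A.1 `&` I)] : set codes).
Proof.
move=> mI; apply: sub_gen_smallest; exists [::], [:: ((I : set R), k)]; split.
  by move=> Ik; rewrite inE => /eqP ->.
apply/seteqP; split => [A h|A [_ h]]; last by apply: (h (I, k)); rewrite inE.
by split => // Ik; rewrite inE => /eqP ->.
Qed.

(* The right end of the component of q in the union of the covered intervals; it
   is +oo or -oo exactly when this component is unbounded or q is uncovered. *)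
Definition reach (q : rat) (A : code) : \bar R :=
  ereal_sup [set (ratr t)%:E | t in [set t : rat | q < t /\ A.2 (q, t)]].

Definition reached (A : code) : set R := [set v | exists2 q, reach q A \is a fin_num & v = fine (reach q A)].

Lemma measurable_reach q : measurable_fun setT (reach q : codes -> \bar R).
Proof.
apply: measurable_ereal_sup_events => t; apply: measurable_and; first exact: measurable_cst_event.
exact: measurable_code_joined.
Qed.

Lemma countable_random_reached : countable_random (reached : codes -> set R).
Proof.
pose q k : rat := odflt 0 (unpickle k).
exists (fun k A => fine (reach (q k) A)), (fun k A => reach (q k) A \is a fin_num); split => [k|k|A].
- exact: (measurableT_comp (@fine_measurable R setT measurableT) (measurable_reach (q k))).
- rewrite (_ : [set t | _] = [set A : codes | (-oo < reach (q k) A)%E /\ (reach (q k) A < +oo)%E]).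
    apply: measurable_and; apply: measurable_lteE => //; exact: measurable_reach.
  by apply/seteqP; split => A /=; rewrite fin_numElt => /andP.
- apply/seteqP; split => v [i fi ->]; last by exists (q i).
  by exists (pickle i); rewrite /q pickleK.
Qed.

Definition decode (A : codes) : config R * config R := (A.1, reached A).

Lemma measurable_decode : measurable_fun setT decode.
Proof.
have m1 : measurable_fun setT (fun A : codes => A.1 : config R).
  by apply: measurable_config_card => I k mI; exact: measurable_code_count.
have m2 : measurable_fun setT (fun A : codes => reached A : config R).
  apply: measurable_config_card => I k mI.
  exact: (measurable_atleast k countable_random_reached mI).
exact: (measurable_fun_pair m1 m2).
Qed.

End codes.

(** A finite right end of a component is broken, since a covered interval around it could be joined
    to the component and extend it. Conversely, isolation on the left leaves a rational [q] with no
    broken point between it and the broken point [v], so the component of [q] ends exactly at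
    [v]. *)
Lemma reached_broken (R : realType) d (Omega : measurableType d) (Y : set R) x B zeta (w : Omega) :
  (forall q : rat, ~ broken x B zeta (ratr q : R) w) ->
  (forall v, broken x B zeta v w -> exists2 u, u < v & forall y, u < y < v -> ~ broken x B zeta y w) ->
  reached (Y, [set ab | joined x B zeta (ratr ab.1) (ratr ab.2) w]) =
  [set v | broken x B zeta v w].
Proof.
move=> nq iso; set J := [set ab | _]; set z := fun q => reach q (Y, J).
have rle (q t : rat) : (ratr q <= ratr t :> R) = (q <= t) by rewrite ler_rat.
have rlt (q t : rat) : (ratr q < ratr t :> R) = (q < t) by rewrite ltr_rat.
have J1 q t : q < t -> J (q, t) -> ((ratr t)%:E <= z q)%E.
  by move=> qt Jt; apply: ereal_sup_ubound; exists t.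
have J2 q v : broken x B zeta v w -> ratr q < v -> (z q <= v%:E)%E.
  move=> bv qv; apply: ge_ereal_sup => _ [t [qt Jt] <-]; rewrite lee_fin leNgt; apply/negP => vt.
  by apply: (bv q t) => //; rewrite qv.
have J3 q (r : R) : z q = r%:E -> broken x B zeta r w /\ ratr q < r.
  move=> zr.
  have [t [qt Jt]] : exists t, q < t /\ J (q, t).
    apply: contrapT => no; have : z q = -oo%E.
      rewrite /z /reach -ereal_sup0; congr ereal_sup; apply/seteqP; split => y //= [t h _].
      by apply: no; exists t.
    by rewrite zr.
  have tr : ratr t <= r by have := J1 _ _ qt Jt; rewrite zr lee_fin.
  have qr : ratr q < r by apply: lt_le_trans tr; rewrite rlt.
  split => // a b /andP[ar rb] Jab.
  have [t' [qt' Jt' at']] : exists t', [/\ q < t', J (q, t') & ratr a < ratr t' :> R].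
    apply: contrapT => no; have : (z q <= (ratr a)%:E)%E.
      apply: ge_ereal_sup => _ [t' [qt' Jt'] <-]; rewrite lee_fin leNgt; apply/negP => at'.
      by apply: no; exists t'.
    by rewrite zr lee_fin leNgt ar.
  have qb : q < b by rewrite -rlt (lt_trans qr rb).
  suff Jqb : J (q, b) by have := J1 _ _ qb Jqb; rewrite zr lee_fin leNgt rb.
  have t'r : ratr t' <= r by have := J1 _ _ qt' Jt'; rewrite zr lee_fin.
  have [aq|qa] := leP (ratr q) (ratr a : R).
    exact: (joined_cat aq (ltW at') (ltW (le_lt_trans t'r rb)) Jt' Jab).
  exact: (joined_sub (ltW qa) (ltW (lt_trans qr rb)) (lexx _) Jab).
apply/seteqP; split => v /=.
  move=> [q fz ->]; have [] := J3 q (fine (z q)); first by rewrite fineK.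
  by [].
move=> bv; have [u uv hu] := iso v bv.
have [q] := rat_in_itvoo uv; rewrite in_itv/= => /andP[uq qv].
(* The rational [q] is not broken, so its component extends to the right and [reach] is not
   [-oo]. *)
have [t [qt Jt]] : exists t, q < t /\ J (q, t).
  have := nq q; rewrite /broken => /existsNP[a /existsNP[b /not_implyP[/andP[aq qb] /contrapT jab]]].
  exists b; rewrite -rlt; split => //; exact: (joined_sub (ltW aq) (ltW qb) (lexx _) jab).
have h2 := J2 q v bv qv; have h1 := J1 _ _ qt Jt.
have fz : z q \is a fin_num.
  by rewrite fin_numElt (lt_le_trans _ h1) ?ltNyr// (le_lt_trans h2) ?ltry.
exists q => //; have zE : z q = (fine (z q))%:E by rewrite fineK.
have [bz qz] := J3 q _ zE; rewrite zE lee_fin in h2.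
have [//|vz] := eqVneq v (fine (z q)); exfalso; apply: (hu (fine (z q))) => //.
by rewrite (lt_trans uq qz) lt_neqAle eq_sym vz.
Qed.

Lemma common_stage (I : eqType) (L : seq I) (Q : I -> nat -> Prop) :
  (forall i n m, (n <= m)%N -> Q i n -> Q i m) -> (forall i, i \in L -> exists n, Q i n) ->
  exists n, forall i, i \in L -> Q i n.
Proof.
move=> mono; elim: L => [_|i L IH h]; first by exists 0%N.
have [|n hn] := IH; first by move=> j jL; apply: h; rewrite inE jL orbT.
have [m hm] := h i (mem_head _ _); exists (maxn n m) => j; rewrite inE => /orP[/eqP ->|/hn].
  exact: mono (leq_maxr _ _) hm.
exact: mono (leq_maxl _ _).
Qed.

Lemma state_event_all (R : realType) (I : eqType) (L : seq I) (E : I -> seq (R * R) -> Prop) :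
  (forall i, i \in L -> state_event (E i)) -> state_event (fun s => forall i, i \in L -> E i s).
Proof.
move=> sE; split => [d T s ms|s1 s2 ss h i iL|c s h i iL]; last 2 first.
- by have [_ he _] := sE i iL; apply: (he _ _ ss); exact: h.
- by have [_ _ he] := sE i iL; apply: he; exact: h.
have : forall i, i \in L -> measurable [set t | E i (s t)].
  by move=> i iL; have [h _ _] := sE i iL; exact: h.
elim: L {sE} => [_|i L IH mE].
  by rewrite (_ : [set t | _] = setT)//; apply/seteqP; split => // t.
rewrite (_ : [set t | _] = [set t | E i (s t) /\ forall j, j \in L -> E j (s t)]).
  apply: measurable_and; first by apply: mE; rewrite mem_head.
  by apply: IH => j jL; apply: mE; rewrite inE jL orbT.
apply/seteqP; split => t /=.
  by move=> h; split => [|j jL]; apply: h; rewrite inE ?eqxx ?jL ?orbT.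
by move=> [h1 h2] j; rewrite inE => /orP[/eqP ->|/h2].
Qed.

Lemma state_event_and (R : realType) (E1 E2 : seq (R * R) -> Prop) :
  state_event E1 -> state_event E2 -> state_event (fun s => E1 s /\ E2 s).
Proof.
move=> [m1 s1 i1] [m2 s2 i2]; split => [d T s ms|u v uv [h1 h2]|c s [h1 h2]].
- by apply: measurable_and; [exact: m1|exact: m2].
- by split; [exact: s1 uv h1|exact: s2 uv h2].
- by split; [exact: i1|exact: i2].
Qed.

Section wilson_code.
Context {R : realType} (kappa : {sigma_finite_measure set (measurableTypeR R) -> \bar R}).
Hypothesis kr : radon_measure kappa.
Hypothesis kappa0 : kappa setT != 0%E.
Context d (Omega : measurableType d) (P : probability Omega R).
Variables (x : nat -> R) (B : nat -> R -> Omega -> R) (zeta : nat -> Omega -> \bar R).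
Hypothesis xinj : injective x.
Hypothesis xdense : dense (range x).
Hypothesis kbm : forall n, killed_brownian_motion P kappa (x n) (B n) (zeta n).
Hypothesis ind : mutually_independent P (fun n => killed_path_sigma (B n) (zeta n)).
Local Notation run := (run x B zeta).

Definition wilson_code w : @codes R :=
  (\bigcup_n [set v | root (run n w) v], [set ab | joined x B zeta (ratr ab.1) (ratr ab.2) w]).

Definition stage_event (F : seq (rat * rat)) (C : seq (set R * nat)) (s : seq (R * R)) : Prop :=
  (forall ab, ab \in F -> covers (ratr ab.1) (ratr ab.2) s) /\
  (forall Ik, Ik \in C -> atleast Ik.2 ([set v | root s v] `&` Ik.1)).

Lemma state_event_stage F C :
  (forall Ik : set R * nat, Ik \in C -> measurable (Ik.1 : set (measurableTypeR R))) ->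
  state_event (stage_event F C).
Proof.
move=> mC; apply: state_event_and; apply: state_event_all => i iL; first exact: state_event_covers.
exact: state_event_atleast (mC i iL).
Qed.

(** Finitely many conditions, each preserved by later steps, hold together from some stage on. *)
Lemma wilson_code_event F C w : code_event F C (wilson_code w) <-> exists n, stage_event F C (run n w).
Proof.
have rmono v n m : (n <= m)%N -> root (run n w) v -> root (run m w) v.
  by move=> nm; apply: (run_mono (E := fun s => root s v) _ nm) => c s h; left.
split => [[h1 h2]|[n [h1 h2]]]; last first.
  split => [ab /h1 h|Ik /h2]; first by exists n.
  by apply: atleast_sub => v [hv hI]; split => //; exists n.
have [n1 hn1] := common_stage (Q := fun ab n => covers (ratr ab.1) (ratr ab.2) (run n w))
  (fun ab n m nm => run_mono (@covers_cons R (ratr ab.1) (ratr ab.2)) nm) h1.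
have [n2 hn2] : exists n, forall Ik, Ik \in C -> atleast Ik.2 ([set v | root (run n w) v] `&` Ik.1).
  apply: common_stage => [Ik n m nm|Ik IkC].
    by apply: atleast_sub => v [hv hI]; split => //; exact: rmono nm hv.
  have [l [ul lk sub]] := h2 Ik IkC.
  have [||n hn] := common_stage (L := l) (Q := fun v n => root (run n w) v).
  - by move=> v n m; exact: rmono.
  - by move=> v vl; have [[n _ hv] _] := sub v vl; exists n.
  by exists n, l; split => // v vl; split; [exact: hn|have [] := sub v vl].
exists (maxn n1 n2); split => [ab abF|Ik IkC].
  exact: (run_mono (@covers_cons R (ratr ab.1) (ratr ab.2)) (leq_maxl _ _) (hn1 ab abF)).
apply: atleast_sub (hn2 Ik IkC) => v [hv hI]; split => //; exact: rmono (leq_maxr _ _) hv.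
Qed.

Lemma wilson_code_preimage F C :
  wilson_code @^-1` code_event F C = [set w | exists n, stage_event F C (run n w)].
Proof. by apply/seteqP; split => w /wilson_code_event. Qed.

Lemma measurable_wilson_code : measurable_fun setT wilson_code.
Proof.
apply: (@measurability _ _ Omega (@codes R) setT wilson_code (@code_events R)) => // _ [_ [F [C [mC ->]]] <-].
rewrite setTI wilson_code_preimage.
by apply: (measurable_run_event kbm); exact: state_event_stage.
Qed.

Lemma decode_wilson : {ae P, forall w, decode (wilson_code w) =
  (wilson_Y x (fun n t => B n t w) (fun n => zeta n w) : config R,
   wilson_Z x (fun n t => B n t w) (fun n => zeta n w) : config R)}.
Proof.
have [e mwc _] := killed_brownian_clock kr (kbm 0%N).
have iso := broken_isolated kr kappa0 xinj xdense kbm ind mwc.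
apply: filterS3 (wilson_run kr kappa0 kbm) iso (wilson_Z_broken kr kappa0 xinj xdense kbm ind) => w tr [nq isol] ->.
rewrite /decode (reached_broken _ nq isol); congr pair.
apply/seteqP; split => v [n _].
  by case: n => // n hv; exists n => //; have [-> _] := tr n.
by have [-> _] := tr n => hv; exists n.+1.
Qed.

End wilson_code.

(** * Comparison of two realisations of the algorithm *)

Section comparison.
Context {R : realType} (kappa : {sigma_finite_measure set (measurableTypeR R) -> \bar R}).
Hypothesis kr : radon_measure kappa.
Hypothesis kappa0 : kappa setT != 0%E.

(** At a finite stage the probability in the first model is an iterated step over a finite list of
    points, hence at most the limit in the second model. The converse inequality follows by
    exchanging the models. *)
Lemma run_event_le d1 (O1 : measurableType d1) (P1 : probability O1 R)
    x1 B1 zeta1 d2 (O2 : measurableType d2) (P2 : probability O2 R) x2 B2 zeta2 E :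
  (forall n, killed_brownian_motion P1 kappa (x1 n) (B1 n) (zeta1 n)) ->
  mutually_independent P1 (fun n => killed_path_sigma (B1 n) (zeta1 n)) ->
  injective x2 -> dense (range x2) ->
  (forall n, killed_brownian_motion P2 kappa (x2 n) (B2 n) (zeta2 n)) ->
  mutually_independent P2 (fun n => killed_path_sigma (B2 n) (zeta2 n)) ->
  state_event E ->
  (P1 [set w | exists n, E (run x1 B1 zeta1 n w)] <= P2 [set w | exists n, E (run x2 B2 zeta2 n w)])%E.
Proof.
move=> kbm1 ind1 inj2 dense2 kbm2 ind2 sE; have [mE _ iE] := sE.
have [e mwc _] := killed_brownian_clock kr (kbm1 0%N).
pose A n := [set w | E (run x1 B1 zeta1 n w)].
have mA n : measurable (A n) by exact: mE (mstate_run_full kbm1 n).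
have UE : [set w | exists n, E (run x1 B1 zeta1 n w)] = \bigcup_n A n.
  by apply/seteqP; split => w [n]; exists n.
have mU : measurable (\bigcup_n A n) by apply: bigcup_measurable.
have ndA : nondecreasing_seq A.
  move=> n m nm; apply/subsetPset => w; exact: (run_mono iE nm).
have cA := nondecreasing_cvg_mu mA mU ndA (mu := P1).
rewrite UE -(cvg_lim _ cA)//; apply: lime_le; first by apply/cvg_ex; exists (P1 (\bigcup_n A n)).
apply: nearW => n /=; rewrite /A (run_event_prob kr kappa0 kbm1 ind1 mwc n sE).
exact: (run_event_limit kr kappa0 inj2 dense2 kbm2 ind2 mwc).
Qed.

Lemma wilson_code_law d1 (O1 : measurableType d1) (P1 : probability O1 R)
    x1 B1 zeta1 d2 (O2 : measurableType d2) (P2 : probability O2 R) x2 B2 zeta2 (S : set (@codes R)) :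
  injective x1 -> dense (range x1) ->
  (forall n, killed_brownian_motion P1 kappa (x1 n) (B1 n) (zeta1 n)) ->
  mutually_independent P1 (fun n => killed_path_sigma (B1 n) (zeta1 n)) ->
  injective x2 -> dense (range x2) ->
  (forall n, killed_brownian_motion P2 kappa (x2 n) (B2 n) (zeta2 n)) ->
  mutually_independent P2 (fun n => killed_path_sigma (B2 n) (zeta2 n)) ->
  measurable S ->
  P1 (wilson_code x1 B1 zeta1 @^-1` S) = P2 (wilson_code x2 B2 zeta2 @^-1` S).
Proof.
move=> inj1 dense1 kbm1 ind1 inj2 dense2 kbm2 ind2 mS.
pose X1 : {mfun O1 >-> @codes R} := HB.pack (wilson_code x1 B1 zeta1)
  (isMeasurableFun.Build _ _ _ _ _ (measurable_wilson_code kbm1)).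
pose X2 : {mfun O2 >-> @codes R} := HB.pack (wilson_code x2 B2 zeta2)
  (isMeasurableFun.Build _ _ _ _ _ (measurable_wilson_code kbm2)).
have mG : @code_events R `<=` (measurable : set (set (@codes R))) by move=> E GE; exact: sub_gen_smallest.
have := @finite_measure_unique _ (@codes R) R (@code_events R) (distribution P1 X1) (distribution P2 X2)
  mG (@code_events_setI R) (@code_events_setT R) _ _ S mS.
apply.
  apply: (@le_lt_trans _ _ 1%E); last exact: ltry.
  exact: (@probability_le1 _ _ _ (distribution P1 X1)).
move=> _ [F [C [mC ->]]].
rewrite /= /distribution /pushforward /= !wilson_code_preimage.
apply/eqP; rewrite eq_le; apply/andP; split; apply: run_event_le => //; exact: state_event_stage.
Qed.

End comparison.

Lemma radon_sigma_finite (R : realType) (kappa : {measure set (measurableTypeR R) -> \bar R}) :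
  radon_measure kappa -> sigma_finite setT kappa.
Proof.
move=> kr; exists (fun n : nat => (`[- n%:R, n%:R]%classic : set R)).
  apply/seteqP; split => // y _; exists (Num.bound `|y|) => //=.
  have h := archi_boundP (normr_ge0 y); rewrite in_itv/=.
  by rewrite -ler_norml ltW.
by move=> n; split; [exact: measurable_itv|apply: kr; exact: segment_compact].
Qed.

(** A copy of [kappa] indexed by the proof that it is Radon, to which the structure of sigma-finite
    measure used by Tonelli can be attached. *)
Definition radon_copy (R : realType) (kappa : {measure set (measurableTypeR R) -> \bar R})
    (kr : radon_measure kappa) : set (measurableTypeR R) -> \bar R := kappa.

HB.instance Definition _ (R : realType) (kappa : {measure set (measurableTypeR R) -> \bar R})
    (kr : radon_measure kappa) := Measure.copy (radon_copy kr) kappa.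

HB.instance Definition _ (R : realType) (kappa : {measure set (measurableTypeR R) -> \bar R})
    (kr : radon_measure kappa) :=
  Measure_isSigmaFinite.Build _ _ _ (radon_copy kr) (radon_sigma_finite kr).

Theorem proposition6p7 (R : realType)
    (kappa : {measure set (measurableTypeR R) -> \bar R})
    (kappa_radon : radon_measure kappa)
    (kappa_neq0 : kappa [set: measurableTypeR R] <> 0%E) :
  exists mu : probability (config R * config R)%type R,
  forall (d : measure_display) (Omega : measurableType d)
    (P : probability Omega R)
    (x : nat -> R) (B : nat -> R -> Omega -> R) (zeta : nat -> Omega -> \bar R),
  injective x -> dense (range x) ->
  (forall n, killed_brownian_motion P kappa (x n) (B n) (zeta n)) ->
  mutually_independent P (fun n => killed_path_sigma (B n) (zeta n)) ->
  has_law P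
    (fun w : Omega =>
       (wilson_Y x (fun n t => B n t w) (fun n => zeta n w) : config R,
        wilson_Z x (fun n t => B n t w) (fun n => zeta n w) : config R))
    mu.
Proof.
pose kf : {sigma_finite_measure set (measurableTypeR R) -> \bar R} := radon_copy kappa_radon.
have kr : radon_measure kf by exact: kappa_radon.
have k0 : kf setT != 0%E by apply/eqP; exact: kappa_neq0.
pose model d (Omega : measurableType d) (P : probability Omega R) x B zeta : Prop :=
  [/\ injective x, dense (range x),
    forall n, killed_brownian_motion P kappa (x n) (B n) (zeta n) &
    mutually_independent P (fun n => killed_path_sigma (B n) (zeta n))].
(* The law is read off one realisation if there is any. Otherwise the conclusion holds vacuously,
   and a Dirac mass serves as [mu]. *)
have [[d0 [Om0 [P0 [x0 [B0 [z0 [inj0 dense0 kbm0 ind0]]]]]]]|none] := pselect (exists d (Omega : measurableType d)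
   (P : probability Omega R) x B zeta, model d Omega P x B zeta); last first.
  exists (dirac (point : config R * config R)) => d Omega P x B zeta h1 h2 h3 h4.
  by exfalso; apply: none; exists d, Omega, P, x, B, zeta.
have mV d (Omega : measurableType d) (P : probability Omega R) x B zeta
    (kbm : forall n, killed_brownian_motion P kappa (x n) (B n) (zeta n)) :
    measurable_fun setT (fun w => decode (wilson_code x B zeta w)).
  exact: (measurableT_comp (@measurable_decode R) (measurable_wilson_code (kappa := kf) kbm)).
pose V0 : {mfun Om0 >-> (config R * config R)%type} := HB.pack (fun w => decode (wilson_code x0 B0 z0 w))
  (isMeasurableFun.Build _ _ _ _ _ (mV _ _ _ _ _ _ kbm0)).
exists (distribution P0 V0) => d Omega P x B zeta xinj xdense kbm ind.
exists (fun w => decode (wilson_code x B zeta w)); split.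
- exact: mV kbm.
- exact: (decode_wilson kr k0 xinj xdense kbm ind).
move=> S mS.
have mDS : measurable (@decode R @^-1` S) by rewrite -[X in measurable X]setTI; exact: measurable_decode.
exact: (wilson_code_law kr k0 inj0 dense0 kbm0 ind0 xinj xdense kbm ind mDS).
Qed.
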